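(* Let $f=\mathfrak d+b$ and $\sigma$ satisfy Hypothesis (A) stated in the context. Then there exist $C>0$ and $\mu>0$ such that for all $\Phi\in B_b(\mathbb R^d)$, all $x,x'\in\mathbb R^d$ and all $t\ge 0$, $$|\mathscr P_t[\Phi](x)-\mathscr P_t[\Phi](x')|\le C(1+|x|^2+|x'|^2)e^{-\mu t}|\Phi|_0 ,$$ where $\mathscr P_t[\Phi](x)=\mathbb E\,\Phi(V_t^x)$. Moreover the constants $C$ and $\mu$ depend on $f$ only through $\eta$ and $B$.
   Context: $d\ge 1$ is an integer; $(\cdot,\cdot)$ and $|\cdot|$ are the Euclidean scalar product and norm ($|\cdot|$ also denotes a norm on matrices), and $|||\cdot|||$ is the operator norm on $\mathbb R^{d\times d}$; for the matrix field $\sigma^{-1}$, $|||\sigma^{-1}|||$ means $\sup_x|||\sigma^{-1}(x)|||$. $(\Omega,\mathcal F,\mathbb P)$ is a complete probability space carrying a standard $\mathbb R^d$-valued Brownian motion $W$, and $(\mathcal F_t)_{t\ge0}$ is its natural filtration augmented by the null sets. $B_b(\mathbb R^d)$ is the set of bounded Borel functions $\mathbb R^d\to\mathbb R$ and $|\Phi|_0=\sup|\Phi|$. Hypothesis (A), on $f=\mathfrak d+b:\mathbb R^d\to\mathbb R^d$ and $\sigma:\mathbb R^d\to\mathbb R^{d\times d}$: (i) $\mathfrak d:\mathbb R^d\to\mathbb R^d$ is $\eta$-dissipative for some $\eta>0$, i.e. $(\mathfrak d(x)-\mathfrak d(x'),x-x')\le-\eta|x-x'|^2$ for all $x,x'$;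 it is locally Lipschitz and has polynomial growth: there are $C,\nu>0$ with $|\mathfrak d(x)|\le C(1+|x|^\nu)$ for all $x$; (ii) $b:\mathbb R^d\to\mathbb R^d$ is Lipschitz and $|b|$ is bounded by $B$; (iii) $\sigma$ is Lipschitz, $\sigma(x)$ is invertible for every $x$, and $|\sigma|$ and $|\sigma^{-1}|$ are bounded by $\sigma_\infty$; (iv) there exists $\Lambda\ge0$ such that $|(y,\sigma(x+y)-\sigma(x))|\le\Lambda|y|$ for all $x,y\in\mathbb R^d$, where $(y,M)$ denotes the row vector ${}^t y\,M$, and there exists $\lambda_0>0$ such that $2(\lambda_0-\lambda_0^2\Lambda^2)>|||\sigma^{-1}|||^2$. $(V_t^x)_{t\ge0}$ is the unique strong solution of $V_t^x=x+\int_0^t f(V_s^x)\,ds+\int_0^t\sigma(V_s^x)\,dW_s$, $t\ge 0$. *)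

(* Defs.v *)
(* Points of R^d are column vectors 'cV[R]_d; time is a real
   number, and only times t >= 0 are ever constrained. *)
From mathcomp Require Import all_boot all_order all_algebra.
From mathcomp Require Import all_classical all_reals all_analysis.

Set Implicit Arguments.
Unset Strict Implicit.
Unset Printing Implicit Defensive.
Import Order.TTheory GRing.Theory Num.Theory.
Import numFieldNormedType.Exports.
Local Open Scope classical_set_scope.
Local Open Scope ring_scope.

Section Norms.
Context {R : realType}.

Definition scalar_product (d : nat) (x y : 'cV[R]_d) : R :=
  \sum_i x i ord0 * y i ord0.

(* The library norm `|M| on matrices is the maximum norm. The norm below is the
   Euclidean norm on columns and rows, and the Frobenius norm on matrices. *)
Definition enorm (m n : nat) (M : 'M[R]_(m, n)) : R :=
  Num.sqrt (\sum_i \sum_j M i j ^+ 2).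

Definition opnorm (d : nat) (M : 'M[R]_d) : R :=
  sup [set enorm (M *m y) | y in [set y : 'cV[R]_d | enorm y <= 1]].

Definition eLipschitz (d m n : nat) (g : 'cV[R]_d -> 'M[R]_(m, n)) : Prop :=
  exists2 L : R, 0 <= L & forall x y, enorm (g x - g y) <= L * enorm (x - y).

Definition locally_eLipschitz (d m n : nat) (g : 'cV[R]_d -> 'M[R]_(m, n)) :
    Prop :=
  forall x0, exists r L : R, [/\ 0 < r, 0 <= L &
    forall x y, enorm (x - x0) < r -> enorm (y - x0) < r ->
      enorm (g x - g y) <= L * enorm (x - y)].

End Norms.

Section HypothesisA.
Context {R : realType} {d : nat}.
Implicit Types (b df : 'cV[R]_d -> 'cV[R]_d) (sg : 'cV[R]_d -> 'M[R]_d).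

Definition dissipative (eta : R) df : Prop :=
  forall x x', scalar_product (df x - df x') (x - x')
               <= - eta * enorm (x - x') ^+ 2.

Definition polynomial_growth df : Prop :=
  exists C nu : R, [/\ 0 < C, 0 < nu &
    forall x, enorm (df x) <= C * (1 + enorm x `^ nu)].

(* |||sg^-1|||, the supremum over x of the operator norms *)
Definition inv_opnorm sg : R := sup [set opnorm (invmx (sg x)) | x in setT].

Record hypA_drift (eta B : R) df b : Prop := HypADrift {
  drift_dissipative : dissipative eta df;
  drift_locLip : locally_eLipschitz df;
  drift_growth : polynomial_growth df;
  drift_pertLip : eLipschitz b;
  drift_pertB : forall x, enorm (b x) <= B }.

Record hypA_diffusion sg : Prop := HypADiffusion {
  diff_Lip : eLipschitz sg;
  diff_unit : forall x, sg x \in unitmx;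
  diff_bounded : exists sgoo : R,
    forall x, enorm (sg x) <= sgoo /\ enorm (invmx (sg x)) <= sgoo;
  diff_Lambda : exists Lambda lambda0 : R, [/\ 0 <= Lambda,
    forall x y : 'cV[R]_d, enorm (y^T *m (sg (x + y) - sg x)) <= Lambda * enorm y,
    0 < lambda0 &
    inv_opnorm sg ^+ 2 < 2 * (lambda0 - lambda0 ^+ 2 * Lambda ^+ 2)] }.

End HypothesisA.

Section Measurability.
Context {R : realType}.

Definition borel_set (m n : nat) : set (set 'M[R]_(m, n)) := <<s open >>.

(* measurability of X with respect to a given sigma-algebra G on its domain *)
Definition measurable_wrt (T : Type) (G : set (set T)) (m n : nat)
    (X : T -> 'M[R]_(m, n)) : Prop :=
  forall A, borel_set A -> G (X @^-1` A).

Definition bounded_borel (d : nat) : set ('cV[R]_d -> R) :=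
  [set Phi | (forall A : set R, measurable A -> borel_set (Phi @^-1` A)) /\
             exists K : R, forall x, `|Phi x| <= K].

Definition sup_norm (d : nat) (Phi : 'cV[R]_d -> R) : R :=
  sup [set `|Phi x| | x in setT].

End Measurability.

Section Processes.
Context {R : realType} {d : nat} {disp : measure_display}
        {Omega : measurableType disp} (P : probability Omega R).
Implicit Types (W V : R -> Omega -> 'cV[R]_d).

Definition past W (t : R) : set (set Omega) :=
  <<s [set E | exists s A, [/\ 0 <= s, s <= t, borel_set A & E = W s @^-1` A]] >>.

Definition filtration W (t : R) : set (set Omega) :=
  <<s past W t `|` P.-negligible >>.

Definition continuous_paths V : Prop :=
  {ae P, forall w, {within `[0%R, +oo[, continuous (fun t => V t w)}}.

(* For s < t the last clause says at once that W t - W s is independent of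
   sigma(W u, u <= s) and (take E = setT) that its coordinates are independent
   with law N(0, t - s). The second argument of [normal_prob] is a standard
   deviation. *)
Record brownian_motion W : Prop := BrownianMotion {
  bm_measurable : forall t, 0 <= t -> measurable_wrt measurable (W t);
  bm_start : {ae P, forall w, W 0 w = 0};
  bm_continuous : continuous_paths W;
  bm_increments : forall (s t : R), 0 <= s -> s < t ->
    forall (E : set Omega) (A : 'I_d -> set R),
      past W s E -> (forall i, measurable (A i)) ->
      P (E `&` [set w | forall i, A i ((W t w - W s w) i ord0)]) =
      (P E * \prod_(i < d) normal_prob 0 (Num.sqrt (t - s)) (A i))%E }.

(* The process sum_k coef k * 1_{]grid k, grid k.+1]}, k < size *)
Record simple_process (F : R -> set (set Omega)) := SimpleProcess {
  sp_size : nat;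
  sp_grid : nat -> R;
  sp_coef : nat -> Omega -> 'M[R]_d;
  sp_grid_ge0 : forall k, 0 <= sp_grid k;
  sp_grid_incr : forall k, sp_grid k <= sp_grid k.+1;
  sp_coef_measurable : forall k, measurable_wrt (F (sp_grid k)) (sp_coef k);
  sp_coef_bounded : forall k, exists K : R, forall w, enorm (sp_coef k w) <= K }.

Definition sp_value F (S : simple_process F) (s : R) (w : Omega) : 'M[R]_d :=
  \sum_(k < sp_size S)
    if sp_grid S k < s <= sp_grid S k.+1 then sp_coef S k w else 0.

Definition sp_integral F (S : simple_process F) W (t : R) (w : Omega) :
    'cV[R]_d :=
  \sum_(k < sp_size S) sp_coef S k w *m
    (W (Num.min (sp_grid S k.+1) t) w - W (Num.min (sp_grid S k) t) w).

Definition cvg_proba0 (X : nat -> Omega -> \bar R) : Prop :=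
  forall e : R, 0 < e ->
    (fun n => P [set w | e%:E <= X n w]%E) @ \oo --> 0%E.

(* Z is (a version of) the Ito integral of H over [0, t] with respect to W:
   the limit in probability of the integrals of adapted simple processes S n
   with int_0^t |S n - H|^2 ds --> 0 in probability. *)
Definition ito_integral W (H : R -> Omega -> 'M[R]_d) (t : R)
    (Z : Omega -> 'cV[R]_d) : Prop :=
  exists S : nat -> simple_process (filtration W),
    cvg_proba0 (fun n w => \int[lebesgue_measure]_(s in `[0%R, t])
                  (enorm (sp_value (S n) s w - H s w) ^+ 2)%:E)%E /\
    cvg_proba0 (fun n w => (enorm (sp_integral (S n) W t w - Z w))%:E).

(* V is a strong solution, started at x and driven by W, of
   dV = f(V) dt + sg(V) dW. *)
Record strong_solution W (f : 'cV[R]_d -> 'cV[R]_d) (sg : 'cV[R]_d -> 'M[R]_d)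
    (x : 'cV[R]_d) V : Prop := StrongSolution {
  sol_adapted : forall t, 0 <= t -> measurable_wrt (filtration W t) (V t);
  sol_continuous : continuous_paths V;
  sol_equation : exists Z : R -> Omega -> 'cV[R]_d,
    (forall t, 0 <= t -> ito_integral W (fun s w => sg (V s w)) t (Z t)) /\
    {ae P, forall w, forall t, 0 <= t ->
       V t w = x
             + (\col_i \int[lebesgue_measure]_(s in `[0, t]) f (V s w) i ord0)
             + Z t w} }.

(* P_t[Phi](x) = E Phi(V_t^x), where V x is the process started at x *)
Definition semigroup (V : 'cV[R]_d -> R -> Omega -> 'cV[R]_d) (t : R)
    (Phi : 'cV[R]_d -> R) (x : 'cV[R]_d) : R :=
  fine ('E_P[fun w => Phi (V x t w)])%E.

End Processes.

(* Main.v *)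
(** Reflection coupling, carried out on the Euler scheme. Far away the dissipativity of the
    drift brings two copies together, nearby the noise does: driving the second copy by the
    noise reflected along [sg x]^-1 (x - y) makes the distance fluctuate, and hypothesis (iv)
    bounds the fluctuations of [sg x - sg y] in the direction x - y so that the reflected part
    survives. Hence a modulus of continuity of the form A (1 - exp (- kap r)) + c r, r = |x - y|,
    is regularized in unit time and then contracted at each step, with constants that depend on
    the drift only through eta and B. The drift is first replaced, outside a ball, by a
    globally Lipschitz and still dissipative one; the Euler chain converges in probability to
    the solution as long as the latter stays in the ball, and the radius then tends to infinity.
    This gives the bound for Lipschitz test functions, which suffice because the functions
    that they approximate in mean under two given laws include all Borel indicators. *)
From HB Require Import structures.
Require Import Defs.
From mathcomp Require Import all_boot all_order all_algebra.
From mathcomp Require Import all_classical all_reals all_analysis.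
From mathcomp Require Import measurable_realfun ring lra.
Set Implicit Arguments.
Unset Strict Implicit.
Unset Printing Implicit Defensive.
Import Order.TTheory GRing.Theory Num.Theory.
Import numFieldNormedType.Exports.
Local Open Scope classical_set_scope.
Local Open Scope ring_scope.

(** * Euclidean norms and the radial projection *)

Section MatrixDot.
Context {R : realType}.

(** No coupled process is constructed. A coupling serves only inside a single step, to bound
    [step_op u x - step_op u y] for the transition operator; the bound is then iterated on
    functions, so the meeting time of two copies never appears. All scales come from one parameter
    [theta]: the time step is [theta ^+ 4], the noise of a step has size [theta ^+ 2], and copies
    closer than [theta] receive the same noise instead of reflected noises. At distance r >= theta
    the error of a reflected step is of order theta^8 / r^3 <= theta^5, below theta that of a common
    noise is r theta^4 <= theta^5, and over t / theta^4 steps these errors add up to O(theta). The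
    Lipschitz constant of the drift acts only on this error and on how small [theta] must be, hence
    not on the rate. On the side of the solution the obstacle is that an Ito integral is given only
    as a limit in probability of simple integrals: the isometry is applied to integrands cut down to
    the bound of [sg], and Lenglart's inequality controls what is cut off. *)

Definition mdot {m n} (A B : 'M[R]_(m, n)) : R := \sum_i \sum_j A i j * B i j.

Lemma scalar_productE d (x y : 'cV[R]_d) : scalar_product x y = mdot x y.
Proof. by apply: eq_bigr => i _; rewrite big_ord1. Qed.

Section mn.
Context {m n : nat}.
Implicit Types A B C : 'M[R]_(m, n).

Lemma mdotC A B : mdot A B = mdot B A.
Proof. by apply: eq_bigr => i _; apply: eq_bigr => j _; rewrite mulrC. Qed.

Lemma mdotDl A B C : mdot (A + B) C = mdot A C + mdot B C.
Proof.
rewrite /mdot -big_split; apply: eq_bigr => i _ /=.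
by rewrite -big_split; apply: eq_bigr => j _ /=; rewrite mxE mulrDl.
Qed.

Lemma mdotZl k A B : mdot (k *: A) B = k * mdot A B.
Proof.
rewrite /mdot mulr_sumr; apply: eq_bigr => i _.
by rewrite mulr_sumr; apply: eq_bigr => j _; rewrite mxE mulrA.
Qed.

Lemma mdotNl A B : mdot (- A) B = - mdot A B.
Proof. by rewrite -scaleN1r mdotZl mulN1r. Qed.

Lemma mdotBl A B C : mdot (A - B) C = mdot A C - mdot B C.
Proof. by rewrite mdotDl mdotNl. Qed.

Lemma mdotDr A B C : mdot A (B + C) = mdot A B + mdot A C.
Proof. by rewrite mdotC mdotDl !(mdotC _ A). Qed.

Lemma mdotZr k A B : mdot A (k *: B) = k * mdot A B.
Proof. by rewrite mdotC mdotZl mdotC. Qed.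

Lemma mdotNr A B : mdot A (- B) = - mdot A B.
Proof. by rewrite mdotC mdotNl mdotC. Qed.

Lemma mdotBr A B C : mdot A (B - C) = mdot A B - mdot A C.
Proof. by rewrite mdotDr mdotNr. Qed.

Lemma mdot0l A : mdot 0 A = 0.
Proof. by rewrite -(scale0r (0 : 'M[R]_(m, n))) mdotZl mul0r. Qed.

Lemma mdot0r A : mdot A 0 = 0.
Proof. by rewrite mdotC mdot0l. Qed.

Lemma mdot_suml I (s : seq I) (Q : pred I) (F : I -> 'M[R]_(m, n)) B :
  mdot (\sum_(i <- s | Q i) F i) B = \sum_(i <- s | Q i) mdot (F i) B.
Proof.
apply: (big_morph (fun x => mdot x B)); last exact: mdot0l.
by move=> x y; exact: mdotDl.
Qed.

Lemma mdot_sumr I (s : seq I) (Q : pred I) (F : I -> 'M[R]_(m, n)) B :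
  mdot B (\sum_(i <- s | Q i) F i) = \sum_(i <- s | Q i) mdot B (F i).
Proof. by rewrite mdotC mdot_suml; apply: eq_bigr => i _; rewrite mdotC. Qed.

Lemma mdotvv_ge0 A : 0 <= mdot A A.
Proof. by apply: sumr_ge0 => i _; apply: sumr_ge0 => j _; rewrite -expr2 sqr_ge0. Qed.

Lemma enorm_sqr A : enorm A ^+ 2 = mdot A A.
Proof.
rewrite /enorm; have -> : \sum_i \sum_j A i j ^+ 2 = mdot A A by [].
by rewrite sqr_sqrtr// mdotvv_ge0.
Qed.

Lemma enorm_ge0 A : 0 <= enorm A.
Proof. exact: sqrtr_ge0. Qed.

Lemma enormZ k A : enorm (k *: A) = `|k| * enorm A.
Proof.
apply/eqP; rewrite -(@eqrXn2 _ 2)// ?enorm_ge0 ?mulr_ge0 ?enorm_ge0//.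
by rewrite exprMn !enorm_sqr mdotZl mdotZr mulrA -expr2 real_normK ?num_real.
Qed.

Lemma enormN A : enorm (- A) = enorm A.
Proof. by rewrite -scaleN1r enormZ normrN1 mul1r. Qed.

Lemma enorm_distC A B : enorm (A - B) = enorm (B - A).
Proof. by rewrite -enormN opprB. Qed.

Lemma entry_le_enorm A i j : `|A i j| <= enorm A.
Proof.
rewrite -(@ler_pXn2r _ 2)// ?nnegrE ?enorm_ge0//.
rewrite real_normK ?num_real// enorm_sqr /mdot (bigD1 i)//= (bigD1 j)//=.
rewrite -addrA -expr2 lerDl addr_ge0//; first by apply: sumr_ge0 => k _; rewrite -expr2 sqr_ge0.
by apply: sumr_ge0 => k _; apply: sumr_ge0 => l _; rewrite -expr2 sqr_ge0.
Qed.

Lemma enorm_eq0 A : (enorm A == 0) = (A == 0).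
Proof.
apply/eqP/eqP => [A0|->].
  apply/matrixP => i j; rewrite mxE; apply/eqP; rewrite -normr_le0 -A0.
  exact: entry_le_enorm.
by apply/eqP; rewrite -sqrf_eq0 enorm_sqr mdot0l.
Qed.

Lemma enorm0 : enorm (0 : 'M[R]_(m, n)) = 0.
Proof. by apply/eqP; rewrite enorm_eq0. Qed.

Lemma enorm_gt0 A : (0 < enorm A) = (A != 0).
Proof. by rewrite lt0r enorm_ge0 andbT enorm_eq0. Qed.

(** Cauchy-Schwarz: with a, b the two norms and c the product, the squared norm of
    [enorm B *: A - enorm A *: B] is 2ab(ab - c). *)
Lemma mdot_le A B : mdot A B <= enorm A * enorm B.
Proof.
have [->|A0] := eqVneq A 0; first by rewrite mdot0l mulr_ge0// enorm_ge0.
have [->|B0] := eqVneq B 0; first by rewrite mdot0r mulr_ge0// enorm_ge0.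
have a0 : 0 < enorm A by rewrite enorm_gt0.
have b0 : 0 < enorm B by rewrite enorm_gt0.
have := mdotvv_ge0 (enorm B *: A - enorm A *: B).
rewrite mdotBl !mdotBr !mdotZl !mdotZr -!enorm_sqr (mdotC B A).
set a := enorm A in a0 *; set b := enorm B in b0 *; set c := mdot A B => H.
have : 0 <= (2 * (a * b)) * (a * b - c) by apply: le_trans H _; lra.
by rewrite pmulr_rge0 ?subr_ge0// !mulr_gt0.
Qed.

Lemma normr_mdot A B : `|mdot A B| <= enorm A * enorm B.
Proof.
by rewrite ler_norml mdot_le andbT lerNl -mdotNl -(enormN A) mdot_le.
Qed.

Lemma ler_enormD A B : enorm (A + B) <= enorm A + enorm B.
Proof.
rewrite -(@ler_pXn2r _ 2)// ?nnegrE ?addr_ge0 ?enorm_ge0// sqrrD !enorm_sqr.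
rewrite mdotDl !mdotDr (mdotC B A); have := mdot_le A B; lra.
Qed.

Lemma ler_enormB A B : enorm (A - B) <= enorm A + enorm B.
Proof. by rewrite -(enormN B) ler_enormD. Qed.

Lemma ler_enorm_dist A B C : enorm (A - C) <= enorm (A - B) + enorm (B - C).
Proof. by rewrite -(subrKA B) ler_enormD. Qed.

Lemma lerB_enorm A B : enorm A - enorm B <= enorm (A - B).
Proof. by rewrite lerBlDr -{1}(subrK B A) ler_enormD. Qed.

Lemma ler_enorm_sum I (s : seq I) (Q : pred I) (F : I -> 'M[R]_(m, n)) :
  enorm (\sum_(i <- s | Q i) F i) <= \sum_(i <- s | Q i) enorm (F i).
Proof.
elim/big_rec2 : _ => [|i y x _ H]; first by rewrite enorm0.
by apply: le_trans (ler_enormD _ _) _; rewrite lerD2l.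
Qed.

Lemma enorm_le_sum A : enorm A <= \sum_i \sum_j `|A i j|.
Proof.
rewrite {1}(matrix_sum_delta A).
apply: le_trans (ler_enorm_sum _ _ _) _; apply: ler_sum => i _.
apply: le_trans (ler_enorm_sum _ _ _) _; apply: ler_sum => j _.
rewrite enormZ ler_piMr// -(@ler_pXn2r _ 2)// ?nnegrE ?enorm_ge0//.
rewrite expr1n enorm_sqr /mdot (bigD1 i)//= (bigD1 j)//= !mxE !eqxx mulr1.
rewrite big1 ?addr0 => [|k /negbTE kj]; last by rewrite mxE kj andbF mul0r.
rewrite big1 ?addr0// => k /negbTE kj; rewrite big1// => l _.
by rewrite mxE kj mul0r.
Qed.

Lemma enorm_sqrD_le A B : enorm (A + B) ^+ 2 <= 2 * enorm A ^+ 2 + 2 * enorm B ^+ 2.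
Proof.
have := ler_enormD A B; have := enorm_ge0 (A + B).
have := sqr_ge0 (enorm A - enorm B); nra.
Qed.

End mn.

Lemma enorm_tr m n (A : 'M[R]_(m, n)) : enorm A^T = enorm A.
Proof.
rewrite /enorm exchange_big; congr Num.sqrt; apply: eq_bigr => i _.
by apply: eq_bigr => j _; rewrite mxE.
Qed.

Lemma mdot_mulmxl m n p (A : 'M[R]_(m, n)) (x : 'M[R]_(n, p)) y :
  mdot (A *m x) y = mdot x (A^T *m y).
Proof.
rewrite /mdot.
under eq_bigr do under eq_bigr do rewrite mxE mulr_suml.
under [RHS]eq_bigr do under eq_bigr do rewrite mxE mulr_sumr.
under eq_bigr do rewrite exchange_big/=.
rewrite exchange_big; apply: eq_bigr => k _; rewrite exchange_big.
apply: eq_bigr => j _; apply: eq_bigr => i _.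
by rewrite mxE mulrCA mulrA.
Qed.

(** Cauchy-Schwarz for each entry, between a row of [A] and a column of [B]. *)
Lemma enorm_mulmx m n p (A : 'M[R]_(m, n)) (B : 'M[R]_(n, p)) :
  enorm (A *m B) <= enorm A * enorm B.
Proof.
rewrite -(@ler_pXn2r _ 2)// ?nnegrE ?mulr_ge0 ?enorm_ge0//.
rewrite exprMn !enorm_sqr /mdot mulr_suml; apply: ler_sum => i _.
rewrite [X in _ * X]exchange_big mulr_sumr; apply: ler_sum => k _ /=.
rewrite -expr2 mxE.
have := @mdot_le _ _ (row i A)^T (col k B); have := @mdot_le _ _ (- (row i A)^T) (col k B).
rewrite enormN mdotNl.
have -> : mdot (row i A)^T (col k B) = \sum_j A i j * B j k.
  by apply: eq_bigr => j _; rewrite big_ord1 !mxE.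
have -> : \sum_j A i j * A i j = enorm (row i A)^T ^+ 2.
  by rewrite enorm_sqr; apply: eq_bigr => j _; rewrite big_ord1 !mxE.
have -> : \sum_j B j k * B j k = enorm (col k B) ^+ 2.
  by rewrite enorm_sqr; apply: eq_bigr => j _; rewrite big_ord1 !mxE.
have := @enorm_ge0 _ _ (row i A)^T; have := @enorm_ge0 _ _ (col k B).
rewrite -exprMn => a0 b0 H1 H2; rewrite -[leLHS]real_normK ?num_real//.
by rewrite ler_pXn2r ?nnegrE ?mulr_ge0// ler_norml H2 lerNl H1.
Qed.

End MatrixDot.

Section RadialProjection.
Context {R : realType} {m n : nat}.
Implicit Types x y : 'M[R]_(m, n).
Variable K : R.
Hypothesis K0 : 0 <= K.

Definition rproj x := if enorm x <= K then x else (K / enorm x) *: x.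

Lemma rproj_id x : enorm x <= K -> rproj x = x.
Proof. by rewrite /rproj => ->. Qed.

Lemma enorm_rproj x : enorm (rproj x) <= K.
Proof.
rewrite /rproj; case: ifPn => //; rewrite -ltNge => Kx.
have x0 := le_lt_trans K0 Kx.
rewrite enormZ ger0_norm ?divr_ge0 ?enorm_ge0// mulfVK ?gt_eqF//.
Qed.

(** The variational inequality of the metric projection onto a ball; monotonicity, the Lipschitz
    bound and minimality of the distance all follow from it. *)
Lemma rproj_var x z : enorm z <= K -> mdot (x - rproj x) (z - rproj x) <= 0.
Proof.
move=> zK; rewrite /rproj; case: ifPn => [_|]; first by rewrite subrr mdot0l.
rewrite -ltNge => Kx; have x0 := le_lt_trans K0 Kx.
set a := K / enorm x.
have a1 : a <= 1 by rewrite ler_pdivrMr// mul1r ltW.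
rewrite -{1}(scale1r x) -scalerBl mdotZl mdotBr mdotZr -enorm_sqr.
rewrite mulr_ge0_le0 ?subr_ge0// /a expr2 mulrA mulfVK ?gt_eqF// subr_le0.
by apply: le_trans (mdot_le _ _) _; rewrite mulrC ler_wpM2r// ltW.
Qed.

(** Add the two variational inequalities, each taken at the projection of the other point. *)
Lemma rproj_mono x y :
  0 <= mdot (rproj x - rproj y) ((x - rproj x) - (y - rproj y)).
Proof.
have := rproj_var x (enorm_rproj y); have := rproj_var y (enorm_rproj x).
rewrite (mdotC (rproj x - rproj y)) !mdotBl !mdotBr (mdotC (rproj y) (rproj x)); lra.
Qed.

Lemma rproj_lip x y : enorm (rproj x - rproj y) <= enorm (x - y).
Proof.
have H := rproj_mono x y.
have E : (x - rproj x) - (y - rproj y) = (x - y) - (rproj x - rproj y).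
  by apply/matrixP => i j; rewrite !mxE; ring.
rewrite E mdotBr -enorm_sqr subr_ge0 in H.
have {}H := le_trans H (mdot_le _ _).
have [->|p0] := eqVneq (enorm (rproj x - rproj y)) 0; first exact: enorm_ge0.
move: H; rewrite expr2 ler_pM2l// lt0r p0 enorm_ge0//.
Qed.

Lemma enorm_sub_rproj_le x z : enorm z <= K -> enorm (x - rproj x) <= enorm (x - z).
Proof.
move=> /(rproj_var x) H.
rewrite -(@ler_pXn2r _ 2)// ?nnegrE ?enorm_ge0//.
have -> : x - z = (x - rproj x) - (z - rproj x) by rewrite opprB addrA subrK.
have := mdotvv_ge0 (z - rproj x).
move: (x - rproj x) (z - rproj x) H => u v H vv.
rewrite !enorm_sqr mdotBl !mdotBr (mdotC v u); lra.
Qed.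

End RadialProjection.

Section EnormTopology.
Context {R : realType} {m n : nat}.
Implicit Types A B : 'M[R]_(m, n).

Lemma entry_le_norm A i j : `|A i j| <= `|A|.
Proof.
rewrite [leRHS]/Num.Def.normr/= mx_normrE.
by apply: (le_trans _ (le_bigmax _ _ (i, j))).
Qed.

Lemma norm_le_enorm A : `|A| <= enorm A.
Proof.
rewrite [leLHS]/Num.Def.normr/= mx_normrE; apply: bigmax_le; first exact: enorm_ge0.
by move=> [i j] _; exact: entry_le_enorm.
Qed.

Lemma enorm_le_norm A : enorm A <= (m * n)%:R * `|A|.
Proof.
apply: le_trans (enorm_le_sum _) _; rewrite pair_big/=.
apply: (@le_trans _ _ (\sum_(p : 'I_m * 'I_n) `|A|)).
  by apply: ler_sum => p _; exact: entry_le_norm.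
by rewrite sumr_const card_prod !card_ord mulr_natl.
Qed.

Lemma near_enorm A (e : R) : 0 < e -> \forall B \near A, enorm (B - A) < e.
Proof.
move=> e0; have d0 : 0 < (m * n)%:R + 1 :> R by rewrite ltr_wpDl.
have := nbhsx_ballx A _ (divr_gt0 e0 d0); apply: filterS => B.
rewrite -ball_normE /ball_/= distrC ltr_pdivlMr// mulrC => H.
apply: le_lt_trans (enorm_le_norm _) (le_lt_trans _ H).
by rewrite ler_wpM2r// lerDl.
Qed.

Lemma nbhs_enormP A (U : set 'M[R]_(m, n)) :
  nbhs A U <-> exists2 e : R, 0 < e & forall B, enorm (B - A) < e -> U B.
Proof.
split=> [/nbhs_ballP[e /= e0 H]|[e e0 H]]; last by apply: filterS (near_enorm A e0).
exists e => // B BA; apply: H; rewrite -ball_normE /ball_/= distrC.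
exact: le_lt_trans (norm_le_enorm _) BA.
Qed.

End EnormTopology.

(** * Globally Lipschitz truncation of a dissipative drift *)

Section LipschitzOnBalls.
Context {R : realType} {d : nat}.
Implicit Types (x y z : 'cV[R]_d) (f : 'cV[R]_d -> 'cV[R]_d).

(** Compactness of a cube containing the ball, in near-covering form. A single small [e] plays both
    roles, radius of validity and inverse of the Lipschitz constant, so that only one quantity has
    to be made uniform. The detour through row vectors is due to the form of the compactness theorem
    for cubes. *)
Lemma locally_eLipschitz_unif f (M : R) : locally_eLipschitz f ->
  exists2 e : R, 0 < e & forall x y, enorm x <= M -> enorm (y - x) < e ->
    enorm (f y - f x) <= e^-1 * enorm (y - x).
Proof.
move=> lf.
pose K := [set v : 'rV[R]_d | forall i, `[- M, M]%classic (v ord0 i)].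
pose Q (e : R) (v : 'rV[R]_d) := forall w, enorm (w - v^T) < e ->
  enorm (f w - f v^T) <= e^-1 * enorm (w - v^T).
have cK : compact K.
  by apply: (@rV_compact _ d (fun=> `[- M, M]%classic)) => _; exact: segment_compact.
have : \forall e \near 0^'+, K `<=` Q e.
  move/compact_near_coveringP : cK; apply => v _.
  have [r [L [r0 L0 H]]] := lf v^T.
  have r2 : 0 < r / 2 by rewrite divr_gt0.
  have N := near_enorm v r2.
  near=> v' e => w Hw.
  have e0 : 0 < e by near: e; exact: nbhs_right_gt.
  have er : e < r / 2 by near: e; exact: nbhs_right_lt.
  have eL : e < (L + 1)^-1 by near: e; apply: nbhs_right_lt; rewrite invr_gt0 ltr_wpDl.
  have v'r : enorm (v'^T - v^T) < r / 2 by rewrite -linearB/= enorm_tr; near: v'.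
  have wr : enorm (w - v^T) < r.
    apply: le_lt_trans (ler_enorm_dist _ v'^T _) _.
    by rewrite [ltRHS]splitr ltrD// (lt_trans Hw).
  apply: le_trans (H _ _ wr _) _; first by apply: lt_trans v'r _; rewrite ltr_pdivrMr// ltr_pMr// ltr1n.
  rewrite ler_wpM2r ?enorm_ge0//.
  apply: (@le_trans _ _ (L + 1)); first by rewrite lerDl.
  by rewrite -(invrK (L + 1)) lef_pV2 ?posrE ?invr_gt0 ?ltr_wpDl// ltW.
move=> near0.
have [e [e0 H]] : exists e : R, 0 < e /\ K `<=` Q e.
  near (0 : R)^'+ => e; exists e; split; first by near: e; exact: nbhs_right_gt.
  by near: e.
exists e => // x y xM yx.
have := H x^T; rewrite /Q trmxK; apply => // i /=.
rewrite in_itv/= -ler_norml mxE; exact: le_trans (entry_le_enorm _ _ _) xM.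
Unshelve. all: by end_near. Qed.

(** Cut the segment from [x] to [y], which stays in the convex ball, into pieces shorter than the
    uniform radius and add up the increments. *)
Lemma locally_eLipschitz_ball f (M : R) : locally_eLipschitz f ->
  exists2 L : R, 0 <= L & forall x y, enorm x <= M -> enorm y <= M ->
    enorm (f y - f x) <= L * enorm (y - x).
Proof.
move=> /locally_eLipschitz_unif-/(_ M)[e e0 H]; exists e^-1; first by rewrite invr_ge0 ltW.
move=> x y xM yM.
pose N := (Num.truncn (enorm (y - x) / e)).+1.
have NE : enorm (y - x) / N%:R < e.
  rewrite ltr_pdivrMr ?ltr0n// mulrC -ltr_pdivrMr//.
  exact: truncnS_gt.
have N0 : (N%:R : R) != 0 by rewrite pnatr_eq0.
pose z (k : nat) : 'cV[R]_d := x + (k%:R / N%:R) *: (y - x).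
have z0 : z 0 = x by rewrite /z mul0r scale0r addr0.
have zN : z N = y by rewrite /z divff// scale1r addrC subrK.
have zS k : z k.+1 - z k = N%:R^-1 *: (y - x).
  rewrite /z opprD addrACA subrr add0r -scalerBl -mulrBl.
  by rewrite -natrB ?leqnSn// subSn// subnn mul1r.
have zM k : (k <= N)%N -> enorm (z k) <= M.
  move=> kN; have -> : z k = (1 - k%:R / N%:R) *: x + (k%:R / N%:R) *: y.
    by apply/matrixP => i j; rewrite !mxE; ring.
  have k1 : k%:R / N%:R <= 1 :> R by rewrite ler_pdivrMr ?ltr0n// mul1r ler_nat.
  have k0 : 0 <= k%:R / N%:R :> R by rewrite divr_ge0.
  apply: le_trans (ler_enormD _ _) _.
  rewrite !enormZ !ger0_norm ?subr_ge0//.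
  by have := ler_wpM2l k0 yM; have := ler_wpM2l (_ : 0 <= 1 - k%:R / N%:R) xM; rewrite subr_ge0 => /(_ k1); lra.
have -> : f y - f x = \sum_(0 <= k < N) (f (z k.+1) - f (z k)).
  by rewrite telescope_sumr// z0 zN.
apply: le_trans (ler_enorm_sum _ _ _) _.
apply: (@le_trans _ _ (\sum_(0 <= k < N) (e^-1 * (enorm (y - x) / N%:R)))).
  rewrite big_nat [leRHS]big_nat; apply: ler_sum => k /= kN.
  have zk : enorm (z k.+1 - z k) = enorm (y - x) / N%:R.
    by rewrite zS enormZ ger0_norm ?invr_ge0// mulrC.
  by rewrite -zk; apply: H; rewrite ?zM ?zk// ltnW.
rewrite sumr_const_nat subn0 -[leLHS]mulr_natr -!mulrA.
by rewrite mulVf// mulr1.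
Qed.

End LipschitzOnBalls.

Section TruncatedDrift.
Context {R : realType} {d : nat}.
Implicit Types (x y z : 'cV[R]_d) (f : 'cV[R]_d -> 'cV[R]_d).

(* [x - rproj M x] pulls back inwards: the monotonicity of the radial projection
   makes a large multiple of it absorb the cross terms that come from composing
   [f] with the projection. *)
Lemma dissipative_truncation (eta M : R) f : 0 < eta -> 0 <= M ->
  dissipative eta f -> locally_eLipschitz f ->
  exists g, [/\ forall x, enorm x <= M -> g x = f x, eLipschitz g &
    dissipative (eta / 4) g].
Proof.
move=> eta0 M0 df /locally_eLipschitz_ball-/(_ M)[L L0 HL].
(* With a and dl the norms of the differences of projections and of residues, L^2 / (2 eta) is what
   Young's inequality needs to absorb L a dl against half of eta a^2; the extra eta / 2 makes the
   residue itself dissipative. The remaining bound -(eta / 2)(a^2 + dl^2) is at most -(eta / 4)(a +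
   dl)^2, whence eta / 4. *)
pose c := L ^+ 2 / (2 * eta) + eta / 2.
have c0 : 0 <= c by rewrite addr_ge0// divr_ge0 ?sqr_ge0// ?mulr_ge0// ltW.
have HLp x y : enorm (f (rproj M x) - f (rproj M y)) <= L * enorm (rproj M x - rproj M y).
  by apply: HL; exact: enorm_rproj.
exists (fun x => f (rproj M x) - c *: (x - rproj M x)); split.
- by move=> x xM; rewrite rproj_id// subrr scaler0 subr0.
- exists (L + c * 2); first by rewrite addr_ge0// mulr_ge0.
  move=> x y.
  have -> : f (rproj M x) - c *: (x - rproj M x) - (f (rproj M y) - c *: (y - rproj M y))
      = (f (rproj M x) - f (rproj M y)) - c *: ((x - y) - (rproj M x - rproj M y)).
    by apply/matrixP => i j; rewrite !mxE; ring.
  apply: le_trans (ler_enormB _ _) _; rewrite enormZ ger0_norm//.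
  have := rproj_lip M0 x y; have := HLp x y.
  have := ler_enormB (x - y) (rproj M x - rproj M y).
  have := enorm_ge0 (x - y).
  move: (enorm (f _ - _)) (enorm (_ - _ - _)) (enorm (rproj M x - _)) (enorm (x - y)) => A D B E.
  move=> E0 H1 H2 H3.
  have : L * B <= L * E by rewrite ler_wpM2l.
  have : c * D <= c * (2 * E) by rewrite ler_wpM2l//; lra.
  lra.
move=> x y; rewrite scalar_productE.
set px := rproj M x; set py := rproj M y.
have -> : f px - c *: (x - px) - (f py - c *: (y - py))
      = (f px - f py) - c *: ((x - px) - (y - py)).
  by apply/matrixP => i j; rewrite !mxE; ring.
have E : x - y = (px - py) + ((x - px) - (y - py)).
  by apply/matrixP => i j; rewrite !mxE; ring.
have := rproj_mono M0 x y; have := df px py; rewrite scalar_productE -/px -/py => H1 H2.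
have := le_trans (mdot_le (f px - f py) ((x - px) - (y - py)))
  (ler_wpM2r (enorm_ge0 _) (HLp x y)).
rewrite -/px -/py.
have := ler_enormD (px - py) ((x - px) - (y - py)); have := enorm_ge0 (x - y).
rewrite !E.
have := enorm_sqr ((x - px) - (y - py)).
move: (x - px - (y - py)) (px - py) (f px - f py) H1 H2 => D p F H1 H2.
rewrite mdotDr !(mdotBl F) !mdotZl (mdotC D p) => D2 E0 H3 H4.
have := enorm_ge0 D; have := enorm_ge0 p.
move: (enorm D) (enorm p) (enorm (p + D)) D2 H1 H3 E0 H4 => dl a r D2 H1 H3 r0 H4 a0 dl0.
rewrite -D2.
apply: (@le_trans _ _ (- eta * a ^+ 2 + L * a * dl - c * dl ^+ 2)).
  by have := mulr_ge0 c0 H2; lra.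
apply: (@le_trans _ _ (- (eta / 2) * a ^+ 2 - (eta / 2) * dl ^+ 2)).
  have : 0 <= (eta * a - L * dl) ^+ 2 / (2 * eta) by rewrite divr_ge0 ?sqr_ge0// mulr_ge0// ltW.
  have -> : (eta * a - L * dl) ^+ 2 / (2 * eta) = eta / 2 * a ^+ 2 - L * a * dl + L ^+ 2 / (2 * eta) * dl ^+ 2.
    by field; rewrite gt_eqF.
  rewrite /c; lra.
have : r ^+ 2 <= 2 * a ^+ 2 + 2 * dl ^+ 2.
  apply: (@le_trans _ _ ((a + dl) ^+ 2)); first by rewrite ler_pXn2r// nnegrE addr_ge0.
  by have := sqr_ge0 (a - dl); lra.
by move=> /(ler_wpM2l (ltW eta0)); lra.
Qed.

End TruncatedDrift.

(** * Measurability and expectations *)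

(** Matrices made into a measurable type whose measurable sets are those of [borel_set]; it lets
    [measurable_wrt] be handled through [measurable_fun]. *)
Definition bspace (R : realType) (m n : nat) := g_sigma_algebraType (@open 'M[R]_(m, n)).

Section BorelMatrices.
Context {R : realType}.

Lemma continuous_measurable_bspace m n (f : 'M[R]_(m, n) -> R) :
  continuous f -> measurable_fun setT (f : bspace R m n -> R).
Proof.
move=> cf; apply: (measurability _ (RGenOpens.measurableE R)) => _ [_ [a [b ->]] <-].
rewrite setTI; apply: sub_sigma_algebra; move/continuousP : cf; apply.
exact: interval_open.
Qed.

Lemma continuous_entry m n (i : 'I_m) (j : 'I_n) :
  continuous (fun A : 'M[R]_(m, n) => A i j).
Proof.
move=> A; exact: coord_continuous.
Qed.

Lemma measurable_entry m n (i : 'I_m) (j : 'I_n) :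
  measurable_fun setT (fun A : bspace R m n => A i j).
Proof. exact: continuous_measurable_bspace (@continuous_entry _ _ i j). Qed.

(** An open set is the countable union of the boxes contained in it that have a rational centre and
    half-side 1 / (N + 1); the preimage of a box only involves entries. *)
Lemma measurable_mx d (T : measurableType d) m n (f : T -> 'M[R]_(m, n)) :
  (forall i j, measurable_fun setT (fun t => f t i j)) ->
  measurable_fun setT (f : T -> bspace R m n).
Proof.
move=> mf.
apply: (@measurability _ _ T (bspace R m n) setT f (@open 'M[R]_(m, n))) => [|_ [U oO <-]]; first by [].
rewrite setTI.
pose box (p : 'M[rat]_(m, n) * nat) : set 'M[R]_(m, n) :=
  [set A | forall i j, `|A i j - ratr (p.1 i j)| < p.2.+1%:R^-1].
have OE : U = \bigcup_(p in [set p | box p `<=` U]) box p.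
  apply/seteqP; split => [A OA|A [p pO pA]]; last exact: pO.
  have /nbhs_enormP[e e0 eO] : nbhs A U by apply: open_nbhs_nbhs.
  pose N := (Num.truncn (2 * (m * n)%:R / e)).
  have NE : N.+1%:R^-1 * (2 * (m * n)%:R) < e.
    by rewrite mulrC ltr_pdivrMr ?ltr0n// [ltRHS]mulrC -ltr_pdivrMr// truncnS_gt.
  have Q i j : exists q : rat, `|A i j - ratr q| < N.+1%:R^-1.
    have /rat_in_itvoo[q] : A i j - N.+1%:R^-1 < A i j + N.+1%:R^-1.
      by rewrite ltrD2l (@lt_trans _ _ 0)// ?oppr_lt0 invr_gt0.
    rewrite in_itv/= => /andP[q1 q2]; exists q.
    by rewrite distrC ltr_distl q1 q2.
  have [q Hq] : exists q : 'M[rat]_(m, n), forall i j, `|A i j - ratr (q i j)| < N.+1%:R^-1.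
    exists (\matrix_(i, j) projT1 (cid (Q i j))) => i j; rewrite mxE.
    exact: projT2 (cid (Q i j)).
  exists (q, N) => //= B qB; apply: eO.
  apply: le_lt_trans (enorm_le_sum _) (le_lt_trans _ NE).
  rewrite pair_big/=.
  apply: (@le_trans _ _ (\sum_(p : 'I_m * 'I_n) (2 * N.+1%:R^-1))).
    apply: ler_sum => -[i j] _ /=; rewrite !mxE.
    have := ler_distD (ratr (q i j)) (B i j) (A i j); have := ltW (qB i j); have := ltW (Hq i j).
    by rewrite /= (distrC (A i j)); move: (N.+1%:R^-1) => ?; lra.
  by rewrite sumr_const card_prod !card_ord -mulr_natr; move: (N.+1%:R^-1) => ?; lra.
have -> : f @^-1` U = \bigcup_p (if `[< box p `<=` U >] then f @^-1` box p else set0).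
  rewrite {1}OE; apply/seteqP; split => [t [p pO pt]|t [p _]].
    by exists p => //; case: asboolP.
  by case: asboolP => // pO pt; exists p.
apply: countable_bigcupT_measurable => [|p]; first exact/countableP.
case: ifPn => // _.
have -> : f @^-1` box p = \bigcap_(ij : 'I_m * 'I_n)
    ((fun t => `|f t ij.1 ij.2 - ratr (p.1 ij.1 ij.2)|) @^-1` `]-oo, p.2.+1%:R^-1[%classic).
  apply/seteqP; split => [t H ij _|t H i j]; first by rewrite /= in_itv/=; exact: H.
  by have := H (i, j) I; rewrite /= in_itv.
apply: fin_bigcap_measurable => // ij _.
rewrite -[X in measurable X]setTI; have : measurable_fun setT (fun t => `|f t ij.1 ij.2 - ratr (p.1 ij.1 ij.2)|); last by apply.
apply: measurableT_comp => //; exact: measurable_funB.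
Qed.

End BorelMatrices.

Section MeasurableMatrixFunctions.
Context {R : realType} d {T : measurableType d}.

Lemma measurable_mxP m n (f : T -> 'M[R]_(m, n)) i j :
  measurable_fun setT (f : T -> bspace R m n) ->
  measurable_fun setT (fun t => f t i j).
Proof.
move=> mf; exact: (measurableT_comp (@measurable_entry _ _ _ i j) mf).
Qed.

Lemma measurable_mxD m n (f g : T -> 'M[R]_(m, n)) :
  measurable_fun setT (f : T -> bspace R m n) ->
  measurable_fun setT (g : T -> bspace R m n) ->
  measurable_fun setT (fun t => f t + g t : bspace R m n).
Proof.
move=> mf mg; apply: measurable_mx => i j.
under eq_fun do rewrite mxE.
by apply: measurable_funD; exact: measurable_mxP.
Qed.

Lemma measurable_mxZ m n (k : T -> R) (f : T -> 'M[R]_(m, n)) :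
  measurable_fun setT k ->
  measurable_fun setT (f : T -> bspace R m n) ->
  measurable_fun setT (fun t => k t *: f t : bspace R m n).
Proof.
move=> mk mf; apply: measurable_mx => i j.
under eq_fun do rewrite mxE.
by apply: measurable_funM => //; exact: measurable_mxP.
Qed.

Lemma measurable_mxN m n (f : T -> 'M[R]_(m, n)) :
  measurable_fun setT (f : T -> bspace R m n) ->
  measurable_fun setT (fun t => - f t : bspace R m n).
Proof.
move=> mf; apply: measurable_mx => i j.
under eq_fun do rewrite mxE.
by apply: measurableT_comp => //; exact: measurable_mxP.
Qed.

Lemma measurable_mxB m n (f g : T -> 'M[R]_(m, n)) :
  measurable_fun setT (f : T -> bspace R m n) ->
  measurable_fun setT (g : T -> bspace R m n) ->
  measurable_fun setT (fun t => f t - g t : bspace R m n).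
Proof. by move=> mf mg; apply: measurable_mxD => //; exact: measurable_mxN. Qed.

Lemma measurable_mulmx m n p (f : T -> 'M[R]_(m, n)) (g : T -> 'M[R]_(n, p)) :
  measurable_fun setT (f : T -> bspace R m n) ->
  measurable_fun setT (g : T -> bspace R n p) ->
  measurable_fun setT (fun t => f t *m g t : bspace R m p).
Proof.
move=> mf mg; apply: measurable_mx => i j.
under eq_fun do rewrite mxE.
by apply: measurable_sum => k; apply: measurable_funM; exact: measurable_mxP.
Qed.

Lemma measurable_mxsum m n I (s : seq I) (f : I -> T -> 'M[R]_(m, n)) :
  (forall i, measurable_fun setT (f i : T -> bspace R m n)) ->
  measurable_fun setT (fun t => \sum_(i <- s) f i t : bspace R m n).
Proof.
move=> mf; apply: measurable_mx => i j.
under eq_fun do rewrite summxE.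
by apply: measurable_sum => k; exact: measurable_mxP.
Qed.

Lemma measurable_mdot m n (f g : T -> 'M[R]_(m, n)) :
  measurable_fun setT (f : T -> bspace R m n) ->
  measurable_fun setT (g : T -> bspace R m n) ->
  measurable_fun setT (fun t => mdot (f t) (g t)).
Proof.
move=> mf mg; apply: measurable_sum => i; apply: measurable_sum => j.
by apply: measurable_funM; exact: measurable_mxP.
Qed.

Lemma measurable_enorm m n (f : T -> 'M[R]_(m, n)) :
  measurable_fun setT (f : T -> bspace R m n) ->
  measurable_fun setT (fun t => enorm (f t)).
Proof.
move=> mf; rewrite (_ : (fun t => _) = @Num.sqrt R \o (fun t => mdot (f t) (f t))); last first.
  by apply/funext => t /=; rewrite -enorm_sqr sqrtr_sqr ger0_norm// enorm_ge0.
apply: measurableT_comp; last exact: measurable_mdot.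
by apply: continuous_measurable_fun; exact: sqrt_continuous.
Qed.

Lemma measurable_mx_if m n (b : T -> bool) (f g : T -> 'M[R]_(m, n)) :
  measurable_fun setT b ->
  measurable_fun setT (f : T -> bspace R m n) ->
  measurable_fun setT (g : T -> bspace R m n) ->
  measurable_fun setT ((fun t => if b t then f t else g t) : T -> bspace R m n).
Proof. by move=> mb mf mg; exact: measurable_fun_ifT. Qed.

End MeasurableMatrixFunctions.

Section LipschitzMeasurable.
Context {R : realType}.

Lemma measurable_lipschitz_mx p q m n (g : 'M[R]_(p, q) -> 'M[R]_(m, n)) (L : R) :
  0 <= L -> (forall x y, enorm (g x - g y) <= L * enorm (x - y)) ->
  measurable_fun setT (g : bspace R p q -> bspace R m n).
Proof.
move=> L0 HL.
apply: (@measurability _ _ (bspace R p q) (bspace R m n) setT g (@open 'M[R]_(m, n))) => [|_ [U oU <-]].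
  by [].
rewrite setTI; apply: sub_sigma_algebra.
rewrite openE => x /= Ux; apply/nbhs_enormP.
have /nbhs_enormP[e e0 eU] : nbhs (g x) U by apply: open_nbhs_nbhs.
exists (e / (L + 1)) => [|y yx]; first by rewrite divr_gt0// ltr_wpDl.
apply: eU; apply: le_lt_trans (HL _ _) _.
rewrite ltr_pdivlMr ?ltr_wpDl// mulrC in yx; apply: le_lt_trans yx.
by rewrite ler_wpM2r ?enorm_ge0// lerDl.
Qed.

Lemma measurable_eLipschitz d m n (g : 'cV[R]_d -> 'M[R]_(m, n)) :
  eLipschitz g -> measurable_fun setT (g : bspace R d 1 -> bspace R m n).
Proof.
by move=> [L L0 HL]; exact: (measurable_lipschitz_mx L0).
Qed.

Definition rLipschitz d (g : 'cV[R]_d -> R) :=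
  exists2 L : R, 0 <= L & forall x y, `|g x - g y| <= L * enorm (x - y).

Lemma measurable_rLipschitz d (g : 'cV[R]_d -> R) :
  rLipschitz g -> measurable_fun setT (g : bspace R d 1 -> R).
Proof.
move=> [L L0 HL].
have H : eLipschitz (fun x => \matrix_(i < 1, j < 1) g x).
  exists L => // x y; apply: le_trans (HL x y).
  apply: le_trans (enorm_le_sum _) _.
  by rewrite !big_ord1 !mxE.
have := measurable_mxP ord0 ord0 (measurable_eLipschitz H).
by rewrite (_ : (fun t => _) = g)//; apply/funext => t; rewrite mxE.
Qed.

End LipschitzMeasurable.

Section Expectation.
Context d {T : measurableType d} {R : realType} (P : probability T R).
Implicit Types (f g : T -> R) (A : set T).

Definition L1 f := P.-integrable setT (EFin \o f).
Definition ex f : R := \int[P]_w f w.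
Definition pr (A : set T) : R := fine (P A).

Lemma prE A : measurable A -> P A = (pr A)%:E.
Proof. by move=> mA; rewrite /pr fineK// fin_num_measure. Qed.

Lemma pr_le A B : measurable A -> measurable B -> A `<=` B -> pr A <= pr B.
Proof. by move=> mA mB AB; rewrite -lee_fin -!prE// le_measure// inE. Qed.

Lemma prU_le A B : measurable A -> measurable B -> pr (A `|` B) <= pr A + pr B.
Proof.
move=> mA mB; rewrite -lee_fin EFinD -!prE//; last exact: measurableU.
exact: measureU2.
Qed.

Lemma L1_meas f : L1 f -> measurable_fun setT f.
Proof. by move/measurable_int/measurable_EFinP. Qed.

Lemma L1_le f g : measurable_fun setT f -> (forall w, `|f w| <= g w) -> L1 g -> L1 f.
Proof.
move=> mf fg; apply: le_integrable => //; first exact/measurable_EFinP.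
by move=> w _ /=; rewrite lee_fin; apply: le_trans (fg w) (ler_norm _).
Qed.

Lemma L1_cst (c : R) : L1 (fun=> c).
Proof. exact: finite_measure_integrable_cst. Qed.

Lemma L1_bounded f (K : R) : measurable_fun setT f -> (forall w, `|f w| <= K) -> L1 f.
Proof. by move=> mf fK; apply: (L1_le (g := fun=> K)) => //; exact: L1_cst. Qed.

Lemma L1D f g : L1 f -> L1 g -> L1 (fun w => f w + g w).
Proof. by move=> lf lg; exact: (integrableD measurableT lf lg). Qed.

Lemma L1B f g : L1 f -> L1 g -> L1 (fun w => f w - g w).
Proof. by move=> lf lg; exact: (integrableB measurableT lf lg). Qed.

Lemma L1Z (k : R) f : L1 f -> L1 (fun w => k * f w).
Proof. by move=> lf; exact: (integrableZl measurableT k lf). Qed.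

Lemma L1Zr (k : R) f : L1 f -> L1 (fun w => f w * k).
Proof. by move=> lf; under [X in L1 X]eq_fun do rewrite mulrC; exact: L1Z. Qed.

Lemma L1_norm f : L1 f -> L1 (fun w => `|f w|).
Proof. by move=> lf; exact: integrable_norm. Qed.

Lemma L1_sum I (s : seq I) (f : I -> T -> R) : (forall i, L1 (f i)) ->
  L1 (fun w => \sum_(i <- s) f i w).
Proof.
move=> lf; elim: s => [|i s IH].
  by under [X in L1 X]eq_fun do rewrite big_nil; exact: L1_cst.
by under [X in L1 X]eq_fun do rewrite big_cons; exact: L1D.
Qed.

Lemma L1_mul f g : measurable_fun setT f -> measurable_fun setT g ->
  L1 (fun w => f w ^+ 2) -> L1 (fun w => g w ^+ 2) -> L1 (fun w => f w * g w).
Proof.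
move=> mf mg lf lg; apply: (L1_le _ _ (L1D lf lg)); first exact: measurable_funM.
move=> w; rewrite ler_norml; have := sqr_ge0 (f w + g w); have := sqr_ge0 (f w - g w).
have := sqr_ge0 (f w); have := sqr_ge0 (g w).
move=> *; apply/andP; split; lra.
Qed.

Lemma L1_indicM A f : measurable A -> L1 f -> L1 (fun w => \1_A w * f w).
Proof.
move=> mA lf; apply: (L1_le _ _ (L1_norm lf)) => [|w].
  by apply: measurable_funM; [exact: measurable_indic|exact: L1_meas].
by rewrite normrM indicE; case: (w \in A); rewrite ?normr0 ?normr1 ?mul0r ?mul1r.
Qed.

Lemma exD f g : L1 f -> L1 g -> ex (fun w => f w + g w) = ex f + ex g.
Proof. by move=> lf lg; rewrite /ex RintegralD. Qed.

Lemma exB f g : L1 f -> L1 g -> ex (fun w => f w - g w) = ex f - ex g.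
Proof. by move=> lf lg; rewrite /ex RintegralB. Qed.

Lemma exZ (k : R) f : L1 f -> ex (fun w => k * f w) = k * ex f.
Proof. by move=> lf; rewrite /ex RintegralZl. Qed.

Lemma exZr (k : R) f : L1 f -> ex (fun w => f w * k) = ex f * k.
Proof. by move=> lf; rewrite /ex RintegralZr. Qed.

Lemma ex_cst (c : R) : ex (fun=> c) = c.
Proof. by rewrite /ex Rintegral_cst//= probability_setT mulr1. Qed.

Lemma ex_sum I (s : seq I) (f : I -> T -> R) : (forall i, L1 (f i)) ->
  ex (fun w => \sum_(i <- s) f i w) = \sum_(i <- s) ex (f i).
Proof.
move=> lf; elim: s => [|i s IH].
  by under [X in ex X]eq_fun do rewrite big_nil; rewrite ex_cst big_nil.
under [X in ex X]eq_fun do rewrite big_cons; rewrite exD ?IH ?big_cons//.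
exact: L1_sum.
Qed.

Lemma ex_ge0 f : (forall w, 0 <= f w) -> 0 <= ex f.
Proof. by move=> f0; exact: Rintegral_ge0. Qed.

Lemma ex_le f g : L1 f -> L1 g -> (forall w, f w <= g w) -> ex f <= ex g.
Proof. by move=> lf lg fg; apply: le_Rintegral. Qed.

Lemma ex_le_ae f g (N : set T) : measurable N -> P N = 0%E -> L1 f -> L1 g ->
  (forall w, ~ N w -> f w <= g w) -> ex f <= ex g.
Proof.
move=> mN PN lf lg fg.
have E h : L1 h -> ex h = ex (fun w => h w * \1_(~` N) w).
  move=> lh; rewrite /ex /Rintegral; congr fine; apply: ae_eq_integral => //.
  - by apply/measurable_EFinP; exact: L1_meas.
  - by apply/measurable_EFinP/measurable_funM; [exact: L1_meas|apply: measurable_indic; exact: measurableC].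
  - exists N; split => // w /= H; apply: contrapT => nN; apply: H => _.
    by rewrite indicE mem_set// mulr1.
rewrite (E f)// (E g)//; apply: ex_le.
- by under [X in L1 X]eq_fun do rewrite mulrC; apply: L1_indicM => //; exact: measurableC.
- by under [X in L1 X]eq_fun do rewrite mulrC; apply: L1_indicM => //; exact: measurableC.
- move=> w; rewrite indicE; case: (boolP (w \in _)) => [/set_mem nN|]; rewrite ?mulr1 ?mulr0//.
  exact: fg.
Qed.

Lemma normr_ex_le f g : L1 f -> L1 g -> (forall w, `|f w| <= g w) -> `|ex f| <= ex g.
Proof.
move=> lf lg fg; apply: le_trans (le_normr_Rintegral _ _) _ => //.
by apply: ex_le => //; exact: L1_norm.
Qed.

Lemma ex_indic A : measurable A -> ex (\1_A : T -> R) = pr A.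
Proof. by move=> mA; rewrite /ex /Rintegral integral_indic// setIT. Qed.

Lemma L1_indic A : measurable A -> L1 (\1_A : T -> R).
Proof. by move=> mA; exact: integrable_indic. Qed.

Lemma measurable_le_set f (c : R) : measurable_fun setT f -> measurable [set w | c <= f w].
Proof.
move=> mf; rewrite -[X in measurable X]setTI.
by apply: measurable_fun_le => //; exact: measurable_cst.
Qed.

Lemma markov_pr f (c : R) : 0 < c -> L1 f -> (forall w, 0 <= f w) ->
  pr [set w | c <= f w] <= ex f / c.
Proof.
move=> c0 lf f0; have mc := measurable_le_set c (L1_meas lf).
rewrite ler_pdivlMr// -ex_indic// -exZr; last exact: L1_indic.
apply: ex_le => //; first by apply: L1Zr; exact: L1_indic.
by move=> w; rewrite indicE; case: (boolP (w \in _)) => [/set_mem//=|]; rewrite ?mul1r ?mul0r.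
Qed.

End Expectation.

Section Independence.
Context d {T : measurableType d} {R : realType} (P : probability T R).
Context d1 {T1 : measurableType d1} d2 {T2 : measurableType d2}.
Variables (X : T -> T1) (Y : T -> T2).
Hypotheses (mX : measurable_fun setT X) (mY : measurable_fun setT Y).
Hypothesis XY : forall A B, measurable A -> measurable B ->
  P (X @^-1` A `&` Y @^-1` B) = (P (X @^-1` A) * P (Y @^-1` B))%E.

Let X' : {mfun T >-> T1} := HB.pack X (isMeasurableFun.Build _ _ _ _ _ mX).
Let Y' : {mfun T >-> T2} := HB.pack Y (isMeasurableFun.Build _ _ _ _ _ mY).
Let XY' w := (X w, Y w).
Let mXY : measurable_fun setT XY'.
Proof. exact: measurable_fun_pair. Qed.
Let Z' : {mfun T >-> (T1 * T2)%type} := HB.pack XY' (isMeasurableFun.Build _ _ _ _ _ mXY).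

Let lawE A : measurable A ->
  (distribution P X' \x distribution P Y')%E A = distribution P Z' A.
Proof.
by move=> mA; apply: product_measure_unique => // B C mB mC; exact: XY.
Qed.

(** By independence the law of the pair is the product of the two laws; the formula is Tonelli's
    theorem for that product, transported back to [T]. *)
Lemma indep_ge0 (F : T1 * T2 -> \bar R) : measurable_fun setT F ->
  (forall z, 0 <= F z)%E ->
  (\int[P]_w F (X w, Y w) = \int[P]_w \int[P]_w' F (X w, Y w'))%E.
Proof.
move=> mF F0.
rewrite -[LHS](@ge0_integral_distribution _ _ _ _ _ _ Z')//.
rewrite (@eq_measure_integral _ _ _ _ (distribution P X' \x distribution P Y')%E); last first.
  by move=> A mA _; apply/esym; exact: lawE.
rewrite fubini_tonelli1// ge0_integral_distribution//.
- apply: eq_integral => w _ /=; rewrite /fubini_F ge0_integral_distribution//.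
  exact: measurableT_comp.
- exact: measurable_fun_fubini_tonelli_F.
- by move=> x; apply: integral_ge0.
Qed.

Lemma measurable_ex_pair1 (F : T1 * T2 -> R) (K : R) : measurable_fun setT F ->
  (forall z, `|F z| <= K) ->
  measurable_fun setT (fun x => ex P (fun w' => F (x, Y w'))).
Proof.
move=> mF FK.
rewrite (_ : (fun x => _) = fun x => ex P (fun w' => F (x, Y w') + K) - K); last first.
  apply/funext => x; rewrite exD ?ex_cst ?addrK//; last exact: L1_cst.
  apply: L1_bounded (fun w => FK _).
  by apply: measurableT_comp => //; apply: measurable_fun_pair.
apply: measurable_funB => //; apply/measurable_EFinP.
have m1 : measurable_fun setT (fun z => (F z + K)%:E).
  by apply/measurable_EFinP; exact: measurable_funD.
have := @measurable_fun_fubini_tonelli_F _ _ T1 T2 R (distribution P Y') _ m1.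
have F0 z : (0 <= (F z + K)%:E)%E.
  by rewrite lee_fin -lerBlDr sub0r; have := FK z; rewrite ler_norml => /andP[].
move=> /(_ F0); rewrite (_ : fubini_F _ _ = EFin \o fun x => ex P (fun w' => F (x, Y w') + K))//.
apply/funext => x; rewrite /fubini_F ge0_integral_distribution//=; last first.
  by apply: (measurableT_comp m1); exact: measurable_fun_pair.
rewrite /ex /Rintegral fineK//; apply: integrable_fin_num => //.
apply: L1D; last exact: L1_cst.
apply: L1_bounded (fun w => FK _).
by apply: measurableT_comp => //; apply: measurable_fun_pair.
Qed.

(** Adding the bound [K] makes the integrand nonnegative and reduces the claim to [indep_ge0]; the
    constant is removed on both sides. *)
Lemma ex_indep (F : T1 * T2 -> R) (K : R) : measurable_fun setT F ->
  (forall z, `|F z| <= K) ->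
  ex P (fun w => F (X w, Y w)) = ex P (fun w => ex P (fun w' => F (X w, Y w'))).
Proof.
move=> mF FK.
have lF : L1 P (fun w => F (X w, Y w)).
  by apply: L1_bounded (fun w => FK _); exact: measurableT_comp.
have lG w : L1 P (fun w' => F (X w, Y w')).
  apply: L1_bounded (fun w => FK _).
  by apply: measurableT_comp => //; apply: measurable_fun_pair.
have lH : L1 P (fun w => ex P (fun w' => F (X w, Y w'))).
  apply: (@L1_bounded _ _ _ _ _ K).
    exact: measurableT_comp (measurable_ex_pair1 mF FK) mX.
  move=> w; apply: le_trans (normr_ex_le (g := fun=> K) _ _ _) _ => //; first exact: L1_cst.
  by rewrite ex_cst.
apply: (@addIr _ K); rewrite -[in LHS](ex_cst P K) -[in RHS](ex_cst P K) -!exD//; try exact: L1_cst.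
have -> : (fun w => ex P (fun w' => F (X w, Y w')) + K) = (fun w => ex P (fun w' => F (X w, Y w') + K)).
  by apply/funext => w; rewrite exD ?ex_cst//; exact: L1_cst.
rewrite {1 2}/ex /Rintegral; congr fine.
have F0 z : (0 <= (F z + K)%:E)%E.
  by rewrite lee_fin -lerBlDr sub0r; have := FK z; rewrite ler_norml => /andP[].
rewrite (@indep_ge0 (fun z => (F z + K)%:E))//; last by apply/measurable_EFinP; exact: measurable_funD.
apply: eq_integral => w _; rewrite /ex /Rintegral fineK//.
by apply: integrable_fin_num => //; apply: L1D; [exact: lG|exact: L1_cst].
Qed.

End Independence.

Section IndependentProduct.
Context d {T : measurableType d} {R : realType} (P : probability T R).
Variables (X Y : T -> R).
Hypotheses (lX : L1 P X) (lY : L1 P Y).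
Hypothesis XY : forall A B, measurable A -> measurable B ->
  P (X @^-1` A `&` Y @^-1` B) = (P (X @^-1` A) * P (Y @^-1` B))%E.

Lemma L1_indepM : L1 P (fun w => X w * Y w).
Proof.
have mX := L1_meas lX; have mY := L1_meas lY.
apply/integrableP; split; first by apply/measurable_EFinP; exact: measurable_funM.
have := @indep_ge0 _ T R P _ _ _ _ X Y mX mY XY (fun z => `|(z.1 * z.2)%:E|%E) _ _.
rewrite /= => ->//; last first.
  do 2 apply: measurableT_comp => //.
  by apply: measurable_funM.
under eq_integral => w _.
  under eq_integral do rewrite normrM EFinM.
  rewrite ge0_integralZl//; last by apply/measurable_EFinP; exact: measurableT_comp.
  over.
have fY : (\int[P]_w `|Y w|%:E)%E \is a fin_num.
  by apply: integrable_fin_num => //; exact: L1_norm.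
rewrite ge0_integralZr//; last 2 first.
- by apply/measurable_EFinP; exact: measurableT_comp.
- by apply: integral_ge0.
rewrite ltey_eq fin_numM//; apply: integrable_fin_num => //; exact: L1_norm.
Qed.

(** Positive and negative parts of independent variables are again independent, and for nonnegative
    factors [indep_ge0] gives the product directly; the four products are then recombined. *)
Lemma ex_indepM : ex P (fun w => X w * Y w) = ex P X * ex P Y.
Proof.
have mX := L1_meas lX; have mY := L1_meas lY.
have pn (f : R -> R) w : f w = Num.max (f w) 0 - Num.max (- f w) 0 :> R.
  by rewrite /Num.max; case: ltP => H1; case: ltP => H2; lra.
have key (f g : R -> R) : measurable_fun setT f -> measurable_fun setT g ->
    (forall x, 0 <= f x <= `|x|) -> (forall x, 0 <= g x <= `|x|) ->
    ex P (fun w => f (X w) * g (Y w)) = ex P (fun w => f (X w)) * ex P (fun w => g (Y w)).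
  move=> mf mg f0 g0.
  have lf : L1 P (fun w => f (X w)).
    apply: (L1_le _ _ (L1_norm lX)) => [|w]; first exact: measurableT_comp.
    by have /andP[] := f0 (X w) => a b; rewrite ger0_norm.
  have lg : L1 P (fun w => g (Y w)).
    apply: (L1_le _ _ (L1_norm lY)) => [|w]; first exact: measurableT_comp.
    by have /andP[] := g0 (Y w) => a b; rewrite ger0_norm.
  have pf w : 0 <= f w by have /andP[] := f0 w.
  have pg w : 0 <= g w by have /andP[] := g0 w.
  rewrite -[RHS]exZr// /ex /Rintegral; congr fine.
  rewrite (@indep_ge0 _ T R P _ _ _ _ X Y mX mY XY (fun z => (f z.1 * g z.2)%:E)) //; last 2 first.
  - by apply/measurable_EFinP; apply: measurable_funM; exact: measurableT_comp.
  - by move=> z; rewrite lee_fin mulr_ge0.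
  apply: eq_integral => w _ /=.
  under eq_integral do rewrite EFinM.
  rewrite ge0_integralZl ?lee_fin//; last 2 first.
  - by apply/measurable_EFinP; exact: measurableT_comp.
  - by move=> z _; rewrite lee_fin.
  by rewrite EFinM fineK//; exact: integrable_fin_num.
pose p (x : R) := Num.max x 0; pose q (x : R) := Num.max (- x) 0.
have mp : measurable_fun setT p by apply: measurable_maxr.
have mq : measurable_fun setT q by apply: measurable_maxr => //; exact: measurableT_comp.
have p0 x : 0 <= p x <= `|x| by rewrite /p le_max lexx orbT ge_max ler_norm normr_ge0.
have q0 x : 0 <= q x <= `|x| by rewrite /q le_max lexx orbT ge_max -normrN ler_norm normr_ge0.
have E x : x = p x - q x by exact: (pn id).
have L (h : R -> R) Z : measurable_fun setT h -> (forall x, 0 <= h x <= `|x|) -> L1 P Z -> L1 P (fun w => h (Z w)).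
  move=> mh h0 lZ; apply: (L1_le _ _ (L1_norm lZ)) => [|w]; first exact: measurableT_comp (L1_meas lZ).
  by have /andP[] := h0 (Z w) => a b; rewrite ger0_norm.
have LL (f g : R -> R) : measurable_fun setT f -> measurable_fun setT g ->
    (forall x, 0 <= f x <= `|x|) -> (forall x, 0 <= g x <= `|x|) ->
    L1 P (fun w => f (X w) * g (Y w)).
  move=> mf mg f0 g0; apply: (L1_le _ _ (L1_norm L1_indepM)) => [|w].
    by apply: measurable_funM; exact: measurableT_comp.
  have /andP[a1 a2] := f0 (X w); have /andP[b1 b2] := g0 (Y w).
  have -> : `|f (X w) * g (Y w)| = f (X w) * g (Y w) by rewrite ger0_norm// mulr_ge0.
  by rewrite normrM; apply: ler_pM.
have -> : (fun w => X w * Y w) = (fun w => (p (X w) * p (Y w) - p (X w) * q (Y w)) - (q (X w) * p (Y w) - q (X w) * q (Y w))).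
  by apply/funext => w; rewrite {1}(E (X w)) {1}(E (Y w)); ring.
rewrite !exB ?key//; try (by apply: L1B; exact: LL); try exact: LL.
have -> : ex P X = ex P (fun w => p (X w)) - ex P (fun w => q (X w)).
  by rewrite -exB; [congr ex; apply/funext => w; exact: E|exact: L|exact: L].
have -> : ex P Y = ex P (fun w => p (Y w)) - ex P (fun w => q (Y w)).
  by rewrite -exB; [congr ex; apply/funext => w; exact: E|exact: L|exact: L].
ring.
Qed.

End IndependentProduct.

(** * Rotation invariance of Gaussian vectors *)

Section LebesgueInvariance.
Context {R : realType}.
Local Notation mu := (@lebesgue_measure R).

Lemma measurable_affine (a b : R) : measurable_fun setT (fun x : R => a * x + b).
Proof. by apply: measurable_funD => //; exact: measurable_funM. Qed.

(* [k] is a sign: translations and the reflection are treated at once *)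
Lemma lebesgue_measure_affine (k b : R) (A : set R) : k ^+ 2 = 1 -> measurable A ->
  mu ((fun x => k * x + b) @^-1` A) = mu A.
Proof.
move=> k1 mA.
pose f : measurableTypeR R -> measurableTypeR R := fun x => k * x + b.
have mf : measurable_fun setT f by exact: measurable_affine.
pose f' : {mfun measurableTypeR R >-> measurableTypeR R} := HB.pack f (isMeasurableFun.Build _ _ _ _ _ mf).
have -> : mu ((fun x => k * x + b) @^-1` A) = pushforward mu f' A by [].
apply/esym; apply: lebesgue_measure_unique => // _ [[u v] _ <-] /=; rewrite /pushforward/=.
have := sqrf_eq1 k; rewrite k1 eqxx => /esym/orP[]/eqP kE.
  have -> : f @^-1` `]u, v]%classic = `]u - b, v - b]%classic.
    by apply/seteqP; split => x /=; rewrite !in_itv/= /f kE => /andP[h1 h2]; apply/andP; split; lra.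
  by rewrite !lebesgue_measure_itv/= !lte_fin ltrD2r !EFinN -!EFinB; case: ifP => // _; congr _%:E; ring.
have -> : f @^-1` `]u, v]%classic = `[b - v, b - u[%classic.
  by apply/seteqP; split => x /=; rewrite !in_itv/= /f kE => /andP[h1 h2]; apply/andP; split; lra.
by rewrite !lebesgue_measure_itv/= !lte_fin ltrD2l ltrN2 !EFinN -!EFinB; case: ifP => // _; congr _%:E; ring.
Qed.

Lemma integral_affine (k b : R) (f : R -> \bar R) : k ^+ 2 = 1 ->
  measurable_fun setT f -> (forall x, 0 <= f x)%E ->
  (\int[mu]_x f (k * x + b)%R = \int[mu]_x f x)%E.
Proof.
move=> k1 mf f0.
pose g : measurableTypeR R -> measurableTypeR R := fun x => k * x + b.
have mg : measurable_fun setT g by exact: measurable_affine.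
pose g' : {mfun measurableTypeR R >-> measurableTypeR R} := HB.pack g (isMeasurableFun.Build _ _ _ _ _ mg).
transitivity (\int[pushforward mu g']_x f x)%E.
  by rewrite ge0_integral_pushforward.
apply: eq_measure_integral => A mA _.
exact: lebesgue_measure_affine.
Qed.

Variable F : R * R -> \bar R.
Hypotheses (mF : measurable_fun setT F) (F0 : forall z, (0 <= F z)%E).

Let m2 (a b c e : R) : measurable_fun setT (fun z : R * R => (a * z.1 + b * z.2, c * z.1 + e * z.2)).
Proof. by apply: measurable_fun_pair; apply: measurable_funD; apply: measurable_funM. Qed.

Lemma integral_shear2 (a : R) :
  (\int[mu]_x \int[mu]_y F (x, y + a * x)%R = \int[mu]_x \int[mu]_y F (x, y))%E.
Proof.
apply: eq_integral => x _.
rewrite -[RHS](@integral_affine 1 (a * x))//; last 2 first.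
- by rewrite expr1n.
- by apply: measurableT_comp => //; exact: measurable_fun_pair.
by under [RHS]eq_integral do rewrite mul1r.
Qed.

Lemma integral_shear1 (a : R) :
  (\int[mu]_x \int[mu]_y F (x + a * y, y)%R = \int[mu]_x \int[mu]_y F (x, y))%E.
Proof.
have mG : measurable_fun setT (fun z : R * R => F (z.1 + a * z.2, z.2)).
  apply: measurableT_comp => //; apply: measurable_fun_pair => //.
  by apply: measurable_funD => //; exact: measurable_funM.
transitivity (\int[mu]_y \int[mu]_x F (x + a * y, y)%R)%E.
  exact: (@fubini_tonelli _ _ (measurableTypeR R) (measurableTypeR R) R mu mu _ mG).
rewrite [RHS](@fubini_tonelli _ _ (measurableTypeR R) (measurableTypeR R) R mu mu _ mF F0).
apply: eq_integral => y _.
rewrite -[RHS](@integral_affine 1 (a * y) (fun x => F (x, y)))//; last 2 first.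
- by rewrite expr1n.
- by apply: measurableT_comp => //; exact: measurable_fun_pair.
by under [RHS]eq_integral do rewrite mul1r.
Qed.

End LebesgueInvariance.

(* A rotation by an angle that is not a multiple of [pi] is a product of three
   shears, and shears preserve Lebesgue measure by Fubini. *)
Lemma integral_rotation {R : realType} (F : R * R -> \bar R) (c s : R) :
  measurable_fun setT F -> (forall z, 0 <= F z)%E ->
  c ^+ 2 + s ^+ 2 = 1 -> s != 0 ->
  (\int[lebesgue_measure]_x \int[lebesgue_measure]_y F (c * x - s * y, s * x + c * y)%R
   = \int[lebesgue_measure]_x \int[lebesgue_measure]_y F (x, y))%E.
Proof.
(* For a rotation by the angle a this is - tan(a / 2): the rotation is the shear [t] of the first
   coordinate, then the shear [s] of the second, then the shear [t] of the first again. *)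
move=> mF F0 cs s0; pose t := (c - 1) / s.
have mF1 : measurable_fun setT (fun z : R * R => F (z.1 + t * z.2, z.2)).
  apply: measurableT_comp => //; apply: measurable_fun_pair => //.
  by apply: measurable_funD => //; exact: measurable_funM.
have mF2 : measurable_fun setT (fun z : R * R => F (z.1 + t * (z.2 + s * z.1), z.2 + s * z.1)).
  have mg : measurable_fun setT (fun z : R * R => (z.1, z.2 + s * z.1)).
    apply: measurable_fun_pair => //.
    by apply: measurable_funD => //; exact: measurable_funM.
  exact: (measurableT_comp mF1 mg).
etransitivity; last exact: (integral_shear1 mF F0 t).
etransitivity; last exact: (integral_shear2 mF1 (fun=> F0 _) s).
etransitivity; last exact: (integral_shear1 mF2 (fun=> F0 _) t).
apply: eq_integral => x _; apply: eq_integral => y _; congr (F (_, _)).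
  have -> : x + t * y + t * (y + s * (x + t * y)) = (1 + t * s) * x + t * (2 + t * s) * y by ring.
  have ts : t * s = c - 1 by rewrite /t mulfVK.
  have -> : t * (2 + t * s) = - s.
    apply: (mulIf s0); rewrite mulrAC ts; have := cs; lra.
  by rewrite ts; ring.
have ts : t * s = c - 1 by rewrite /t mulfVK.
have -> : y + s * (x + t * y) = s * x + (1 + t * s) * y by ring.
by rewrite ts; ring.
Qed.

Section NormalLaw.
Context {R : realType} (sigma : R).
Hypothesis sigma0 : sigma != 0.
Local Notation mu := (@lebesgue_measure R).
Local Notation N := (normal_prob 0 sigma).
Local Notation n := (normal_pdf 0 sigma).

(** Integration against [N] is integration against its Radon-Nikodym derivative, which agrees almost
    everywhere with [normal_pdf] because both have the same integral over every measurable set. *)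
Lemma ge0_integral_normal (f : R -> \bar R) : (forall x, 0 <= f x)%E ->
  measurable_fun setT f ->
  (\int[N]_x f x = \int[mu]_x (f x * (n x)%:E))%E.
Proof.
move=> f0 mf.
have dom := normal_prob_dominates 0 sigma.
rewrite -(Radon_Nikodym_SigmaFinite.change_of_variables dom)//.
have i1 := Radon_Nikodym_SigmaFinite.f_integrable dom.
apply: ae_eq_integral => //.
- by apply: emeasurable_funM => //; exact: measurable_int i1.
- by apply: emeasurable_funM => //; apply/measurable_EFinP; exact: measurable_normal_pdf.
apply: ae_eqe_mul2l; apply: integral_ae_eq => //.
  by apply/measurable_EFinP; exact: measurable_normal_pdf.
by move=> A _ mA; rewrite -Radon_Nikodym_SigmaFinite.f_integral.
Qed.

Lemma normal_pdf_opp x : n (- x) = n x.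
Proof. by rewrite !normal_pdfE// /normal_fun !subr0 sqrrN. Qed.

Lemma normal_opp (A : set R) : measurable A -> N (-%R @^-1` A) = N A.
Proof.
move=> mA; rewrite /normal_prob integral_mkcond [RHS]integral_mkcond.
set f := _ \_ A.
have mf : measurable_fun setT f.
  apply/(measurable_restrictT _ mA); apply/measurable_funTS/measurable_EFinP.
  exact: measurable_normal_pdf.
have f0 x : (0 <= f x)%E.
  by rewrite /f /patch; case: ifP => // _; rewrite lee_fin normal_pdf_ge0.
have k1 : (-1) ^+ 2 = 1 :> R by rewrite sqrrN expr1n.
etransitivity; last exact: (integral_affine 0 k1 mf f0).
apply: eq_integral => x _; rewrite addr0 mulN1r /f /patch/= normal_pdf_opp.
have -> : (x \in -%R @^-1` A) = (- x \in A); last by [].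
by apply/idP/idP; rewrite !inE.
Qed.

(** The joint density depends on x^2 + y^2 only, so a rotation of the plane changes neither it nor
    Lebesgue measure. *)
Lemma normal_rotation (c s : R) (A B : set R) : c ^+ 2 + s ^+ 2 = 1 -> s != 0 ->
  measurable A -> measurable B ->
  (N \x N)%E [set z | A (c * z.1 - s * z.2) /\ B (s * z.1 + c * z.2)] = (N A * N B)%E.
Proof.
move=> cs s0 mA mB.
pose g (z : R * R) : R * R := (c * z.1 - s * z.2, s * z.1 + c * z.2).
have mg : measurable_fun setT g.
  by apply: measurable_fun_pair; [apply: measurable_funB|apply: measurable_funD]; apply: measurable_funM.
have key (X : set (R * R)) : measurable X ->
    (N \x N)%E X = (\int[mu]_x \int[mu]_y ((\1_X (x, y) * (n x * n y))%R%:E))%E.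
  move=> mX.
  have m1X : measurable_fun setT (fun z : R * R => (\1_X z : R)%:E).
    by apply/measurable_EFinP; exact: measurable_indic.
  have := integral_indic (N \x N)%E measurableT mX; rewrite setIT => <-.
  have i0 z : (0 <= (\1_X z : R)%:E)%E by rewrite lee_fin.
  rewrite fubini_tonelli1//.
  rewrite ge0_integral_normal; last 2 first.
  - by move=> x; apply: integral_ge0 => y _; rewrite lee_fin.
  - by apply: measurable_fun_fubini_tonelli_F.
  apply: eq_integral => x _; rewrite /fubini_F ge0_integral_normal; last 2 first.
  - by move=> y; rewrite lee_fin.
  - by apply: (measurableT_comp m1X); exact: measurable_fun_pair.
  rewrite -ge0_integralZr//=; last 3 first.
  - apply: emeasurable_funM; last by apply/measurable_EFinP; exact: measurable_normal_pdf.
    by apply: (measurableT_comp m1X); exact: measurable_fun_pair.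
  - by move=> y _; rewrite -EFinM lee_fin mulr_ge0// normal_pdf_ge0.
  - by rewrite lee_fin normal_pdf_ge0.
  by apply: eq_integral => y _; rewrite -!EFinM; congr _%:E; ring.
have -> : [set z | A (c * z.1 - s * z.2) /\ B (s * z.1 + c * z.2)] = g @^-1` (A `*` B) by [].
have mAB : measurable (A `*` B) by exact: measurableX.
have mgAB : measurable (g @^-1` (A `*` B)) by rewrite -[X in measurable X]setTI; exact: mg.
etransitivity; last exact: (@product_measure1E _ _ (measurableTypeR R) (measurableTypeR R) R N N A B mA mB).
apply: (etrans (key _ mgAB)); apply: (etrans _ (esym (key _ mAB))).
pose F (z : R * R) := ((\1_(A `*` B) z : R) * (n z.1 * n z.2))%:E.
have mn := measurable_normal_pdf (0 : R) sigma.
have mF : measurable_fun setT F.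
  apply/measurable_EFinP; apply: measurable_funM; first exact: measurable_indic.
  by apply: measurable_funM; exact: measurableT_comp.
have F0 z : (0 <= F z)%E by rewrite lee_fin mulr_ge0 ?mulr_ge0 ?normal_pdf_ge0.
etransitivity; last exact: (integral_rotation mF F0 cs s0).
apply: eq_integral => x _; apply: eq_integral => y _; rewrite /F /=; congr ((_ * _)%:E).
rewrite !normal_pdfE// /normal_fun !subr0 mulrACA [RHS]mulrACA -!expRD; congr (_ * expR _).
rewrite -!mulrDl; congr (_ / _); rewrite -!opprD; congr (- _).
have -> : (c * x - s * y) ^+ 2 + (s * x + c * y) ^+ 2 = (c ^+ 2 + s ^+ 2) * (x ^+ 2 + y ^+ 2) by ring.
by rewrite cs mul1r.
Qed.

(** A crude bound by comparison of densities: x^4 times the density of deviation sigma is at most 64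
    sigma^4 times the density of deviation 2 sigma, because y^2 exp(-y) <= 2. Only the order sigma^4
    matters later. *)
Lemma integral_normal_pow4 :
  (\int[N]_x (x ^+ 4)%:E <= (64 * sigma ^+ 4)%:E)%E.
Proof.
rewrite ge0_integral_normal//; last 2 first.
- by move=> x; rewrite lee_fin exprn_even_ge0.
- by apply/measurable_EFinP; exact: exprn_measurable.
have s20 : 2 * sigma != 0 by rewrite mulf_neq0.
have key x : x ^+ 4 * n x <= 64 * sigma ^+ 4 * normal_pdf 0 (2 * sigma) x.
  have pkE : normal_peak sigma = 2 * normal_peak (2 * sigma).
    rewrite /normal_peak.
    have -> : (2 * sigma) ^+ 2 * pi *+ 2 = 2 ^+ 2 * (sigma ^+ 2 * pi *+ 2) :> R by ring.
    rewrite [in RHS]sqrtrM ?sqr_ge0// sqrtr_sqr (ger0_norm (ler0n _ 2)).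
    by rewrite invfM mulrA divff// mul1r.
  rewrite !normal_pdfE// pkE /normal_fun !subr0.
  set y := 3 * x ^+ 2 / (8 * sigma ^+ 2).
  have y0 : 0 <= y by rewrite divr_ge0// mulr_ge0// sqr_ge0.
  have yE : - x ^+ 2 / (sigma ^+ 2 *+ 2) = - x ^+ 2 / ((2 * sigma) ^+ 2 *+ 2) - y.
    by rewrite /y; field; rewrite sigma0.
  have x4 : x ^+ 4 = 64 / 9 * sigma ^+ 4 * y ^+ 2 by rewrite /y; field; rewrite sigma0.
  have ex2 : y ^+ 2 * expR (- y) <= 2.
    rewrite expRN ler_pdivrMr ?expR_gt0//.
    have H : 1 + y ^+ 2 / 2 <= expR y := expR_ge1Dxn 1 y0.
    by move: H; move: (y ^+ 2) (expR y) => ? ?; lra.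
  rewrite yE expRD x4.
  have s4 : 0 <= sigma ^+ 4 by rewrite exprn_even_ge0.
  have A0 := expR_ge0 (- x ^+ 2 / ((2 * sigma) ^+ 2 *+ 2)).
  have p0 := ltW (normal_peak_gt0 s20).
  set A := expR _ in A0 *; set p := normal_peak _ in p0 *.
  apply: (@le_trans _ _ (128 / 9 * (sigma ^+ 4 * A * p) * (y ^+ 2 * expR (- y)))); first by lra.
  have C0 : 0 <= sigma ^+ 4 * A * p by rewrite mulr_ge0// mulr_ge0.
  apply: (@le_trans _ _ (128 / 9 * (sigma ^+ 4 * A * p) * 2)); last by lra.
  by rewrite ler_wpM2l// mulr_ge0// mulr_ge0.
apply: (@le_trans _ _ (\int[mu]_x ((64 * sigma ^+ 4)%:E * (normal_pdf 0 (2 * sigma) x)%:E)))%E.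
  apply: ge0_le_integral => //.
  - by move=> x _; rewrite -EFinM lee_fin mulr_ge0 ?exprn_even_ge0 ?normal_pdf_ge0.
  - apply/measurable_EFinP; apply: measurable_funM; first exact: exprn_measurable.
    exact: measurable_normal_pdf.
  - by apply/measurable_EFinP; apply: measurable_funM => //; exact: measurable_normal_pdf.
  - by move=> x _; rewrite -!EFinM lee_fin.
rewrite integralZl//=; last exact: integrable_normal_pdf.
by rewrite integral_normal_pdf mule1.
Qed.

End NormalLaw.

Section NormalVariance.
Context {R : realType} (sigma : R).
Hypothesis sigma0 : 0 < sigma.
Local Notation mu := (@lebesgue_measure R).
Local Notation N := (normal_prob 0 sigma).
Local Notation n := (normal_pdf 0 sigma).
Let F (x : R) := - (sigma ^+ 2 * x * n x).
Let f (x : R) := (x ^+ 2 - sigma ^+ 2) * n x.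

Let sN0 : sigma != 0. Proof. by rewrite gt_eqF. Qed.
Let s20 : 0 < sigma ^+ 2. Proof. exact: exprn_gt0. Qed.

Let is_deriveF (x : R) : is_derive x (1 : R) F (f x).
Proof.
pose k := (sigma ^+ 2 *+ 2)^-1; pose p := normal_peak sigma.
have nE y : n y = p * expR (- k * (y * y)).
  rewrite normal_pdfE// /normal_fun subr0; congr (_ * expR _).
  by rewrite mulNr -expr2 mulrC mulNr.
have -> : F = (fun y => - (sigma ^+ 2 * y * (p * expR (- k * (y * y))))).
  by apply/funext => y; rewrite /F nE.
have d1 : is_derive x (1 : R) (fun y : R => expR (- k * (y * y))) (expR (- k * (x * x)) * (- k * (x + x))).
  apply: is_derive1_comp.
  apply: is_derive_eq; rewrite /GRing.scale/= !mulr1; ring.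
rewrite /f nE.
apply: is_derive_eq; rewrite /GRing.scale/= !mulr1.
rewrite /k; field.
by rewrite sN0.
Qed.

Let continuous_n : continuous n. Proof. exact: continuous_normal_pdf. Qed.

Let continuous_F : continuous F.
Proof. by move=> x; apply/differentiable_continuous/derivable1_diffP; case: (is_deriveF x). Qed.

Let continuous_f : continuous f.
Proof.
move=> x; apply: cvgM; last exact: continuous_n.
apply: cvgB; last exact: cvg_cst.
exact: exprn_continuous.
Qed.

Let F_cvg : F x @[x --> +oo] --> (0 : R).
Proof.
pose k := (sigma ^+ 2 *+ 2)^-1; pose p := normal_peak sigma.
have k0 : 0 < k by rewrite invr_gt0 pmulrn_rgt0.
have p0 : 0 <= p by rewrite ltW// normal_peak_gt0.
have G : \forall x \near +oo, - (sigma ^+ 2 * p * k^-1 * x^-1) <= F x <= 0.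
  near=> x; have x0 : 0 < x by near: x; exact: nbhs_pinfty_gt.
  have Fge0 : 0 <= sigma ^+ 2 * x * n x.
    by rewrite mulr_ge0 ?normal_pdf_ge0// mulr_ge0// ltW.
  rewrite /F lerN2 oppr_le0 Fge0 andbT.
  have nE : n x = p * expR (- (k * x ^+ 2)).
    rewrite normal_pdfE// /normal_fun subr0; congr (_ * expR _).
    by rewrite mulNr mulrC.
  have : expR (- (k * x ^+ 2)) <= (k * x ^+ 2)^-1.
    rewrite expRN lef_pV2 ?posrE ?expR_gt0 ?mulr_gt0 ?exprn_gt0//.
    by apply: le_trans (expR_ge1Dx _); rewrite lerDr.
  move=> /(ler_wpM2l (mulr_ge0 (mulr_ge0 (ltW s20) (ltW x0)) p0)) H.
  rewrite nE mulrA; apply: le_trans H _.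
  by rewrite le_eqVlt; apply/orP; left; apply/eqP; field; rewrite ?gt_eqF.
apply: (squeeze_cvgr G); last exact: cvg_cst.
rewrite -oppr0; apply: cvgN; rewrite -(mulr0 (sigma ^+ 2 * p * k^-1)).
apply: cvgM; first exact: cvg_cst.
apply/(@gtr0_cvgV0 _ _ _ _ id); last exact: cvg_id.
exact: nbhs_pinfty_gt.
Unshelve. all: by end_near. Qed.

(** Integration by parts: [F] is a primitive of [f]. Cutting the half-line at [sigma], where [f]
    changes sign, keeps every integrand nonnegative; the integral of [f] beyond [sigma] and that of
    [- f] before it are both [- F sigma], so x^2 and sigma^2 have the same integral against the
    density. *)
Lemma integral_normal_sqr : (\int[N]_x (x ^+ 2)%:E = (sigma ^+ 2)%:E)%E.
Proof.
have n0 x : 0 <= n x by exact: normal_pdf_ge0.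
have mn : measurable_fun setT n by exact: measurable_normal_pdf.
have mx2 : measurable_fun setT (fun x : R => x ^+ 2 * n x).
  by apply: measurable_funM => //; exact: exprn_measurable.
have split (g : R -> R) : measurable_fun setT g -> (forall x, 0 <= g x) ->
    (\int[mu]_(x in [set x | 0 <= x]%R) (g x)%:E =
     \int[mu]_(x in `[0%R, sigma]) (g x)%:E + \int[mu]_(x in `[sigma, +oo[) (g x)%:E)%E.
  move=> mg g0; rewrite -set_itvcy (@itv_bndbnd_setU _ _ (BLeft 0) (BRight sigma))//; last first.
    by rewrite bnd_simp ltW.
  rewrite ge0_integral_setU//=.
  - by rewrite integral_itv_obnd_cbnd//; apply/measurable_EFinP; exact: measurable_funTS.
  - by apply/measurable_EFinP; exact: measurable_funTS.
  - by move=> x _; rewrite lee_fin.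
  - apply/disj_setPS => x [] /=; rewrite !in_itv/= andbT => /andP[_ h1] h2.
    by have := le_lt_trans h1 h2; rewrite ltxx.
have sq2 x : sigma <= x -> 0 <= x ^+ 2 - sigma ^+ 2.
  by move=> sx; rewrite subr_sqr mulr_ge0 ?subr_ge0// addr_ge0 ?(le_trans (ltW sigma0) sx)// ltW.
have I1 : (\int[mu]_(x in `[sigma, +oo[) (f x)%:E = (- F sigma)%:E)%E.
  have H1 x : sigma <= x -> 0 <= f x by move=> sx; rewrite mulr_ge0// sq2.
  have H2 : {within `[sigma, +oo[, continuous f} by exact: continuous_subspaceT.
  have H3 x : sigma < x -> derivable F x 1 by move=> _; case: (is_deriveF x).
  have H4 : F x @[x --> sigma^'+] --> F sigma by apply: cvg_at_right_filter; exact: continuous_F.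
  have H5 : {in `]sigma, +oo[, F^`()%classic =1 f}.
    by move=> x _; rewrite derive1E; exact: derive_val.
  by rewrite (ge0_continuous_FTC2y H1 H2 F_cvg H3 H4 H5) sub0e.
have I2 : (\int[mu]_(x in `[0%R, sigma]) (- f x)%:E = (- F sigma)%:E)%E.
  have -> : (- F sigma)%:E = ((- F sigma)%:E - (- F 0)%:E)%E.
    by rewrite /F mulr0 mul0r !oppr0 sube0.
  have H1 : {within `[0, sigma], continuous (fun x => - f x)}.
    by apply: continuous_subspaceT => x; apply: cvgN; exact: continuous_f.
  have H2 : derivable_oo_LRcontinuous (fun x => - F x) 0 sigma.
    split => [x _| |].
    - by apply: derivableN; case: (is_deriveF x).
    - by apply: cvg_at_right_filter; apply: cvgN; exact: continuous_F.
    - by apply: cvg_at_left_filter; apply: cvgN; exact: continuous_F.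
  have H3 : {in `]0, sigma[, (fun x => - F x)^`()%classic =1 (fun x => - f x)}.
    move=> x _; rewrite derive1E.
    by have [] := is_deriveN (is_deriveF x).
  by rewrite (continuous_FTC2 sigma0 H1 H2 H3).
have mf : measurable_fun setT f by exact: continuous_measurable_fun.
have I3 : (\int[mu]_(x in `[sigma, +oo[) (x ^+ 2 * n x)%:E =
    (- F sigma)%:E + \int[mu]_(x in `[sigma, +oo[) (sigma ^+ 2 * n x)%:E)%E.
  rewrite -I1 -ge0_integralD//.
  - by apply: eq_integral => x _; rewrite -EFinD; congr _%:E; rewrite /f; ring.
  - move=> x /=; rewrite in_itv/= andbT => sx; by rewrite lee_fin mulr_ge0//; exact: sq2.
  - by apply/measurable_EFinP; exact: measurable_funTS.
  - by move=> x _; rewrite lee_fin mulr_ge0// ltW.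
  - by apply/measurable_EFinP; apply: measurable_funTS; exact: measurable_funM.
have I4 : (\int[mu]_(x in `[0%R, sigma]) (sigma ^+ 2 * n x)%:E =
    (- F sigma)%:E + \int[mu]_(x in `[0%R, sigma]) (x ^+ 2 * n x)%:E)%E.
  rewrite -I2 -ge0_integralD//.
  - by apply: eq_integral => x _; rewrite -EFinD; congr _%:E; rewrite /f; ring.
  - by move=> x /=; rewrite in_itv/= => /andP[x0 xs]; rewrite lee_fin -mulNr mulr_ge0// opprB subr_sqr mulr_ge0 ?subr_ge0// addr_ge0//; exact: ltW sigma0.
  - by apply/measurable_EFinP; apply: measurable_funTS; exact: measurableT_comp.
  - by move=> x _; rewrite lee_fin mulr_ge0// sqr_ge0.
  - by apply/measurable_EFinP; exact: measurable_funTS.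
rewrite ge0_integral_normal//; last 2 first.
- by move=> x; rewrite lee_fin sqr_ge0.
- by apply/measurable_EFinP; exact: exprn_measurable.
under eq_integral do rewrite -EFinM.
rewrite ge0_symfun_integralT; last 3 first.
- by move=> x; rewrite mulr_ge0// sqr_ge0.
- by move=> x; apply: cvgM; [exact: exprn_continuous|exact: continuous_n].
- by move=> x /=; rewrite sqrrN normal_pdf_opp.
rewrite split//; last by move=> x; rewrite mulr_ge0// sqr_ge0.
rewrite I3 addeCA addeA -I4 -split; last 2 first.
- exact: measurable_funM.
- by move=> x; rewrite mulr_ge0// ltW.
rewrite -ge0_symfun_integralT; last 3 first.
- by move=> x; rewrite mulr_ge0// ltW.
- by move=> x; apply: cvgM; [exact: cvg_cst|exact: continuous_n].
- by move=> x /=; rewrite normal_pdf_opp.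
under eq_integral do rewrite EFinM.
rewrite integralZl//; last exact: integrable_normal_pdf.
by rewrite integral_normal_pdf mule1.
Qed.

End NormalVariance.

Section SameLaw.
Context dT {T : measurableType dT} {R : realType} (P : probability T R).
Context d' {T' : measurableType d'}.
Variables (X Y : T -> T').
Hypotheses (mX : measurable_fun setT X) (mY : measurable_fun setT Y).
Hypothesis XY : forall B, measurable B -> P (X @^-1` B) = P (Y @^-1` B).

Let X' : {mfun T >-> T'} := HB.pack X (isMeasurableFun.Build _ _ _ _ _ mX).
Let Y' : {mfun T >-> T'} := HB.pack Y (isMeasurableFun.Build _ _ _ _ _ mY).

Lemma ge0_integral_same_law (f : T' -> \bar R) : measurable_fun setT f ->
  (forall z, 0 <= f z)%E -> (\int[P]_w f (X w) = \int[P]_w f (Y w))%E.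
Proof.
move=> mf f0.
rewrite -[LHS](@ge0_integral_distribution _ _ _ _ _ _ X')//.
rewrite -[RHS](@ge0_integral_distribution _ _ _ _ _ _ Y')//.
by apply: eq_measure_integral => A mA _; exact: XY.
Qed.

Lemma ex_same_law (f : T' -> R) : measurable_fun setT f ->
  ex P (fun w => f (X w)) = ex P (fun w => f (Y w)).
Proof.
move=> mf; rewrite /ex /Rintegral; congr fine.
have mEf : measurable_fun setT (EFin \o f) by exact/measurable_EFinP.
have HZ (Z : T -> T') : (\int[P]_w (f (Z w))%:E =
    \int[P]_w (EFin \o f)^\+ (Z w) - \int[P]_w (EFin \o f)^\- (Z w))%E.
  rewrite -[in LHS]/(\int[P]_w ((EFin \o f) \o Z) w)%E integralE.
  congr (_ - _)%E; apply: eq_integral => w _.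
    exact: (congr1 (fun h => h w) (funepos_comp (EFin \o f) Z)).
  exact: (congr1 (fun h => h w) (funeneg_comp (EFin \o f) Z)).
rewrite !HZ; congr (_ - _)%E.
- by apply: ge0_integral_same_law; [exact: measurable_funepos|move=> z; exact: funepos_ge0].
- by apply: ge0_integral_same_law; [exact: measurable_funeneg|move=> z; exact: funeneg_ge0].
Qed.

End SameLaw.

Section GaussianVectors.
Context dT {T : measurableType dT} {R : realType} (P : probability T R).
Context {d : nat} (s : R).
Hypothesis s0 : 0 < s.
Implicit Types X : T -> 'cV[R]_d.
Local Notation N := (normal_prob 0 s).

Let sN0 : s != 0. Proof. by rewrite gt_eqF. Qed.

(** Product sets form a class stable under intersection that generates the Borel sets, so they
    determine a law; they are also the sets for which [bm_increments] gives information. *)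
Definition boxes : set (set 'cV[R]_d) :=
  [set B | exists2 A : 'I_d -> set R, (forall i, measurable (A i)) &
    B = [set x : 'cV[R]_d | forall i, A i (x i ord0)]].

Lemma bspace_boxes : @measurable _ (bspace R d 1) = <<s boxes >>.
Proof.
apply/seteqP; split => [B mB|]; last first.
  apply: smallest_sub; first exact: (@sigma_algebra_measurable _ (bspace R d 1)).
  move=> _ [A mA ->].
  have -> : [set x : 'cV[R]_d | forall i, A i (x i ord0)] =
     \bigcap_(i : 'I_d) (fun x : bspace R d 1 => x i ord0) @^-1` (A i).
    by apply/seteqP; split => x H i; [move=> _; exact: H|exact: (H i I)].
  apply: fin_bigcap_measurable => // i _; rewrite -[X in measurable X]setTI.
  exact: measurable_entry.
have : measurable_fun setT (fun x : g_sigma_algebraType boxes => x : bspace R d 1).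
  apply: measurable_mx => i j; rewrite ord1 => _ A mA; rewrite setTI.
  apply: sub_sigma_algebra; exists (fun k => if k == i then A else setT).
    by move=> k; case: ifP.
  apply/seteqP; split => x /= H.
    by move=> k; case: eqP => // ->.
  by have := H i; rewrite eqxx.
by move=> /(_ measurableT B mB); rewrite setTI.
Qed.

Lemma boxes_law X Y : measurable_fun setT (X : T -> bspace R d 1) ->
  measurable_fun setT (Y : T -> bspace R d 1) ->
  (forall B, boxes B -> P (X @^-1` B) = P (Y @^-1` B)) ->
  forall B : set (bspace R d 1), measurable B -> P (X @^-1` B) = P (Y @^-1` B).
Proof.
move=> mX mY XY.
pose X' : {mfun T >-> bspace R d 1} := HB.pack X (isMeasurableFun.Build _ _ T (bspace R d 1) _ mX).
pose Y' : {mfun T >-> bspace R d 1} := HB.pack Y (isMeasurableFun.Build _ _ T (bspace R d 1) _ mY).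
move=> B mB.
rewrite -[LHS]/(distribution P X' B) -[RHS]/(distribution P Y' B).
apply: (@measure_unique _ R (bspace R d 1) boxes (fun=> setT) bspace_boxes) => //.
- move=> _ _ [A mA ->] [A' mA' ->]; exists (fun i => A i `&` A' i).
    by move=> i; exact: measurableI.
  by apply/seteqP; split => [x [H1 H2] i|x H]; [split|split => i; have [] := H i].
- by move=> _; exists (fun=> setT) => //; apply/seteqP; split.
- by apply/seteqP; split => // x _; exists 0%N.
- by move=> _; exact: le_lt_trans (probability_le1 _ _) (ltry _).
Qed.

(** A centred Gaussian vector with independent coordinates of standard deviation [s], phrased
    through product sets so that a Brownian increment is an instance by [bm_increments]. *)
Definition gaussian X := measurable_fun setT (X : T -> bspace R d 1) /\
  forall A : 'I_d -> set R, (forall i, measurable (A i)) ->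
    P [set w | forall i, A i (X w i ord0)] = (\prod_(i < d) N (A i))%E.

Lemma gaussian_law X Y : gaussian X -> gaussian Y ->
  forall B : set (bspace R d 1), measurable B -> P (X @^-1` B) = P (Y @^-1` B).
Proof.
move=> [mX gX] [mY gY]; apply: boxes_law => // _ [A mA ->].
exact: (etrans (gX A mA) (esym (gY A mA))).
Qed.

Lemma prod_update2 (F : 'I_d -> \bar R) (i j : 'I_d) (a b : \bar R) : j != i ->
  (\prod_k (if k == i then a else if k == j then b else F k) =
   a * (b * \prod_(k | (k != i) && (k != j)) F k))%E.
Proof.
move=> ji; rewrite (bigD1 i)//= eqxx (bigD1 j)//= (negbTE ji) eqxx.
congr (_ * (_ * _))%E; apply: eq_bigr => k /andP[/negbTE-> /negbTE->].
by [].
Qed.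

Definition givens (i j : 'I_d) (c t : R) (v : 'cV[R]_d) : 'cV[R]_d :=
  \col_k (if k == i then c * v i ord0 - t * v j ord0
          else if k == j then t * v i ord0 + c * v j ord0 else v k ord0).

(** Only the coordinates [i] and [j] move. On the event [E] that fixes the others, the pair has for
    its law a multiple of the product of two normal laws, first on rectangles and then on all Borel
    sets of the plane; [normal_rotation] applies to that law. *)
Lemma gaussian_givens X i j c t : j != i -> c ^+ 2 + t ^+ 2 = 1 -> t != 0 ->
  gaussian X -> gaussian (givens i j c t \o X).
Proof.
move=> ji ct t0 [mX gX].
have mXi k : measurable_fun setT (fun w => X w k ord0) by exact: measurable_mxP.
split.
  apply: measurable_mx => k l; rewrite ord1.
  under eq_fun do rewrite mxE.
  case: (k == i); first by apply: measurable_funB; apply: measurable_funM.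
  case: (k == j); last exact: mXi.
  by apply: measurable_funD; apply: measurable_funM.
move=> A mA.
pose E := [set w | forall k, k != i -> k != j -> A k (X w k ord0)].
have mE : measurable E.
  have -> : E = \bigcap_(k in [set k | (k != i) && (k != j)]) (fun w => X w k ord0) @^-1` (A k).
    by apply/seteqP; split => [w H k /andP[]|w H k ki kj]; [exact: H|apply: H; rewrite /= ki].
  apply: fin_bigcap_measurable => [|k _]; first exact: finite_finset; rewrite -[X in measurable X]setTI.
  exact: mXi.
pose a := (\prod_(k | (k != i) && (k != j)) N (A k))%E.
have a0 : (0 <= a)%E by apply: prode_ge0 => k _; exact: measure_ge0.
have afin : a \is a fin_num.
  by apply: prode_fin_num => k _; exact: (fin_num_measure N _ (mA k)).
have rect (B C : set R) : measurable B -> measurable C ->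
    P (E `&` [set w | B (X w i ord0) /\ C (X w j ord0)]) = (a * (N B * N C))%E.
  move=> mB mC.
  have -> : E `&` [set w | B (X w i ord0) /\ C (X w j ord0)] =
      [set w | forall k, (if k == i then B else if k == j then C else A k) (X w k ord0)].
    apply/seteqP; split => [w [/= HE [HB HC]] k|w /= H].
      by case: eqP => [->//|/eqP ki]; case: eqP => [->//|/eqP kj]; exact: HE.
    split; first by move=> k ki kj; have := H k; rewrite (negbTE ki) (negbTE kj).
    by split; [have := H i|have := H j]; rewrite eqxx ?(negbTE ji).
  rewrite (gX (fun k => if k == i then B else if k == j then C else A k)); last first.
    by move=> k; case: ifP => // _; case: ifP.
  rewrite (eq_bigr (fun k => if k == i then N B else if k == j then N C else N (A k))); last first.
    by move=> k _; case: ifP => // _; case: ifP.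
  by rewrite prod_update2// muleA muleC.
pose RR : measurableType _ := measurableTypeR R.
pose Y w : (RR * RR)%type := (X w i ord0, X w j ord0).
have mY : measurable_fun setT Y.
  by apply: (@measurable_fun_pair _ _ _ T RR RR); exact: mXi.
pose Y' : {mfun T >-> (RR * RR)%type} := HB.pack Y (isMeasurableFun.Build _ _ _ _ _ mY).
pose c0 : {nonneg R} := NngNum (fine_ge0 a0).
have key (Z : set (RR * RR)) : measurable Z -> pushforward (mrestr P mE) Y' Z = mscale c0 (N \x N)%E Z.
  move=> mZ.
  apply: (@measure_unique _ R (RR * RR)%type [set B `*` C | B in measurable & C in measurable] (fun=> setT) (measurable_prod_measurableType _ _)) => //.
  - move=> _ _ [B mB [C mC <-]] [B' mB' [C' mC' <-]]; exists (B `&` B'); first exact: measurableI.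
    by exists (C `&` C'); [exact: measurableI|rewrite setXI].
  - by move=> _; exists setT => //; exists setT => //; rewrite setXTT.
  - by apply/seteqP; split => // x _; exists 0%N.
  - move=> _ [B mB [C mC <-]].
    rewrite -[LHS]/(P ((Y @^-1` (B `*` C)) `&` E)) setIC.
    etransitivity; first exact: (rect B C mB mC).
    rewrite -[RHS]/((fine a)%:E * (N \x N) (B `*` C))%E fineK//; congr (_ * _)%E.
    by apply/esym; exact: (@product_measure1E _ _ RR RR R N N B C mB mC).
  - move=> _; rewrite -[ltLHS]/(P (setT `&` E)).
    exact: le_lt_trans (probability_le1 _ (measurableI _ _ measurableT mE)) (ltry _).
have mg : measurable_fun setT (fun z : R * R => (c * z.1 - t * z.2, t * z.1 + c * z.2)).
  by apply: measurable_fun_pair; [apply: measurable_funB|apply: measurable_funD]; apply: measurable_funM.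
pose Z := [set z : RR * RR | A i (c * z.1 - t * z.2) /\ A j (t * z.1 + c * z.2)].
have mZ : measurable Z.
  have := mg measurableT (A i `*` A j) (measurableX (mA i) (mA j)).
  by rewrite setTI.
have H : P ((Y @^-1` Z) `&` E) = (a * (N (A i) * N (A j)))%E.
  rewrite -(normal_rotation sN0 ct t0 (mA i) (mA j)).
  by etransitivity; first exact: (key _ mZ); rewrite -[LHS]/((fine a)%:E * (N \x N) Z)%E fineK.
rewrite [RHS](eq_bigr (fun k => if k == i then N (A i) else if k == j then N (A j) else N (A k))); last first.
  by move=> k _; case: eqP => [->//|_]; case: eqP => [->|].
rewrite prod_update2// muleA muleC -/a; etransitivity; last exact: H.
congr (P _).
apply/seteqP; split => [w /= Hw|w /= [[H1 H2] H3] k].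
  split; last by move=> k ki kj; have := Hw k; rewrite mxE (negbTE ki) (negbTE kj).
  by split; [have := Hw i|have := Hw j]; rewrite mxE eqxx ?(negbTE ji).
rewrite mxE; case: eqP => [->//|/eqP ki]; case: eqP => [->//|/eqP kj].
exact: H3.
Qed.

Definition flip (i : 'I_d) (v : 'cV[R]_d) : 'cV[R]_d :=
  \col_k (if k == i then - v k ord0 else v k ord0).

Lemma gaussian_flip X i : gaussian X -> gaussian (flip i \o X).
Proof.
move=> [mX gX].
have mXi k : measurable_fun setT (fun w => X w k ord0) by exact: measurable_mxP.
split.
  apply: measurable_mx => k l; rewrite ord1.
  under eq_fun do rewrite mxE.
  case: (k == i); last exact: mXi.
  exact: (measurable_funN (mXi k)).
move=> A mA.
have -> : [set w | forall k, A k ((flip i \o X) w k ord0)] =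
   [set w | forall k, (if k == i then -%R @^-1` A k else A k) (X w k ord0)].
  apply/seteqP; split => w /= H k; have := H k; rewrite mxE; by case: ifP.
rewrite (gX (fun k => if k == i then -%R @^-1` A k else A k)); last first.
  move=> k; case: ifP => // _; rewrite -[X in measurable X]setTI.
  by have := measurable_funN (@measurable_id _ _ setT) measurableT (mA k).
by apply: eq_bigr => k _; case: ifP => // _; exact: normal_opp.
Qed.

(** An orthogonal map [phi] with its inverse and adjoint [psi], packed with the fact that both
    preserve Gaussian vectors. The package is stable under composition, which allows an orthogonal
    map to be built from plane rotations without showing invariance under the whole orthogonal
    group. *)
Record gauss_isometry (phi psi : 'cV[R]_d -> 'cV[R]_d) : Prop := GaussIsometry {
  gi_adjoint : forall u v, mdot (phi u) v = mdot u (psi v);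
  gi_can : cancel phi psi;
  gi_lin : forall k u v, psi (u + k *: v) = psi u + k *: psi v;
  gi_gauss : forall X, gaussian X -> gaussian (phi \o X);
  gi_gaussV : forall X, gaussian X -> gaussian (psi \o X) }.

Lemma gauss_isometry_id : gauss_isometry id id.
Proof. by split. Qed.

Lemma gauss_isometry_comp f f' g g' : gauss_isometry f f' -> gauss_isometry g g' ->
  gauss_isometry (g \o f) (f' \o g').
Proof.
move=> hf hg; split.
- by move=> u v /=; rewrite (gi_adjoint hg) (gi_adjoint hf).
- by move=> u /=; rewrite (gi_can hg) (gi_can hf).
- by move=> k u v /=; rewrite (gi_lin hg) (gi_lin hf).
- by move=> X gX; exact: (gi_gauss hg (gi_gauss hf gX)).
- by move=> X gX; exact: (gi_gaussV hf (gi_gaussV hg gX)).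
Qed.

Lemma gauss_isometry_givens i j c t : j != i -> c ^+ 2 + t ^+ 2 = 1 -> t != 0 ->
  gauss_isometry (givens i j c t) (givens i j c (- t)).
Proof.
move=> ji ct t0; split.
- move=> u v; rewrite /mdot (bigD1 i)//= (bigD1 j)//= [RHS](bigD1 i)//= [X in _ = _ + X](bigD1 j)//=.
  rewrite !big_ord1 !mxE !eqxx (negbTE ji) !addrA; congr (_ + _); first by ring.
  by apply: eq_bigr => k /andP[/negbTE ki /negbTE kj]; rewrite !big_ord1 !mxE ki kj.
- move=> u; apply/matrixP => k l; rewrite ord1 !mxE !eqxx (negbTE ji).
  case: eqP => [->|_].
    rewrite -[RHS]mul1r -ct; ring.
  case: eqP => [->|_]; last by [].
  rewrite -[RHS]mul1r -ct; ring.
- move=> k u v; apply/matrixP => m l; rewrite !mxE.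
  case: ifP => _; first by ring.
  by case: ifP => _; [ring|rewrite ord1].
- by move=> X; exact: gaussian_givens.
- by move=> X; apply: gaussian_givens; rewrite ?sqrrN ?oppr_eq0.
Qed.

(** Induction on the number of nonzero coordinates of [e] other than [i]: a plane rotation
    annihilates one of them, [j], and leaves the rest unchanged. Its sine is nonzero because the
    coordinate [j] is, as [gaussian_givens] demands. *)
Lemma gauss_isometry_axis (i : 'I_d) n (e : 'cV[R]_d) :
  (#|[pred j | (j != i) && (e j ord0 != 0)%R]| <= n)%N ->
  exists phi psi, gauss_isometry phi psi /\ exists a, phi e = a *: delta_mx i ord0.
Proof.
elim: n e => [|n IH] e en; have [/existsP[j /andP[ji ej]]|/existsPn H] := boolP [exists j, (j != i) && (e j ord0 != 0)].
- move: en; rewrite leqn0 => /eqP/card0_eq/(_ j).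
  by rewrite !inE ji ej.
- exists id, id; split; first exact: gauss_isometry_id.
  exists (e i ord0); apply/matrixP => j l; rewrite ord1 !mxE andbT.
  case: eqP => [->|/eqP ji]; first by rewrite mulr1.
  by have := H j; rewrite ji/= negbK => /eqP ->; rewrite mulr0.
- pose r := Num.sqrt (e i ord0 ^+ 2 + e j ord0 ^+ 2).
  have r2 : r ^+ 2 = e i ord0 ^+ 2 + e j ord0 ^+ 2 by rewrite sqr_sqrtr// addr_ge0 ?sqr_ge0.
  have r0 : r != 0.
    rewrite -sqrf_eq0 r2 paddr_eq0 ?sqr_ge0// negb_and !sqrf_eq0 ej orbT//.
  pose c := e i ord0 / r; pose t := - (e j ord0 / r).
  have ct : c ^+ 2 + t ^+ 2 = 1.
    by rewrite /c /t sqrrN !expr_div_n -mulrDl -r2 divff// sqrf_eq0.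
  have t0 : t != 0 by rewrite oppr_eq0 mulf_neq0// invr_eq0.
  have gi := gauss_isometry_givens ji ct t0.
  have [|phi [psi [gpp [a Ha]]]] := IH (givens i j c t e).
    rewrite -ltnS; apply: leq_trans en; apply: proper_card; apply/properP; split.
      apply/fintype.subsetP => k; rewrite !inE mxE => /andP[ki]; rewrite (negbTE ki)/=.
      by case: (k =P j) => [->|].
    exists j; rewrite !inE ?ji// mxE (negbTE ji) eqxx negbK /t /c.
    by apply/eqP; field.
  exists (phi \o givens i j c t), (givens i j c (- t) \o psi); split.
    exact: gauss_isometry_comp.
  by exists a.
- exists id, id; split; first exact: gauss_isometry_id.
  exists (e i ord0); apply/matrixP => j l; rewrite ord1 !mxE andbT.
  case: eqP => [->|/eqP ji]; first by rewrite mulr1.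
  by have := H j; rewrite ji/= negbK => /eqP ->; rewrite mulr0.
Qed.

Definition householder (e v : 'cV[R]_d) := v - (2 * mdot e v) *: e.

(** The reflection along [e] is a conjugate of the sign change of one coordinate: rotate [e] onto an
    axis, flip that axis, rotate back. *)
Lemma gaussian_householder X e : enorm e = 1 -> gaussian X ->
  gaussian (householder e \o X).
Proof.
move=> e1 gX.
have [i ei0] : exists i, e i ord0 != 0.
  apply/existsP; rewrite -[X in is_true X]negbK negb_exists; apply/negP => /forallP H.
  have e0 : e = 0.
    by apply/matrixP => i j; rewrite ord1 mxE; apply/eqP; have := H i; rewrite negbK.
  by move: e1; rewrite e0 enorm0 => /eqP; rewrite eq_sym oner_eq0.
have [phi [psi [g [a pe]]]] := gauss_isometry_axis (leqnn #|[pred j | (j != i) && (e j ord0 != 0)]|).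
have flipE v : flip i v = v + (- (2 * mdot (delta_mx i ord0) v)) *: delta_mx i ord0.
  apply/matrixP => k l; rewrite ord1 !mxE andbT.
  have -> : mdot (delta_mx i ord0) v = v i ord0.
    rewrite /mdot (bigD1 i)//= big_ord1 mxE !eqxx mul1r big1 ?addr0// => j /negbTE ji.
    by rewrite big_ord1 mxE ji mul0r.
  have -> : v k 0 = v k ord0 by [].
  by case: (k =P i) => [->|_]; rewrite ?mulr1 ?mulr0 ?addr0//; ring.
have ed : e = a *: psi (delta_mx i ord0).
  have := gi_lin g a 0 (delta_mx i ord0); rewrite add0r -pe (gi_can g).
  have -> : psi 0 = 0.
    by have := gi_lin g (-1) (phi e) (phi e); rewrite scaleN1r subrr (gi_can g) scaleN1r subrr.
  by rewrite add0r.
have a2 : a ^+ 2 = 1.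
  have : mdot (phi e) (phi e) = 1 by rewrite (gi_adjoint g) (gi_can g) -enorm_sqr e1 expr1n.
  rewrite pe mdotZl mdotZr mulrA -expr2 => <-; rewrite -[LHS]mulr1; congr (_ * _).
  rewrite /mdot (bigD1 i)//= big_ord1 mxE !eqxx mul1r big1 ?addr0// => j /negbTE ji.
  by rewrite big_ord1 mxE ji mul0r.
have -> : householder e \o X = psi \o (flip i \o (phi \o X)).
  apply/funext => w /=; rewrite flipE (gi_lin g) (gi_can g) /householder.
  rewrite (mdotC (delta_mx _ _)) (gi_adjoint g).
  rewrite {1 2}ed mdotZl scalerA -scaleNr; congr (_ + _ *: _).
  by rewrite (mdotC _ (psi _)) -[in RHS](mul1r (2 * _)) -a2; ring.
by apply: (gi_gaussV g); apply: gaussian_flip; exact: (gi_gauss g).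
Qed.

End GaussianVectors.

Section GaussianMoments.
Context dT {T : measurableType dT} {R : realType} (P : probability T R).
Context {d : nat} (s : R).
Hypothesis s0 : 0 < s.
Variable X : T -> 'cV[R]_d.
Hypothesis gX : gaussian P s X.
Local Notation N := (normal_prob 0 s).

Let sN0 : s != 0. Proof. by rewrite gt_eqF. Qed.
Let mX : measurable_fun setT (X : T -> bspace R d 1). Proof. by case: gX. Qed.

Lemma measurable_gaussian_entry i : measurable_fun setT (fun w => X w i ord0).
Proof. exact: measurable_mxP. Qed.
Let mXi := measurable_gaussian_entry.

Lemma gaussian_entry_law i (A : set R) : measurable A ->
  P ((fun w => X w i ord0) @^-1` A) = N A.
Proof.
move=> mA; have [_ /(_ (fun k => if k == i then A else setT))] := gX.
have -> : [set w | forall k, (if k == i then A else setT) (X w k ord0)] = (fun w => X w i ord0) @^-1` A.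
  apply/seteqP; split => w /= H; first by have := H i; rewrite eqxx.
  by move=> k; case: (k =P i) => // ->.
move=> ->; last by move=> k; case: ifP.
rewrite (bigD1 i)//= eqxx big1 ?mule1// => k /negbTE ->.
exact: (probability_setT (normal_prob 0 s)).
Qed.

Lemma ge0_integral_gaussian_entry i (f : R -> \bar R) : measurable_fun setT f ->
  (forall x, 0 <= f x)%E -> (\int[P]_w f (X w i ord0) = \int[N]_x f x)%E.
Proof.
move=> mf f0.
pose Y : T -> measurableTypeR R := fun w => X w i ord0.
have mY : measurable_fun setT Y by exact: mXi.
pose Y' : {mfun T >-> measurableTypeR R} := HB.pack Y (isMeasurableFun.Build _ _ _ _ _ mY).
rewrite -[LHS](@ge0_integral_distribution _ _ _ _ _ _ Y')//.
apply: eq_measure_integral => A mA _.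
exact: gaussian_entry_law.
Qed.

Lemma integral_gaussian_entry4 i : (\int[P]_w ((X w i ord0) ^+ 4)%:E <= (64 * s ^+ 4)%:E)%E.
Proof.
rewrite (@ge0_integral_gaussian_entry i (fun x => (x ^+ 4)%:E)).
- exact: integral_normal_pow4.
- by apply/measurable_EFinP; exact: exprn_measurable.
- by move=> x; rewrite lee_fin exprn_even_ge0.
Qed.

Lemma L1_gaussian_entry4 i : L1 P (fun w => X w i ord0 ^+ 4).
Proof.
apply/integrableP; split; first by apply/measurable_EFinP; exact: measurable_funX.
under eq_integral => w _ do rewrite /= ger0_norm ?exprn_even_ge0//.
exact: le_lt_trans (integral_gaussian_entry4 i) (ltry _).
Qed.

Lemma ex_gaussian_entry4 i : ex P (fun w => X w i ord0 ^+ 4) <= 64 * s ^+ 4.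
Proof.
rewrite -lee_fin /ex /Rintegral fineK; first exact: integral_gaussian_entry4.
by apply: integrable_fin_num => //; exact: L1_gaussian_entry4.
Qed.

Lemma L1_gaussian_entry2 i : L1 P (fun w => X w i ord0 ^+ 2).
Proof.
apply: (L1_le (g := fun w => 1 + X w i ord0 ^+ 4)).
- exact: measurable_funX.
- move=> w; rewrite ger0_norm ?sqr_ge0//.
  have := sqr_ge0 (X w i ord0 ^+ 2 - 1); have := sqr_ge0 (X w i ord0).
  move: (X w i ord0) => x; nra.
- by apply: L1D; [exact: L1_cst|exact: L1_gaussian_entry4].
Qed.

Lemma ex_gaussian_entry2 i : ex P (fun w => X w i ord0 ^+ 2) = s ^+ 2.
Proof.
rewrite /ex /Rintegral (@ge0_integral_gaussian_entry i (fun x => (x ^+ 2)%:E)).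
- by rewrite integral_normal_sqr.
- by apply/measurable_EFinP; exact: exprn_measurable.
- by move=> x; rewrite lee_fin sqr_ge0.
Qed.

Lemma L1_gaussian_entryM i j : L1 P (fun w => X w i ord0 * X w j ord0).
Proof. by apply: L1_mul => //; exact: L1_gaussian_entry2. Qed.

Lemma L1_gaussian_entry i : L1 P (fun w => X w i ord0).
Proof.
apply: (L1_le (g := fun w => 1 + X w i ord0 ^+ 2)) => // [w|].
  have := sqr_ge0 (X w i ord0 - 1); have := sqr_ge0 (X w i ord0 + 1).
  by move=> *; rewrite ler_norml; apply/andP; split; lra.
by apply: L1D; [exact: L1_cst|exact: L1_gaussian_entry2].
Qed.

(** Used for symmetry: an expectation that changes sign when one coordinate does must vanish, which
    gives the means and the mixed second moments. *)
Lemma ex_gaussian_flip i (f : 'cV[R]_d -> R) :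
  measurable_fun setT (f : bspace R d 1 -> R) ->
  ex P (fun w => f (X w)) = ex P (fun w => f (flip i (X w))).
Proof.
move=> mf.
have gfX := gaussian_flip s0 i gX.
apply: (@ex_same_law _ T R P _ (bspace R d 1) X (flip i \o X)) => //.
  by case: gfX.
exact: (gaussian_law gX gfX).
Qed.

Lemma ex_gaussian_entry i : ex P (fun w => X w i ord0) = 0.
Proof.
have H := @ex_gaussian_flip i (fun x => x i ord0) (measurable_entry i ord0).
have E : ex P (fun w => flip i (X w) i ord0) = - ex P (fun w => X w i ord0).
  under [X in ex _ X]eq_fun do rewrite mxE eqxx -mulN1r.
  by rewrite exZ ?mulN1r//; exact: L1_gaussian_entry.
by move: H; rewrite E; lra.
Qed.

Lemma ex_gaussian_entryM i j : ex P (fun w => X w i ord0 * X w j ord0) = (i == j)%:R * s ^+ 2.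
Proof.
case: eqP => [<-|/eqP ij]; first by rewrite mul1r; exact: ex_gaussian_entry2.
rewrite mul0r.
have mf : measurable_fun setT (fun x : bspace R d 1 => x i ord0 * x j ord0).
  by apply: measurable_funM; exact: measurable_entry.
have H := @ex_gaussian_flip i (fun x => x i ord0 * x j ord0) mf.
have E : ex P (fun w => flip i (X w) i ord0 * flip i (X w) j ord0) = - ex P (fun w => X w i ord0 * X w j ord0).
  under [X in ex _ X]eq_fun do rewrite !mxE eqxx (eq_sym j) (negbTE ij) mulNr -mulN1r.
  by rewrite exZ ?mulN1r//; exact: L1_gaussian_entryM.
by move: H; rewrite E; lra.
Qed.

Let mdotE v w : mdot v (X w) = \sum_i v i ord0 * X w i ord0.
Proof. by rewrite -scalar_productE. Qed.

Let enormE w : enorm (X w) ^+ 2 = \sum_i X w i ord0 ^+ 2.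
Proof. by rewrite enorm_sqr -scalar_productE; apply: eq_bigr => i _; rewrite expr2. Qed.

Lemma L1_gaussian_mdot v : L1 P (fun w => mdot v (X w)).
Proof.
under [X in L1 _ X]eq_fun do rewrite mdotE.
by apply: L1_sum => i; apply: L1Z; exact: L1_gaussian_entry.
Qed.

Lemma ex_gaussian_mdot v : ex P (fun w => mdot v (X w)) = 0.
Proof.
under [X in ex _ X]eq_fun do rewrite mdotE.
rewrite ex_sum => [|i]; last by apply: L1Z; exact: L1_gaussian_entry.
by rewrite big1// => i _; rewrite exZ ?ex_gaussian_entry ?mulr0//; exact: L1_gaussian_entry.
Qed.

Let mdot2E v w : mdot v (X w) ^+ 2 =
  \sum_i \sum_j (v i ord0 * v j ord0) * (X w i ord0 * X w j ord0).
Proof.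
rewrite mdotE expr2 mulr_suml; apply: eq_bigr => i _; rewrite mulr_sumr.
by apply: eq_bigr => j _; rewrite mulrACA.
Qed.

Lemma L1_gaussian_mdot2 v : L1 P (fun w => mdot v (X w) ^+ 2).
Proof.
under [X in L1 _ X]eq_fun do rewrite mdot2E.
by apply: L1_sum => i; apply: L1_sum => j; apply: L1Z; exact: L1_gaussian_entryM.
Qed.

Lemma ex_gaussian_mdot2 v : ex P (fun w => mdot v (X w) ^+ 2) = s ^+ 2 * enorm v ^+ 2.
Proof.
under [X in ex _ X]eq_fun do rewrite mdot2E.
rewrite ex_sum => [|i]; last first.
  by apply: L1_sum => j; apply: L1Z; exact: L1_gaussian_entryM.
rewrite enorm_sqr -scalar_productE mulr_sumr; apply: eq_bigr => i _.
rewrite ex_sum => [|j]; last by apply: L1Z; exact: L1_gaussian_entryM.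
rewrite (bigD1 i)//= big1 => [|j /negbTE ji].
  by rewrite addr0 exZ ?ex_gaussian_entryM ?eqxx ?mul1r 1?mulrC//; exact: L1_gaussian_entryM.
by rewrite exZ ?ex_gaussian_entryM 1?eq_sym ?ji ?mul0r ?mulr0//; exact: L1_gaussian_entryM.
Qed.

Lemma L1_gaussian_enorm2 : L1 P (fun w => enorm (X w) ^+ 2).
Proof.
under [X in L1 _ X]eq_fun do rewrite enormE.
by apply: L1_sum => i; exact: L1_gaussian_entry2.
Qed.

Lemma ex_gaussian_enorm2 : ex P (fun w => enorm (X w) ^+ 2) = d%:R * s ^+ 2.
Proof.
under [X in ex _ X]eq_fun do rewrite enormE.
rewrite ex_sum => [|i]; last exact: L1_gaussian_entry2.
under eq_bigr do rewrite ex_gaussian_entry2.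
by rewrite sumr_const card_ord [RHS]mulr_natl.
Qed.

Let enorm4_le w : enorm (X w) ^+ 4 <= d%:R * \sum_i X w i ord0 ^+ 4.
Proof.
rewrite (exprM _ 2 2) enormE.
have := mdot_le (const_mx 1 : 'cV[R]_d) (\col_i X w i ord0 ^+ 2).
rewrite -scalar_productE /scalar_product.
under eq_bigr do rewrite !mxE mul1r.
move=> /(lerXn2r 2 _ _); rewrite !nnegrE => /(_ _ _).
rewrite exprMn !enorm_sqr -!scalar_productE /scalar_product => H.
apply: le_trans (H _ _) _.
- by apply: sumr_ge0 => i _; rewrite sqr_ge0.
- by rewrite mulr_ge0// enorm_ge0.
under eq_bigr do rewrite !mxE mulr1.
rewrite sumr_const card_ord -[X in X * _]mulr_natl mulr1 ler_wpM2l//.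
by apply: ler_sum => i _; rewrite !mxE -exprD.
Qed.

Lemma L1_gaussian_enorm4 : L1 P (fun w => enorm (X w) ^+ 4).
Proof.
apply: (L1_le (g := fun w => d%:R * \sum_i X w i ord0 ^+ 4)).
- by apply: measurable_funX; exact: measurable_enorm.
- by move=> w; rewrite ger0_norm ?exprn_even_ge0// enorm4_le.
- by apply: L1Z; apply: L1_sum => i; exact: L1_gaussian_entry4.
Qed.

Lemma ex_gaussian_enorm4 : ex P (fun w => enorm (X w) ^+ 4) <= 64 * d%:R ^+ 2 * s ^+ 4.
Proof.
apply: (@le_trans _ _ (ex P (fun w => d%:R * \sum_i X w i ord0 ^+ 4))).
  apply: ex_le; [exact: L1_gaussian_enorm4| |exact: enorm4_le].
  by apply: L1Z; apply: L1_sum => i; exact: L1_gaussian_entry4.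
rewrite exZ; last by apply: L1_sum => i; exact: L1_gaussian_entry4.
rewrite ex_sum; last by move=> i; exact: L1_gaussian_entry4.
apply: (@le_trans _ _ (d%:R * \sum_(i < d) (64 * s ^+ 4))).
  by rewrite ler_wpM2l//; apply: ler_sum => i _; exact: ex_gaussian_entry4.
by rewrite sumr_const card_ord -[_ *+ d]mulr_natl; lra.
Qed.

(** The one-step majorants are all brought to this shape: the linear term has mean zero, the
    quadratic ones have exact means, and only the fourth moment is merely bounded above, hence the
    sign condition on [c4] alone. *)
Lemma gaussian_poly (v : 'cV[R]_d) (c0 c1 c2 c3 c4 : R) : 0 <= c4 ->
  let f w := c0 + c1 * mdot v (X w) + c2 * mdot v (X w) ^+ 2
             + c3 * enorm (X w) ^+ 2 + c4 * enorm (X w) ^+ 4 in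
  L1 P f /\ ex P f <= c0 + c2 * (s ^+ 2 * enorm v ^+ 2) + c3 * (d%:R * s ^+ 2)
                      + c4 * (64 * d%:R ^+ 2 * s ^+ 4).
Proof.
move=> c40 f.
have l0 := L1_cst P c0.
have l1 := L1Z c1 (L1_gaussian_mdot v).
have l2 := L1Z c2 (L1_gaussian_mdot2 v).
have l3 := L1Z c3 L1_gaussian_enorm2.
have l4 := L1Z c4 L1_gaussian_enorm4.
have lf := L1D (L1D (L1D (L1D l0 l1) l2) l3) l4.
split; first exact: lf.
rewrite /f exD; [|exact: (L1D (L1D (L1D l0 l1) l2) l3)|exact: l4].
rewrite exD; [|exact: (L1D (L1D l0 l1) l2)|exact: l3].
rewrite exD; [|exact: (L1D l0 l1)|exact: l2].
rewrite exD// ex_cst !exZ; try first [exact: L1_gaussian_mdot|exact: L1_gaussian_mdot2|exact: L1_gaussian_enorm2|exact: L1_gaussian_enorm4].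
rewrite ex_gaussian_mdot ex_gaussian_mdot2 ex_gaussian_enorm2 mulr0 addr0.
by rewrite lerD2l ler_wpM2l// ex_gaussian_enorm4.
Qed.

End GaussianMoments.

(** * Reflection coupling of one Euler step *)

Section ScalarBounds.
Context {R : realType}.
Implicit Types r q w x y : R.

(** Here [q] is the radial displacement and [w] the squared transversal one. For q >= -r/2 the
    square root costs at most w / r. A larger inward jump can overshoot the meeting point; it is
    rare and is paid by a fourth power, which has expectation of order theta^8 for a noise of size
    theta^2. *)
Lemma coupled_distance_le (r' r q w : R) : 0 < r -> 0 <= r' -> 0 <= w ->
  r' ^+ 2 = (r + q) ^+ 2 + w -> r' <= r + q + (w / r + 20 * (q ^+ 4 / r ^+ 3)).
Proof.
move=> r0 r'0 w0 r'E.
have r3 : 0 < r ^+ 3 by rewrite exprn_gt0.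
set u := w / r; set b := q ^+ 4 / r ^+ 3.
have u0 : 0 <= u by rewrite divr_ge0// ltW.
have b0 : 0 <= b by apply: divr_ge0; [exact: exprn_even_ge0|exact: ltW].
have uE : w = u * r by rewrite /u mulfVK// gt_eqF.
have bE : q ^+ 4 = b * r ^+ 3 by rewrite /b mulfVK// gt_eqF.
have [qr|qr] := leP (- (r / 2)) q.
  suff H : r' <= r + q + u by lra.
  rewrite -(@ler_pXn2r _ 2)// ?nnegrE ?r'E ?uE; nra.
(* In this regime 2 |q| > r, so q^4 / r^3 is at least |q| / 8; the factor 20 then leaves 5/2 |q|,
   more than the 2 |q| lost by the overshoot. *)
have bq : - q / 8 <= b.
  rewrite -(ler_pM2r r3) -bE.
  have q0 : 0 <= - q by lra.
  have : r ^+ 3 <= 8 * (- q) ^+ 3.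
    rewrite (_ : 8 * (- q) ^+ 3 = (2 * - q) ^+ 3); last by ring.
    by rewrite lerXn2r ?nnegrE//; lra.
  move=> /(ler_wpM2l q0); lra.
have : r' <= `|r + q| + Num.sqrt w.
  rewrite -(@ler_pXn2r _ 2)// ?nnegrE ?addr_ge0 ?sqrtr_ge0//.
  rewrite r'E [X in _ <= X]sqrrD real_normK ?num_real// sqr_sqrtr//.
  by have := mulr_ge0 (normr_ge0 (r + q)) (sqrtr_ge0 w); lra.
have : Num.sqrt w <= u + r / 4.
  rewrite -(@ler_pXn2r _ 2)// ?nnegrE ?sqrtr_ge0 ?addr_ge0 ?divr_ge0 ?(ltW r0)//.
  by rewrite sqr_sqrtr// uE; have := sqr_ge0 (u - r / 4); lra.
have : `|r + q| <= - q - r \/ `|r + q| <= r / 2.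
  have [H|H] := leP 0 (r + q); [right; rewrite ger0_norm//|left; rewrite ltr0_norm//]; lra.
by move=> [H|H] H1 H2; lra.
Qed.

(** A lower expansion valid for all real [x]. For small [x] the quadratic part is the square of 1 -
    x/2 <= exp(-x/2), which explains the coefficient 1/4 instead of 1/2; once x^2 >= 1/4 the quartic
    term outweighs the quadratic one. The quadratic term is the source of the second-order gain. *)
Lemma expRN_ge_quad x y : 0 <= y ->
  1 - x + x ^+ 2 / 4 - x ^+ 4 - 2 * y <= expR (- (x + y)).
Proof.
move=> y0; have E := expR_ge1Dx (- (x + y)).
have [H|H] := leP (1 / 4) (x ^+ 2).
  apply: le_trans E; have : x ^+ 2 / 4 <= x ^+ 4 by rewrite -[x ^+ 4]/(x ^+ (2 * 2)) exprM; nra.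
  lra.
have x1 : - (1 / 2) <= x <= 1 / 2 by apply/andP; split; nra.
have Ex : 1 - x + x ^+ 2 / 4 <= expR (- x).
  have /andP[x1l x1r] := x1.
  have E2 := expR_ge1Dx (- (x / 2)).
  have -> : - x = - (x / 2) + - (x / 2) by lra.
  rewrite expRD -expr2; apply: (@le_trans _ _ ((1 + - (x / 2)) ^+ 2)); first by lra.
  by rewrite lerXn2r ?nnegrE ?expR_ge0//; lra.
have Ey := expR_ge1Dx (- y).
have Ex2 : expR (- x) <= 2.
  have : expR (- x) <= expR (1 / 2) by rewrite ler_expR; lra.
  have : expR (1 / 2) <= 2 :> R.
    have := expR_ge1Dx (- (1 / 2) : R); rewrite expRN => H2.
    have e0 := expR_gt0 (1 / 2 : R).
    move: H2; rewrite -[(expR _)^-1]div1r ler_pdivlMr//; lra.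
  lra.
rewrite opprD expRD.
have e0 := expR_ge0 (- x).
have : expR (- x) * (1 + - y) <= expR (- x) * expR (- y) by rewrite ler_wpM2l.
have : expR (- x) * y <= 2 * y by rewrite ler_wpM2r.
have : 0 <= x ^+ 4 by rewrite exprn_even_ge0.
lra.
Qed.

Lemma pow4_expRN_le x : 0 <= x -> x ^+ 4 * expR (- x) <= 24.
Proof.
move=> x0; rewrite expRN ler_pdivrMr ?expR_gt0//.
have H : 1 + x ^+ 4 / 24 <= expR x := expR_ge1Dxn 3 x0.
by move: H; move: (x ^+ 4) (expR x) => a b; lra.
Qed.

Lemma sqr4D_le x y : (x + y) ^+ 4 <= 8 * (x ^+ 4 + y ^+ 4).
Proof. by have := sqr_ge0 (x ^+ 2 - y ^+ 2); have := sqr_ge0 (x - y); nra. Qed.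

End ScalarBounds.

Section Householder.
Context {R : realType} {d : nat}.
Implicit Types u v e : 'cV[R]_d.

Lemma mdot_householder e u v : mdot u (householder e v) = mdot (householder e u) v.
Proof.
rewrite /householder mdotBr mdotBl mdotZr mdotZl; congr (_ - _).
by rewrite (mdotC u e); ring.
Qed.

Lemma enorm_householder e v : enorm e = 1 -> enorm (householder e v) = enorm v.
Proof.
move=> e1; apply/eqP; rewrite -(@eqrXn2 _ 2)// ?enorm_ge0// !enorm_sqr /householder.
rewrite mdotBr !mdotBl !mdotZr !mdotZl -(enorm_sqr e) e1 expr1n (mdotC v e).
by apply/eqP; ring.
Qed.

Lemma enorm_unit_decomp e u (a b : R) : mdot e e = 1 ->
  enorm (a *: e + (u + b *: e)) ^+ 2
  = (a + (b + mdot e u)) ^+ 2 + (enorm u ^+ 2 - mdot e u ^+ 2).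
Proof.
move=> e1; rewrite !enorm_sqr !mdotDl !mdotDr !mdotZl !mdotZr e1 (mdotC u e).
by ring.
Qed.

End Householder.

Section OneStep.
Context {R : realType} {d : nat}.
Implicit Types x y z xi : 'cV[R]_d.

(* [sc_LamK] is what is used of Hypothesis (iv): it says Lambda |||sg^-1||| <= 1. *)
Record step_coeffs (Lf eta B S Ls K Lam : R) (f : 'cV[R]_d -> 'cV[R]_d)
    (sg : 'cV[R]_d -> 'M[R]_d) : Prop := StepCoeffs {
  sc_Lf0 : 0 <= Lf; sc_eta0 : 0 < eta; sc_B0 : 0 <= B; sc_S0 : 0 <= S;
  sc_Ls0 : 0 <= Ls; sc_K0 : 0 < K; sc_Lam0 : 0 <= Lam;
  sc_fL : forall x y, enorm (f x - f y) <= Lf * enorm (x - y);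
  sc_fD : forall x y, mdot (f x - f y) (x - y)
            <= - eta * enorm (x - y) ^+ 2 + B * enorm (x - y);
  sc_unit : forall x, sg x \in unitmx;
  sc_S : forall x, enorm (sg x) <= S;
  sc_sL : forall x y, enorm (sg x - sg y) <= Ls * enorm (x - y);
  sc_K : forall x z, enorm (invmx (sg x) *m z) <= K * enorm z;
  sc_Lam : forall x y, enorm ((x - y)^T *m (sg x - sg y)) <= Lam * enorm (x - y);
  sc_LamK : forall x z, Lam * enorm (invmx (sg x) *m z) <= enorm z }.

Context (Lf eta B S Ls K Lam : R) (f : 'cV[R]_d -> 'cV[R]_d) (sg : 'cV[R]_d -> 'M[R]_d).
Hypothesis H : step_coeffs Lf eta B S Ls K Lam f sg.

Let Lf0 := sc_Lf0 H. Let B0 := sc_B0 H. Let S0 := sc_S0 H. Let Ls0 := sc_Ls0 H.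
Let K0 := sc_K0 H. Let Lam0 := sc_Lam0 H. Let eta0 := sc_eta0 H.

Definition euler_step (h : R) x xi := x + h *: f x + sg x *m xi.

(** One factor is bounded by 2S and the other by the Lipschitz constant. Linear growth in the
    distance, rather than quadratic, is wanted: division by the distance in [coupled_distance_le]
    then leaves a bounded outward drift. *)
Lemma enorm_sg_dist2 x y : enorm (sg x - sg y) ^+ 2 <= 2 * S * Ls * enorm (x - y).
Proof.
have h1 := sc_sL H x y; have h2 := ler_enormB (sg x) (sg y).
have h3 := sc_S H x; have h4 := sc_S H y; have h0 := enorm_ge0 (sg x - sg y).
have -> : 2 * S * Ls * enorm (x - y) = (S + S) * (Ls * enorm (x - y)) by ring.
by rewrite expr2 ler_pM//; apply: le_trans h2 _; exact: lerD.
Qed.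

(** With [zh] the direction of x - y, the unit vector [e] is chosen so that [sg x *m e] is
    [rho *: zh]. Reflecting the noise of the second copy along [e] then adds a purely radial noise 2
    rho (e, xi), while the rest of the noise carries the factor [sg x - sg y]. The vector [v]
    collects the whole radial noise, the scalar [w] the transversal part. *)
Lemma reflection_increment x y : x != y ->
  exists e v : 'cV[R]_d, [/\ enorm e = 1, K^-1 <= enorm v, enorm v <= 3 * S &
    forall h xi, exists2 w, 0 <= w <= 2 * h ^+ 2 * Lf ^+ 2 * enorm (x - y) ^+ 2
                      + 4 * S * Ls * enorm (x - y) * enorm xi ^+ 2 &
      enorm (euler_step h x xi - euler_step h y (householder e xi)) ^+ 2
      = (enorm (x - y)
         + (h * (mdot (f x - f y) (x - y) / enorm (x - y)) + mdot v xi)) ^+ 2 + w].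
Proof.
move=> xy; set z := x - y; set r := enorm z.
have z0 : z != 0 by rewrite subr_eq0.
have r0 : 0 < r by rewrite enorm_gt0.
have rN0 : r != 0 by rewrite gt_eqF.
pose w0 := invmx (sg x) *m z.
have sw0 : sg x *m w0 = z by rewrite mulKVmx// (sc_unit H).
have w0N : w0 != 0 by apply: contraNneq z0 => w00; rewrite -sw0 w00 mulmx0.
set n := enorm w0; have n0 : 0 < n by rewrite enorm_gt0.
have nN0 : n != 0 by rewrite gt_eqF.
pose e := n^-1 *: w0; pose zh := r^-1 *: z; pose rho := r / n.
have e1 : enorm e = 1 by rewrite /e enormZ gtr0_norm ?invr_gt0// mulVf.
have zh1 : enorm zh = 1 by rewrite /zh enormZ gtr0_norm ?invr_gt0// mulVf.
have sge : sg x *m e = rho *: zh.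
  by rewrite /e -scalemxAr sw0 /zh scalerA /rho; congr (_ *: _); field; rewrite nN0 rN0.
have rho0 : 0 < rho by rewrite divr_gt0.
have rhoK : K^-1 <= rho.
  by rewrite ler_pdivlMr// -ler_pdivlMl ?invr_gt0// invrK; exact: (sc_K H).
(* Hypothesis (iv) enters here: the radial part [u] of the noise coming from [sg x - sg y] has norm
   at most Lam <= rho and cannot cancel the reflected part, of size 2 rho; at least rho >= 1 / K
   survives. *)
have rhoLam : Lam <= rho by rewrite ler_pdivlMr//; exact: (sc_LamK H).
have rhoS : rho <= S.
  have -> : rho = enorm (sg x *m e) by rewrite sge enormZ zh1 mulr1 gtr0_norm.
  by apply: le_trans (enorm_mulmx _ _) _; rewrite e1 mulr1; exact: (sc_S H).
pose D := sg x - sg y.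
pose u := householder e (D^T *m zh).
have uLam : enorm u <= Lam.
  rewrite /u enorm_householder// -enorm_tr trmx_mul trmxK /zh linearZ/= -scalemxAl enormZ.
  rewrite gtr0_norm ?invr_gt0// -(ler_pM2l r0) mulrA mulfV// mul1r mulrC.
  exact: (sc_Lam H).
pose v := (2 * rho) *: e + u.
have ve : enorm ((2 * rho) *: e) = 2 * rho by rewrite enormZ e1 mulr1; apply: gtr0_norm; lra.
have v1 : K^-1 <= enorm v.
  have := lerB_enorm ((2 * rho) *: e) (- u); rewrite opprK enormN -/v ve; lra.
have v2 : enorm v <= 3 * S.
  by have := ler_enormD ((2 * rho) *: e) u; rewrite -/v ve; lra.
exists e, v; split=> // h xi.
set F := f x - f y.
pose p1 := h *: F + D *m householder e xi.
pose c := 2 * rho * mdot e xi.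
have pE : euler_step h x xi - euler_step h y (householder e xi) = z + (p1 + c *: zh).
  have -> : c *: zh = sg x *m (xi - householder e xi).
    by rewrite /householder subKr -scalemxAr sge [RHS]scalerA /c mulrAC.
  rewrite /euler_step /p1 /D /F /z; move: (householder e xi) => q.
  rewrite mulmxBl (mulmxBr (sg x)) scalerBr.
  by apply/matrixP => i j; rewrite !mxE; ring.
have zE : z = r *: zh by rewrite /zh scalerA mulfV// scale1r.
have mzh : mdot zh zh = 1 by rewrite -enorm_sqr zh1 expr1n.
(* The squared length of the component of [p1] orthogonal to [zh]. *)
exists (enorm p1 ^+ 2 - mdot zh p1 ^+ 2).
  apply/andP; split.
    rewrite subr_ge0 -[leLHS]real_normK ?num_real//.
    rewrite lerXn2r ?nnegrE ?enorm_ge0 ?normr_ge0//.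
    by apply: le_trans (normr_mdot _ _) _; rewrite zh1 mul1r.
  apply: (@le_trans _ _ (enorm p1 ^+ 2)); first by rewrite gerBl sqr_ge0.
  apply: le_trans (enorm_sqrD_le _ _) _.
  have h1 : enorm (h *: F) ^+ 2 <= h ^+ 2 * (Lf ^+ 2 * r ^+ 2).
    rewrite enormZ exprMn real_normK ?num_real// ler_wpM2l ?sqr_ge0// -exprMn.
    by rewrite lerXn2r ?nnegrE ?mulr_ge0 ?enorm_ge0//; exact: (sc_fL H).
  have h2 : enorm (D *m householder e xi) ^+ 2 <= (2 * S * Ls * r) * enorm xi ^+ 2.
    apply: (@le_trans _ _ ((enorm D * enorm xi) ^+ 2)).
      rewrite lerXn2r ?nnegrE ?mulr_ge0 ?enorm_ge0//.
      by apply: le_trans (enorm_mulmx _ _) _; rewrite enorm_householder.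
    by rewrite exprMn ler_wpM2r ?sqr_ge0//; exact: enorm_sg_dist2.
  by rewrite -/z -/r; lra.
rewrite pE -/z -/r -/F {1}zE enorm_sqr.
have -> : mdot v xi = c + mdot zh (D *m householder e xi).
  rewrite /v mdotDl mdotZl -/c; congr (_ + _).
  by rewrite (mdotC zh) mdot_mulmxl (mdotC (householder _ _)) mdot_householder.
have -> : h * (mdot F z / r) = mdot zh (h *: F).
  have -> : mdot F z = mdot zh F * r by rewrite {1}zE mdotZr (mdotC F) mulrC.
  by rewrite mulfK// [RHS]mdotZr.
have -> : mdot zh (h *: F) + (c + mdot zh (D *m householder e xi)) = c + mdot zh p1.
  by rewrite /p1 mdotDr; ring.
by rewrite -enorm_sqr; exact: enorm_unit_decomp.
Qed.

End OneStep.

Lemma enorm_sqrD {R : realType} m n (A C : 'M[R]_(m, n)) :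
  enorm (A + C) ^+ 2 = enorm A ^+ 2 + 2 * mdot A C + enorm C ^+ 2.
Proof. by rewrite !enorm_sqr mdotDl !mdotDr (mdotC C A); ring. Qed.

Lemma mixed_profile_le {R : realType} (al be kap r r' q G : R) : 0 <= al -> 0 <= be ->
  0 <= kap -> 0 <= G -> r' <= r + q + G ->
  al * (1 - expR (- (kap * r'))) + be * r'
  <= al * (1 - expR (- (kap * r)) * (1 - kap * q + (kap * q) ^+ 2 / 4 - (kap * q) ^+ 4
     - 2 * (kap * G))) + be * (r + q + G).
Proof.
move=> al0 be0 kap0 G0 r'le; apply: lerD; last exact: ler_wpM2l.
rewrite ler_wpM2l// lerB//.
apply: (@le_trans _ _ (expR (- (kap * r) + - (kap * q + kap * G)))).
  by rewrite expRD ler_wpM2l ?expR_ge0// expRN_ge_quad// mulr_ge0.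
by rewrite ler_expR -opprD lerN2 -!mulrDr ler_wpM2l// addrA.
Qed.

Section OneStepExpectation.
Context {R : realType} {d : nat}.
Implicit Types x y z xi : 'cV[R]_d.
Context (Lf eta B S Ls K Lam : R) (f : 'cV[R]_d -> 'cV[R]_d) (sg : 'cV[R]_d -> 'M[R]_d).
Hypothesis H : step_coeffs Lf eta B S Ls K Lam f sg.

Let Lf0 := sc_Lf0 H. Let B0 := sc_B0 H. Let S0 := sc_S0 H. Let Ls0 := sc_Ls0 H.
Let K0 := sc_K0 H. Let Lam0 := sc_Lam0 H. Let eta0 := sc_eta0 H.

(** The outward drift per unit time produced by the transversal noise: the term w / r contributes 4
    S Ls |xi|^2, and |xi|^2 has mean d times the time step. *)
Definition noise_drift : R := 4 * S * Ls * d%:R.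
Local Notation D := noise_drift.

(** Origin of the factors: 81 is 3^4 from |v| <= 3S, 8 comes from [sqr4D_le], 20 from
    [coupled_distance_le], 64 d^2 from the Gaussian fourth moment, and in [reflect_err] 192 is 8
    times the 24 of [pow4_expRN_le]. *)
Definition reflect_err_lin : R := 64 * 20 * (8 * 81) * S ^+ 4 * d%:R ^+ 2.
Definition reflect_err (kap : R) : R :=
  192 * Lf ^+ 4 + 64 * (8 * 81) * S ^+ 4 * d%:R ^+ 2 * kap ^+ 4 + 2 * kap * reflect_err_lin.

(** The distance estimate is inserted into the profile and everything is majorized by a polynomial
    in [mdot v xi] and [enorm xi] of the shape that [gaussian_poly] integrates. *)
Lemma reflect_pointwise x y (v : 'cV[R]_d) (h al be kap w r' : R) xi :
  let r := enorm (x - y) in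
  let f1 := mdot (f x - f y) (x - y) / r in
  let g0 := (2 * h ^+ 2 * Lf ^+ 2 + 160 * h ^+ 4 * Lf ^+ 4) * r in
  let E := expR (- (kap * r)) in
  let G := 2 * al * E * kap + be in
  0 < r -> 0 <= h -> 0 <= al -> 0 <= be -> 0 <= kap -> 0 <= r' -> enorm v <= 3 * S ->
  0 <= w <= 2 * h ^+ 2 * Lf ^+ 2 * r ^+ 2 + 4 * S * Ls * r * enorm xi ^+ 2 ->
  r' ^+ 2 = (r + (h * f1 + mdot v xi)) ^+ 2 + w ->
  al * (1 - expR (- (kap * r'))) + be * r' <=
    (al * (1 - E * (1 - kap * (h * f1) - 8 * kap ^+ 4 * (h * f1) ^+ 4))
       + be * (r + h * f1) + G * g0)
    + (al * E * (kap - kap ^+ 2 * (h * f1) / 2) + be) * mdot v xi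
    + (- (al * E * kap ^+ 2 / 4)) * mdot v xi ^+ 2
    + (G * (4 * S * Ls)) * enorm xi ^+ 2
    + (al * E * kap ^+ 4 * (8 * 81 * S ^+ 4) + G * (20 * (8 * 81) * S ^+ 4 / r ^+ 3)) * enorm xi ^+ 4.
Proof.
move=> r f1 g0 E G r0 h0 al0 be0 kap0 r'0 vS /andP[w0 wle] r'E.
set m := mdot v xi; set q := h * f1 + m; set X2 := enorm xi ^+ 2; set X4 := enorm xi ^+ 4.
have X40 : 0 <= X4 by rewrite exprn_ge0 ?enorm_ge0.
have X20 : 0 <= X2 by rewrite exprn_ge0 ?enorm_ge0.
have r3 : 0 < r ^+ 3 by rewrite exprn_gt0.
have rN0 : r != 0 by rewrite gt_eqF.
have m4 : m ^+ 4 <= 81 * S ^+ 4 * X4.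
  have -> : 81 * S ^+ 4 * X4 = (3 * S * enorm xi) ^+ 4 by rewrite /X4; ring.
  have -> : m ^+ 4 = `|m| ^+ 4.
    by rewrite -[RHS]/(`|m| ^+ (2 * 2)) exprM real_normK ?num_real// -exprM.
  rewrite lerXn2r ?nnegrE ?mulr_ge0 ?enorm_ge0//.
  by apply: le_trans (normr_mdot _ _) _; rewrite ler_wpM2r ?enorm_ge0.
have q4 : q ^+ 4 <= 8 * ((h * f1) ^+ 4 + m ^+ 4) := sqr4D_le _ _.
have f1r : `|f1| <= Lf * r.
  rewrite /f1 normrM normfV (gtr0_norm r0) ler_pdivrMr// -mulrA.
  apply: le_trans (normr_mdot _ _) _; rewrite -/r mulrA ler_wpM2r ?(ltW r0)//.
  exact: (sc_fL H).
have hf4 : (h * f1) ^+ 4 <= h ^+ 4 * Lf ^+ 4 * r ^+ 4.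
  have -> : h ^+ 4 * Lf ^+ 4 * r ^+ 4 = h ^+ 4 * (Lf * r) ^+ 4 by ring.
  rewrite exprMn ler_wpM2l ?exprn_ge0//.
  have -> : f1 ^+ 4 = `|f1| ^+ 4.
    by rewrite -[RHS]/(`|f1| ^+ (2 * 2)) exprM real_normK ?num_real// -exprM.
  by rewrite lerXn2r ?nnegrE ?mulr_ge0 ?(ltW r0).
pose GG := g0 + 4 * S * Ls * X2 + 20 * (8 * 81) * S ^+ 4 / r ^+ 3 * X4.
have GGle : w / r + 20 * (q ^+ 4 / r ^+ 3) <= GG.
  have h1 : w / r <= 2 * h ^+ 2 * Lf ^+ 2 * r + 4 * S * Ls * X2.
    by rewrite ler_pdivrMr//; apply: le_trans wle _; rewrite -/X2; lra.
  have h2 : q ^+ 4 / r ^+ 3 <= 8 * h ^+ 4 * Lf ^+ 4 * r + 8 * 81 * S ^+ 4 / r ^+ 3 * X4.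
    rewrite ler_pdivrMr//.
    have -> : (8 * h ^+ 4 * Lf ^+ 4 * r + 8 * 81 * S ^+ 4 / r ^+ 3 * X4) * r ^+ 3
       = 8 * (h ^+ 4 * Lf ^+ 4 * r ^+ 4 + 81 * S ^+ 4 * X4) by field.
    lra.
  have -> : GG = (2 * h ^+ 2 * Lf ^+ 2 * r + 4 * S * Ls * X2)
     + 20 * (8 * h ^+ 4 * Lf ^+ 4 * r + 8 * 81 * S ^+ 4 / r ^+ 3 * X4).
    by rewrite /GG /g0; field.
  lra.
have GG0 : 0 <= GG.
  apply: le_trans GGle; rewrite addr_ge0 ?divr_ge0 ?(ltW r0)//.
  by rewrite mulr_ge0// divr_ge0 ?(ltW r3)// exprn_even_ge0.
have r'le : r' <= r + q + GG.
  by apply: le_trans (coupled_distance_le r0 r'0 w0 r'E) _; rewrite -/q lerD2l.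
apply: le_trans (mixed_profile_le al0 be0 kap0 GG0 r'le) _; rewrite -/E.
have aE : 0 <= al * E by rewrite mulr_ge0 ?expR_ge0.
have k4 : 0 <= kap ^+ 4 by rewrite exprn_ge0.
have k2 : 0 <= kap ^+ 2 by rewrite exprn_ge0.
(* In the square of h f1 + m the term (h f1)^2 is dropped as nonnegative, whereas the cross term
   must be kept: it has no sign, but it is linear in [m] and its mean vanishes. *)
have key : 1 - kap * (h * f1) - kap * m + kap ^+ 2 * (m ^+ 2 + 2 * (h * f1) * m) / 4
    - 8 * kap ^+ 4 * ((h * f1) ^+ 4 + 81 * S ^+ 4 * X4) - 2 * (kap * GG)
    <= 1 - kap * q + (kap * q) ^+ 2 / 4 - (kap * q) ^+ 4 - 2 * (kap * GG).
  have e1 : (kap * q) ^+ 4 <= 8 * kap ^+ 4 * ((h * f1) ^+ 4 + 81 * S ^+ 4 * X4).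
    by rewrite exprMn; apply: le_trans (ler_wpM2l k4 q4) _; have := ler_wpM2l k4 m4; lra.
  have e2 : kap ^+ 2 * (m ^+ 2 + 2 * (h * f1) * m) <= (kap * q) ^+ 2.
    rewrite exprMn ler_wpM2l// /q sqrrD.
    by have := sqr_ge0 (h * f1); rewrite -mulr_natl; lra.
  have e3 : kap * q = kap * (h * f1) + kap * m by rewrite /q mulrDr.
  by move: e1 e2 e3; move: (kap * q) => Q; lra.
have := ler_wpM2l aE key; rewrite -/m -/X2 -/X4 /G /GG /q.
move: (h * f1) (20 * (8 * 81) * S ^+ 4 / r ^+ 3) => F1 C; lra.
Qed.


Context dT {T : measurableType dT} (P : probability T R) (X : T -> 'cV[R]_d) (theta : R).
Hypothesis theta0 : 0 < theta.
Hypothesis theta1 : theta <= 1.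
Hypothesis gX : gaussian P (theta ^+ 2) X.
Local Notation h := (theta ^+ 4).

Definition step_op (u : 'cV[R]_d -> R) x : R := ex P (fun w => u (euler_step f sg h x (X w))).

Definition bounded_meas (u : 'cV[R]_d -> R) :=
  measurable_fun setT (u : bspace R d 1 -> R) /\ exists M : R, forall x, `|u x| <= M.

Let mX : measurable_fun setT (X : T -> bspace R d 1). Proof. by case: gX. Qed.

Lemma measurable_euler_step d' (T' : measurableType d') (Y : T' -> 'cV[R]_d) x :
  measurable_fun setT (Y : T' -> bspace R d 1) ->
  measurable_fun setT ((fun w => euler_step f sg h x (Y w)) : T' -> bspace R d 1).
Proof.
move=> mY; apply: (@measurable_mxD _ _ _ _ _ (fun=> x + h *: f x) (fun w => sg x *m Y w)).
  exact: measurable_cst.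
by apply: (@measurable_mulmx _ _ _ _ _ _ (fun=> sg x) Y) => //; exact: measurable_cst.
Qed.

Lemma L1_euler_step u (Y : T -> 'cV[R]_d) x : bounded_meas u ->
  measurable_fun setT (Y : T -> bspace R d 1) ->
  L1 P (fun w => u (euler_step f sg h x (Y w))).
Proof.
move=> [mu [M uM]] mY; apply: (@L1_bounded _ _ _ _ _ M) => //.
by apply: (measurableT_comp mu); exact: measurable_euler_step.
Qed.

(** This is where the coupling enters: the reflected noise has the same law, so the two starting
    points may be driven by [X] and [householder e \o X] on one probability space. *)
Lemma step_op_householder u x e : bounded_meas u -> enorm e = 1 ->
  step_op u x = ex P (fun w => u (euler_step f sg h x (householder e (X w)))).
Proof.
move=> bu e1; have gQ := gaussian_householder (exprn_gt0 2 theta0) e1 gX.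
apply: (@ex_same_law _ _ _ P _ (bspace R d 1) X (householder e \o X) mX _ _
  (fun z => u (euler_step f sg h x z))).
- by case: gQ.
- by move=> A mA; exact: (gaussian_law gX gQ).
- apply: (measurableT_comp (proj1 bu)).
  exact: (@measurable_euler_step _ (bspace R d 1) id x (@measurable_id _ _ _)).
Qed.

(* By reflection coupling along [sg x]^-1 (x - y): the concave profile gains the second-order
   term [kap ^+ 2 * K ^- 2 / 4]. *)
Lemma reflect_step u x y (al be kap c : R) : bounded_meas u ->
  0 <= al -> 0 <= be -> 0 <= kap ->
  (forall x y, u x - u y <= al * (1 - expR (- (kap * enorm (x - y)))) + be * enorm (x - y) + c) ->
  h * (2 * Lf ^+ 2 + 160 * Lf ^+ 4) <= eta / 2 -> forall r, r = enorm (x - y) -> theta <= r ->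
  step_op u x - step_op u y <=
    al * (1 - expR (- (kap * r)) * (1 + h * (kap ^+ 2 * K ^- 2 / 4 - kap * (B + 2 * D))))
    + be * (r * (1 - h * eta / 2) + h * (B + D)) + c
    + (al * reflect_err kap + be * reflect_err_lin) * theta ^+ 5.
Proof.
move=> bu al0 be0 kap0 uP hsmall r rE rth.
have r0 : 0 < r by exact: lt_le_trans rth.
have xy : x != y by rewrite -subr_eq0 -enorm_gt0 -rE.
have rN0 : r != 0 by rewrite gt_eqF.
have h0 : 0 < h by rewrite exprn_gt0.
have th0 := ltW theta0; have h0' := ltW h0.
have [e [v [e1 vK vS hw]]] := reflection_increment H xy; rewrite -rE in hw.
rewrite (step_op_householder y bu e1) /step_op.
rewrite -exB; [|exact: L1_euler_step|apply: L1_euler_step=> //]; last first.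
  by case: (gaussian_householder (exprn_gt0 2 theta0) e1 gX).
set f1 := mdot (f x - f y) (x - y) / r.
set g0 := (2 * h ^+ 2 * Lf ^+ 2 + 160 * h ^+ 4 * Lf ^+ 4) * r.
set E := expR (- (kap * r)); set G := 2 * al * E * kap + be.
have E0 : 0 <= E := expR_ge0 _.
have G0 : 0 <= G by rewrite addr_ge0 ?mulr_ge0.
have r3 : 0 < r ^+ 3 by rewrite exprn_gt0.
have aE : 0 <= al * E by rewrite mulr_ge0.
pose c0 := al * (1 - E * (1 - kap * (h * f1) - 8 * kap ^+ 4 * (h * f1) ^+ 4))
       + be * (r + h * f1) + G * g0 + c.
pose c1 := al * E * (kap - kap ^+ 2 * (h * f1) / 2) + be.
pose c2 := - (al * E * kap ^+ 2 / 4).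
pose c3 := G * (4 * S * Ls).
pose c4 := al * E * kap ^+ 4 * (8 * 81 * S ^+ 4) + G * (20 * (8 * 81) * S ^+ 4 / r ^+ 3).
have c40 : 0 <= c4.
  have S4 : 0 <= S ^+ 4 by rewrite exprn_ge0.
  apply: addr_ge0; apply: mulr_ge0 => //.
  - by rewrite mulr_ge0// exprn_ge0.
  - by apply: mulr_ge0 => //; apply: mulr_ge0.
  - by apply: divr_ge0; [apply: mulr_ge0 => //; apply: mulr_ge0|exact: ltW].
have [lp ep] := gaussian_poly (exprn_gt0 2 theta0) gX v c0 c1 c2 c3 c40.
apply: (@le_trans _ _ _ _ _ (le_trans _ ep)).
  apply: ex_le => [|//|w].
    apply: L1B; apply: L1_euler_step => //.
    by case: (gaussian_householder (exprn_gt0 2 theta0) e1 gX).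
  apply: le_trans (uP _ _) _.
  have [ww wb wE] := hw h (X w).
  have := @reflect_pointwise x y v h al be kap ww _ (X w) _ (ltW h0) al0 be0 kap0
    (enorm_ge0 _) vS.
  rewrite -rE -/f1 -/g0 -/E -/G -/c1 -/c2 -/c3 -/c4 /c0 => /(_ _ _ _ r0 wb wE); lra.
rewrite (_ : theta ^+ 2 ^+ 2 = h); last by rewrite -exprM.
rewrite (_ : theta ^+ 2 ^+ 4 = theta ^+ 8); last by rewrite -exprM.
have f1le : f1 <= - eta * r + B.
  rewrite /f1 ler_pdivrMr//; apply: le_trans (sc_fD H x y) _; rewrite -rE; lra.
have hf1 : h * f1 + h * eta * r - h * B <= 0.
  by have := ler_wpM2l (ltW h0) f1le; lra.
have f1r : `|f1| <= Lf * r.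
  rewrite /f1 normrM normfV (gtr0_norm r0) ler_pdivrMr// -mulrA.
  apply: le_trans (normr_mdot _ _) _; rewrite -rE mulrA ler_wpM2r ?(ltW r0)//.
  by rewrite rE; exact: (sc_fL H).
have hf4 : (h * f1) ^+ 4 <= h ^+ 4 * Lf ^+ 4 * r ^+ 4.
  have -> : h ^+ 4 * Lf ^+ 4 * r ^+ 4 = h ^+ 4 * (Lf * r) ^+ 4 by ring.
  rewrite exprMn ler_wpM2l ?exprn_ge0 ?(ltW h0)//.
  have -> : f1 ^+ 4 = `|f1| ^+ 4.
    by rewrite -[RHS]/(`|f1| ^+ (2 * 2)) exprM real_normK ?num_real// -exprM.
  by rewrite lerXn2r ?nnegrE ?mulr_ge0 ?(ltW r0).
have h1 : h <= 1 by rewrite exprn_ile1 ?(ltW theta0).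
have h85 : theta ^+ 8 <= theta ^+ 5 by rewrite ler_wiXn2l.
have h165 : h ^+ 4 <= theta ^+ 5 by rewrite -exprM ler_wiXn2l.
(* The threshold [theta <= r] is used here; theta^5 is theta times the step. *)
have h8r : theta ^+ 8 / r ^+ 3 <= theta ^+ 5.
  rewrite ler_pdivrMr//; apply: (@le_trans _ _ (theta ^+ 5 * theta ^+ 3)); first by rewrite -exprD.
  by rewrite ler_wpM2l ?exprn_ge0// lerXn2r ?nnegrE// ltW.
(* The terms of second order in the step, which contain [Lf], consume half of the dissipativity;
   this leaves eta / 2 in the conclusion. *)
have g0le : g0 <= h * eta / 2 * r.
  rewrite /g0 ler_wpM2r ?(ltW r0)//; apply: (@le_trans _ _ (h * (h * (2 * Lf ^+ 2 + 160 * Lf ^+ 4)))).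
    have -> : h * (h * (2 * Lf ^+ 2 + 160 * Lf ^+ 4)) = 2 * h ^+ 2 * Lf ^+ 2 + 160 * (h ^+ 2 * Lf ^+ 4) by ring.
    rewrite lerD2l -mulrA ler_wpM2l// ler_wpM2r ?exprn_ge0//.
    by rewrite ler_wiXn2l ?(ltW h0).
  by rewrite -mulrA ler_wpM2l ?(ltW h0).
(* The mean of [mdot v (X w) ^+ 2] is h |v|^2 and comes with the negative coefficient [c2]: this
   lower bound on the radial noise is the gain. *)
have vK2 : K ^- 2 <= enorm v ^+ 2.
  by rewrite -exprVn lerXn2r ?nnegrE ?enorm_ge0 ?invr_ge0 ?(ltW K0).
(* The fourth power of the drift increment grows like r^4; the exponential factor [E] keeps it
   bounded uniformly in the distance. *)
have Ek4 : E * (kap ^+ 4 * r ^+ 4) <= 24.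
  by rewrite mulrC -exprMn; apply: pow4_expRN_le; rewrite mulr_ge0 ?(ltW r0).
have E1 : E <= 1 by rewrite -expR0 ler_expR oppr_le0 mulr_ge0 ?(ltW r0).
have k4 : 0 <= kap ^+ 4 by rewrite exprn_ge0.
have S4 : 0 <= S ^+ 4 by rewrite exprn_ge0.
have d2 : 0 <= d%:R ^+ 2 :> R by rewrite exprn_ge0.
have lin0 : 0 <= reflect_err_lin.
  by rewrite /reflect_err_lin; apply: mulr_ge0 => //; apply: mulr_ge0 => //; rewrite !mulr_ge0.
have th5 : 0 <= theta ^+ 5 by rewrite exprn_ge0.
have t1 : al * E * kap * (h * f1 + h * eta * r - h * B) <= 0.
  by rewrite mulr_ge0_le0// mulr_ge0.
have t2 : be * (h * f1 + h * eta * r - h * B) <= 0 by rewrite mulr_ge0_le0.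
have t3 : G * g0 <= G * (h * eta / 2 * r) by rewrite ler_wpM2l.
have t4 : al * (E * (8 * kap ^+ 4 * (h * f1) ^+ 4)) <= al * (192 * Lf ^+ 4 * theta ^+ 5).
  rewrite ler_wpM2l//.
  apply: (@le_trans _ _ (8 * Lf ^+ 4 * h ^+ 4 * (E * (kap ^+ 4 * r ^+ 4)))).
    have -> : 8 * Lf ^+ 4 * h ^+ 4 * (E * (kap ^+ 4 * r ^+ 4))
      = E * (8 * kap ^+ 4 * (h ^+ 4 * Lf ^+ 4 * r ^+ 4)) by ring.
    by rewrite ler_wpM2l// ler_wpM2l// mulr_ge0.
  apply: (@le_trans _ _ (8 * Lf ^+ 4 * h ^+ 4 * 24)).
    by rewrite ler_wpM2l// !mulr_ge0 ?exprn_ge0 ?(ltW h0).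
  have := ler_wpM2l (exprn_ge0 4 Lf0) h165; lra.
have t5 : al * E * kap ^+ 2 / 4 * (h * K ^- 2) <= al * E * kap ^+ 2 / 4 * (h * enorm v ^+ 2).
  by rewrite ler_wpM2l ?divr_ge0 ?mulr_ge0 ?exprn_ge0 ?(ltW h0)// ler_wpM2l ?(ltW h0).
have t6 : al * E * kap ^+ 4 * (8 * 81 * S ^+ 4) * (64 * d%:R ^+ 2 * theta ^+ 8)
    <= al * (64 * (8 * 81) * S ^+ 4 * d%:R ^+ 2 * kap ^+ 4) * theta ^+ 5.
  have -> : al * E * kap ^+ 4 * (8 * 81 * S ^+ 4) * (64 * d%:R ^+ 2 * theta ^+ 8)
    = al * (64 * (8 * 81) * S ^+ 4 * d%:R ^+ 2 * kap ^+ 4) * (E * theta ^+ 8) by ring.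
  rewrite ler_wpM2l ?mulr_ge0//.
  by rewrite -[leRHS]mul1r ler_pM ?exprn_ge0.
have t7 : G * (20 * (8 * 81) * S ^+ 4 / r ^+ 3) * (64 * d%:R ^+ 2 * theta ^+ 8)
   <= (2 * al * kap + be) * reflect_err_lin * theta ^+ 5.
  have -> : G * (20 * (8 * 81) * S ^+ 4 / r ^+ 3) * (64 * d%:R ^+ 2 * theta ^+ 8)
    = G * (reflect_err_lin * (theta ^+ 8 / r ^+ 3)) by rewrite /reflect_err_lin; ring.
  rewrite -mulrA; apply: ler_pM => //.
  - by apply: mulr_ge0 => //; apply: divr_ge0; [exact: exprn_ge0|exact: ltW].
  - rewrite lerD2r -[leRHS]mulr1 [leLHS](_ : _ = 2 * al * kap * E); last by ring.
    by rewrite ler_wpM2l ?mulr_ge0.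
  - by rewrite ler_wpM2l ?mulr_ge0.
move: t3 t7; rewrite /c4 /c3 /c2 /c0 /noise_drift /reflect_err /G => t3 t7.
move: t1 t2 t3 t4 t5 t6 t7;
move: (enorm v ^+ 2) (K ^- 2) (20 * (8 * 81) * S ^+ 4 / r ^+ 3) reflect_err_lin => v2 K2 CC C2.
move: (E) (g0) (h) (theta ^+ 5) (theta ^+ 8) (h * f1) ((h * f1) ^+ 4) => EE gg hh th5' th8 F1 F4.
lra.
Qed.


Definition sync_err : R := Lf + Lf ^+ 2 + Ls ^+ 2 * d%:R.

(** At distance at most [theta] both copies receive the same noise. Nothing is gained, but the
    expected distance grows at most by a factor 1 + O(h), that is by O(r h), which is O(theta^5). *)
Lemma sync_step u x y (al be kap c : R) : bounded_meas u ->
  0 <= al -> 0 <= be -> 0 <= kap -> 0 <= c ->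
  (forall x y, u x - u y <= al * (1 - expR (- (kap * enorm (x - y)))) + be * enorm (x - y) + c) ->
  forall r, r = enorm (x - y) -> r <= theta ->
  step_op u x - step_op u y <=
    al * (1 - expR (- (kap * r))) + be * r + c + (al * kap + be) * sync_err * theta ^+ 5.
Proof.
move=> bu al0 be0 kap0 c_ge0 uP r rE rth.
have th0 := ltW theta0; have h0' : 0 <= h by rewrite exprn_ge0.
have th5 : 0 <= theta ^+ 5 by rewrite exprn_ge0.
have err0 : 0 <= sync_err by rewrite /sync_err !addr_ge0 ?mulr_ge0 ?exprn_ge0.
have r0 : 0 <= r by rewrite rE enorm_ge0.
have a0 : 0 <= (al * kap + be) * sync_err * theta ^+ 5.
  by apply: mulr_ge0 => //; apply: mulr_ge0 => //; rewrite addr_ge0// mulr_ge0.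
have kr0 : 0 <= kap * r by rewrite mulr_ge0.
have E1 : expR (- (kap * r)) <= 1 by rewrite -expR0 ler_expR oppr_le0.
have [xy|xy] := eqVneq x y.
  rewrite xy subrr addr_ge0// addr_ge0// addr_ge0 ?mulr_ge0// subr_ge0//.
have rp : 0 < r by rewrite rE enorm_gt0 subr_eq0.
have rN0 : r != 0 by rewrite gt_eqF.
rewrite /step_op -exB; [|exact: L1_euler_step|exact: L1_euler_step].
set E := expR (- (kap * r)) in E1 *.
have E0 : 0 <= E := expR_ge0 _.
pose g := al * E * kap + be.
have g0 : 0 <= g by rewrite addr_ge0 ?mulr_ge0.
pose z1 := x - y + h *: (f x - f y).
pose v := (sg x - sg y)^T *m z1.
pose c0 := al * (1 - E) + be * r + c + g * ((enorm z1 ^+ 2 - r ^+ 2) / (2 * r)).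
pose c3 := g * (Ls ^+ 2 * r / 2).
have [lp ep] := gaussian_poly (exprn_gt0 2 theta0) gX v c0 (g / r) 0 c3 (lexx 0).
apply: (@le_trans _ _ _ _ _ (le_trans _ ep)).
  apply: ex_le => [|//|w]; first by apply: L1B; exact: L1_euler_step.
  apply: le_trans (uP _ _) _.
  set r' := enorm _.
  have r'0 : 0 <= r' := enorm_ge0 _.
  have r'2 : r' ^+ 2 <= enorm z1 ^+ 2 + 2 * mdot v (X w) + Ls ^+ 2 * r ^+ 2 * enorm (X w) ^+ 2.
    have -> : r' = enorm (z1 + (sg x - sg y) *m X w).
      rewrite /r' /euler_step /z1 mulmxBl scalerBr; congr enorm.
      by apply/matrixP => i j; rewrite !mxE; ring.
    rewrite enorm_sqrD.
    have -> : mdot z1 ((sg x - sg y) *m X w) = mdot v (X w) by rewrite mdotC mdot_mulmxl mdotC.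
    have : enorm ((sg x - sg y) *m X w) ^+ 2 <= Ls ^+ 2 * r ^+ 2 * enorm (X w) ^+ 2.
      rewrite -!exprMn lerXn2r ?nnegrE ?mulr_ge0 ?enorm_ge0//.
      apply: le_trans (enorm_mulmx _ _) _; rewrite ler_wpM2r ?enorm_ge0// rE.
      exact: (sc_sL H).
    lra.
  (* The concave profile lies below its tangent at [r], so only the mean of r' - r is needed. *)
  have conc : 1 - expR (- (kap * r')) <= 1 - E + E * kap * (r' - r).
    have -> : - (kap * r') = - (kap * r) + kap * (r - r') by ring.
    rewrite expRD; have := ler_wpM2l E0 (expR_ge1Dx (kap * (r - r'))).
    rewrite -/E; lra.
  (* The square root is bounded by its tangent, r' - r <= (r'^2 - r^2) / (2r), which is a polynomial
     in the noise. *)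
  have rr : r' - r <= (enorm z1 ^+ 2 - r ^+ 2) / (2 * r) + mdot v (X w) / r
      + Ls ^+ 2 * r / 2 * enorm (X w) ^+ 2.
    rewrite -(ler_pM2r rp).
    have -> : ((enorm z1 ^+ 2 - r ^+ 2) / (2 * r) + mdot v (X w) / r
      + Ls ^+ 2 * r / 2 * enorm (X w) ^+ 2) * r
      = (enorm z1 ^+ 2 + 2 * mdot v (X w) + Ls ^+ 2 * r ^+ 2 * enorm (X w) ^+ 2 - r ^+ 2) / 2
      by field.
    by have := sqr_ge0 (r' - r); lra.
  have h1 := ler_wpM2l al0 conc; have h2 := ler_wpM2l g0 rr.
  rewrite /c0 /c3 mul0r addr0; move: h1 h2; rewrite /g.
  rewrite (_ : (al * E * kap + be) / r * mdot v (X w) = (al * E * kap + be) * (mdot v (X w) / r));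
    last by rewrite mulrAC mulrA.
  move: ((enorm z1 ^+ 2 - r ^+ 2) / (2 * r)) (mdot v (X w) / r) => aa bb.
  by lra.
rewrite (_ : theta ^+ 2 ^+ 2 = h); last by rewrite -exprM.
rewrite !mul0r !addr0.
have z1le : enorm z1 <= r * (1 + h * Lf).
  apply: le_trans (ler_enormD _ _) _; rewrite enormZ ger0_norm// -rE.
  by have := ler_wpM2l h0' (sc_fL H x y); rewrite -rE; lra.
have z12 : (enorm z1 ^+ 2 - r ^+ 2) / (2 * r) <= r * (h * (Lf + Lf ^+ 2 / 2)).
  rewrite ler_pdivrMr ?mulr_gt0//.
  have : enorm z1 ^+ 2 <= (r * (1 + h * Lf)) ^+ 2.
    by rewrite lerXn2r ?nnegrE ?enorm_ge0 ?mulr_ge0 ?addr_ge0 ?mulr_ge0.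
  have hh : h ^+ 2 <= h by rewrite expr2 ler_piMl// exprn_ile1.
  have := ler_wpM2l (mulr_ge0 (exprn_ge0 2 r0) (exprn_ge0 2 Lf0)) hh; lra.
have gle : g <= al * kap + be.
  rewrite /g lerD2r -[leRHS]mulr1 [leLHS](_ : _ = al * kap * E); last by ring.
  by rewrite ler_wpM2l// mulr_ge0.
have rh : r * h <= theta ^+ 5 by rewrite exprS ler_wpM2r.
rewrite /c0 /c3.
have t1 := ler_wpM2l g0 z12.
have t2 : g * (r * h * sync_err) <= (al * kap + be) * sync_err * theta ^+ 5.
  rewrite -[leRHS]mulrA; apply: ler_pM => //; first by rewrite !mulr_ge0.
  by rewrite [leRHS]mulrC ler_wpM2r.
have t3 : 0 <= g * (r * h * Lf ^+ 2) by rewrite !mulr_ge0 ?exprn_ge0.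
have t4 : 0 <= g * (r * h * (Ls ^+ 2 * d%:R)) by rewrite !mulr_ge0 ?exprn_ge0.
move: t1 t2; rewrite /sync_err; move: ((enorm z1 ^+ 2 - r ^+ 2) / (2 * r)) ((al * kap + be)) => aa bb.
lra.
Qed.

End OneStepExpectation.

(** * Iterating the step: regularization, then contraction *)

Section Phases.
Context {R : realType} {d : nat}.
Implicit Types x y z xi : 'cV[R]_d.
Context (Lf eta B S Ls K Lam : R) (f : 'cV[R]_d -> 'cV[R]_d) (sg : 'cV[R]_d -> 'M[R]_d).
Hypothesis H : step_coeffs Lf eta B S Ls K Lam f sg.

Let Lf0 := sc_Lf0 H. Let B0 := sc_B0 H. Let S0 := sc_S0 H. Let Ls0 := sc_Ls0 H.
Let K0 := sc_K0 H. Let eta0 := sc_eta0 H.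

Local Notation D := (@noise_drift R d S Ls).
Local Notation rerr := (@reflect_err R d Lf S).
Local Notation rlin := (@reflect_err_lin R d S).
Local Notation serr := (@sync_err R d Lf Ls).

Lemma noise_drift_ge0 : 0 <= D.
Proof. by rewrite /noise_drift !mulr_ge0. Qed.

Lemma reflect_err_lin_ge0 : 0 <= rlin.
Proof.
have S4 : 0 <= S ^+ 4 by rewrite exprn_ge0.
by rewrite /reflect_err_lin; apply: mulr_ge0 => //; apply: mulr_ge0 => //; rewrite !mulr_ge0.
Qed.

Lemma sync_err_ge0 : 0 <= serr.
Proof. by rewrite /sync_err !addr_ge0 ?mulr_ge0 ?exprn_ge0. Qed.

Lemma reflect_err_mono k k' : 0 <= k -> k <= k' -> 0 <= rerr k <= rerr k'.
Proof.
move=> k0 kk'; have k'0 := le_trans k0 kk'.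
have S4 : 0 <= 64 * (8 * 81) * S ^+ 4 * d%:R ^+ 2.
  apply: mulr_ge0; last exact: exprn_ge0.
  by apply: mulr_ge0; [apply: mulr_ge0 => //; apply: mulr_ge0|exact: exprn_ge0].
have L4 : 0 <= 192 * Lf ^+ 4 by rewrite mulr_ge0// exprn_ge0.
have rl := reflect_err_lin_ge0.
rewrite /reflect_err; apply/andP; split.
  by rewrite !addr_ge0// mulr_ge0 ?exprn_ge0// mulr_ge0.
rewrite lerD// ?lerD2l; first by rewrite ler_wpM2l// lerXn2r ?nnegrE.
by rewrite ler_wpM2r// ler_wpM2l.
Qed.

Context dT {T : measurableType dT} (P : probability T R) (X : T -> 'cV[R]_d) (theta : R).
Hypothesis theta0 : 0 < theta.
Hypothesis theta1 : theta <= 1.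
Hypothesis gX : gaussian P (theta ^+ 2) X.
Hypothesis hsmall : theta ^+ 4 * (2 * Lf ^+ 2 + 160 * Lf ^+ 4) <= eta / 2.
Local Notation h := (theta ^+ 4).
Local Notation Tm := (step_op f sg P X theta).

Definition unit_meas (u : 'cV[R]_d -> R) :=
  measurable_fun setT (u : bspace R d 1 -> R) /\ forall x, 0 <= u x <= 1.

Lemma unit_bounded u : unit_meas u -> bounded_meas u.
Proof. by move=> [mu u01]; split=> //; exists 1 => x; have /andP[u0 u1] := u01 x; rewrite ger0_norm. Qed.

Hypothesis mf : measurable_fun setT (f : bspace R d 1 -> bspace R d 1).
Hypothesis msg : measurable_fun setT (sg : bspace R d 1 -> bspace R d d).

Lemma unit_step u : unit_meas u -> unit_meas (Tm u).
Proof.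
move=> uu; have [mu u01] := uu; have mX : measurable_fun setT (X : T -> bspace R d 1) by case: gX.
split; last first.
  move=> x; have l1 := L1_euler_step f sg P theta x (unit_bounded uu) mX.
  rewrite ex_ge0 ?(le_trans (ex_le l1 (L1_cst P 1) _)) ?ex_cst// => w; first by case/andP: (u01 (euler_step f sg h x (X w))).
  by case/andP: (u01 (euler_step f sg h x (X w))).
apply: (@measurable_ex_pair1 _ T R P _ (bspace R d 1) _ T id (@measurable_id _ _ _) (fun p => u (euler_step f sg h p.1 (X p.2))) 1).
  apply: (measurableT_comp mu).
  apply: (@measurable_mxD _ _ _ _ _ (fun p : bspace R d 1 * T => p.1 + h *: f p.1) (fun p => sg p.1 *m X p.2)).
    apply: measurable_mxD; first exact: measurable_fst.
    apply: (@measurable_mxZ _ _ _ _ _ (fun=> h)) => //.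
    by apply: (measurableT_comp mf); exact: measurable_fst.
  apply: measurable_mulmx.
    by apply: (measurableT_comp msg); exact: measurable_fst.
  by apply: (measurableT_comp mX); exact: measurable_snd.
by move=> p; have /andP[u0 u1] := u01 (euler_step f sg h p.1 (X p.2)); rewrite ger0_norm.
Qed.

Lemma unit_iter k u : unit_meas u -> unit_meas (iter k Tm u).
Proof. by move=> uu; elim: k => [//|k IH] /=; exact: unit_step. Qed.

(** The constant [c] is not part of the modulus of continuity: it accumulates the errors of order
    theta^5 made at each step. *)
Definition profile (al be kap c : R) (u : 'cV[R]_d -> R) := forall x y,
  u x - u y <= al * (1 - expR (- (kap * enorm (x - y)))) + be * enorm (x - y) + c.

(* The steepness [kp] of the concave profile decreases from [kap0 / eps], where it dominates a
   Lipschitz function, to [kap0 / (eps + 1)]: in unit time the oscillation is regularized with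
   constants that do not depend on the Lipschitz constant. *)
Section Regularization.
Variables (kap0 eps : R).
Hypothesis kap0_ge1 : 1 <= kap0.
Hypothesis eps01 : 0 < eps <= 1.
Hypothesis kap0_big : B + 2 * D + 2 <= kap0 * (K ^- 2 / 8).
Hypothesis heps : h <= eps / 2.

Let kp k : R := kap0 / (eps + k%:R * h).
Definition reg_err : R := 2 * rerr (kap0 / eps) + 2 * (kap0 / eps) * serr + 2 * (kap0 / eps ^+ 2).

(** The time condition concerns the start (k - 1) h of the last step, so that the conclusion still
    covers the first [k] with k h >= 1, where the steepness has come down to at most [kap0]. *)
Lemma regularization u : unit_meas u -> profile 2 0 (kap0 / eps) 0 u ->
  forall k, (k%:R - 1) * h <= 1 -> profile 2 0 (kp k) (k%:R * (reg_err * theta ^+ 5)) (iter k Tm u).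
Proof.
move=> uu pu; have /andP[e0 e1] := eps01; have he := heps; have kb := kap0_big; have k1 := kap0_ge1.
have h0 : 0 < h by rewrite exprn_gt0.
have th5 : 0 <= theta ^+ 5 by rewrite exprn_ge0// ltW.
have kap00 : 0 < kap0 by lra.
have ke0 : 0 <= kap0 / eps by rewrite divr_ge0 ?ltW.
have kee0 : 0 <= kap0 / eps ^+ 2 by rewrite divr_ge0 ?exprn_ge0 ?ltW.
have /andP[rr0 _] := reflect_err_mono ke0 (lexx _).
have err0 : 0 <= reg_err.
  have s0 := sync_err_ge0; rewrite /reg_err; apply: addr_ge0; last by rewrite mulr_ge0.
  by apply: addr_ge0; [rewrite mulr_ge0|apply: mulr_ge0 => //; rewrite mulr_ge0].
elim=> [|k IH] kh.
  by rewrite /kp !mul0r addr0.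
have kh1 : k%:R * h <= 1 by move: kh; rewrite -natr1 addrK.
have kh0 : 0 <= k%:R * h by apply: mulr_ge0 => //; exact: ltW.
have {}IH : profile 2 0 (kp k) (k%:R * (reg_err * theta ^+ 5)) (iter k Tm u).
  by apply: IH; lra.
set c := k%:R * _ in IH.
have c0 : 0 <= c by rewrite mulr_ge0// mulr_ge0.
have cE : k.+1%:R * (reg_err * theta ^+ 5) = c + reg_err * theta ^+ 5.
  by rewrite -natr1 mulrDl mul1r.
rewrite cE => x y; rewrite mul0r addr0 iterS.
set uk := iter k Tm u in IH *.
have uuk : unit_meas uk := unit_iter k uu.
have buk := unit_bounded uuk.
set a := eps + k%:R * h; have a0 : 0 < a by rewrite /a; lra.
have aE : eps + k.+1%:R * h = a + h by rewrite /a -natr1; ring.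
have kpk : kp k = kap0 / a by [].
have kpk1 : kp k.+1 = kap0 / (a + h) by rewrite /kp aE.
have ah0 : 0 < a + h by lra.
have kp0 : 0 < kp k by rewrite kpk divr_gt0.
have kp10 : 0 < kp k.+1 by rewrite kpk1 divr_gt0.
have kple : kp k <= kap0 / eps by rewrite kpk ler_wpM2l ?(ltW kap00)// lef_pV2 ?posrE// /a lerDl.
have kp1le : kp k.+1 <= kap0 / eps by rewrite kpk1 ler_wpM2l ?(ltW kap00)// lef_pV2 ?posrE// /a; lra.
have delE : kp k - kp k.+1 = h / kap0 * (kp k * kp k.+1).
  by rewrite kpk kpk1; field; rewrite !gt_eqF.
set r := enorm (x - y); have r0 : 0 <= r := enorm_ge0 _.
(* With the factor 2 in front, the profile is at least 1 as soon as kp r >= 1, and a function with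
   values in [0, 1] satisfies it trivially. *)
have [big|small] := leP 1 (kp k.+1 * r).
  have /andP[_ h1] := (unit_step uuk).2 x; have /andP[h2 _] := (unit_step uuk).2 y.
  have : expR (- (kp k.+1 * r)) <= 1 / 2.
    rewrite expRN -[_^-1]div1r ler_pdivrMr ?expR_gt0//.
    by have := expR_ge1Dx (kp k.+1 * r); lra.
  have := mulr_ge0 err0 th5; lra.
(* The inverse of [kp] grows by h / kap0 per step, so one step lowers the steepness by h / kap0
   times kp k kp k.+1, a quantity comparable with the second-order gain h kp^2. *)
have dele : (kp k - kp k.+1) * r <= h / kap0 * kp k.
  have -> : (kp k - kp k.+1) * r = h / kap0 * kp k * (kp k.+1 * r) by rewrite delE; ring.
  by apply: ler_piMr; [apply: mulr_ge0; [apply: divr_ge0; exact: ltW|exact: ltW]|exact: ltW].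
have del0 : 0 <= (kp k - kp k.+1) * r.
  rewrite delE; apply: mulr_ge0 => //; apply: mulr_ge0; first by apply: divr_ge0; exact: ltW.
  by apply: mulr_ge0; exact: ltW.
have E1E : expR (- (kp k.+1 * r)) = expR (- (kp k * r)) * expR ((kp k - kp k.+1) * r).
  by rewrite -expRD; congr expR; ring.
set E := expR (- (kp k * r)) in E1E *.
have E0 : 0 <= E := expR_ge0 _.
have E1 : E <= 1 by rewrite -expR0 ler_expR oppr_le0 mulr_ge0// ltW.
have [rth|rth] := leP theta r.
  have := reflect_step H theta0 theta1 gX buk (ler0n _ 2) (lexx 0) (ltW kp0) IH hsmall (erefl r) rth.
  rewrite -/E !mul0r !addr0 => le1; apply: le_trans le1 _.
  have rle : 2 * rerr (kp k) * theta ^+ 5 <= reg_err * theta ^+ 5.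
    rewrite ler_wpM2r//; have /andP[_ h1] := reflect_err_mono (ltW kp0) kple.
    have := mulr_ge0 ke0 sync_err_ge0; rewrite /reg_err; lra.
  suff : E * expR ((kp k - kp k.+1) * r) <= E * (1 + h * (kp k ^+ 2 * K ^- 2 / 4 - kp k * (B + 2 * D))).
    by rewrite E1E; lra.
  rewrite ler_wpM2l//.
  have y12 : (kp k - kp k.+1) * r <= 1 / 2.
    apply: le_trans dele _; have -> : h / kap0 * kp k = h / a by rewrite kpk; field; rewrite !gt_eqF.
    by rewrite ler_pdivrMr// /a; lra.
  have e2 : expR ((kp k - kp k.+1) * r) <= 1 + 2 * ((kp k - kp k.+1) * r).
    move: del0 y12; move: ((kp k - _) * r) => yy y0 y1.
    have := expR_ge1Dx (- yy); rewrite expRN => e1'.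
    rewrite -[expR yy]invrK invf_ple ?posrE ?invr_gt0 ?expR_gt0//; last by lra.
    apply: le_trans e1'; rewrite -[_^-1]div1r ler_pdivrMr; last by lra.
    by have := mulr_ge0 y0 y0; nra.
  apply: le_trans e2 _; rewrite lerD2l.
  apply: (@le_trans _ _ (2 * (h / kap0 * kp k))); first by rewrite ler_wpM2l.
  have -> : 2 * (h / kap0 * kp k) = h * kp k * (2 / kap0) by field; rewrite gt_eqF.
  have -> : h * (kp k ^+ 2 * K ^- 2 / 4 - kp k * (B + 2 * D))
    = h * kp k * (kp k * (K ^- 2 / 4) - (B + 2 * D)) by ring.
  apply: ler_wpM2l; first by apply: mulr_ge0; exact: ltW.
  (* Here [kap0_big] is spent: a <= 2 gives kp k >= kap0 / 2, so the gain kp K^-2 / 4 pays for the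
     outward drift B + 2D and for the 2 / kap0 that lowering the steepness costs. *)
  have k2 : 2 / kap0 <= 2 by rewrite ler_pdivrMr//; lra.
  have : kap0 * (K ^- 2 / 8) <= kp k * (K ^- 2 / 4).
    have -> : kap0 * (K ^- 2 / 8) = kap0 / 2 * (K ^- 2 / 4) by field; rewrite gt_eqF.
    rewrite ler_wpM2r ?divr_ge0 ?invr_ge0 ?exprn_ge0 ?(ltW K0)//.
    by rewrite kpk ler_wpM2l ?(ltW kap00)// lef_pV2 ?posrE// /a; lra.
  lra.
have := sync_step H theta0 theta1 gX buk (ler0n _ 2) (lexx 0) (ltW kp0) c0 IH (erefl r) (ltW rth).
rewrite -/E !mul0r !addr0 => le1; apply: le_trans le1 _.
have s1 : 2 * kp k * serr * theta ^+ 5 <= 2 * (kap0 / eps) * serr * theta ^+ 5.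
  by rewrite ler_wpM2r// ler_wpM2r ?sync_err_ge0// ler_wpM2l.
have s2 : 2 * (expR (- (kp k.+1 * r)) - E) <= 2 * (kap0 / eps ^+ 2) * theta ^+ 5.
  rewrite -mulrA ler_wpM2l//.
  have -> : E = expR (- (kp k.+1 * r)) * expR (- ((kp k - kp k.+1) * r)).
    by rewrite /E -expRD; congr expR; ring.
  have := expR_ge1Dx (- ((kp k - kp k.+1) * r)).
  have E10 := expR_ge0 (- (kp k.+1 * r)).
  have E11 : expR (- (kp k.+1 * r)) <= 1.
    by rewrite -expR0 ler_expR oppr_le0 mulr_ge0// ltW.
  move=> /(ler_wpM2l E10).
  have := ler_wpM2r del0 E11; rewrite mul1r.
  suff : (kp k - kp k.+1) * r <= kap0 / eps ^+ 2 * theta ^+ 5 by lra.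
  rewrite delE.
  have -> : kap0 / eps ^+ 2 * theta ^+ 5 = h / kap0 * ((kap0 / eps) * (kap0 / eps)) * theta.
    by rewrite [theta ^+ 5]exprSr; move: (theta ^+ 4) => hh; field; rewrite !gt_eqF.
  have hk : 0 <= h / kap0 by apply: divr_ge0; exact: ltW.
  have pq : 0 <= kp k * kp k.+1 by apply: mulr_ge0; exact: ltW.
  apply: ler_pM => //; [exact: mulr_ge0|apply: ler_wpM2l => //|exact: ltW].
  by apply: ler_pM => //; exact: ltW.
have := mulr_ge0 rr0 th5; rewrite /reg_err; lra.
Qed.

End Regularization.

Section Contraction.
Variable kap : R.
Hypothesis kap_ge0 : 0 <= kap.
Hypothesis kap_big : 1 <= kap ^+ 2 * K ^- 2 / 4 - kap * (B + 2 * D).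

(** The radius 8 (B + D + 1) / eta is where the pull of the dissipative drift on the linear part
    outweighs the outward drift. Inside it exp(- kap r) is at least 2 (B + D + 1) times the slope,
    so that the concave part pays for the linear one. *)
Definition contr_slope : R := expR (- (kap * (8 * (B + D + 1) / eta))) / (2 * (B + D + 1)).
Definition contr_rate : R := Num.min (eta / 4) contr_slope.
Local Notation del := contr_slope.
Local Notation cc := contr_rate.
Definition contr_err : R := 2 * (rerr kap + del * rlin) + 2 * (kap + del) * (serr + cc).

Lemma contr_slope_gt0 : 0 < del.
Proof.
rewrite /contr_slope divr_gt0 ?expR_gt0// mulr_gt0//.
by have := noise_drift_ge0; have := B0; lra.
Qed.

Lemma contr_rate_gt0 : 0 < cc.
Proof. by rewrite /contr_rate lt_min contr_slope_gt0 divr_gt0. Qed.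

(* Far away the dissipativity of the drift acts on the linear part of the profile, nearby the
   noise acts on its concave part. *)
Lemma contr_drift r : 0 <= r ->
  cc * (1 - expR (- (kap * r)) + del * r) + del * (B + D)
  <= expR (- (kap * r)) + eta * del * r / 2.
Proof.
move=> r0; set E := expR _.
have E0 : 0 <= E := expR_ge0 _.
have d0 := contr_slope_gt0; have c0 := contr_rate_gt0.
have e0 := eta0; have D0 := noise_drift_ge0; have b0 := B0.
have ce : cc <= eta / 4 by rewrite /contr_rate ge_min lexx.
have cd : cc <= del by rewrite /contr_rate ge_min lexx orbT.
have dr : 0 <= del * r by rewrite mulr_ge0// ltW.
have t1 : cc * (del * r) <= eta / 4 * (del * r) by rewrite ler_wpM2r.
have t2 : 0 <= cc * E by rewrite mulr_ge0// ltW.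
have t5 : 0 <= eta * (del * r) by rewrite mulr_ge0// ltW.
have [rR|rR] := leP (8 * (B + D + 1) / eta) r.
  have t3 : del * (B + D + 1) * 8 <= del * r * eta.
    by move: rR; rewrite ler_pdivrMr// => /(ler_wpM2l (ltW d0)); lra.
  have t4 : 0 <= del * (B + D) by rewrite mulr_ge0 ?(ltW d0)// addr_ge0.
  lra.
have EE : del * (2 * (B + D + 1)) <= E.
  rewrite /contr_slope mulfVK ?gt_eqF//; last by lra.
  by rewrite ler_expR lerN2 ler_wpM2l// ltW.
have t4 : 0 <= del * (B + D) by rewrite mulr_ge0 ?(ltW d0)// addr_ge0.
lra.
Qed.

(** By [kap_big] the concave part gains at least h exp(- kap r) per step, and [contr_drift] converts
    this gain and the dissipativity into a factor 1 - cc h on both coefficients; the steepness [kap]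
    stays fixed. *)
Lemma profile_contraction u c0 : unit_meas u -> 0 <= c0 -> profile 2 (2 * del) kap c0 u ->
  cc * h <= 1 ->
  forall k, profile (2 * (1 - cc * h) ^+ k) (2 * (1 - cc * h) ^+ k * del) kap
              (c0 + k%:R * (contr_err * theta ^+ 5)) (iter k Tm u).
Proof.
move=> uu c00 pu ch1.
have kb := kap_big; have kp0 := kap_ge0.
have h0 : 0 <= h by rewrite exprn_ge0// ltW.
have th5 : 0 <= theta ^+ 5 by rewrite exprn_ge0// ltW.
have d0 := ltW contr_slope_gt0; have cc0 := ltW contr_rate_gt0.
have s0 := sync_err_ge0; have rl0 := reflect_err_lin_ge0.
have /andP[rr0 _] := reflect_err_mono kp0 (lexx _).
have kd0 : 0 <= kap + del by rewrite addr_ge0.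
have e1 : 0 <= rerr kap + del * rlin by rewrite addr_ge0// mulr_ge0.
have e2 : 0 <= (kap + del) * (serr + cc) by rewrite mulr_ge0// addr_ge0.
have err0 : 0 <= contr_err by rewrite /contr_err -mulrA addr_ge0// mulr_ge0.
have q0 : 0 <= 1 - cc * h by rewrite subr_ge0.
have q1 : 1 - cc * h <= 1 by rewrite gerBl mulr_ge0.
elim=> [|k IH]; first by rewrite expr0 !mulr1 mul0r addr0.
set c := c0 + _ in IH.
have c_ge0 : 0 <= c by rewrite addr_ge0// mulr_ge0// mulr_ge0.
have cE : c0 + k.+1%:R * (contr_err * theta ^+ 5) = c + contr_err * theta ^+ 5.
  by rewrite -natr1 mulrDl mul1r addrA.
rewrite cE => x y; rewrite iterS.
set uk := iter k Tm u in IH *.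
have uuk : unit_meas uk := unit_iter k uu.
have buk := unit_bounded uuk.
set al := 2 * (1 - cc * h) ^+ k in IH.
have al0 : 0 <= al by rewrite mulr_ge0// exprn_ge0.
have al2 : al <= 2.
  by rewrite -[leRHS]mulr1 ler_wpM2l// exprn_ile1.
have -> : 2 * (1 - cc * h) ^+ k.+1 = al * (1 - cc * h) by rewrite exprSr mulrA.
set r := enorm (x - y); have r0 : 0 <= r := enorm_ge0 _.
have E0 := expR_ge0 (- (kap * r)).
have alE : al * contr_err * theta ^+ 5 <= 2 * contr_err * theta ^+ 5.
  by rewrite ler_wpM2r// ler_wpM2r.
have [rth|rth] := leP theta r.
  have ald0 : 0 <= al * del by rewrite mulr_ge0.
  have := reflect_step H theta0 theta1 gX buk al0 ald0 kp0 IH hsmall (erefl r) rth.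
  have D1 := contr_drift r0.
  set E := expR (- (kap * r)) in E0 D1 *.
  move=> le1; apply: le_trans le1 _.
  have t1 := ler_wpM2l (mulr_ge0 al0 h0) D1.
  have t2 := ler_wpM2l (mulr_ge0 (mulr_ge0 al0 h0) E0) kb.
  have t3 : (al * rerr kap + al * del * rlin) * theta ^+ 5 <= 2 * (rerr kap + del * rlin) * theta ^+ 5.
    rewrite ler_wpM2r// (_ : al * rerr kap + al * del * rlin = al * (rerr kap + del * rlin)); last by ring.
    by rewrite ler_wpM2r.
  have t4 := mulr_ge0 e2 th5.
  move: t1 t2 t3 t4; rewrite /contr_err.
  move: (kap ^+ 2 * K ^- 2 / 4 - kap * (B + 2 * D)) (rerr kap) => G RR; lra.
have ald0 : 0 <= al * del by rewrite mulr_ge0.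
have := sync_step H theta0 theta1 gX buk al0 ald0 kp0 c_ge0 IH (erefl r) (ltW rth).
set E := expR (- (kap * r)) in E0 *.
move=> le1; apply: le_trans le1 _.
have t1 : (al * kap + al * del) * serr * theta ^+ 5 <= 2 * ((kap + del) * serr) * theta ^+ 5.
  rewrite ler_wpM2r// -mulrDr -mulrA ler_wpM2r//.
  by rewrite mulr_ge0.
have EE : 1 - E <= kap * r by have := expR_ge1Dx (- (kap * r)); rewrite -/E; lra.
(* Below [theta] nothing contracts, but there the profile is at most (kap + del) theta, so claiming
   the factor 1 - cc h costs an error of order theta h only. *)
have t2 : al * (cc * h) * (1 - E + del * r) <= 2 * ((kap + del) * cc) * theta ^+ 5.
  have -> : 2 * ((kap + del) * cc) * theta ^+ 5 = 2 * (cc * h) * ((kap + del) * theta).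
    by rewrite [theta ^+ 5]exprSr; ring.
  have ch0 : 0 <= cc * h by rewrite mulr_ge0.
  have E1 : E <= 1 by rewrite -expR0 ler_expR oppr_le0 mulr_ge0.
  apply: ler_pM => //; [exact: mulr_ge0| |by rewrite ler_wpM2r|].
    by rewrite addr_ge0 ?subr_ge0// mulr_ge0.
  by have := ler_wpM2l kd0 (ltW rth); lra.
have t3 := mulr_ge0 e1 th5.
move: t1 t2 t3; rewrite /contr_err; move: (rerr kap) => RR; lra.
Qed.

End Contraction.
End Phases.

(** The oscillation is at most min(1, kap r), which is at most 2 (1 - 1 / (1 + kap r)), and exp(-
    kap r) <= 1 / (1 + kap r). *)
Lemma profile_Lipschitz {R : realType} {d : nat} (u : 'cV[R]_d -> R) (L kap : R) : 0 <= L <= kap ->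
  unit_meas u -> (forall x y, u x - u y <= L * enorm (x - y)) -> profile 2 0 kap 0 u.
Proof.
move=> /andP[L0 Lk] [_ u01] uL x y; rewrite mul0r !addr0.
set r := enorm _; have r0 : 0 <= r := enorm_ge0 _.
have a0 : 0 <= kap * r by rewrite mulr_ge0// (le_trans L0).
have e1 : expR (- (kap * r)) <= (1 + kap * r)^-1.
  by rewrite expRN lef_pV2 ?posrE ?expR_gt0 ?expR_ge1Dx//; lra.
have a1 : 0 < 1 + kap * r by lra.
have e2 : (1 + kap * r) * (1 + kap * r)^-1 = 1 by rewrite mulfV// gt_eqF.
have i0 : 0 < (1 + kap * r)^-1 by rewrite invr_gt0.
have /andP[ux0 ux1] := u01 x; have /andP[uy0 uy1] := u01 y.
have uxy := uL x y; rewrite -/r in uxy.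
have uk : u x - u y <= kap * r by apply: le_trans uxy _; rewrite ler_wpM2r.
suff : u x - u y <= 2 * (1 - (1 + kap * r)^-1) by lra.
have [big|small] := leP 1 (kap * r); first by nra.
by nra.
Qed.

(* [Lf] is quantified after [C] and [c] because the Lipschitz constant of the truncated drift
   blows up with the truncation radius. *)
Theorem euler_contraction {R : realType} {d : nat} (eta B S Ls K Lam : R) :
  0 < eta -> 0 <= B -> 0 <= S -> 0 <= Ls -> 0 < K ->
  exists C c : R, [/\ 0 < C, 0 < c & forall Lf (f : 'cV[R]_d -> 'cV[R]_d) (sg : 'cV[R]_d -> 'M[R]_d),
    step_coeffs Lf eta B S Ls K Lam f sg ->
    forall L t e : R, 0 <= L -> 2 <= t -> 0 < e -> exists2 th0 : R, 0 < th0 &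
    forall n th, 0 < th <= th0 -> n%:R * th ^+ 4 = t ->
    forall dT (T : measurableType dT) (P : probability T R) (X : T -> 'cV[R]_d),
    gaussian P (th ^+ 2) X -> forall u, unit_meas u ->
    (forall x y, u x - u y <= L * enorm (x - y)) -> forall x y,
    iter n (step_op f sg P X th) u x - iter n (step_op f sg P X th) u y
    <= C * (1 + enorm (x - y)) * expR (- c * t) + e].
Proof.
move=> eta0 B0 S0 Ls0 K0.
pose D := @noise_drift R d S Ls.
have D0 : 0 <= D by rewrite /D /noise_drift !mulr_ge0.
(* A common steepness for both phases: [kap8] is the requirement of the regularization, [kap4] that
   of the contraction. *)
have [kap [kap1 kap8 kap4]] : exists kap, [/\ 1 <= kap, B + 2 * D + 2 <= kap * (K ^- 2 / 8) &
    1 <= kap ^+ 2 * K ^- 2 / 4 - kap * (B + 2 * D)].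
  have K2 : 0 < K ^+ 2 by rewrite exprn_gt0.
  move: (D) D0 => D' D0'; pose kap := 1 + (B + 2 * D' + 2) * 8 * K ^+ 2.
  have kap1 : 1 <= kap by rewrite lerDl; apply: mulr_ge0; [lra|exact: ltW].
  have kap8 : B + 2 * D' + 2 <= kap * (K ^- 2 / 8).
    have -> : kap * (K ^- 2 / 8) = (8 * K ^+ 2)^-1 + (B + 2 * D' + 2).
      by rewrite /kap; field; rewrite gt_eqF.
    by rewrite lerDr invr_ge0 mulr_ge0// ltW.
  exists kap; split=> //; move: kap1 kap8; move: (kap) => k k1 k8.
  have -> : k ^+ 2 * K ^- 2 / 4 - k * (B + 2 * D')
    = k * (2 * (k * (K ^- 2 / 8)) - (B + 2 * D')) by field; rewrite gt_eqF.
  have : 1 * 1 <= k * (2 * (k * (K ^- 2 / 8)) - (B + 2 * D')).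
    by apply: ler_pM => //; lra.
  by rewrite mul1r.
pose del := @contr_slope R d eta B S Ls kap.
pose cc := @contr_rate R d eta B S Ls kap.
have del0 : 0 < del.
  by rewrite /del /contr_slope divr_gt0 ?expR_gt0// mulr_gt0// -/D; lra.
have cc0 : 0 < cc by rewrite /cc /contr_rate lt_min del0 divr_gt0.
exists (2 * expR (2 * cc) * (1 + del)), cc; split=> //.
  by rewrite !mulr_gt0 ?expR_gt0//; lra.
move=> Lf f sg Hs L t e L0 t2 e0.
have mf : measurable_fun setT (f : bspace R d 1 -> bspace R d 1).
  by apply: measurable_eLipschitz; exists Lf; [exact: (sc_Lf0 Hs)|exact: (sc_fL Hs)].
have msg : measurable_fun setT (sg : bspace R d 1 -> bspace R d d).
  by apply: measurable_eLipschitz; exists Ls; [exact: (sc_Ls0 Hs)|exact: (sc_sL Hs)].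
(* The initial steepness kap / eps is then at least L, as [profile_Lipschitz] requires. *)
pose eps := (1 + L)^-1.
have eps0 : 0 < eps by rewrite invr_gt0; lra.
have eps1 : eps <= 1 by rewrite invf_le1 ?lerDl// ltr_pwDl.
pose e1 := @reg_err R d Lf S Ls kap eps.
pose e2 := @contr_err R d Lf eta B S Ls kap.
pose A1 := (2 * Lf ^+ 2 + 160 * Lf ^+ 4) * 2 / eta.
pose A2 := 2 / eps.
pose A4 := t * (`|e1| + `|e2|) / e.
have Lf0 := sc_Lf0 Hs.
have A10 : 0 <= A1.
  apply: divr_ge0; last exact: ltW.
  by apply: mulr_ge0 => //; apply: addr_ge0; apply: mulr_ge0 => //; exact: exprn_ge0.
have A20 : 0 <= A2 by rewrite divr_ge0// ltW.
have A40 : 0 <= A4 by rewrite divr_ge0 ?(ltW e0)// mulr_ge0 ?addr_ge0//; lra.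
(* The requirements on the step are gathered in one number: theta A <= 1 yields theta <= 1 and,
   through [A1], [A2], [cc] and [A4] in turn, [hs], [he], [hc] and an accumulated error at most
   [e]. *)
pose A := 1 + A1 + A2 + cc + A4.
have [A1A A2A ccA A4A] : [/\ A1 <= A, A2 <= A, cc <= A & A4 <= A].
  by rewrite /A; move: A10 A20 A40 cc0; move: (A1) (A2) (cc) (A4) => *; split; lra.
have A0 : 0 < A by rewrite /A; move: A10 A20 A40 cc0; move: (A1) (A2) (cc) (A4) => *; lra.
have A1' : 1 <= A by rewrite /A; move: A10 A20 A40 cc0; move: (A1) (A2) (cc) (A4) => *; lra.
exists A^-1; first by rewrite invr_gt0.
move=> n th /andP[th0 thA] nth_ dT T P X gX u uu uL x y.
have thA1 a : 0 <= a -> a <= A -> th * a <= 1.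
  move=> a0 aA; apply: (@le_trans _ _ (A^-1 * A)); last by rewrite mulVf// gt_eqF.
  by apply: ler_pM => //; exact: ltW.
have th1 : th <= 1 by rewrite -[th]mulr1 thA1.
set h := th ^+ 4 in nth_.
have h0 : 0 < h by rewrite exprn_gt0.
have hth : h <= th by rewrite /h -[leRHS]expr1 ler_wiXn2l// ltW.
have hA1 a : 0 <= a -> a <= A -> h * a <= 1.
  by move=> a0 aA; apply: le_trans (thA1 _ a0 aA); rewrite ler_wpM2r.
have hs : h * (2 * Lf ^+ 2 + 160 * Lf ^+ 4) <= eta / 2.
  by have := hA1 A1 A10 A1A; rewrite /A1 !mulrA ler_pdivrMr// mul1r ler_pdivlMr.
have he : h <= eps / 2.
  by have := hA1 A2 A20 A2A; rewrite /A2 mulrA ler_pdivrMr// mul1r ler_pdivlMr.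
have hc : cc * h <= 1 by rewrite mulrC hA1 ?(ltW cc0).
(* Regularization takes the first [m] steps, [m] minimal with m h >= 1, and contraction the others;
   minimality gives (m - 1) h <= 1, hence m h <= 2. *)
have exm : exists m, 1 <= m%:R * h by exists n; rewrite nth_; lra.
have [m mh mmin] := ex_minnP exm.
have mn : (m <= n)%N by apply: mmin; rewrite nth_; lra.
have mh2 : (m%:R - 1) * h <= 1.
  case: m mh mmin {mn} => [|m] mh mmin; first by rewrite sub0r mulN1r; lra.
  rewrite -natr1 addrK; rewrite leNgt; apply/negP => H1.
  by have := mmin m (ltW H1); rewrite ltnn.
have eps01 : 0 < eps <= 1 by rewrite eps0 eps1.
have p0 : profile 2 0 (kap / eps) 0 u.
  apply: (profile_Lipschitz (L := L)) => //; rewrite L0/= /eps invrK.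
  by rewrite -[leLHS]mul1r; apply: ler_pM => //; lra.
have p1 := regularization Hs th0 th1 gX hs mf msg kap1 eps01 kap8 he uu p0 mh2.
set kpm := kap / _ in p1; set um := iter m _ u in p1.
have kpm_le : kpm <= kap.
  have h1 : 1 <= eps + m%:R * h by apply: (le_trans mh); rewrite lerDr ltW.
  rewrite /kpm ler_pdivrMr; last exact: lt_le_trans h1.
  by apply: ler_peMr => //; exact: le_trans kap1.
have th5 : 0 <= th ^+ 5 by rewrite exprn_ge0// ltW.
have c10 : 0 <= m%:R * (`|e1| * th ^+ 5) by apply: mulr_ge0 => //; exact: mulr_ge0.
have p2 : profile 2 (2 * del) kap (m%:R * (`|e1| * th ^+ 5)) um.
  move=> a b; apply: le_trans (p1 a b) _.
  have r0 := enorm_ge0 (a - b).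
  rewrite mul0r addr0; apply: lerD; last first.
    by rewrite ler_wpM2l// ler_wpM2r// ler_norm.
  rewrite -[leLHS]addr0 lerD//; last by rewrite mulr_ge0// mulr_ge0// ltW.
  by rewrite ler_wpM2l// lerD2l lerN2 ler_expR lerN2 ler_wpM2r.
have uum : unit_meas um by exact: unit_iter.
have p3 := profile_contraction Hs th0 th1 gX hs mf msg (le_trans ler01 kap1) kap4 uum c10 p2 hc (n - m).
have := p3 x y; rewrite -iterD subnK// => le3; apply: le_trans le3 _.
apply: lerD; last first.
  (* At most n steps of error theta^5 each, and n theta^4 = t: the total is t theta times the
     constants. *)
  rewrite -/e2; apply: (@le_trans _ _ (t * (`|e1| + `|e2|) * th)).
    have -> : t * (`|e1| + `|e2|) * th = n%:R * (`|e1| * th ^+ 5) + n%:R * (`|e2| * th ^+ 5).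
      by rewrite -nth_ /h; ring.
    apply: lerD; first by rewrite ler_wpM2r ?ler_nat//; exact: mulr_ge0.
    apply: (@le_trans _ _ ((n - m)%:R * (`|e2| * th ^+ 5))).
      by rewrite ler_wpM2l// ler_wpM2r// ler_norm.
    by rewrite ler_wpM2r ?ler_nat ?leq_subr//; exact: mulr_ge0.
  by have := thA1 A4 A40 A4A; rewrite /A4 mulrA ler_pdivrMr// mul1r mulrC.
rewrite -/cc -/del -/h; set q := (1 - cc * h) ^+ _; set r := enorm _.
have r0 : 0 <= r := enorm_ge0 _.
have q0 : 0 <= q by rewrite exprn_ge0// subr_ge0.
(* The contraction runs during t - m h >= t - 2 only; the factor exp(2 cc) in the constant makes up
   for this. *)
have qle : q <= expR (2 * cc) * expR (- cc * t).
  apply: (@le_trans _ _ (expR (- (cc * h)) ^+ (n - m))).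
    by rewrite lerXn2r ?nnegrE ?subr_ge0 ?expR_ge0//; exact: expR_ge1Dx.
  rewrite -expRM_natr -expRD ler_expR natrB//.
  have : cc * (m%:R * h) <= cc * 2 by rewrite ler_wpM2l ?(ltW cc0)//; lra.
  have -> : - (cc * h) * (n%:R - m%:R) = - cc * (n%:R * h) + cc * (m%:R * h) by ring.
  by rewrite nth_; lra.
have E0 := expR_ge0 (- (kap * r)).
have -> : 2 * q * (1 - expR (- (kap * r))) + 2 * q * del * r = 2 * q * (1 - expR (- (kap * r)) + del * r) by ring.
have -> : 2 * expR (2 * cc) * (1 + del) * (1 + r) * expR (- cc * t)
  = 2 * (expR (2 * cc) * expR (- cc * t)) * ((1 + del) * (1 + r)) by ring.
have dr : 0 <= del * r by rewrite mulr_ge0// ltW.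
have E1 : expR (- (kap * r)) <= 1 by rewrite -expR0 ler_expR oppr_le0 mulr_ge0//; lra.
apply: ler_pM; rewrite ?mulr_ge0//; [by rewrite addr_ge0// subr_ge0|by rewrite ler_wpM2l|lra].
Qed.

(** * The Brownian filtration and the Ito isometry *)

Section Filtration.
Context {R : realType} {d : nat} {disp : measure_display}
        {Omega : measurableType disp} (P : probability Omega R).
Hypothesis P_complete : measure_is_complete P.
Variable W : R -> Omega -> 'cV[R]_d.
Hypothesis BM : brownian_motion P W.

Definition fbase (t : R) : set (set Omega) := past W t `|` P.-negligible.

(* [Omega] with the sigma-algebra [filtration P W t] *)
Definition FT (t : R) := g_sigma_algebraType (fbase t).

Lemma past_measurable t A : past W t A -> measurable A.
Proof.
apply: smallest_sub; first exact: sigma_algebra_measurable.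
by move=> _ [s [B [s0 _ mB ->]]]; exact: (bm_measurable BM).
Qed.

Lemma past_mono s t : s <= t -> past W s `<=` past W t.
Proof.
move=> st; apply: sub_sigma_algebra2 => _ [u [B [u0 us mB ->]]].
by exists u, B; split=> //; exact: le_trans us st.
Qed.

Lemma FT_mono s t (A : set Omega) : s <= t ->
  @measurable _ (FT s) A -> @measurable _ (FT t) A.
Proof.
move=> st; apply: sub_sigma_algebra2 => B [pB|nB]; [left; exact: past_mono pB|by right].
Qed.

Lemma FT_negligible t (A : set Omega) : P.-negligible A -> @measurable _ (FT t) A.
Proof. by move=> nA; apply: sub_sigma_algebra; right. Qed.

Lemma measurable_FT t (A : set Omega) : @measurable _ (FT t) A -> measurable A.
Proof.
apply: smallest_sub; first exact: sigma_algebra_measurable.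
by move=> B [pB|nB]; [exact: past_measurable pB|exact: P_complete].
Qed.

Lemma measurable_fun_FT d' (T' : measurableType d') t (f : Omega -> T') :
  measurable_fun setT (f : FT t -> T') -> measurable_fun setT f.
Proof.
by move=> mf _ A mA; rewrite setTI; apply: (@measurable_FT t); rewrite -[X in measurable X]setTI; exact: mf.
Qed.

Lemma measurable_fun_FTle d' (T' : measurableType d') s t (f : Omega -> T') : s <= t ->
  measurable_fun setT (f : FT s -> T') -> measurable_fun setT (f : FT t -> T').
Proof.
by move=> st mf _ A mA; rewrite setTI; apply: (FT_mono st); rewrite -[X in measurable X]setTI; exact: mf.
Qed.

Lemma measurable_wrtE t m n (X : Omega -> 'M[R]_(m, n)) :
  measurable_wrt (filtration P W t) X <-> measurable_fun setT (X : FT t -> bspace R m n).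
Proof.
split=> [mX _ A mA|mX A mA]; first by rewrite setTI; exact: mX.
by have := mX measurableT A mA; rewrite setTI.
Qed.

Lemma measurable_FT_W s t : 0 <= s -> s <= t ->
  measurable_fun setT (W s : FT t -> bspace R d 1).
Proof.
move=> s0 st _ A mA; rewrite setTI; apply: sub_sigma_algebra; left; apply: sub_sigma_algebra.
by exists s, A; split.
Qed.

Lemma measurable_W t : 0 <= t -> measurable_fun setT (W t : Omega -> bspace R d 1).
Proof. by move=> t0 _ A mA; rewrite setTI; exact: (bm_measurable BM t0). Qed.

Definition dW (s t : R) (w : Omega) : 'cV[R]_d := W t w - W s w.

Lemma measurable_FT_dW s t u : 0 <= s -> s <= u -> 0 <= t -> t <= u ->
  measurable_fun setT (dW s t : FT u -> bspace R d 1).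
Proof. by move=> s0 su t0 tu; apply: measurable_mxB; exact: measurable_FT_W. Qed.

Lemma measurable_dW s t : 0 <= s -> 0 <= t ->
  measurable_fun setT (dW s t : Omega -> bspace R d 1).
Proof. by move=> s0 t0; apply: measurable_mxB; exact: measurable_W. Qed.

Lemma dWD s t u w : dW s u w = dW s t w + dW t u w.
Proof. by rewrite /dW [RHS]addrC addrA subrK. Qed.

Lemma dWss s w : dW s s w = 0. Proof. exact: subrr. Qed.

(** The sets that differ from a set of the past by a negligible set form a sigma-algebra, and it
    contains both families of generators. *)
Lemma filtration_past t (A : set Omega) : @measurable _ (FT t) A ->
  exists2 E, past W t E & P.-negligible ((A `\` E) `|` (E `\` A)).
Proof.
have sp : sigma_algebra setT (past W t) by exact: smallest_sigma_algebra.
move: A; apply: smallest_sub; last first.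
  move=> B [pB|nB]; first by exists B => //; rewrite !setDv setU0; exact: negligible_set0.
  by exists set0; [case: sp|rewrite setD0 set0D setU0].
case: sp => s0 sC sU; split.
- by exists set0 => //; rewrite !setDv setU0; exact: negligible_set0.
- move=> B [E pE nE]; exists (~` E); first by rewrite -setTD; exact: sC.
  apply: negligibleS nE => w; rewrite setTD => -[[/= nB /contrapT Ew]|[/= nE /contrapT Bw]].
    by right.
  by left.
- move=> F HF.
  have /boolp.choice[E pE] : forall n, exists E, past W t E /\ P.-negligible ((F n `\` E) `|` (E `\` F n)).
    by move=> n; have [E pE nE] := HF n; exists E.
  exists (\bigcup_n E n); first by apply: sU => n; exact: (pE n).1.
  apply: (@negligibleS _ _ _ _ (\bigcup_n ((F n `\` E n) `|` (E n `\` F n)))); last first.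
    by apply: negligible_bigcup => n; exact: (pE n).2.
  move=> w [[[n _ Fn] nE]|[[n _ En] nF]]; exists n => //.
    by left; split=> // En; apply: nE; exists n.
  by right; split=> // Fn; apply: nF; exists n.
Qed.

(** Augmentation does not harm independence: [E] may be replaced by a set of the past without
    changing any of the probabilities involved. *)
Lemma FT_indep_box s t (E : set Omega) (A : 'I_d -> set R) : 0 <= s -> s < t ->
  @measurable _ (FT s) E -> (forall i, measurable (A i)) ->
  P (E `&` [set w | forall i, A i (dW s t w i ord0)]) =
    (P E * \prod_(i < d) normal_prob 0 (Num.sqrt (t - s)) (A i))%E.
Proof.
move=> s0 st mE mA.
have [E' pE' [N [mN N0 EN]]] := filtration_past mE; have {}N0 : P N = 0%E := N0.
have mE1 := measurable_FT mE; have mE'1 := past_measurable pE'.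
pose B := [set w | forall i, A i (dW s t w i ord0)].
have mB : measurable B.
  rewrite (_ : B = \bigcap_(i in [set: 'I_d]) [set w | A i (dW s t w i ord0)]); last first.
    by apply/seteqP; split => [w Bw i _|w Bw i]; exact: Bw.
  apply: fin_bigcap_measurable => [|i _]; first exact: finite_finset.
  rewrite -[X in measurable X]setTI.
  exact: (measurable_mxP i ord0 (measurable_dW s0 (le_trans s0 (ltW st)))).
have U2 C : measurable C -> (P (C `|` N) <= P C)%E.
  move=> mC; have := measureU2 P mC mN.
  by rewrite [X in (_ <= _ + X)%E](_ : _ = 0%E)// adde0.
have eqP_ C : measurable C -> P (E `&` C) = P (E' `&` C).
  move=> mC; apply/eqP; rewrite eq_le; apply/andP; split.
    apply: (@le_trans _ _ (P ((E' `&` C) `|` N))).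
      apply: le_measure; rewrite ?inE; [exact: measurableI|apply: measurableU => //; exact: measurableI|].
      move=> w [Ew Cw]; have [E'w|nE'w] := pselect (E' w); first by left.
      by right; apply: EN; left.
    by apply: U2; exact: measurableI.
  apply: (@le_trans _ _ (P ((E `&` C) `|` N))).
    apply: le_measure; rewrite ?inE; [exact: measurableI|apply: measurableU => //; exact: measurableI|].
    move=> w [Ew Cw]; have [E'w|nE'w] := pselect (E w); first by left.
    by right; apply: EN; right.
  by apply: U2; exact: measurableI.
rewrite -/B eqP_// -[in RHS](setIT E) eqP_// setIT.
exact: (bm_increments BM).
Qed.

Lemma gaussian_dW s t : 0 <= s -> s < t -> gaussian P (Num.sqrt (t - s)) (dW s t).
Proof.
move=> s0 st; split; first by apply: measurable_dW => //; exact: le_trans (ltW st).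
move=> A mA; have := FT_indep_box s0 st (@measurableT _ (FT s)) mA.
by rewrite setTI probability_setT mul1e.
Qed.

(** For fixed [E] the sets [B] that satisfy the product formula form a Dynkin class containing the
    boxes, which are stable under intersection. *)
Lemma FT_indep s t (E : set Omega) (B : set (bspace R d 1)) : 0 <= s -> s < t ->
  @measurable _ (FT s) E -> measurable B ->
  P (E `&` dW s t @^-1` B) = (P E * P (dW s t @^-1` B))%E.
Proof.
move=> s0 st mE mB; have mE1 := measurable_FT mE.
have mdW : measurable_fun setT (dW s t : Omega -> bspace R d 1).
  by apply: measurable_dW => //; exact: le_trans (ltW st).
have mpre C : @measurable _ (bspace R d 1) C -> measurable (dW s t @^-1` C).
  by move=> mC; rewrite -[X in measurable X]setTI; exact: mdW.
pose G : set (set (bspace R d 1)) := [set C : set (bspace R d 1) | measurable C /\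
  P (E `&` dW s t @^-1` C) = (P E * P (dW s t @^-1` C))%E].
suff : measurable `<=` G by move=> /(_ B mB) [].
rewrite bspace_boxes -setI_closed_g_dynkin_g_sigma_algebra; last first.
  move=> _ _ [A mA ->] [A' mA' ->]; exists (fun i => A i `&` A' i).
    by move=> i; exact: measurableI.
  by apply/seteqP; split => [x [H1 H2] i|x H]; [split|split => i; have [] := H i].
apply: smallest_sub.
  split.
  - split; first exact: measurableT.
    by rewrite preimage_setT setIT probability_setT mule1.
  - move=> C [mC HC]; split; first exact: measurableC.
    rewrite preimage_setC probability_setC; last exact: mpre.
    rewrite -setDE measureD//; [|exact: mpre|by rewrite -ge0_fin_numE// fin_num_measure].
    rewrite -[X in (_ - P X)%E]/(E `&` dW s t @^-1` C) HC muleBr ?mule1//; first exact: fin_num_measure.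
  - move=> F tF GF; have mF n : @measurable _ (bspace R d 1) (F n) by case: (GF n).
    split; first exact: bigcup_measurable.
    have tpre : trivIset setT (fun n => dW s t @^-1` F n).
      by move=> i j _ _ [w [Fi Fj]]; apply: tF => //; exists (dW s t w).
    rewrite preimage_bigcup setI_bigcupr measure_bigcup//; last first.
    - by move=> i j _ _ [w [[_ Fi] [_ Fj]]]; apply: tF => //; exists (dW s t w).
    - by move=> n _; apply: measurableI => //; exact: mpre.
    have PE := fin_num_measure P _ mE1.
    rewrite measure_bigcup//; last by move=> n _; exact: mpre.
    rewrite -(fineK PE) -nneseriesZl//; apply: eq_eseriesr => n _.
    by rewrite fineK//; case: (GF n).
move=> _ [A mA ->]; have mbox : measurable ([set v | forall i, A i (v i ord0)] : set (bspace R d 1)).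
  by rewrite bspace_boxes; apply: sub_sigma_algebra; exists A.
split=> //.
have HE := FT_indep_box s0 st mE mA.
have HT := FT_indep_box s0 st (@measurableT _ (FT s)) mA.
by move: HT; rewrite setTI probability_setT mul1e => HT; rewrite HE -HT.
Qed.


Lemma ex_indep_dW s t (a : Omega -> R) (phi : bspace R d 1 -> R) : 0 <= s -> s < t ->
  measurable_fun setT (a : FT s -> R) -> L1 P a -> measurable_fun setT phi ->
  L1 P (fun w => phi (dW s t w)) ->
  L1 P (fun w => a w * phi (dW s t w)) /\
  ex P (fun w => a w * phi (dW s t w)) = ex P a * ex P (fun w => phi (dW s t w)).
Proof.
move=> s0 st ma la mphi lphi.
have ind (A B : set R) : measurable A -> measurable B ->
    P (a @^-1` A `&` (fun w => phi (dW s t w)) @^-1` B)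
    = (P (a @^-1` A) * P ((fun w => phi (dW s t w)) @^-1` B))%E.
  move=> mA mB; apply: (@FT_indep s t (a @^-1` A) (phi @^-1` B)) => //.
    by have := ma measurableT A mA; rewrite setTI.
  by have := mphi measurableT B mB; rewrite setTI.
by split; [exact: L1_indepM|exact: ex_indepM].
Qed.

(** The martingale property: each coordinate of the increment is centred and independent of the
    coefficients, which are known at its starting time. *)
Lemma ex_mdot_dW s t (v : Omega -> 'cV[R]_d) : 0 <= s -> s <= t ->
  measurable_fun setT (v : FT s -> bspace R d 1) -> L1 P (fun w => enorm (v w)) ->
  L1 P (fun w => mdot (v w) (dW s t w)) /\ ex P (fun w => mdot (v w) (dW s t w)) = 0.
Proof.
move=> s0; rewrite le_eqVlt => /orP[/eqP <-|st] mv lv.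
  rewrite (_ : (fun w => _) = fun=> 0); last by apply/funext => w; rewrite dWss mdot0r.
  by split; [exact: L1_cst|exact: ex_cst].
have sq0 : 0 < Num.sqrt (t - s) by rewrite sqrtr_gt0 subr_gt0.
have g := gaussian_dW s0 st.
rewrite (_ : (fun w => _) = fun w => \sum_i v w i ord0 * dW s t w i ord0); last first.
  by apply/funext => w; rewrite /mdot; apply: eq_bigr => i _; rewrite big_ord1.
have H i : L1 P (fun w => v w i ord0 * dW s t w i ord0) /\
    ex P (fun w => v w i ord0 * dW s t w i ord0) = 0.
  have mvi : measurable_fun setT ((fun w => v w i ord0) : FT s -> R) by exact: measurable_mxP.
  have lvi : L1 P (fun w => v w i ord0).
    apply: L1_le lv; first exact: measurable_fun_FT mvi.
    by move=> w; exact: entry_le_enorm.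
  have [l e] := ex_indep_dW s0 st mvi lvi (measurable_entry i ord0) (L1_gaussian_entry sq0 g i).
  by split=> //; rewrite e (ex_gaussian_entry sq0 g) mulr0.
split; first by apply: L1_sum => i; exact: (H i).1.
by rewrite ex_sum => [|i]; [rewrite big1// => i _; exact: (H i).2|exact: (H i).1].
Qed.

Lemma measurable_trmx d' (T' : measurableType d') m n (A : T' -> 'M[R]_(m, n)) :
  measurable_fun setT (A : T' -> bspace R m n) ->
  measurable_fun setT ((fun w => (A w)^T) : T' -> bspace R n m).
Proof.
move=> mA; apply: measurable_mx => i j.
by under eq_fun do rewrite mxE; exact: measurable_mxP.
Qed.

(** The increment has covariance t - s times the identity and is independent of [A] and [B], so only
    the trace of the transpose of [A] times [B] remains. *)
Lemma ex_bilinear_dW s t (A B : Omega -> 'M[R]_d) (KA KB : R) : 0 <= s -> s <= t ->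
  measurable_fun setT (A : FT s -> bspace R d d) -> measurable_fun setT (B : FT s -> bspace R d d) ->
  (forall w, enorm (A w) <= KA) -> (forall w, enorm (B w) <= KB) ->
  L1 P (fun w => mdot (A w *m dW s t w) (B w *m dW s t w)) /\
  ex P (fun w => mdot (A w *m dW s t w) (B w *m dW s t w)) = (t - s) * ex P (fun w => mdot (A w) (B w)).
Proof.
move=> s0; rewrite le_eqVlt => /orP[/eqP <-|st] mA mB AK BK.
  rewrite (_ : (fun w => mdot (_ *m _) _) = fun=> 0); last by apply/funext => w; rewrite dWss !mulmx0 mdot0r.
  by rewrite subrr mul0r; split; [exact: L1_cst|exact: ex_cst].
have sq0 : 0 < Num.sqrt (t - s) by rewrite sqrtr_gt0 subr_gt0.
have g := gaussian_dW s0 st.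
pose C w := (A w)^T *m B w.
have mC : measurable_fun setT (C : FT s -> bspace R d d).
  by apply: measurable_mulmx => //; exact: measurable_trmx.
have CK w : enorm (C w) <= KA * KB.
  apply: le_trans (enorm_mulmx _ _) _; rewrite enorm_tr.
  by apply: ler_pM; rewrite ?enorm_ge0.
have lC i j : L1 P (fun w => C w i j).
  apply: (@L1_bounded _ _ _ _ _ (KA * KB)).
    exact: measurable_fun_FT (measurable_mxP i j mC).
  by move=> w; apply: le_trans (entry_le_enorm _ _ _) (CK w).
have H i j : L1 P (fun w => C w i j * (dW s t w i ord0 * dW s t w j ord0)) /\
    ex P (fun w => C w i j * (dW s t w i ord0 * dW s t w j ord0))
    = ex P (fun w => C w i j) * ((i == j)%:R * (t - s)).
  have [l e] := @ex_indep_dW s t _ (fun v => v i ord0 * v j ord0) s0 st (measurable_mxP i j mC) (lC i j)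
     (measurable_funM (measurable_entry i ord0) (measurable_entry j ord0))
     (L1_gaussian_entryM sq0 g i j).
  by split=> //; rewrite e (ex_gaussian_entryM sq0 g) sqr_sqrtr// subr_ge0 ltW.
have E : (fun w => mdot (A w *m dW s t w) (B w *m dW s t w)) =
    fun w => \sum_i \sum_j C w i j * (dW s t w i ord0 * dW s t w j ord0).
  apply/funext => w; rewrite mdot_mulmxl mulmxA -/(C w) /mdot; apply: eq_bigr => i _.
  rewrite big_ord1 [X in _ * X]mxE mulr_sumr; apply: eq_bigr => j _; ring.
rewrite E; split; first by apply: L1_sum => i; apply: L1_sum => j; exact: (H i j).1.
rewrite ex_sum => [|i]; last by apply: L1_sum => j; exact: (H i j).1.
have -> : (fun w => mdot (A w) (B w)) = fun w => \sum_i C w i i.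
  apply/funext => w; rewrite /mdot exchange_big; apply: eq_bigr => i _; rewrite mxE.
  by apply: eq_bigr => j _; rewrite mxE.
rewrite ex_sum => [|i]; last exact: lC.
rewrite mulr_sumr; apply: eq_bigr => i _.
rewrite ex_sum => [|j]; last exact: (H i j).1.
rewrite (eq_bigr (fun j => ex P (fun w => C w i j) * ((i == j)%:R * (t - s)))) => [|j _]; last exact: (H i j).2.
rewrite (bigD1 i)//= eqxx mul1r mulrC; apply/eqP; rewrite -subr_eq0 addrAC subrr add0r; apply/eqP.
by rewrite big1// => j /negbTE ji; rewrite eq_sym ji mul0r mulr0.
Qed.

Section PairIsometry.
Variables (A A' : Omega -> 'M[R]_d) (K K' : R).
Hypotheses (AK : forall w, enorm (A w) <= K) (AK' : forall w, enorm (A' w) <= K').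

Lemma L1_AdW2 s t : 0 <= s -> s <= t -> measurable_fun setT (A : FT s -> bspace R d d) ->
  L1 P (fun w => enorm (A w *m dW s t w) ^+ 2).
Proof.
move=> s0 st mA; have [l _] := ex_bilinear_dW s0 st mA mA AK AK.
by under eq_fun do rewrite enorm_sqr.
Qed.

Lemma L1_enorm_sqr n (X : Omega -> 'cV[R]_n) : measurable_fun setT (X : Omega -> bspace R n 1) ->
  L1 P (fun w => enorm (X w) ^+ 2) -> L1 P (fun w => enorm (X w)).
Proof.
move=> mX l2; apply: L1_le (L1D (L1_cst P 1) l2); first exact: measurable_enorm.
move=> w; rewrite ger0_norm ?enorm_ge0//; have := sqr_ge0 (enorm (X w) - 1).
by have := sqr_ge0 (enorm (X w)); lra.
Qed.

Lemma measurable_FT_AdW s t u : 0 <= s -> s <= t -> t <= u ->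
  measurable_fun setT (A : FT s -> bspace R d d) ->
  measurable_fun setT ((fun w => A w *m dW s t w) : FT u -> bspace R d 1).
Proof.
move=> s0 st tu mA; apply: measurable_mulmx.
  by apply: measurable_fun_FTle mA; exact: le_trans st tu.
by apply: measurable_FT_dW => //; [exact: le_trans st tu|exact: le_trans st].
Qed.

Lemma ex_pair_disjoint a b a' b' : 0 <= a -> a <= b -> b <= a' -> a' <= b' ->
  measurable_fun setT (A : FT a -> bspace R d d) ->
  measurable_fun setT (A' : FT a' -> bspace R d d) ->
  L1 P (fun w => mdot (A w *m dW a b w) (A' w *m dW a' b' w)) /\
  ex P (fun w => mdot (A w *m dW a b w) (A' w *m dW a' b' w)) = 0.
Proof.
move=> a0 ab ba' ab' mA mA'.
have a'0 : 0 <= a' by apply: le_trans ba'; exact: le_trans ab.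
have -> : (fun w => mdot (A w *m dW a b w) (A' w *m dW a' b' w))
    = fun w => mdot ((A' w)^T *m (A w *m dW a b w)) (dW a' b' w).
  by apply/funext => w; rewrite mdotC mdot_mulmxl mdotC.
have mX := measurable_FT_AdW a0 ab ba' mA.
have mv : measurable_fun setT ((fun w => (A' w)^T *m (A w *m dW a b w)) : FT a' -> bspace R d 1).
  by apply: measurable_mulmx => //; exact: measurable_trmx.
apply: ex_mdot_dW => //.
have lX := L1_enorm_sqr (measurable_fun_FT mX) (L1_AdW2 a0 ab mA).
apply: L1_le (L1Z K' lX); first by apply: measurable_enorm; exact: measurable_fun_FT mv.
move=> w; rewrite ger0_norm ?enorm_ge0//; apply: le_trans (enorm_mulmx _ _) _.
by rewrite enorm_tr ler_wpM2r ?enorm_ge0.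
Qed.

End PairIsometry.

Lemma ex_pair_same c b b' (A A' : Omega -> 'M[R]_d) (K K' : R) :
  0 <= c -> c <= b -> b <= b' ->
  (forall w, enorm (A w) <= K) -> (forall w, enorm (A' w) <= K') ->
  measurable_fun setT (A : FT c -> bspace R d d) ->
  measurable_fun setT (A' : FT c -> bspace R d d) ->
  L1 P (fun w => mdot (A w *m dW c b w) (A' w *m dW c b' w)) /\
  ex P (fun w => mdot (A w *m dW c b w) (A' w *m dW c b' w))
  = (b - c) * ex P (fun w => mdot (A w) (A' w)).
Proof.
move=> c0 cb bb' AK AK' mA mA'.
have -> : (fun w => mdot (A w *m dW c b w) (A' w *m dW c b' w)) = fun w =>
   mdot (A w *m dW c b w) (A' w *m dW c b w) + mdot (A w *m dW c b w) (A' w *m dW b b' w).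
  by apply/funext => w; rewrite -mdotDr -mulmxDr -dWD.
have [l1 e1] := ex_bilinear_dW c0 cb mA mA' AK AK'.
have [l2 e2] := ex_pair_disjoint AK AK' c0 cb (lexx b) bb' mA (measurable_fun_FTle cb mA').
by split; [exact: L1D|rewrite exD// e1 e2 addr0].
Qed.

(** The length of the intersection of two intervals. It is needed because the grid of a simple
    process and that of the Euler scheme have no relation to each other. *)
Definition overlap (a b a' b' : R) := Num.max 0 (Num.min b b' - Num.max a a').

Lemma overlapC a b a' b' : overlap a b a' b' = overlap a' b' a b.
Proof. by rewrite /overlap minC (maxC a). Qed.

(** By symmetry a <= a'. The piece of the first increment before a' is orthogonal to the second
    increment; what remains starts at a', where both coefficients are known, and the parts beyond
    the shorter of the two intervals are orthogonal again. *)
Lemma ex_pair a b a' b' (A A' : Omega -> 'M[R]_d) (K K' : R) :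
  0 <= a -> a <= b -> 0 <= a' -> a' <= b' ->
  (forall w, enorm (A w) <= K) -> (forall w, enorm (A' w) <= K') ->
  measurable_fun setT (A : FT a -> bspace R d d) ->
  measurable_fun setT (A' : FT a' -> bspace R d d) ->
  L1 P (fun w => mdot (A w *m dW a b w) (A' w *m dW a' b' w)) /\
  ex P (fun w => mdot (A w *m dW a b w) (A' w *m dW a' b' w))
  = overlap a b a' b' * ex P (fun w => mdot (A w) (A' w)).
Proof.
wlog aa' : a b a' b' A A' K K' / a <= a' => [IH a0 ab a'0 ab' AK AK' mA mA'|].
  have [aa'|/ltW aa'] := leP a a'; first exact: (IH _ _ _ _ _ _ K K').
  have := IH _ _ _ _ _ _ K' K aa' a'0 ab' a0 ab AK' AK mA' mA; rewrite overlapC.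
  rewrite (_ : (fun w => mdot (A' w *m _) _) = (fun w => mdot (A w *m dW a b w) (A' w *m dW a' b' w))).
    rewrite (_ : (fun w => mdot (A' w) (A w)) = (fun w => mdot (A w) (A' w)))//.
    by apply/funext => w; rewrite mdotC.
  by apply/funext => w; rewrite mdotC.
move=> a0 ab a'0 ab' AK AK' mA mA'.
have [ba'|a'b] := leP b a'.
  have -> : overlap a b a' b' = 0.
    rewrite /overlap (max_idPr aa') max_l// subr_le0.
    by apply: le_trans ba'; rewrite ge_min lexx.
  by rewrite mul0r; exact: (ex_pair_disjoint AK AK').
have -> : (fun w => mdot (A w *m dW a b w) (A' w *m dW a' b' w)) = fun w =>
   mdot (A w *m dW a a' w) (A' w *m dW a' b' w) + mdot (A w *m dW a' b w) (A' w *m dW a' b' w).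
  by apply/funext => w; rewrite -mdotDl -mulmxDr -dWD.
have [l1 e1] := ex_pair_disjoint AK AK' a0 aa' (lexx a') ab' mA mA'.
have mAa := measurable_fun_FTle aa' mA.
have -> : overlap a b a' b' = Num.min b b' - a'.
  rewrite /overlap (max_idPr aa') max_r// subr_ge0 le_min ab' andbT; exact: ltW.
have [l2 e2] : L1 P (fun w => mdot (A w *m dW a' b w) (A' w *m dW a' b' w)) /\
  ex P (fun w => mdot (A w *m dW a' b w) (A' w *m dW a' b' w))
  = (Num.min b b' - a') * ex P (fun w => mdot (A w) (A' w)).
  have [bb'|/ltW bb'] := leP b b'; first exact: (ex_pair_same a'0 (ltW a'b) bb' AK AK' mAa mA').
  have := ex_pair_same a'0 ab' bb' AK' AK mA' mAa.
  rewrite (_ : (fun w => mdot (A' w *m _) _) = (fun w => mdot (A w *m dW a' b w) (A' w *m dW a' b' w))).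
    rewrite (_ : (fun w => mdot (A' w) (A w)) = (fun w => mdot (A w) (A' w)))//.
    by apply/funext => w; rewrite mdotC.
  by apply/funext => w; rewrite mdotC.
by split; [exact: L1D|rewrite exD// e1 e2 add0r].
Qed.

(* The Ito isometry for a sum of increments over possibly overlapping intervals. *)
Lemma ex_family (I : finType) (a b : I -> R) (A : I -> Omega -> 'M[R]_d) (K : I -> R) :
  (forall i, 0 <= a i) -> (forall i, a i <= b i) -> (forall i w, enorm (A i w) <= K i) ->
  (forall i, measurable_fun setT (A i : FT (a i) -> bspace R d d)) ->
  L1 P (fun w => enorm (\sum_i A i w *m dW (a i) (b i) w) ^+ 2) /\
  ex P (fun w => enorm (\sum_i A i w *m dW (a i) (b i) w) ^+ 2)
  = ex P (fun w => \sum_i \sum_j overlap (a i) (b i) (a j) (b j) * mdot (A i w) (A j w)).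
Proof.
move=> a0 ab AK mA.
have H i j := ex_pair (a0 i) (ab i) (a0 j) (ab j) (AK i) (AK j) (mA i) (mA j).
have -> : (fun w => enorm (\sum_i A i w *m dW (a i) (b i) w) ^+ 2) = fun w =>
    \sum_i \sum_j mdot (A i w *m dW (a i) (b i) w) (A j w *m dW (a j) (b j) w).
  apply/funext => w; rewrite enorm_sqr mdot_suml; apply: eq_bigr => i _.
  by rewrite mdot_sumr.
split; first by apply: L1_sum => i; apply: L1_sum => j; exact: (H i j).1.
have lm i j : L1 P (fun w => mdot (A i w) (A j w)).
  apply: (@L1_bounded _ _ _ _ _ (K i * K j)).
    by apply: measurable_mdot; exact: measurable_fun_FT (mA _).
  move=> w; apply: le_trans (normr_mdot _ _) _.
  by apply: ler_pM; rewrite ?enorm_ge0.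
rewrite !ex_sum => [|i|i]; [|by apply: L1_sum => j; apply: L1Z|by apply: L1_sum => j; exact: (H i j).1].
apply: eq_bigr => i _.
rewrite !ex_sum => [|j|j]; [|by apply: L1Z|exact: (H i j).1].
by apply: eq_bigr => j _; rewrite (H i j).2 exZ.
Qed.

End Filtration.

(** * Time integrals of step functions *)

Section TimeIntegral.
Context {R : realType}.
Notation mu := (@lebesgue_measure R).

Definition tint (tau : R) (g : R -> R) : \bar R := (\int[lebesgue_measure]_(s in `[0%R, tau]) (g s)%:E)%E.

Lemma measurable_itv0 (tau : R) : measurable (`[0%R, tau]%classic : set (measurableTypeR R)).
Proof. exact: measurable_itv. Qed.

Lemma tint_ge0 tau g : (forall s, 0 <= g s) -> (0 <= tint tau g)%E.
Proof. by move=> g0; apply: integral_ge0 => s _; rewrite lee_fin. Qed.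

Lemma tint_le tau (g1 g2 : R -> R) : measurable_fun setT g1 -> measurable_fun setT g2 ->
  (forall s, 0 <= g1 s) -> (forall s, 0 <= s <= tau -> g1 s <= g2 s) -> (tint tau g1 <= tint tau g2)%E.
Proof.
move=> m1 m2 g0 g12; apply: ge0_le_integral => //=.
- by move=> s _; rewrite lee_fin.
- by apply/measurable_EFinP; exact: measurable_funS m1.
- by apply/measurable_EFinP; exact: measurable_funS m2.
Qed.

Lemma tintD tau (g1 g2 : R -> R) : measurable_fun setT g1 -> measurable_fun setT g2 ->
  (forall s, 0 <= g1 s) -> (forall s, 0 <= g2 s) ->
  tint tau (fun s => g1 s + g2 s) = (tint tau g1 + tint tau g2)%E.
Proof.
move=> m1 m2 g10 g20; rewrite /tint -ge0_integralD//=.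
- by move=> s _; rewrite lee_fin.
- by apply/measurable_EFinP; exact: measurable_funS m1.
- by move=> s _; rewrite lee_fin.
- by apply/measurable_EFinP; exact: measurable_funS m2.
Qed.

Lemma tintZ tau (k : R) (g : R -> R) : 0 <= k -> measurable_fun setT g -> (forall s, 0 <= g s) ->
  tint tau (fun s => k * g s) = (k%:E * tint tau g)%E.
Proof.
move=> k0 mg g0; rewrite /tint -ge0_integralZl_EFin//=.
- by move=> s _; rewrite lee_fin.
- by apply/measurable_EFinP; exact: measurable_funS mg.
Qed.

Lemma lebesgue_itv0 (tau : R) : 0 <= tau -> mu `[0%R, tau]%classic = tau%:E.
Proof.
move=> t0; rewrite lebesgue_measure_itv/= lte_fin; case: ltP => [_|t1]; first by rewrite sube0.
by congr EFin; apply/eqP; rewrite eq_le t0 t1.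
Qed.

Lemma tint_cst tau (k : R) : 0 <= tau -> tint tau (fun=> k) = (k * tau)%:E.
Proof.
move=> t0; rewrite /tint (integral_cst mu (measurable_itv0 tau) k%:E) EFinM.
by congr (_ * _)%E; exact: lebesgue_itv0.
Qed.

Lemma tint_le_cst tau (k : R) (g : R -> R) : 0 <= tau -> measurable_fun setT g -> (forall s, 0 <= g s) ->
  (forall s, 0 <= s <= tau -> g s <= k) -> (tint tau g <= (k * tau)%:E)%E.
Proof.
by move=> t0 mg g0 gk; rewrite -tint_cst//; apply: tint_le => //; exact: measurable_cst.
Qed.

Lemma tint_indic tau a b : 0 <= a -> b <= tau ->
  (\int[mu]_(s in `[0%R, tau]) (\1_(`]a, b]%classic) s)%:E = (Num.max 0 (b - a))%:E)%E.
Proof.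
move=> a0 bt; rewrite (integral_indic mu (measurable_itv0 tau) (measurable_itv `]a, b])).
rewrite (_ : _ `&` _ = `]a, b]%classic); last first.
  apply/seteqP; split => [s []//|s sab]; split => //.
  by move: sab; rewrite /= !in_itv/= => /andP[as_ sb]; apply/andP; split; [apply: le_trans a0 _; exact: ltW|exact: le_trans bt].
apply: (etrans (lebesgue_measure_itv `]a, b])); rewrite /= lte_fin; case: ltP => [ab|ba].
  by rewrite -EFinB max_r// subr_ge0 ltW.
by rewrite max_l// subr_le0.
Qed.

Definition step_fun m n (I : finType) (a b : I -> R) (M : I -> 'M[R]_(m, n)) (s : R) : 'M[R]_(m, n) :=
  \sum_i if a i < s <= b i then M i else 0.

(** This is the double sum of [ex_family]: together the two lemmas are the Ito isometry, the mean
    square of a sum of increments being the mean of the time integral of the squared step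
    function. *)
Lemma tint_step_fun m n (I : finType) (a b : I -> R) (M : I -> 'M[R]_(m, n)) tau :
  (forall i, 0 <= a i) -> (forall i, b i <= tau) ->
  tint tau (fun s => enorm (step_fun a b M s) ^+ 2)
  = (\sum_i \sum_j overlap (a i) (b i) (a j) (b j) * mdot (M i) (M j))%:E.
Proof.
move=> a0 bt; rewrite /tint.
pose J i j : set (measurableTypeR R) := `]Num.max (a i) (a j), Num.min (b i) (b j)]%classic.
have mJ i j : measurable (J i j) by exact: measurable_itv.
have iJ i j : mu.-integrable `[0%R, tau]%classic (fun s => (mdot (M i) (M j))%:E * (\1_(J i j) s)%:E)%E.
  apply: (integrableS measurableT) => //; apply: integrableZl => //.
  exact: integrable_indic_itv.
have E (s : R) : (enorm (step_fun a b M s) ^+ 2)%:E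
    = (\sum_i \sum_j (mdot (M i) (M j))%:E * (\1_(J i j) s)%:E)%E.
  rewrite enorm_sqr /step_fun mdot_suml -sumEFin; apply: eq_bigr => i _.
  rewrite mdot_sumr -sumEFin; apply: eq_bigr => j _; rewrite -EFinM indicE mem_setE.
  rewrite /J in_itv/= gt_max le_min andbACA.
  case: ifP => _; rewrite ?mdot0l ?mulr0//.
  by case: ifP => _; rewrite ?mdot0r ?mulr0 ?mulr1.
rewrite (eq_integral (fun s => (\sum_i \sum_j (mdot (M i) (M j))%:E * (\1_(J i j) s)%:E)%E)); last first.
  by move=> s _; rewrite E.
rewrite integral_sum//; last by move=> i; apply: integrable_sum => // j _; exact: iJ.
rewrite -sumEFin; apply: eq_bigr => i _.
rewrite integral_sum// -sumEFin; apply: eq_bigr => j _.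
rewrite integralZl//; last first.
  by apply: (integrableS measurableT) => //; exact: integrable_indic_itv.
rewrite tint_indic; first by rewrite -EFinM mulrC.
  by rewrite le_max a0.
by rewrite ge_min bt.
Qed.

Lemma measurable_step_fun d' (T : measurableType d') m n (I : finType) (a b : I -> R)
    (M : I -> T -> 'M[R]_(m, n)) :
  (forall i, measurable_fun setT (M i : T -> bspace R m n)) ->
  measurable_fun setT ((fun p => step_fun a b (fun i => M i p.2) p.1)
    : measurableTypeR R * T -> bspace R m n).
Proof.
move=> mM; apply: (@measurable_mxsum _ _ _ _ _ I _ (fun i (p : measurableTypeR R * T) =>
   if a i < p.1 <= b i then M i p.2 else 0)) => i.
apply: measurable_mx_if.
- apply: measurable_and.
    by apply: measurable_fun_ltr => //; exact: measurable_fst.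
  by apply: measurable_fun_ler => //; exact: measurable_fst.
- by apply: measurableT_comp => //; exact: measurable_snd.
- exact: measurable_cst.
Qed.

(* At most one of the intervals of a grid contains a given time. *)
Lemma step_fun_pick m n m' n' N (g : nat -> R) (M : 'I_N -> 'M[R]_(m, n))
    (phi : 'M[R]_(m, n) -> 'M[R]_(m', n')) s : (forall k, g k <= g k.+1) -> phi 0 = 0 ->
  step_fun (fun k : 'I_N => g k) (fun k : 'I_N => g k.+1) (fun k => phi (M k)) s
  = phi (step_fun (fun k : 'I_N => g k) (fun k : 'I_N => g k.+1) M s).
Proof.
move=> gi phi0; rewrite /step_fun.
have gm i j : (i <= j)%N -> g i <= g j 
  by apply: (@homo_leq _ g (fun x y => x <= y)) => // x y z; exact: le_trans.
have [[k /andP[k1 k2]]|Hk] := pselect (exists k : 'I_N, g k < s <= g k.+1); last first.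
  rewrite !big1 ?phi0// => i _; case: ifP => // H; by case: Hk; exists i.
have U (i : 'I_N) : i != k -> g i < s <= g i.+1 = false.
  move=> ik; apply/negP => /andP[i1 i2].
  have [ik'|ki] := ltnP i k.
    by have := lt_le_trans k1 (le_trans i2 (gm _ _ ik')); rewrite ltxx.
  have ki' : (k < i)%N by rewrite ltn_neqAle ki andbT eq_sym; apply: contraNneq ik => /val_inj ->.
  by have := lt_le_trans i1 (le_trans k2 (gm _ _ ki')); rewrite ltxx.
rewrite (bigD1 k)//= [in RHS](bigD1 k)//= k1 k2/= !big1 ?addr0// => i ik; by rewrite U.
Qed.

End TimeIntegral.

(** The terms are nonnegative, so those kept form an initial segment whose full sum does not exceed
    [delta]. This is the pathwise part of the stopping argument in [lenglart]. *)
Lemma capped_sum_le {R : realType} (q : nat -> R) (delta : R) n : 0 <= delta -> (forall k, 0 <= q k) ->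
  \sum_(l < n) (if \sum_(j < l.+1) q j <= delta then q l else 0) <= delta.
Proof.
move=> d0 q0; elim: n => [|n IH]; first by rewrite big_ord0.
rewrite big_ord_recr/=; case: ifP => [H|_]; last by rewrite addr0.
apply: le_trans H; rewrite [leRHS]big_ord_recr/= lerD2r; apply: ler_sum => i _.
by case: ifP.
Qed.

(** * Integrals of simple processes and Lenglart's inequality *)

Section SimpleIntegral.
Context {R : realType} {d : nat} {disp : measure_display}
        {Omega : measurableType disp} (P : probability Omega R).
Hypothesis P_complete : measure_is_complete P.
Variable W : R -> Omega -> 'cV[R]_d.
Hypothesis BM : brownian_motion P W.
Local Notation FT := (FT P W).
Local Notation dW := (dW W).

Lemma measurable_tint tau (g : measurableTypeR R * Omega -> R) : measurable_fun setT g ->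
  (forall p, 0 <= g p) -> measurable_fun setT (fun w => tint tau (fun s => g (s, w))).
Proof.
move=> mg g0.
pose I0 : set (measurableTypeR R) := `[0%R, tau]%classic.
pose G (p : measurableTypeR R * Omega) := (\1_I0 p.1 * g p)%:E.
have mG : measurable_fun setT G.
  apply/measurable_EFinP; apply: measurable_funM => //.
  have m1 : measurable_fun setT (\1_I0 : measurableTypeR R -> R).
    by apply: measurable_indic; exact: measurable_itv.
  exact: (measurableT_comp m1 measurable_fst).
have -> : (fun w => tint tau (fun s => g (s, w))) = fubini_G (@lebesgue_measure R) G.
  apply/funext => w; rewrite /fubini_G /tint [LHS]integral_mkcond; apply: eq_integral => s _.
  rewrite /G/= patchE indicE; case: ifPn => _; by rewrite ?mul1r ?mul0r.
apply: measurable_fun_fubini_tonelli_G => // p.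
by rewrite lee_fin mulr_ge0// indicE ler0n.
Qed.

Section Grid.
Variables (S : simple_process (d := d) (filtration P W)) (tau : R).
Hypothesis tau0 : 0 <= tau.
Local Notation g := (sp_grid S).
Local Notation N := (sp_size S).

Definition spa k := Num.min (g k) tau.
Definition spb k := Num.min (g k.+1) tau.
(** A coefficient that starts after [tau] is replaced by 0, since it need not be known at the
    clipped time [spa k]; its clipped increment vanishes anyway. The map [phi] allows the same
    integral to be formed with the coefficients kept, projected, or reduced to the part that the
    projection removes. *)
Definition spc (phi : 'M[R]_d -> 'M[R]_d) k w := if g k <= tau then phi (sp_coef S k w) else 0.
Definition spI (phi : 'M[R]_d -> 'M[R]_d) w : 'cV[R]_d :=
  \sum_(k < N) spc phi k w *m dW (spa k) (spb k) w.

Lemma spa_ge0 k : 0 <= spa k. Proof. by rewrite le_min sp_grid_ge0. Qed.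
Lemma spab k : spa k <= spb k.
Proof. by rewrite /spa /spb le_min !ge_min lexx orbT sp_grid_incr. Qed.
Lemma spb_le k : spb k <= tau. Proof. by rewrite ge_min lexx orbT. Qed.

Lemma sp_grid_mono i j : (i <= j)%N -> g i <= g j.
Proof.
apply: (@homo_leq _ g (fun x y => x <= y)) => // [x y z|]; first exact: le_trans.
exact: sp_grid_incr.
Qed.

Lemma spa_mono i j : (i <= j)%N -> spa i <= spa j.
Proof. by move=> ij; rewrite /spa le_min !ge_min lexx orbT sp_grid_mono. Qed.

Lemma overlap_grid i j : i != j -> overlap (spa i) (spb i) (spa j) (spb j) = 0.
Proof.
wlog ij : i j / (i < j)%N => [IH ne|_].
  by have := ne; rewrite neq_ltn => /orP[/IH->//|/IH H]; rewrite overlapC H// eq_sym.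
rewrite /overlap max_l// subr_le0.
have : spb i <= spa j by rewrite /spb -/(spa i.+1); exact: spa_mono.
by move=> H; rewrite ge_min le_max H orbT.
Qed.

Lemma overlap_self i : overlap (spa i) (spb i) (spa i) (spb i) = spb i - spa i.
Proof. by rewrite /overlap minxx maxxx max_r// subr_ge0 spab. Qed.

Lemma sp_integralE w : sp_integral S W tau w = spI id w.
Proof.
rewrite /sp_integral; apply: eq_bigr => k _.
rewrite -/(spa k) -/(spb k) -/(dW (spa k) (spb k) w) /spc; case: ifPn => //; rewrite -ltNge => tg.
have -> : spb k = spa k.
  rewrite /spa /spb !min_r// ?(ltW tg)//; apply: le_trans (ltW tg) _; exact: sp_grid_incr.
by rewrite dWss !mulmx0.
Qed.

Lemma step_fun_sp phi s w : phi 0 = 0 -> s <= tau ->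
  step_fun (fun k : 'I_N => spa k) (fun k : 'I_N => spb k) (fun k => spc phi k w) s
  = phi (sp_value S s w).
Proof.
move=> phi0 st.
have -> : sp_value S s w = step_fun (fun k : 'I_N => g k) (fun k : 'I_N => g k.+1) (fun k => sp_coef S k w) s by [].
rewrite -(step_fun_pick _ _ (sp_grid_incr S) phi0).
apply: eq_bigr => k _; rewrite /spa /spb /spc gt_min le_min st andbT.
rewrite (ltNge tau s) st orbF; case: ifP => // /andP[gs _].
by rewrite (le_trans (ltW gs) st).
Qed.

Lemma measurable_spc phi k : measurable_fun setT (phi : bspace R d d -> bspace R d d) ->
  measurable_fun setT (spc phi k : FT (spa k) -> bspace R d d).
Proof.
move=> mphi; rewrite /spc; case: leP => gt; last exact: measurable_cst.
apply: (measurableT_comp mphi); apply/measurable_wrtE.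
by rewrite /spa min_l//; exact: sp_coef_measurable.
Qed.

Lemma spc_bounded phi k : (forall M, enorm (phi M) <= enorm M) -> exists K, forall w, enorm (spc phi k w) <= K.
Proof.
move=> phiM; have [K HK] := sp_coef_bounded S k; exists K => w.
rewrite /spc; case: ifP => _; first exact: le_trans (phiM _) (HK w).
by rewrite enorm0; exact: le_trans (enorm_ge0 _) (HK w).
Qed.

Lemma measurable_spI phi : measurable_fun setT (phi : bspace R d d -> bspace R d d) ->
  measurable_fun setT (spI phi : Omega -> bspace R d 1).
Proof.
move=> mphi; apply: (@measurable_mxsum _ _ _ _ _ _ _ (fun k : 'I_N => fun w => spc phi k w *m dW (spa k) (spb k) w)) => k.
apply: measurable_mulmx; first by apply: (measurable_fun_FT P_complete BM (t := spa k)); exact: measurable_spc.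
apply: (measurable_dW BM); first exact: spa_ge0.
by apply: le_trans (spab k); exact: spa_ge0.
Qed.

Lemma sum_overlap_grid (M : 'I_N -> 'M[R]_d) :
  \sum_(i < N) \sum_(j < N) overlap (spa i) (spb i) (spa j) (spb j) * mdot (M i) (M j)
  = \sum_(i < N) (spb i - spa i) * enorm (M i) ^+ 2.
Proof.
apply: eq_bigr => i _; rewrite (bigD1 i)//= overlap_self enorm_sqr big1 ?addr0// => j ji.
by rewrite overlap_grid ?mul0r// eq_sym.
Qed.

(* Lenglart's inequality: stop the integrand when its accumulated square exceeds [delta]. *)
Lemma lenglart (phi : 'M[R]_d -> 'M[R]_d) (J : Omega -> \bar R) (delta c : R) :
  phi 0 = 0 -> (forall M, enorm (phi M) <= enorm M) ->
  measurable_fun setT (phi : bspace R d d -> bspace R d d) -> measurable_fun setT J ->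
  (forall w, (tint tau (fun s => (enorm (phi (sp_value S s w)) ^+ 2)%R) <= J w)%E) ->
  0 < delta -> 0 < c ->
  pr P [set w | c <= enorm (spI phi w)] <= pr P [set w | delta%:E <= J w]%E + delta / c ^+ 2.
Proof.
move=> phi0 phiM mphi mJ HJ d0 c0.
pose D k w := spc phi k w.
pose q w k := (spb k - spa k) * enorm (D k w) ^+ 2.
have q0 w k : 0 <= q w k by rewrite mulr_ge0 ?subr_ge0 ?spab// exprn_ge0 ?enorm_ge0.
(* The test includes the k-th term itself: the length and the coefficient of that term are known at
   [spa k], so the stopped coefficient is still admissible for the isometry while the accumulated
   square never exceeds [delta]. *)
pose D' k w := if \sum_(j < k.+1) q w j <= delta then D k w else 0.
have /boolp.choice[KD HKD] k := spc_bounded k phiM.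
have mq k i : (i <= k)%N -> measurable_fun setT ((fun w => q w i) : FT (spa k) -> R).
  move=> ik; apply: measurable_funM => //; apply: measurable_funX; apply: measurable_enorm.
  by apply: (measurable_fun_FTle (s := spa i) (spa_mono ik)); exact: measurable_spc.
have mD' k : measurable_fun setT (D' k : FT (spa k) -> bspace R d d).
  apply: measurable_mx_if; [|exact: measurable_spc|exact: measurable_cst].
  apply: measurable_fun_ler => //; apply: measurable_sum => i; apply: mq.
  by rewrite -ltnS.
have D'K k w : enorm (D' k w) <= KD k.
  rewrite /D'; case: ifP => _; first exact: HKD.
  by rewrite enorm0; apply: le_trans (HKD k w); exact: enorm_ge0.
have [l2 e2] := ex_family P_complete BM (fun i : 'I_N => spa_ge0 i) (fun i => spab i)
  (fun (i : 'I_N) w => D'K i w) (fun i => mD' i).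
have le2 : ex P (fun w => enorm (\sum_(i < N) D' i w *m dW (spa i) (spb i) w) ^+ 2) <= delta.
  rewrite e2 -[leRHS](ex_cst P); apply: ex_le; last 1 first.
  - move=> w; rewrite sum_overlap_grid.
    apply: le_trans (capped_sum_le N (ltW d0) (q0 w)); apply: ler_sum => i _.
    by rewrite /D' /q; case: ifP => // _; rewrite enorm0 expr0n mulr0.
  - apply: L1_sum => i; apply: L1_sum => j; apply: L1Z.
    apply: (@L1_bounded _ _ _ _ _ (KD i * KD j)).
      by apply: measurable_mdot; exact: (measurable_fun_FT P_complete BM (mD' _)).
    by move=> w; apply: le_trans (normr_mdot _ _) _; apply: ler_pM; rewrite ?enorm_ge0.
  - exact: L1_cst.
have mI := measurable_spI mphi.
have mE1 : measurable [set w | c <= enorm (spI phi w)].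
  by apply: measurable_le_set; exact: measurable_enorm.
have mE2 : measurable [set w | delta%:E <= J w]%E.
  by rewrite -[X in measurable X]setTI; exact: emeasurable_fun_c_infty.
pose I' w := \sum_(i < N) D' i w *m dW (spa i) (spb i) w.
have mE3 : measurable [set w | c ^+ 2 <= enorm (I' w) ^+ 2].
  by apply: measurable_le_set; exact: L1_meas l2.
apply: (@le_trans _ _ (pr P ([set w | delta%:E <= J w]%E `|` [set w | c ^+ 2 <= enorm (I' w) ^+ 2]))).
  apply: pr_le => //; first exact: measurableU.
  (* If J < delta the sum of all the squares stays below [delta], the stopping never acts, and the
     stopped integral is the original one. *)
  move=> w /= cw; have [Jd|Jd] := leP delta%:E (J w); first by left.
  right; rewrite lerXn2r ?nnegrE ?(ltW c0) ?enorm_ge0//=.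
  suff -> : I' w = spI phi w by [].
  apply: eq_bigr => k _; rewrite /D' ifT//.
  have tl : \sum_(i < N) q w i <= delta.
    have := @tint_step_fun R d d 'I_N (fun i => spa i) (fun i => spb i) (fun i => D i w) tau
      (fun i => spa_ge0 i) (fun i => spb_le i).
    rewrite sum_overlap_grid => tE; rewrite -lee_fin -[X in (X <= _)%E]tE.
    apply: ltW; apply: le_lt_trans Jd; apply: le_trans (HJ w).
    rewrite le_eqVlt; apply/orP; left; apply/eqP; apply: eq_integral => s.
    by rewrite inE/= in_itv/= => /andP[_ st]; rewrite step_fun_sp.
  apply: le_trans tl.
  rewrite -(big_mkord xpredT (q w)) -[leRHS](big_mkord xpredT (q w)).
  by rewrite [leRHS](@big_cat_nat _ _ _ k.+1)//= lerDl sumr_ge0.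
apply: le_trans (prU_le _ _ _) _ => //; rewrite lerD2l.
have l2' := l2; have := @markov_pr _ _ _ P (fun w => enorm (I' w) ^+ 2) (c ^+ 2).
move=> /(_ (exprn_gt0 2 c0) l2 (fun w => exprn_ge0 2 (enorm_ge0 _))) H.
by apply: le_trans H _; rewrite ler_wpM2r// invr_ge0 exprn_ge0// ltW.
Qed.

End Grid.
End SimpleIntegral.

Lemma measurable_rproj {R : realType} m n (K : R) : 0 <= K ->
  measurable_fun setT (rproj K : bspace R m n -> bspace R m n).
Proof.
move=> K0; apply: (measurable_lipschitz_mx (L := 1)) => // x y; rewrite mul1r; exact: rproj_lip.
Qed.

(** * Comparison of an Ito integral with its Riemann sums *)

Section ItoStep.
Context {R : realType} {d : nat} {disp : measure_display}
        {Omega : measurableType disp} (P : probability Omega R).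
Hypothesis P_complete : measure_is_complete P.
Variable W : R -> Omega -> 'cV[R]_d.
Hypothesis BM : brownian_motion P W.
Local Notation FT := (FT P W).
Local Notation dW := (dW W).
Variables (H : R -> Omega -> 'M[R]_d) (K : R).
Hypothesis K0 : 0 <= K.
Hypothesis HK : forall s w, enorm (H s w) <= K.
Hypothesis mH : measurable_fun setT ((fun p => H p.1 p.2) : measurableTypeR R * Omega -> bspace R d d).
Hypothesis aH : forall s, 0 <= s -> measurable_fun setT (H s : FT s -> bspace R d d).
Variables (h : R) (k : nat).
Hypothesis h0 : 0 <= h.
Let tau := k%:R * h.

Definition riemann_ito w : 'cV[R]_d := \sum_(j < k) H (j%:R * h) w *m dW (j%:R * h) (j.+1%:R * h) w.
Definition riemann_step s w : 'M[R]_d :=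
  step_fun (fun j : 'I_k => j%:R * h) (fun j : 'I_k => j.+1%:R * h) (fun j => H (j%:R * h) w) s.
Definition riemann_gap w : R := fine (tint tau (fun s => (enorm (H s w - riemann_step s w) ^+ 2)%R)).

Let tau0 : 0 <= tau. Proof. by rewrite mulr_ge0. Qed.
Let jh0 (j : nat) : 0 <= j%:R * h. Proof. by rewrite mulr_ge0. Qed.
Let jh1 (j : nat) : j%:R * h <= j.+1%:R * h. Proof. by rewrite ler_wpM2r// ler_nat. Qed.
Let jht (j : 'I_k) : j.+1%:R * h <= tau. Proof. by rewrite ler_wpM2r// ler_nat. Qed.
Let rp0 : rproj K 0 = 0 :> 'M[R]_d. Proof. by rewrite rproj_id// enorm0. Qed.
Let mrp : measurable_fun setT (rproj K : bspace R d d -> bspace R d d).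
Proof. exact: measurable_rproj. Qed.

(** At each time a step function takes one of its values or 0, so the projection onto the ball of
    radius [K] may be applied to the values; these lie in the ball and are fixed by it. *)
Lemma riemann_step_le s w : enorm (riemann_step s w) <= K.
Proof.
have E := @step_fun_pick R d d d d k (fun j => j%:R * h) (fun j => H (j%:R * h) w) (rproj K) s jh1 rp0.
rewrite /riemann_step (_ : step_fun _ _ _ _ = rproj K (riemann_step s w)); first exact: enorm_rproj.
by rewrite -E; apply: eq_bigr => j _; rewrite rproj_id.
Qed.

Let mHn : measurable_fun setT ((fun p => riemann_step p.1 p.2) : measurableTypeR R * Omega -> bspace R d d).
Proof.
apply: (@measurable_step_fun R _ Omega d d 'I_k (fun j : 'I_k => j%:R * h) (fun j : 'I_k => j.+1%:R * h)
  (fun j w => H (j%:R * h) w)) => j.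
by apply: (measurable_fun_FT P_complete BM (t := j%:R * h)); exact: aH.
Qed.

Let sec (g : measurableTypeR R * Omega -> R) w : measurable_fun setT g ->
  measurable_fun setT ((fun s => g (s, w)) : R -> R).
Proof. by move=> mg; apply: (measurableT_comp mg); exact: pair2_measurable. Qed.

Let gapf (p : measurableTypeR R * Omega) : R := enorm (H p.1 p.2 - riemann_step p.1 p.2) ^+ 2.
Let mgapf : measurable_fun setT gapf.
Proof. by apply: measurable_funX; apply: measurable_enorm; exact: measurable_mxB. Qed.

Lemma sqr_dist_le (A B : 'M[R]_d) : enorm A <= K -> enorm B <= K -> enorm (A - B) ^+ 2 <= 4 * K ^+ 2.
Proof.
move=> AK BK; have -> : 4 * K ^+ 2 = (2 * K) ^+ 2 by ring.
rewrite lerXn2r ?nnegrE ?enorm_ge0 ?mulr_ge0//.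
by apply: le_trans (ler_enormB _ _) _; lra.
Qed.

Lemma tint_gap w : tint tau (fun s => (enorm (H s w - riemann_step s w) ^+ 2)%R) = (riemann_gap w)%:E.
Proof.
rewrite /riemann_gap fineK// ge0_fin_numE; last by apply: tint_ge0 => s; rewrite exprn_ge0 ?enorm_ge0.
apply: le_lt_trans (@tint_le_cst _ tau (4 * K ^+ 2) _ tau0 (sec w mgapf) _ _) (ltry _) => [s|s _].
  by rewrite exprn_ge0 ?enorm_ge0.
exact: (sqr_dist_le (HK _ _) (riemann_step_le _ _)).
Qed.

Lemma riemann_gap_bound w : 0 <= riemann_gap w <= 4 * K ^+ 2 * tau.
Proof.
rewrite -!lee_fin -tint_gap; apply/andP; split; first by apply: tint_ge0 => s; rewrite exprn_ge0 ?enorm_ge0.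
apply: (@tint_le_cst _ tau (4 * K ^+ 2) _ tau0 (sec w mgapf)) => [s|s _].
  by rewrite exprn_ge0 ?enorm_ge0.
exact: (sqr_dist_le (HK _ _) (riemann_step_le _ _)).
Qed.

Lemma measurable_riemann_gap : measurable_fun setT riemann_gap.
Proof.
apply/measurable_EFinP.
rewrite (_ : _ \o _ = fun w => tint tau (fun s => gapf (s, w))); last first.
  by apply/funext => w; rewrite /= -tint_gap.
by apply: measurable_tint => // p; rewrite exprn_ge0 ?enorm_ge0.
Qed.

Lemma L1_riemann_gap : L1 P riemann_gap.
Proof.
apply: (@L1_bounded _ _ _ _ _ (4 * K ^+ 2 * tau)) => [|w]; first exact: measurable_riemann_gap.
by have /andP[g0 g1] := riemann_gap_bound w; rewrite ger0_norm.
Qed.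

Lemma measurable_riemann_ito : measurable_fun setT (riemann_ito : Omega -> bspace R d 1).
Proof.
apply: (@measurable_mxsum _ _ _ _ _ _ _ (fun j : 'I_k => fun w => H (j%:R * h) w *m dW (j%:R * h) (j.+1%:R * h) w)) => j.
apply: measurable_mulmx; last by apply: (measurable_dW BM).
by apply: (measurable_fun_FT P_complete BM (t := j%:R * h)); exact: aH.
Qed.

Section OneSimple.
Variable S : simple_process (d := d) (filtration P W).
Variable J : Omega -> \bar R.
Hypothesis JE : forall w, J w = tint tau (fun s => (enorm (sp_value S s w - H s w) ^+ 2)%R).

Let msp : measurable_fun setT ((fun p => sp_value S p.1 p.2) : measurableTypeR R * Omega -> bspace R d d).
Proof.
apply: (@measurable_step_fun R _ Omega d d 'I_(sp_size S) (fun k : 'I__ => sp_grid S k)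
  (fun k : 'I__ => sp_grid S k.+1) (fun k w => sp_coef S k w)) => i.
apply: (measurable_fun_FT P_complete BM (t := sp_grid S i)); apply/measurable_wrtE.
exact: sp_coef_measurable.
Qed.

Let mdist : measurable_fun setT ((fun p => enorm (sp_value S p.1 p.2 - H p.1 p.2) ^+ 2) : measurableTypeR R * Omega -> R).
Proof. by apply: measurable_funX; apply: measurable_enorm; exact: measurable_mxB. Qed.

Lemma measurable_J : measurable_fun setT J.
Proof.
pose g (p : measurableTypeR R * Omega) : R := enorm (sp_value S p.1 p.2 - H p.1 p.2) ^+ 2.
rewrite (_ : J = fun w => tint tau (fun s => g (s, w))); last by apply/funext => w; rewrite JE.
by apply: measurable_tint => // p; rewrite exprn_ge0 ?enorm_ge0.
Qed.

Local Notation II := (spI S tau).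

(** The simple process is close to [H] only in probability and may be huge on small events. What the
    projection removes is itself a simple integrand, no larger than the distance to [H] because [H]
    lies in the ball, so [lenglart] applies to it. *)
Lemma truncation_error (delta c : R) : 0 < delta -> 0 < c ->
  pr P [set w | c <= enorm (II id w - II (rproj K) w)]
  <= pr P [set w | delta%:E <= J w]%E + delta / c ^+ 2.
Proof.
move=> d0 c0.
pose phi (M : 'M[R]_d) := M - rproj K M.
have mphi : measurable_fun setT (phi : bspace R d d -> bspace R d d).
  by apply: measurable_mxB => //; exact: measurable_id.
have phi0 : phi 0 = 0 by rewrite /phi rp0 subrr.
have E w : II id w - II (rproj K) w = II phi w.
  rewrite /spI -sumrB; apply: eq_bigr => i _.
  by rewrite -mulmxBl /spc; case: ifP => // _; rewrite subrr.
have -> : [set w | c <= enorm (II id w - II (rproj K) w)] = [set w | c <= enorm (II phi w)].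
  by apply/seteqP; split => w /=; rewrite E.
apply: (lenglart P_complete BM tau0 phi0) => //.
- by move=> M; rewrite -[X in _ <= enorm X]subr0; apply: enorm_sub_rproj_le; rewrite ?enorm0.
- exact: measurable_J.
- move=> w; rewrite JE; apply: tint_le.
  + have mp := measurableT_comp mphi msp.
    by apply: (sec w (g := fun p => enorm (phi (sp_value S p.1 p.2)) ^+ 2)); apply: measurable_funX; apply: measurable_enorm.
  + exact: (sec w mdist).
  + by move=> s; rewrite exprn_ge0 ?enorm_ge0.
  + by move=> s _; rewrite lerXn2r ?nnegrE ?enorm_ge0//; exact: enorm_sub_rproj_le.
Qed.

(** After the projection all coefficients are bounded by [K] and the isometry holds in mean. The
    time integral is split at [H]; on the event where [J] is not small only the bound 4 K^2 tau is
    available, weighted by the probability of that event. *)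
Lemma truncated_isometry (delta : R) : 0 < delta ->
  L1 P (fun w => enorm (II (rproj K) w - riemann_ito w) ^+ 2) /\
  ex P (fun w => enorm (II (rproj K) w - riemann_ito w) ^+ 2)
  <= 2 * (delta + 4 * K ^+ 2 * tau * pr P [set w | delta%:E <= J w]%E) + 2 * ex P riemann_gap.
Proof.
move=> d0.
pose N := sp_size S.
(* The two grids are merged into one family: the left summand carries the projected simple process,
   the right one [- H] on the Riemann grid. *)
pose a (i : 'I_N + 'I_k) : R := match i with inl i => spa S tau i | inr j => j%:R * h end.
pose b (i : 'I_N + 'I_k) : R := match i with inl i => spb S tau i | inr j => j.+1%:R * h end.
pose A (i : 'I_N + 'I_k) w : 'M[R]_d :=
  match i with inl i => spc S tau (rproj K) i w | inr j => - H (j%:R * h) w end.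
have a0 i : 0 <= a i by case: i => i /=; [exact: spa_ge0|].
have ab i : a i <= b i by case: i => i /=; [exact: spab|].
have bt i : b i <= tau by case: i => i /=; [exact: spb_le|].
have AK i w : enorm (A i w) <= K.
  case: i => i /=; last by rewrite enormN.
  by rewrite /spc; case: ifP => _; rewrite ?enorm0// enorm_rproj.
have mA i : measurable_fun setT (A i : FT (a i) -> bspace R d d).
  case: i => i /=; first exact: measurable_spc.
  by apply: measurable_mxN; exact: aH.
have [l2 e2] := ex_family P_complete BM a0 ab AK mA.
have IE w : \sum_i A i w *m dW (a i) (b i) w = II (rproj K) w - riemann_ito w.
  rewrite big_sumType/=; congr (_ + _); rewrite /riemann_ito -sumrN.
  by apply: eq_bigr => j _; rewrite mulNmx.
have {}IE : (fun w => enorm (\sum_i A i w *m dW (a i) (b i) w) ^+ 2)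
    = fun w => enorm (II (rproj K) w - riemann_ito w) ^+ 2 by apply/funext => w; rewrite IE.
rewrite IE in l2 e2; split=> //; rewrite e2.
pose B0 := [set w | delta%:E <= J w]%E.
have mB0 : measurable B0.
  by rewrite -[X in measurable X]setTI; apply: emeasurable_fun_c_infty => //; exact: measurable_J.
have lB0 : L1 P (\1_B0 : Omega -> R) by exact: L1_indic.
pose C := 4 * K ^+ 2 * tau.
have C0 : 0 <= C by rewrite !mulr_ge0// exprn_ge0.
apply: (@le_trans _ _ (ex P (fun w => 2 * (delta + C * \1_B0 w) + 2 * riemann_gap w))); last first.
  rewrite exD; [|apply: L1Z; apply: L1D; [exact: L1_cst|exact: L1Z]|apply: L1Z; exact: L1_riemann_gap].
  rewrite !exZ; [|exact: L1_riemann_gap|apply: L1D; [exact: L1_cst|exact: L1Z]].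
  rewrite exD; [|exact: L1_cst|exact: L1Z].
  by rewrite ex_cst exZ// ex_indic.
apply: ex_le.
- apply: L1_sum => i; apply: L1_sum => j; apply: L1Z.
  apply: (@L1_bounded _ _ _ _ _ (K * K)).
    by apply: measurable_mdot; [apply: (measurable_fun_FT P_complete BM (t := a i))|apply: (measurable_fun_FT P_complete BM (t := a j))]; exact: mA.
  by move=> w; apply: le_trans (normr_mdot _ _) _; apply: ler_pM; rewrite ?enorm_ge0.
- by apply: L1D; apply: L1Z; [apply: L1D; [exact: L1_cst|exact: L1Z]|exact: L1_riemann_gap].
move=> w; rewrite -lee_fin -(tint_step_fun (tau := tau) (fun i => A i w) a0 bt).
pose g1 s := enorm (rproj K (sp_value S s w) - H s w) ^+ 2.
pose g2 s := enorm (H s w - riemann_step s w) ^+ 2.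
have mg1 : measurable_fun setT (g1 : R -> R).
  apply: (sec w (g := fun p => enorm (rproj K (sp_value S p.1 p.2) - H p.1 p.2) ^+ 2)).
  apply: measurable_funX; apply: measurable_enorm; apply: measurable_mxB => //.
  exact: (measurableT_comp mrp msp).
have mg2 : measurable_fun setT (g2 : R -> R) by exact: (sec w mgapf).
have g10 s : 0 <= g1 s by rewrite exprn_ge0 ?enorm_ge0.
have g20 s : 0 <= g2 s by rewrite exprn_ge0 ?enorm_ge0.
(* [H] is fixed by the projection, which is 1-Lipschitz; hence the projected process is no farther
   from [H] than the original one, whose distance is [J]. *)
have g1E : (tint tau g1 <= (delta + C * \1_B0 w)%:E)%E.
  have rH s : rproj K (H s w) = H s w by rewrite rproj_id.
  rewrite indicE; have [wB|wB] := boolP (w \in B0).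
    rewrite mulr1; apply: (@le_trans _ _ (C%:E)); last by rewrite lee_fin lerDr ltW.
    apply: tint_le_cst => // s _; apply: sqr_dist_le => //; exact: enorm_rproj.
  have Jd : (J w < delta%:E)%E.
    by rewrite ltNge; apply: contraNN wB => H1; rewrite inE.
  rewrite mulr0 addr0; apply: le_trans (ltW Jd); rewrite JE; apply: tint_le => //.
    exact: (sec w mdist).
  by move=> s _; rewrite /g1 -{1}rH lerXn2r ?nnegrE ?enorm_ge0// rproj_lip.
apply: (@le_trans _ _ (tint tau (fun s => (2 * g1 s + 2 * g2 s)%R))).
  have mstep : measurable_fun setT ((fun s => step_fun a b (fun i => A i w) s) : measurableTypeR R -> bspace R d d).
    have m1 := @measurable_step_fun R _ Omega d d _ a b (fun i _ => A i w) (fun i => @measurable_cst _ _ _ _ _ _).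
    have p0 : Omega by [].
    by apply: (measurableT_comp m1 (pair2_measurable w)).
  apply: tint_le.
  - by apply: (measurable_funX 2); apply: measurable_enorm.
  - by apply: measurable_funD; exact: measurable_funM.
  - by move=> s; rewrite exprn_ge0 ?enorm_ge0.
  - move=> s /andP[_ st].
    have -> : step_fun a b (fun i => A i w) s = (rproj K (sp_value S s w) - H s w) + (H s w - riemann_step s w).
      rewrite addrA subrK /step_fun big_sumType/=; congr (_ + _); first exact: step_fun_sp.
      by rewrite /riemann_step /step_fun -sumrN; apply: eq_bigr => j _; case: ifP; rewrite ?oppr0.
    exact: enorm_sqrD_le.
rewrite tintD; [|exact: measurable_funM|exact: measurable_funM|by move=> s; rewrite mulr_ge0|by move=> s; rewrite mulr_ge0].
rewrite !tintZ// tint_gap [leRHS]EFinD; apply: leeD; rewrite [leRHS]EFinM; apply: lee_pmul => //.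
  exact: tint_ge0.
by rewrite lee_fin; case/andP: (riemann_gap_bound w).
Qed.

(* Along the simple processes [S] that define the Ito integral [Z], the probabilities on the
   right vanish. *)
Lemma ito_step_bound (Z : Omega -> 'cV[R]_d) (delta c N : R) : 0 < delta -> 0 < c -> 0 <= N ->
  measurable_fun setT (Z : Omega -> bspace R d 1) ->
  ex P (fun w => Num.min (enorm (Z w - riemann_ito w) ^+ 2) N)
  <= 4 * ex P riemann_gap + 4 * delta + 8 * c ^+ 2 + N * (delta / c ^+ 2)
     + (16 * K ^+ 2 * tau + N) * pr P [set w | delta%:E <= J w]%E
     + N * pr P [set w | c <= enorm (sp_integral S W tau w - Z w)].
Proof.
move=> d0 c0 N0 mZ.
have [l2 e2] := truncated_isometry d0.
have te := truncation_error d0 c0.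
have mI phi : measurable_fun setT (phi : bspace R d d -> bspace R d d) ->
  measurable_fun setT (II phi : Omega -> bspace R d 1) by move=> mphi; exact: (measurable_spI P_complete BM).
pose B1 := [set w | c <= enorm (II id w - II (rproj K) w)].
pose B2 := [set w | c <= enorm (sp_integral S W tau w - Z w)].
have mB1 : measurable B1.
  by apply: measurable_le_set; apply: measurable_enorm; apply: measurable_mxB; apply: mI => //; exact: measurable_id.
have mB2 : measurable B2.
  apply: measurable_le_set; apply: measurable_enorm; apply: measurable_mxB => //.
  rewrite (_ : sp_integral S W tau = II id); last by apply/funext => w; rewrite sp_integralE.
  by apply: mI; exact: measurable_id.
have lB1 : L1 P (\1_B1 : Omega -> R) by exact: L1_indic.
have lB2 : L1 P (\1_B2 : Omega -> R) by exact: L1_indic.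
pose q w := enorm (II (rproj K) w - riemann_ito w) ^+ 2.
have mmin : measurable_fun setT (fun w => Num.min (enorm (Z w - riemann_ito w) ^+ 2) N).
  apply: measurable_minr => //; apply: measurable_funX; apply: measurable_enorm.
  by apply: measurable_mxB => //; exact: measurable_riemann_ito.
have lr : L1 P (fun w => 2 * q w + 8 * c ^+ 2 + N * \1_B1 w + N * \1_B2 w).
  by apply: L1D; [apply: L1D; [apply: L1D; [exact: L1Z|exact: L1_cst]|exact: L1Z]|exact: L1Z].
have lm : L1 P (fun w => Num.min (enorm (Z w - riemann_ito w) ^+ 2) N).
  apply: (@L1_bounded _ _ _ _ _ N) => // w; rewrite ger0_norm ?ge_min ?lexx ?orbT//.
  by rewrite le_min N0 exprn_ge0 ?enorm_ge0.
apply: (@le_trans _ _ (ex P (fun w => 2 * q w + 8 * c ^+ 2 + N * \1_B1 w + N * \1_B2 w))).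
  apply: ex_le => // w.
  have q0 : 0 <= q w by rewrite exprn_ge0 ?enorm_ge0.
  have c20 : 0 <= 8 * c ^+ 2 by rewrite mulr_ge0// exprn_ge0// ltW.
  have i1 : 0 <= N * \1_B1 w by rewrite mulr_ge0// indicE ler0n.
  have i2 : 0 <= N * \1_B2 w by rewrite mulr_ge0// indicE ler0n.
  have [wB1|wB1] := boolP (w \in B1).
    have -> : \1_B1 w = 1 :> R by rewrite indicE wB1.
    by rewrite mulr1; apply: (@le_trans _ _ N); [rewrite ge_min lexx orbT|lra].
  have [wB2|wB2] := boolP (w \in B2).
    have -> : \1_B2 w = 1 :> R by rewrite indicE wB2.
    by rewrite mulr1; apply: (@le_trans _ _ N); [rewrite ge_min lexx orbT|lra].
  have {}wB1 : enorm (II id w - II (rproj K) w) < c.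
    by rewrite ltNge; apply: contraNN wB1 => H1; rewrite inE.
  have {}wB2 : enorm (II id w - Z w) < c.
    by rewrite -sp_integralE ltNge; apply: contraNN wB2 => H1; rewrite inE.
  apply: (@le_trans _ _ (2 * q w + 8 * c ^+ 2)); last by rewrite -addrA lerDl addr_ge0.
  rewrite ge_min; apply/orP; left.
  have -> : Z w - riemann_ito w = (II (rproj K) w - riemann_ito w) + (Z w - II (rproj K) w).
    by apply/matrixP => i j; rewrite !mxE; ring.
  apply: le_trans (enorm_sqrD_le _ _) _; rewrite lerD2l.
  have : enorm (Z w - II (rproj K) w) ^+ 2 <= (2 * c) ^+ 2.
    rewrite lerXn2r ?nnegrE ?enorm_ge0 ?mulr_ge0 ?(ltW c0)//.
    apply: le_trans (ler_enorm_dist _ (II id w) _) _; rewrite enorm_distC; lra.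
  lra.
rewrite exD; [|apply: L1D; [apply: L1D; [exact: L1Z|exact: L1_cst]|exact: L1Z]|exact: L1Z].
rewrite exD; [|apply: L1D; [exact: L1Z|exact: L1_cst]|exact: L1Z].
rewrite exD; [|exact: L1Z|exact: L1_cst].
rewrite ex_cst !exZ// !ex_indic//.
have := ler_wpM2l N0 te; rewrite -/B1 -/B2; move: e2; rewrite -/(q _) => e2; lra.
Qed.

End OneSimple.
End ItoStep.

Lemma cvg0_eps {R : realType} (u : nat -> R) :
  u @ \oo --> 0 <-> forall e, 0 < e -> exists n0, forall n, (n0 <= n)%N -> `|u n| < e.
Proof.
split=> [/cvgrPdist_lt H e e0|H].
  by have [n0 _ Hn] := H e e0; exists n0 => n /Hn; rewrite sub0r normrN.
apply/cvgrPdist_lt => e /H[n0 Hn]; exists n0 => // n /Hn.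
by rewrite sub0r normrN.
Qed.

Section BoundedConvergence.
Context {d : measure_display} {T : measurableType d} {R : realType} (P : probability T R).

Lemma ex_cvg0 (f : nat -> T -> R) (C : R) : (forall n, measurable_fun setT (f n)) ->
  (forall n w, `|f n w| <= C) -> (forall w, f ^~ w @ \oo --> 0) ->
  (fun n => ex P (f n)) @ \oo --> 0.
Proof.
move=> mf fC f0.
have mE n : measurable_fun setT (EFin \o f n) by exact/measurable_EFinP.
have ae1 : {ae P, forall x, setT x -> (fun n => (EFin \o f n) x) @ \oo --> (cst 0%E) x}.
  by apply: aeW => x _; apply/fine_cvgP; split; [exact: nearW|exact: f0].
have ae2 : {ae P, forall x n, setT x -> (`|(EFin \o f n) x| <= (EFin \o cst C) x)%E}.
  by apply: aeW => x n _; rewrite /= lee_fin.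
have iC : P.-integrable setT (EFin \o (cst C : T -> R)) by exact: (L1_cst P C).
have [_ _] := dominated_convergence measurableT mE (@measurable_cst _ _ _ _ _ _) ae1 iC ae2.
rewrite integral0 => /fine_cvgP[_ H]; apply: H.
Qed.

(** Monotone convergence in the cap. It is needed because convergence in probability only controls
    capped squares. *)
Lemma L1_of_min (f : T -> R) (C : R) : measurable_fun setT f -> (forall w, 0 <= f w) -> 0 <= C ->
  (forall N : nat, ex P (fun w => Num.min (f w) N%:R) <= C) -> L1 P f /\ ex P f <= C.
Proof.
move=> mf f0 C0 HC.
pose g n w : \bar R := (Num.min (f w) n%:R)%:E.
have mg n : measurable_fun setT (g n) by apply/measurable_EFinP; exact: measurable_minr.
have g0 n w : setT w -> (0 <= g n w)%E by move=> _; rewrite lee_fin le_min f0 ler0n.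
have gnd w : setT w -> nondecreasing_seq (g ^~ w).
  move=> _ m n mn; rewrite lee_fin le_min !ge_min lexx/=.
  by apply/orP; right; rewrite ler_nat.
have gE w : limn (g ^~ w) = (f w)%:E.
  apply/cvg_lim => //; apply: cvg_near_cst.
  exists (Num.truncn (f w)).+1 => // n /= nf; rewrite /g min_l//.
  by apply: ltW; apply: lt_le_trans (truncnS_gt _) _; rewrite ler_nat.
have lg n : L1 P (fun w => Num.min (f w) n%:R).
  apply: (@L1_bounded _ _ _ _ _ n%:R); first exact: measurable_minr.
  by move=> w; rewrite ger0_norm ?ge_min ?lexx ?orbT// le_min f0 ler0n.
have ile : (\int[P]_w (f w)%:E <= C%:E)%E.
  rewrite (eq_integral (fun w => limn (g ^~ w))); last by move=> w _; rewrite gE.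
  rewrite monotone_convergence//; apply: lime_le.
    apply: ereal_nondecreasing_is_cvgn => m n mn; apply: ge0_le_integral => //.
    - by move=> w; exact: g0.
    - by move=> w _; exact: gnd.
  apply: nearW => n; rewrite -(fineK (integrable_fin_num measurableT (lg n))) lee_fin.
  exact: HC.
have lf : L1 P f.
  apply/integrableP; split; first exact/measurable_EFinP.
  rewrite (eq_integral (fun w => (f w)%:E)); last by move=> w _; rewrite /= ger0_norm.
  by apply: le_lt_trans ile _; exact: ltry.
split=> //; rewrite -lee_fin fineK//; exact: (integrable_fin_num measurableT lf).
Qed.

End BoundedConvergence.

(** * Continuous paths, their step approximations and joint measurability *)

Section Paths.
Context {R : realType} {m n : nat}.
Implicit Types phi : R -> 'M[R]_(m, n).

Definition econtinuous phi := forall (s e : R), 0 < e ->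
  exists2 de : R, 0 < de & forall u, `|u - s| < de -> enorm (phi u - phi s) < e.

Definition rstep k (h : R) phi s : 'M[R]_(m, n) :=
  step_fun (fun j : 'I_k => j%:R * h) (fun j : 'I_k => j.+1%:R * h) (fun j => phi (j%:R * h)) s.

Lemma step_index (h s : R) k : 0 < h -> 0 < s -> s <= k%:R * h ->
  exists j : 'I_k, j%:R * h < s <= j.+1%:R * h.
Proof.
move=> h0 s0 sk.
have ex_ : exists l, s <= l%:R * h by exists k.
have [l sl lmin] := ex_minnP ex_.
have lk : (l <= k)%N by exact: lmin.
case: l sl lmin lk => [|l] sl lmin lk.
  by move: sl; rewrite mul0r leNgt s0.
exists (Ordinal lk) => /=; rewrite sl andbT ltNge; apply/negP => /lmin.
by rewrite ltnn.
Qed.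

Lemma rstep_at (h s : R) k phi (j : 'I_k) : 0 <= h -> j%:R * h < s <= j.+1%:R * h ->
  rstep k h phi s = phi (j%:R * h).
Proof.
move=> h0 /andP[j1 j2]; rewrite /rstep /step_fun (bigD1 j)//= j1 j2/= big1 ?addr0// => i ij.
case: ifP => // /andP[i1 i2].
have gm a b : (a <= b)%N -> a%:R * h <= b%:R * h by move=> ab; rewrite ler_wpM2r// ler_nat.
have [lt|le] := ltnP i j.
  by have := lt_le_trans j1 (le_trans i2 (gm _ _ lt)); rewrite ltxx.
have ji : (j < i)%N by rewrite ltn_neqAle le andbT eq_sym; apply: contraNneq ij => /val_inj ->.
by have := lt_le_trans i1 (le_trans j2 (gm _ _ ji)); rewrite ltxx.
Qed.

Lemma rstep_le0 (h s : R) k phi : 0 <= h -> s <= 0 -> rstep k h phi s = 0.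
Proof.
move=> h0 s0; rewrite /rstep /step_fun big1// => i _; case: ifP => // /andP[i1 _].
by have := lt_le_trans i1 s0; rewrite ltNge mulr_ge0.
Qed.

Lemma rstep_mono (h s : R) k l phi : 0 < h -> (k <= l)%N -> s <= k%:R * h ->
  rstep k h phi s = rstep l h phi s.
Proof.
move=> h0 kl sk; have [s0|s0] := leP s 0; first by rewrite !rstep_le0// ltW.
have [j Hj] := step_index h0 s0 sk.
by rewrite (rstep_at _ (ltW h0) Hj) (@rstep_at _ _ l _ (widen_ord kl j) (ltW h0) Hj).
Qed.

Lemma rstep_near (h s de e : R) k phi : 0 < h -> 0 < s -> s <= k%:R * h -> h < de ->
  (forall u, `|u - s| < de -> enorm (phi u - phi s) < e) -> enorm (phi s - rstep k h phi s) < e.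
Proof.
move=> h0 s0 sk hd H; have [j Hj] := step_index h0 s0 sk.
rewrite (rstep_at _ (ltW h0) Hj) enorm_distC; apply: H.
move: Hj => /andP[j1 j2]; rewrite distrC ger0_norm ?subr_ge0 ?(ltW j1)//.
by move: j2; rewrite -natr1 mulrDl mul1r; lra.
Qed.

Lemma mesh_lt (t de : R) : 0 < de -> exists n0, forall k, (n0 <= k)%N -> t / k.+1%:R < de.
Proof.
move=> d0; exists (Num.truncn (t / de)) => k kt.
rewrite ltr_pdivrMr// mulrC -ltr_pdivrMr//.
by apply: lt_le_trans (truncnS_gt _) _; rewrite ler_nat.
Qed.

Lemma rstep_cvg (t s e : R) phi : econtinuous phi -> 0 < s -> s <= t -> 0 < e ->
  exists n0, forall k, (n0 <= k)%N -> enorm (phi s - rstep k.+1 (t / k.+1%:R) phi s) < e.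
Proof.
move=> cphi s0 st e0; have [de de0 H] := cphi s e e0.
have [n0 Hn] := mesh_lt t de0.
have t0 : 0 < t by exact: lt_le_trans st.
exists n0 => k nk; apply: (rstep_near _ s0 _ (Hn k nk) H); first by rewrite divr_gt0.
by rewrite mulrC mulfVK// pnatr_eq0.
Qed.

End Paths.

Section JointMeasurability.
Context {R : realType} {disp : measure_display} {Omega : measurableType disp} {m n : nat}.

Lemma measurable_rstep k (h : R) (V : R -> Omega -> 'M[R]_(m, n)) : 0 <= h ->
  (forall s, 0 <= s -> measurable_fun setT (V s : Omega -> bspace R m n)) ->
  measurable_fun setT ((fun p => rstep k h (V ^~ p.2) p.1) : measurableTypeR R * Omega -> bspace R m n).
Proof.
move=> h0 mV; apply: (@measurable_step_fun R _ Omega m n 'I_k (fun j : 'I_k => j%:R * h)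
  (fun j : 'I_k => j.+1%:R * h) (fun j w => V (j%:R * h) w)) => j.
by apply: mV; rewrite mulr_ge0.
Qed.

Lemma joint_measurable (V : R -> Omega -> 'M[R]_(m, n)) :
  (forall s, 0 <= s -> measurable_fun setT (V s : Omega -> bspace R m n)) ->
  (forall w, econtinuous (V ^~ w)) -> (forall s w, s <= 0 -> V s w = V 0 w) ->
  measurable_fun setT ((fun p => V p.1 p.2) : measurableTypeR R * Omega -> bspace R m n).
Proof.
move=> mV cV V0.
rewrite (_ : (fun p => _) = fun p : measurableTypeR R * Omega =>
   if 0 < p.1 then (if 0 < p.1 then V p.1 p.2 else 0) else V 0 p.2); last first.
  by apply/funext => -[s w] /=; case: ltP => // s0; exact: V0.
have m0 : measurable_fun setT (fun p : measurableTypeR R * Omega => 0 < p.1).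
  by apply: measurable_fun_ltr => //; exact: measurable_fst.
apply: measurable_mx_if => //; last by apply: (measurableT_comp (mV 0 (lexx 0))); exact: measurable_snd.
apply: measurable_mx => i j.
(* With mesh 1 / (k + 1) and (k + 1)^2 intervals the grid reaches time k + 1: it becomes finer and
   exhausts the half-line at once. *)
apply: (@measurable_fun_cvg _ _ _ _ (fun k (p : measurableTypeR R * Omega) =>
  rstep (k.+1 * k.+1) (k.+1%:R^-1) (V ^~ p.2) p.1 i j)) => [k|[s w] _ /=].
  by apply: measurable_mxP; apply: measurable_rstep.
case: ltP => s0; last first.
  rewrite mxE (_ : (fun k => _) = fun=> 0); first exact: cvg_cst.
  by apply/funext => k; rewrite rstep_le0 ?mxE.
apply/cvgrPdist_lt => e e0; have [de de0 H] := cV w s e e0.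
have [n0 Hn] := mesh_lt 1 de0.
exists (maxn n0 (Num.truncn s)) => // k /=; rewrite geq_max => /andP[nk sk].
have := @rstep_near _ m n (k.+1%:R^-1) s de e (k.+1 * k.+1) (V ^~ w) _ s0 _ _ H.
rewrite invr_gt0 ltr0n => /(_ isT) HH.
apply: le_lt_trans (HH _ _).
- by have := entry_le_enorm (V s w - rstep (k.+1 * k.+1) k.+1%:R^-1 (V^~ w) s) i j; rewrite !mxE.
- rewrite natrM mulfK ?pnatr_eq0//; apply: ltW; apply: lt_le_trans (truncnS_gt _) _.
  by rewrite ler_nat.
- by have := Hn k nk; rewrite div1r.
Qed.

(** Dominated convergence in time along each path, then over the paths. Time 0 is left out because
    left-open step functions vanish there; a point has measure zero. *)
Lemma ex_tint_cvg0 (P : probability Omega R) (g : nat -> measurableTypeR R * Omega -> R) (C t : R) : 0 <= t ->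
  (forall k, measurable_fun setT (g k)) -> (forall k p, 0 <= g k p <= C) ->
  (forall w s, 0 < s -> s <= t -> (fun k => g k (s, w)) @ \oo --> 0) ->
  (fun k => ex P (fun w => fine (tint t (fun s => g k (s, w))))) @ \oo --> 0.
Proof.
move=> t0 mg gC gc.
have C0 : 0 <= C.
  have [w _] : exists w : Omega, True.
    apply/not_existsP => H; have := probability_setT P; rewrite (_ : setT = set0) ?measure0.
      by move=> /eqP; rewrite eq_sym onee_eq0.
    by apply/seteqP; split => // w; case: (H w).
  by have /andP[g0 g1] := gC 0%N (0, w); exact: le_trans g1.
have sec k w : measurable_fun setT ((fun s => g k (s, w)) : R -> R).
  by apply: (measurableT_comp (mg k)); exact: pair2_measurable.
have tE k w : (0 <= tint t (fun s => g k (s, w)) <= (C * t)%:E)%E.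
  apply/andP; split; first by apply: tint_ge0 => s; case/andP: (gC k (s, w)).
  by apply: tint_le_cst => // s; case/andP: (gC k (s, w)).
have tfin k w : tint t (fun s => g k (s, w)) \is a fin_num.
  have /andP[h1 h2] := tE k w; rewrite ge0_fin_numE//; exact: le_lt_trans h2 (ltry _).
apply: (@ex_cvg0 _ _ _ _ _ (C * t)).
- move=> k; apply/measurable_EFinP.
  rewrite (_ : _ \o _ = fun w => tint t (fun s => g k (s, w))).
    by apply: measurable_tint => // p; case/andP: (gC k p).
  by apply/funext => w; rewrite /= fineK.
- move=> k w; have /andP[h1 h2] := tE k w.
  by rewrite ger0_norm ?fine_ge0// -lee_fin fineK.
move=> w.
have mI := @measurable_itv0 R t.
have mE k : measurable_fun (`[0%R, t]%classic : set (measurableTypeR R)) (fun s => (g k (s, w))%:E).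
  by apply/measurable_EFinP; exact: measurable_funS (sec k w).
have ae1 : {ae (@lebesgue_measure R), forall s, (`[0%R, t]%classic : set (measurableTypeR R)) s ->
    (fun k => (g k (s, w))%:E) @ \oo --> (cst 0%E) s}.
  exists [set 0%R]; split; [exact: measurable_set1|exact: lebesgue_measure_set1|].
  move=> s /= H; apply: contrapT => s0; apply: H; rewrite in_itv/= => /andP[s00 st].
  apply/fine_cvgP; split; first exact: nearW.
  by apply: gc => //; rewrite lt_neqAle s00 andbT; apply/eqP => /esym.
have ae2 : {ae (@lebesgue_measure R), forall s k, (`[0%R, t]%classic : set (measurableTypeR R)) s ->
    (`|(g k (s, w))%:E| <= (cst C%:E) s)%E}.
  by apply: aeW => s k _; have /andP[h1 h2] := gC k (s, w); rewrite /= lee_fin ger0_norm.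
have iC : (@lebesgue_measure R).-integrable (`[0%R, t]%classic : set (measurableTypeR R)) (cst C%:E).
  apply/integrableP; split; first exact: measurable_cst.
  rewrite (eq_integral (cst C%:E)); last by move=> s _; rewrite /= ger0_norm.
  by have := @tint_cst _ t C t0; rewrite /tint => ->; exact: ltry.
have [_ _] := dominated_convergence mI mE (@measurable_cst _ _ _ _ _ _) ae1 iC ae2.
by rewrite integral0 => /fine_cvgP[_ H].
Qed.

End JointMeasurability.

Section NullModification.
Context {R : realType} {disp : measure_display} {Omega : measurableType disp} (P : probability Omega R).
Hypothesis P_complete : measure_is_complete P.
Variable N : set Omega.
Hypotheses (mN : measurable N) (N0 : P N = 0%E).

(** [A] and [A'] differ only inside the null set [N], all of whose subsets are measurable by
    completeness. *)
Lemma measurable_mod (A A' : set Omega) : measurable A' -> (forall w, ~ N w -> (A w <-> A' w)) ->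
  measurable A /\ P A = P A'.
Proof.
move=> mA' AA'.
have mAN (B : set Omega) : measurable (B `&` N).
  by apply: P_complete; exists N; split=> // w [].
have AE : A = (A' `\` N) `|` (A `&` N).
  apply/seteqP; split => w.
    by move=> Aw; have [Nw|Nw] := pselect (N w); [right|left; split=> //; apply/AA'].
  by move=> [[A'w Nw]|[]//]; apply/AA'.
have mA : measurable A by rewrite AE; apply: measurableU => //; exact: measurableD.
split=> //; apply/eqP; rewrite eq_le; apply/andP; split.
  have U : (P (A' `|` N) <= P A')%E by have := measureU2 P mA' mN; rewrite [X in (_ <= _ + X)%E](_ : _ = 0%E)// adde0.
  apply: le_trans U; apply: le_measure; rewrite ?inE//; first exact: measurableU.
  by move=> w Aw; have [Nw|Nw] := pselect (N w); [right|left; apply/AA'].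
have U : (P (A `|` N) <= P A)%E by have := measureU2 P mA mN; rewrite [X in (_ <= _ + X)%E](_ : _ = 0%E)// adde0.
apply: le_trans U; apply: le_measure; rewrite ?inE//; first exact: measurableU.
by move=> w Aw; have [Nw|Nw] := pselect (N w); [right|left; apply/AA'].
Qed.

Lemma cvg_proba0_mod (X X' : nat -> Omega -> \bar R) : (forall n, measurable_fun setT (X' n)) ->
  (forall n w, ~ N w -> X n w = X' n w) -> cvg_proba0 P X -> cvg_proba0 P X'.
Proof.
move=> mX' XX' H e e0; rewrite [X in X @ _ --> _](_ : _ = fun n => P [set w | e%:E <= X n w]%E); first exact: H.
apply/funext => n; apply/esym.
apply: (proj2 (measurable_mod _ _)) => [|w Nw /=]; last by rewrite XX'.
by rewrite -[X in measurable X]setTI; exact: emeasurable_fun_c_infty.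
Qed.

End NullModification.

Section Measurability.
Context {R : realType} {disp : measure_display} {Omega : measurableType disp}.

Lemma measurable_Rintegral_time (t : R) (g : measurableTypeR R * Omega -> R) : measurable_fun setT g ->
  measurable_fun setT (fun w => (\int[lebesgue_measure]_(s in `[0%R, t]) g (s, w))%R).
Proof.
move=> mg.
have pm (x : R) : 0 <= Num.max x 0 by rewrite le_max lexx orbT.
have m1 := @measurable_tint R disp Omega t (fun p => Num.max (g p) 0) (measurable_maxr mg (@measurable_cst _ _ _ _ _ _)) (fun p => pm _).
have mgN : measurable_fun setT (fun p => - g p) by exact: measurableT_comp.
have m2 := @measurable_tint R disp Omega t (fun p => Num.max (- g p) 0) (measurable_maxr mgN (@measurable_cst _ _ _ _ _ _)) (fun p => pm _).
rewrite (_ : (fun w => _) = fine \o (fun w => tint t (fun s => (Num.max (g (s, w)) 0)%R) - tint t (fun s => (Num.max (- g (s, w)) 0)%R))%E).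
  by apply: measurableT_comp => //; exact: emeasurable_funB.
apply/funext => w; rewrite /= /Rintegral integralE; congr (fine (_ - _)%E).
  by rewrite (funerpos (fun s => g (s, w))).
by rewrite (funerneg (fun s => g (s, w))).
Qed.

End Measurability.

(** * Solutions freed from their exceptional null sets *)

Section CleanSolution.
Context {R : realType} {d : nat} {disp : measure_display}
        {Omega : measurableType disp} (P : probability Omega R).
Hypothesis P_complete : measure_is_complete P.
Variable W : R -> Omega -> 'cV[R]_d.
Hypothesis BM : brownian_motion P W.
Local Notation FT := (FT P W).
Local Notation dW := (dW W).
Variables (f : 'cV[R]_d -> 'cV[R]_d) (sg : 'cV[R]_d -> 'M[R]_d).
Hypothesis mf : measurable_fun setT (f : bspace R d 1 -> bspace R d 1).
Hypothesis lsg : eLipschitz sg.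

Definition drift_integral (V : R -> Omega -> 'cV[R]_d) (t : R) (w : Omega) : 'cV[R]_d :=
  \col_i \int[lebesgue_measure]_(s in `[0, t]) f (V s w) i ord0.

(** By the equation this is the Ito integral, up to a null set; being written in terms of [V] alone,
    its measurability follows from that of [V]. *)
Definition noise_part x (V : R -> Omega -> 'cV[R]_d) t w := V t w - x - drift_integral V t w.

(* A version of the solution with no exceptional null set, frozen at negative times so that
   its paths are continuous on the whole line. *)
Record clean_solution (x : 'cV[R]_d) (V : R -> Omega -> 'cV[R]_d) : Prop := CleanSolution {
  cs_adapted : forall t, 0 <= t -> measurable_fun setT (V t : FT t -> bspace R d 1);
  cs_cont : forall w, econtinuous (V ^~ w);
  cs_neg : forall s w, s <= 0 -> V s w = V 0 w;
  cs_ito : forall t, 0 <= t -> exists S : nat -> simple_process (d := d) (filtration P W),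
    cvg_proba0 P (fun n w => tint t (fun s => (enorm (sp_value (S n) s w - sg (V s w)) ^+ 2)%R)) /\
    cvg_proba0 P (fun n w => (enorm (sp_integral (S n) W t w - noise_part x V t w))%:E) }.

Lemma clean_measurable x V : clean_solution x V -> forall s, 0 <= s ->
  measurable_fun setT (V s : Omega -> bspace R d 1).
Proof. by move=> cV s s0; apply: (measurable_fun_FT P_complete BM (t := s)); exact: (cs_adapted cV). Qed.

Lemma clean_joint x V : clean_solution x V ->
  measurable_fun setT ((fun p => V p.1 p.2) : measurableTypeR R * Omega -> bspace R d 1).
Proof.
move=> cV; apply: joint_measurable; [exact: (clean_measurable cV)|exact: (cs_cont cV)|exact: (cs_neg cV)].
Qed.

Lemma measurable_drift_integral V t :
  measurable_fun setT ((fun p => V p.1 p.2) : measurableTypeR R * Omega -> bspace R d 1) ->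
  measurable_fun setT (drift_integral V t : Omega -> bspace R d 1).
Proof.
move=> mV; apply: measurable_mx => i j; under eq_fun do rewrite mxE.
apply: (measurable_Rintegral_time t (g := fun p => f (V p.1 p.2) i ord0)).
by apply: measurable_mxP; exact: (measurableT_comp mf mV).
Qed.

Lemma within_econtinuous (V : R -> 'cV[R]_d) :
  {within `[0%R, +oo[, continuous V} -> econtinuous (fun s => V (Num.max 0 s)).
Proof.
move=> /subspace_continuousP cV s e e0.
have inA (u : R) : `[0%R, +oo[%classic (Num.max 0 u).
  by rewrite /= in_itv/= le_max lexx.
have := cV _ (inA s) _ (near_enorm (V (Num.max 0 s)) e0).
rewrite /= nbhs_simpl/= => /nbhs_ballP[de /= de0 H].
exists de => // u us; apply: H; last exact: inA.
rewrite /ball/=; apply: le_lt_trans us.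
rewrite distrC.
have [u0|u0] := leP 0 u; have [s0|s0] := leP 0 s.
- by [].
- by rewrite subr0 ger0_norm// ger0_norm; lra.
- by rewrite sub0r normrN ger0_norm// distrC ger0_norm; lra.
- by rewrite subrr normr0.
Qed.

Lemma clean_of_strong x V : strong_solution P W f sg x V -> exists V' N, [/\ clean_solution x V',
  measurable N, P N = 0%E & forall w, ~ N w -> forall t, 0 <= t -> V' t w = V t w].
Proof.
move=> sV; have [Z [itoZ eqZ]] := sol_equation sV.
have [N [mN N0 HN]] : exists N, [/\ measurable N, P N = 0%E & forall w, ~ N w ->
    {within `[0%R, +oo[, continuous (fun t => V t w)} /\
    forall t, 0 <= t -> V t w = x + drift_integral V t w + Z t w].
  have [N1 [mN1 N10 H1]] := sol_continuous sV; have [N2 [mN2 N20 H2]] := eqZ.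
  exists (N1 `|` N2); split; first exact: measurableU.
    have := measureU2 P mN1 mN2.
    rewrite [X in (_ <= X + _)%E](_ : _ = 0%E)// [X in (_ <= _ + X)%E](_ : _ = 0%E)// adde0 measure_le0.
    by move=> /eqP.
  move=> w Nw; split.
    by apply: contrapT => H; apply: Nw; left; apply: H1.
  by apply: contrapT => H; apply: Nw; right; apply: H2.
(* On the exceptional set the path is the constant [x]. Since [N] is negligible it belongs to the
   filtration at every time, so adaptedness is preserved. *)
pose V' t w := if w \in N then x else V (Num.max 0 t) w.
have V'E w t : ~ N w -> 0 <= t -> V' t w = V t w.
  by move=> Nw t0; rewrite /V' memNset// max_r.
have cV' w : econtinuous (V' ^~ w).
  rewrite /V'; case: (boolP (w \in N)) => wN.
    by move=> s e e0; exists 1 => // u _; rewrite subrr enorm0.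
  have Nw : ~ N w by move/mem_set; rewrite (negbTE wN).
  exact: (within_econtinuous (HN w Nw).1).
have aV' t : 0 <= t -> measurable_fun setT (V' t : FT t -> bspace R d 1).
  move=> t0; apply: (@measurable_mx_if _ _ (FT t) _ _ (fun w => w \in N) (fun=> x) (V (Num.max 0 t))).
  - have mNt : @measurable _ (FT t) N by apply: FT_negligible; exists N; split.
    by apply: (measurable_fun_bool true); rewrite setTI (_ : _ @^-1` _ = N)//; apply/seteqP; split => w /=; [exact: set_mem|exact: mem_set].
  - exact: measurable_cst.
  - by rewrite max_r//; apply/measurable_wrtE; exact: (sol_adapted sV).
have nV' s w : s <= 0 -> V' s w = V' 0 w by move=> s0; rewrite /V' !max_l.
have jV' : measurable_fun setT ((fun p => V' p.1 p.2) : measurableTypeR R * Omega -> bspace R d 1).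
  apply: joint_measurable => // s s0; apply: (measurable_fun_FT P_complete BM (t := s)); exact: aV'.
have msg := measurable_eLipschitz lsg.
exists V', N; split=> //; last by move=> w Nw t; exact: V'E.
split=> // t t0.
have [S [S1 S2]] := itoZ t t0; exists S.
have jsp n : measurable_fun setT ((fun p => sp_value (S n) p.1 p.2) : measurableTypeR R * Omega -> bspace R d d).
  apply: (@measurable_step_fun R _ Omega d d 'I_(sp_size (S n)) (fun k : 'I__ => sp_grid (S n) k)
    (fun k : 'I__ => sp_grid (S n) k.+1) (fun k w => sp_coef (S n) k w)) => i.
  apply: (measurable_fun_FT P_complete BM (t := sp_grid (S n) i)); apply/measurable_wrtE.
  exact: sp_coef_measurable.
split.
  apply: (cvg_proba0_mod P_complete mN N0 _ _ S1) => [n|n w Nw].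
    apply: (measurable_tint t (g := fun p => enorm (sp_value (S n) p.1 p.2 - sg (V' p.1 p.2)) ^+ 2)).
      apply: measurable_funX; apply: measurable_enorm; apply: measurable_mxB => //.
      exact: (measurableT_comp msg jV').
    by move=> p; rewrite exprn_ge0 ?enorm_ge0.
  apply: eq_integral => s; rewrite inE/= in_itv/= => /andP[s0 _].
  by rewrite V'E.
apply: (cvg_proba0_mod P_complete mN N0 _ _ S2) => [n|n w Nw].
  apply/measurable_EFinP; apply: measurable_enorm; apply: measurable_mxB.
    rewrite (_ : sp_integral (S n) W t = spI (S n) t id); last by apply/funext => w; rewrite sp_integralE.
    by apply: (measurable_spI P_complete BM) => //; exact: measurable_id.
  apply: measurable_mxB; last exact: measurable_drift_integral.
  apply: measurable_mxB; last exact: measurable_cst.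
  by apply: (measurable_fun_FT P_complete BM (t := t)); exact: aV'.
congr (_%:E); congr (enorm (_ - _)).
rewrite /noise_part V'E// ((HN w Nw).2 t t0).
have -> : drift_integral V' t w = drift_integral V t w.
  apply/matrixP => i j; rewrite !mxE /Rintegral; congr fine; apply: eq_integral => s.
  by rewrite inE/= in_itv/= => /andP[s0 _]; rewrite V'E.
by apply/matrixP => i j; rewrite !mxE; ring.
Qed.

End CleanSolution.

(** * Convergence of the Euler scheme *)

Section RiemannIntegralGap.
Context {R : realType} {m n : nat}.
Notation mu := (@lebesgue_measure R).
Variables (phi : R -> 'M[R]_(m, n)) (K h : R) (k : nat).
Hypothesis mphi : measurable_fun setT (phi : measurableTypeR R -> bspace R m n).
Hypothesis phiK : forall s, enorm (phi s) <= K.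
Hypothesis h0 : 0 <= h.
Let tau := k%:R * h.
Let tau0 : 0 <= tau. Proof. by rewrite mulr_ge0. Qed.

Lemma enorm_rstep s : enorm (rstep k h phi s) <= K.
Proof.
have K0 : 0 <= K by apply: le_trans (phiK 0); exact: enorm_ge0.
have jh1 (j : nat) : j%:R * h <= j.+1%:R * h by rewrite ler_wpM2r// ler_nat.
have rp0 : rproj K 0 = 0 :> 'M[R]_(m, n) by rewrite rproj_id// enorm0.
have E := @step_fun_pick R m n m n k (fun j => j%:R * h) (fun j => phi (j%:R * h)) (rproj K) s jh1 rp0.
rewrite (_ : rstep _ _ _ _ = rproj K (rstep k h phi s)); first exact: enorm_rproj.
by rewrite -E; apply: eq_bigr => j _; rewrite rproj_id.
Qed.

Lemma measurable_rstep_path : measurable_fun setT (rstep k h phi : measurableTypeR R -> bspace R m n).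
Proof.
apply: (@measurable_mxsum _ _ _ _ _ _ _ (fun j : 'I_k => fun s : measurableTypeR R =>
  if j%:R * h < s <= j.+1%:R * h then phi (j%:R * h) else 0)) => j.
apply: measurable_mx_if; [|exact: measurable_cst|exact: measurable_cst].
by apply: measurable_and; [apply: measurable_fun_ltr|apply: measurable_fun_ler].
Qed.

Definition path_gap : R := fine (tint tau (fun s => enorm (phi s - rstep k h phi s))).

Let mgap : measurable_fun setT ((fun s => enorm (phi s - rstep k h phi s)) : R -> R).
Proof. by apply: measurable_enorm; apply: measurable_mxB => //; exact: measurable_rstep_path. Qed.

Lemma path_gapE : tint tau (fun s => enorm (phi s - rstep k h phi s)) = path_gap%:E.
Proof.
rewrite /path_gap fineK// ge0_fin_numE; last by apply: tint_ge0 => s; exact: enorm_ge0.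
apply: le_lt_trans (@tint_le_cst _ tau (2 * K) _ tau0 mgap _ _) (ltry _) => [s|s _]; first exact: enorm_ge0.
by apply: le_trans (ler_enormB _ _) _; have := phiK s; have := enorm_rstep s; lra.
Qed.

Lemma path_gap_bound : 0 <= path_gap <= 2 * K * tau.
Proof.
rewrite -!lee_fin -path_gapE; apply/andP; split; first by apply: tint_ge0 => s; exact: enorm_ge0.
apply: (@tint_le_cst _ tau (2 * K) _ tau0 mgap) => [s|s _]; first exact: enorm_ge0.
by apply: le_trans (ler_enormB _ _) _; have := phiK s; have := enorm_rstep s; lra.
Qed.

Lemma Rintegral_rstep i j :
  \int[mu]_(s in `[0%R, tau]) (rstep k h phi s i j) = \sum_(l < k) h * phi (l%:R * h) i j.
Proof.
pose J (l : 'I_k) : set (measurableTypeR R) := `]l%:R * h, l.+1%:R * h]%classic.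
have mI := @measurable_itv0 R tau.
have iJ l : mu.-integrable `[0%R, tau]%classic (fun s => (\1_(J l) s)%:E)%E.
  by apply: (integrableS measurableT) => //; exact: integrable_indic_itv.
rewrite /Rintegral.
rewrite (eq_integral (fun s => (\sum_(l < k) (phi (l%:R * h) i j)%:E * (\1_(J l) s)%:E)%E)); last first.
  move=> s _; rewrite /rstep /step_fun summxE -sumEFin; apply: eq_bigr => l _.
  rewrite -EFinM indicE mem_setE /J in_itv/=.
  by case: ifP => _; rewrite ?mulr1 ?mulr0 ?mxE.
rewrite integral_sum//; last by move=> l; exact: integrableZl.
rewrite (eq_bigr (fun l : 'I_k => (h * phi (l%:R * h) i j)%:E)); first by rewrite sumEFin.
move=> l _; rewrite integralZl// tint_indic; [|by rewrite mulr_ge0|by rewrite ler_wpM2r// ler_nat].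
by rewrite -EFinM -mulrBl -natr1 addrAC subrr add0r mul1r max_r// mulrC.
Qed.

(** The left Riemann sum is the integral of the step approximation, so the quadrature error of each
    entry is at most the integrated distance between the path and that approximation. *)
Lemma integral_gap_le i j :
  `|\int[mu]_(s in `[0%R, tau]) (phi s i j) - \sum_(l < k) h * phi (l%:R * h) i j| <= path_gap.
Proof.
rewrite -Rintegral_rstep.
have mI := @measurable_itv0 R tau.
have bint (g : R -> R) C : measurable_fun setT g -> (forall s, `|g s| <= C) ->
    mu.-integrable `[0%R, tau]%classic (EFin \o g).
  move=> mg gC; apply: measurable_bounded_integrable => //.
  - by apply: (le_lt_trans _ (ltry tau)); rewrite [X in (X <= _)%E](lebesgue_itv0 tau0).
  - exact: measurable_funS mg.
  - by exists C; split; [exact: num_real|move=> y Cy s _; exact: le_trans (gC s) (ltW Cy)].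
have m1 : measurable_fun setT ((fun s => phi s i j) : R -> R) by exact: measurable_mxP.
have m2 : measurable_fun setT ((fun s => rstep k h phi s i j) : R -> R).
  by apply: measurable_mxP; exact: measurable_rstep_path.
have i1 := bint _ K m1 (fun s => le_trans (entry_le_enorm _ _ _) (phiK s)).
have i2 := bint _ K m2 (fun s => le_trans (entry_le_enorm _ _ _) (enorm_rstep s)).
rewrite -RintegralB//.
apply: le_trans (le_normr_Rintegral _ _) _ => //.
  by have := integrableB mI i1 i2.
rewrite -lee_fin -path_gapE /Rintegral fineK; last first.
  apply: integrable_fin_num => //; have := integrable_abse (integrableB mI i1 i2).
  by apply: eq_integrable => // s _.
apply: ge0_le_integral => //.
- apply/measurable_EFinP.
  have m3 : measurable_fun setT ((fun s => `|phi s i j - rstep k h phi s i j|) : R -> R).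
    by apply: measurableT_comp => //; exact: measurable_funB.
  exact: measurable_funS m3.
- by apply/measurable_EFinP; exact: measurable_funS mgap.
- by move=> s _; rewrite lee_fin; have := entry_le_enorm (phi s - rstep k h phi s) i j; rewrite !mxE.
Qed.

End RiemannIntegralGap.

Lemma pr_cvg0 {R : realType} {disp : measure_display} {Omega : measurableType disp}
    (P : probability Omega R) (X : nat -> Omega -> \bar R) (c e : R) : cvg_proba0 P X -> 0 < c -> 0 < e ->
  exists n0, forall n, (n0 <= n)%N -> pr P [set w | c%:E <= X n w]%E < e.
Proof.
move=> HX c0 e0; have /fine_cvgP[_ /cvg0_eps/(_ e e0)[n0 Hn]] := HX c c0.
by exists n0 => n /Hn; apply: le_lt_trans; exact: ler_norm.
Qed.

(** The inductive step of [gronwall] in abstract variables, with [Q] a power and [c] the rate times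
    the step. *)
Lemma gronwall_arith {R : realType} (a b c k Q e : R) : (1 + c) * a <= (1 + c) * (k * (c * e) * Q) ->
  c * b <= c * e -> c * e <= c * e * ((1 + c) * Q) ->
  (1 + c) * a + c * b <= (k + 1) * (c * e) * ((1 + c) * Q).
Proof. by lra. Qed.

Section EulerConvergence.
Context {R : realType} {d : nat} {disp : measure_display}
        {Omega : measurableType disp} (P : probability Omega R).
Hypothesis P_complete : measure_is_complete P.
Variable W : R -> Omega -> 'cV[R]_d.
Hypothesis BM : brownian_motion P W.
Local Notation FT := (FT P W).
Local Notation dW := (dW W).
Variables (f : 'cV[R]_d -> 'cV[R]_d) (sg : 'cV[R]_d -> 'M[R]_d) (S Ls : R).
Hypothesis mf : measurable_fun setT (f : bspace R d 1 -> bspace R d 1).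
Hypothesis Ls0 : 0 <= Ls.
Hypothesis sgL : forall x y, enorm (sg x - sg y) <= Ls * enorm (x - y).
Hypothesis sgS : forall x, enorm (sg x) <= S.
Variables (x : 'cV[R]_d) (V : R -> Omega -> 'cV[R]_d).
Hypothesis cV : clean_solution P W f sg x V.

Let S0 : 0 <= S. Proof. by apply: le_trans (sgS 0); exact: enorm_ge0. Qed.
Let msg : measurable_fun setT (sg : bspace R d 1 -> bspace R d d).
Proof. by apply: measurable_eLipschitz; exists Ls. Qed.
Let mV s : 0 <= s -> measurable_fun setT (V s : Omega -> bspace R d 1).
Proof. exact: (clean_measurable P_complete BM cV). Qed.
Let jV : measurable_fun setT ((fun p => V p.1 p.2) : measurableTypeR R * Omega -> bspace R d 1).
Proof. exact: (clean_joint P_complete BM cV). Qed.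

Definition sgV (s : R) (w : Omega) := sg (V s w).
Let jH : measurable_fun setT ((fun p => sgV p.1 p.2) : measurableTypeR R * Omega -> bspace R d d).
Proof. exact: (measurableT_comp msg jV). Qed.
Let aH s : 0 <= s -> measurable_fun setT (sgV s : FT s -> bspace R d d).
Proof. by move=> s0; exact: (measurableT_comp msg (cs_adapted cV s0)). Qed.
Let HK s w : enorm (sgV s w) <= S. Proof. exact: sgS. Qed.

(** Along the simple processes that define the Ito integral, [ito_step_bound] leaves the mean gap
    and arbitrarily small terms, for the square capped at any [N]; [L1_of_min] then removes the
    cap. *)
Lemma ito_riemann (h : R) (k : nat) : 0 <= h ->
  let E := fun w => enorm (noise_part f x V (k%:R * h) w - riemann_ito W sgV h k w) ^+ 2 in
  L1 P E /\ ex P E <= 4 * ex P (riemann_gap sgV h k).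
Proof.
move=> h0 E.
set tau := k%:R * h; have tau0 : 0 <= tau by rewrite mulr_ge0.
have mZ : measurable_fun setT (noise_part f x V tau : Omega -> bspace R d 1).
  apply: measurable_mxB; last exact: measurable_drift_integral.
  by apply: measurable_mxB; [exact: mV|exact: measurable_cst].
have mE : measurable_fun setT E.
  apply: measurable_funX; apply: measurable_enorm; apply: measurable_mxB => //.
  exact: (measurable_riemann_ito P_complete BM aH).
have gap0 : 0 <= ex P (riemann_gap sgV h k).
  apply: ex_ge0 => w.
  by have /andP[] := riemann_gap_bound P_complete BM S0 HK jH aH k h0 w.
apply: L1_of_min => //.
- by move=> w; rewrite exprn_ge0 ?enorm_ge0.
- by rewrite mulr_ge0.
move=> N; apply/ler_addgt0Pr => e' e'0.
(* 15 = 4 + 8 + 1 + 1 + 1: the terms 4 delta, 8 e^2, N delta / e^2 and the two probabilities with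
   their weights. The cube in [delta] makes delta / e^2 small as well. *)
pose e := Num.min 1 (e' / 15).
have e0 : 0 < e by rewrite lt_min ltr01 divr_gt0.
have e15 : 15 * e <= e' by rewrite -ler_pdivlMl// mulrC ge_min lexx orbT.
have e1 : e <= 1 by rewrite ge_min lexx.
pose q : R := 1 + N%:R.
have q0 : 0 < q by rewrite ltr_pwDl.
pose delta := e ^+ 3 / q.
have d0 : 0 < delta by rewrite divr_gt0// exprn_gt0.
have de : delta <= e.
  rewrite ler_pdivrMr//; apply: (@le_trans _ _ e); last by rewrite ler_peMr// ?lerDl// ltW.
  by rewrite -[leRHS]expr1 ler_wiXn2l// ltW.
have Nd : N%:R * (delta / e ^+ 2) <= e.
  have -> : N%:R * (delta / e ^+ 2) = e * (N%:R / q) by rewrite /delta; field; rewrite !gt_eqF.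
  by rewrite ler_piMr ?(ltW e0)// ler_pdivrMr// mul1r lerDr.
pose C := 16 * S ^+ 2 * tau + N%:R.
have C0 : 0 <= C by rewrite addr_ge0// !mulr_ge0// exprn_ge0.
have C1 : 0 < C + 1 by rewrite ltr_wpDl.
have [Sn [S1 S2]] := cs_ito cV tau0.
have [n1 H1] := pr_cvg0 S1 d0 (divr_gt0 e0 C1).
have [n2 H2] := pr_cvg0 S2 e0 (divr_gt0 e0 q0).
pose n := maxn n1 n2.
have {}H1 := H1 n (leq_maxl _ _); have {}H2 := H2 n (leq_maxr _ _).
have := @ito_step_bound _ _ _ _ P P_complete W BM sgV S S0 HK jH aH h k h0 (Sn n) _ (fun w => erefl)
  (noise_part f x V tau) delta e N%:R d0 e0 (ler0n _ _) mZ.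
rewrite -/tau -/E => le1; apply: le_trans le1 _.
have t1 : C * pr P [set w | (delta%:E <= tint tau (fun s => (enorm (sp_value (Sn n) s w - sgV s w) ^+ 2)%R))%E] <= e.
  apply: (@le_trans _ _ (C * (e / (C + 1)))); first by rewrite ler_wpM2l// ltW.
  have -> : C * (e / (C + 1)) = e * (C / (C + 1)) by field; rewrite gt_eqF.
  by rewrite ler_piMr ?(ltW e0)// ler_pdivrMr// mul1r lerDl.
have t2 : N%:R * pr P [set w | e <= enorm (sp_integral (Sn n) W tau w - noise_part f x V tau w)] <= e.
  apply: (@le_trans _ _ (N%:R * (e / q))).
    rewrite ler_wpM2l//; apply: ltW; apply: le_lt_trans H2.
    by rewrite le_eqVlt; apply/orP; left; apply/eqP; congr (pr P _); apply/seteqP; split => w /=; rewrite lee_fin.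
  have -> : N%:R * (e / q) = e * (N%:R / q) by field; rewrite gt_eqF.
  by rewrite ler_piMr ?(ltW e0)// ler_pdivrMr// mul1r lerDr.
have ee : e ^+ 2 <= e by rewrite -[leRHS]expr1 ler_wiXn2l// ltW.
move: t1 t2 Nd; rewrite /C; lra.
Qed.

Section Gronwall.
Variables (ft : 'cV[R]_d -> 'cV[R]_d) (Lf M : R).
Hypothesis Lf0 : 0 <= Lf.
Hypothesis M0 : 0 <= M.
Hypothesis ftL : forall y z, enorm (ft y - ft z) <= Lf * enorm (y - z).
Hypothesis ft_f : forall y, enorm y <= M -> ft y = f y.

(** Composing with the projection makes the drift bounded along any path, hence its time integrals
    finite; on the ball of radius [M] it agrees with [f]. *)
Definition drift_trunc y := ft (rproj M y).
Local Notation F := drift_trunc.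
Definition drift_bound : R := enorm (ft 0) + Lf * M.
Local Notation KF := drift_bound.

Let FK y : enorm (F y) <= KF.
Proof.
have -> : F y = ft 0 + (ft (rproj M y) - ft 0) by rewrite addrC subrK.
apply: le_trans (ler_enormD _ _) _; rewrite lerD2l; apply: le_trans (ftL _ _) _.
by rewrite subr0 ler_wpM2l// enorm_rproj.
Qed.
Let KF0 : 0 <= KF. Proof. exact: le_trans (enorm_ge0 _) (FK 0). Qed.
Let mft : measurable_fun setT (ft : bspace R d 1 -> bspace R d 1).
Proof. by apply: measurable_eLipschitz; exists Lf. Qed.
Let mF : measurable_fun setT (F : bspace R d 1 -> bspace R d 1).
Proof. by apply: (measurableT_comp mft); exact: measurable_rproj. Qed.

Lemma drift_trunc_lip y z : enorm (F y - F z) <= Lf * enorm (y - z).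
Proof. by apply: le_trans (ftL _ _) _; rewrite ler_wpM2l// rproj_lip. Qed.

Definition stay (t : R) : set Omega := [set w | forall s, 0 <= s -> s <= t -> enorm (V s w) <= M].

Variable h : R.
Hypothesis h0 : 0 < h.
Hypothesis h1 : h <= 1.
Let hge0 : 0 <= h := ltW h0.
Let kh0 (k : nat) : 0 <= k%:R * h. Proof. by rewrite mulr_ge0. Qed.
Let khS (k : nat) : k%:R * h <= k.+1%:R * h. Proof. by rewrite ler_wpM2r// ler_nat. Qed.
Let khD (k : nat) : k.+1%:R * h - k%:R * h = h.
Proof. by rewrite -mulrBl -natr1 addrAC subrr add0r mul1r. Qed.

(** By continuity it suffices to test the countably many times i t / (l + 1) in [0, t]. The event is
    thus known at time [t], which allows its indicator to multiply the coefficients of the next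
    step. *)
Lemma measurable_stay t : 0 <= t -> @measurable _ (FT t) (stay t).
Proof.
move=> t0.
pose Q (i l : nat) : set Omega := [set w | (i <= l.+1)%N -> enorm (V (i%:R * (t / l.+1%:R)) w) <= M].
have -> : stay t = \bigcap_i \bigcap_l Q i l.
  apply/seteqP; split => [w Hw i _ l _ il|w Hw s s0 st].
    apply: Hw; first by rewrite mulr_ge0// divr_ge0.
    by rewrite mulrA ler_pdivrMr ?ltr0n// mulrC ler_wpM2l// ler_nat.
  rewrite leNgt; apply/negP => Ms.
  have e0 : 0 < enorm (V s w) - M by rewrite subr_gt0.
  have cw : econtinuous (V ^~ w) by exact: (cs_cont cV).
  have [de de0 Hd] := cw s _ e0.
  have [sz|sp] := leP s 0.
    have s00 : s = 0 by apply/eqP; rewrite eq_le sz s0.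
    by have := Hw 0%N I 0%N I isT; rewrite mul0r -s00 leNgt Ms.
  have tp : 0 < t by exact: lt_le_trans st.
  have [l0 Hl] := mesh_lt t de0.
  have ml : 0 < t / l0.+1%:R by rewrite divr_gt0.
  have sl : s <= l0.+1%:R * (t / l0.+1%:R) by rewrite mulrC mulfVK// pnatr_eq0.
  have [j /andP[j1 j2]] := step_index ml sp sl.
  have Vj := Hw j I l0 I (ltnW (ltn_ord j)).
  have dist : `|j%:R * (t / l0.+1%:R) - s| < de.
    rewrite distrC ger0_norm ?subr_ge0 ?(ltW j1)//; apply: le_lt_trans (Hl l0 (leqnn _)).
    have : s <= (j%:R + 1) * (t / l0.+1%:R) by rewrite natr1.
    by rewrite mulrDl mul1r lerBlDl.
  have := Hd _ dist; rewrite enorm_distC => D1.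
  by have := lerB_enorm (V s w) (V (j%:R * (t / l0.+1%:R)) w); lra.
apply: bigcap_measurable => [|i _]; first by exists 0%N.
apply: bigcap_measurable => [|l _]; first by exists 0%N.
have [il|il] := boolP (i <= l.+1)%N; last first.
  rewrite (_ : Q i l = setT); first exact: measurableT.
  by apply/seteqP; split => // w _; rewrite /Q/= (negbTE il).
have tl : 0 <= i%:R * (t / l.+1%:R) by rewrite mulr_ge0// divr_ge0.
have tl1 : i%:R * (t / l.+1%:R) <= t.
  by rewrite mulrA ler_pdivrMr ?ltr0n// mulrC ler_wpM2l// ler_nat.
have m1 : measurable_fun setT ((fun w => enorm (V (i%:R * (t / l.+1%:R)) w)) : FT t -> R).
  by apply: measurable_enorm; apply: (measurable_fun_FTle tl1); exact: (cs_adapted cV).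
rewrite (_ : Q i l = setT `&` (fun w => enorm (V (i%:R * (t / l.+1%:R)) w)) @^-1` `]-oo, M]%classic).
  by apply: m1 => //; exact: measurable_itv.
rewrite setTI; apply/seteqP; split => w /=; rewrite in_itv/=; [by apply|by move=> H _].
Qed.

Definition drift_gap k w : R := path_gap (fun s => F (V s w)) h k.

Let jFV : measurable_fun setT ((fun p => F (V p.1 p.2)) : measurableTypeR R * Omega -> bspace R d 1).
Proof. exact: (measurableT_comp mF jV). Qed.
Let mFV w : measurable_fun setT ((fun s => F (V s w)) : measurableTypeR R -> bspace R d 1).
Proof. exact: (measurableT_comp jFV (@pair2_measurable _ _ (measurableTypeR R) Omega w)). Qed.

Lemma measurable_drift_gap k : measurable_fun setT (drift_gap k).
Proof.
apply/measurable_EFinP.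
pose g (p : measurableTypeR R * Omega) := enorm (F (V p.1 p.2) - rstep k h (fun s => F (V s p.2)) p.1).
rewrite (_ : _ \o _ = fun w => tint (k%:R * h) (fun s => g (s, w))); last first.
  by apply/funext => w; rewrite /= -(path_gapE k (mFV w) (fun s => FK _) hge0).
apply: measurable_tint; last by move=> p; exact: enorm_ge0.
apply: measurable_enorm; apply: measurable_mxB => //.
apply: (measurable_rstep k (h := h) (V := fun s w => F (V s w))) => // s s0.
by apply: (measurableT_comp mF); exact: mV.
Qed.

Lemma drift_gap_bound k w : 0 <= drift_gap k w <= 2 * KF * (k%:R * h).
Proof. exact: (path_gap_bound k (mFV w) (fun s => FK _) hge0). Qed.

Lemma drift_integral_gap k w : stay (k%:R * h) w ->
  enorm (drift_integral f V (k%:R * h) w - \sum_(j < k) h *: F (V (j%:R * h) w)) <= d%:R * drift_gap k w.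
Proof.
move=> sw; apply: le_trans (enorm_le_sum _) _.
apply: (@le_trans _ _ (\sum_(i < d) drift_gap k w)); last by rewrite sumr_const card_ord mulr_natl.
apply: ler_sum => i _; rewrite big_ord1 !mxE summxE.
have -> : \int[lebesgue_measure]_(s in `[0%R, k%:R * h]) f (V s w) i ord0
    = \int[lebesgue_measure]_(s in `[0%R, k%:R * h]) (F (V s w)) i ord0.
  rewrite /Rintegral; congr fine; apply: eq_integral => s.
  rewrite inE/= in_itv/= => /andP[s0 st].
  by rewrite /drift_trunc rproj_id ?ft_f//; exact: sw.
rewrite (eq_bigr (fun l : 'I_k => h * F (V (l%:R * h) w) i ord0)); last by move=> l _; rewrite mxE.
exact: (@integral_gap_le R d 1 (fun s => F (V s w)) KF h k (mFV w) (fun s => FK _) hge0 i ord0).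
Qed.

Fixpoint euler_chain k w : 'cV[R]_d :=
  if k is k'.+1 then euler_step ft sg h (euler_chain k' w) (dW (k'%:R * h) (k'.+1%:R * h) w) else x.
Local Notation X := euler_chain.

(* The Euler scheme with the true solution [V] in its coefficients. *)
Definition euler_driven k w : 'cV[R]_d :=
  x + \sum_(j < k) h *: F (V (j%:R * h) w) + riemann_ito W sgV h k w.
Local Notation Y := euler_driven.

Lemma measurable_chain k : measurable_fun setT (X k : FT (k%:R * h) -> bspace R d 1).
Proof.
elim: k => [|k IH]; first exact: measurable_cst.
have mX := measurable_fun_FTle (khS k) IH.
apply: measurable_mxD.
  apply: measurable_mxD => //; apply: (@measurable_mxZ _ _ _ _ _ (fun=> h)) => //.
  exact: (measurableT_comp mft mX).
apply: measurable_mulmx; first exact: (measurableT_comp msg mX).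
by apply: measurable_FT_dW.
Qed.

Lemma euler_drivenS k w : Y k.+1 w = Y k w + h *: F (V (k%:R * h) w)
  + sgV (k%:R * h) w *m dW (k%:R * h) (k.+1%:R * h) w.
Proof.
rewrite /euler_driven /riemann_ito !big_ord_recr/=.
move: (\sum_(i < k) _) (\sum_(i < k) _) (h *: _) (sgV _ _ *m _) => a b c e.
by apply/matrixP => i j; rewrite !mxE; ring.
Qed.

Lemma measurable_driven k : measurable_fun setT (Y k : FT (k%:R * h) -> bspace R d 1).
Proof.
elim: k => [|k IH].
  rewrite (_ : Y 0 = fun=> x); first exact: measurable_cst.
  by apply/funext => w; rewrite /euler_driven /riemann_ito !big_ord0 !addr0.
rewrite (_ : Y k.+1 = fun w => Y k w + h *: F (V (k%:R * h) w)
  + sgV (k%:R * h) w *m dW (k%:R * h) (k.+1%:R * h) w); last by apply/funext => w; exact: euler_drivenS.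
have mVk := measurable_fun_FTle (khS k) (cs_adapted cV (kh0 k)).
apply: measurable_mxD.
  apply: measurable_mxD; first exact: measurable_fun_FTle IH.
  by apply: (@measurable_mxZ _ _ _ _ _ (fun=> h)) => //; exact: (measurableT_comp mF mVk).
apply: measurable_mulmx; first exact: (measurableT_comp msg mVk).
by apply: measurable_FT_dW.
Qed.

Definition euler_eps k : R :=
  8 * ex P (riemann_gap sgV h k) + 2 * d%:R ^+ 2 * (2 * KF * (k%:R * h)) * ex P (drift_gap k).

Definition stayI k w : R := \1_(stay (k%:R * h)) w.

Let stayI01 k w : stayI k w = 0 \/ (stayI k w = 1 /\ stay (k%:R * h) w).
Proof.
rewrite /stayI indicE; have [H|H] := boolP (w \in _); last by left.
by right; split=> //; exact: set_mem.
Qed.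
Let mstayI k : measurable_fun setT (stayI k : FT (k%:R * h) -> R).
Proof. by apply: measurable_indic; apply: measurable_stay. Qed.

(** While the path stays in the ball, V - Y is the error of the Riemann sums of the Ito integral
    plus the quadrature error of the drift. The square of the latter is bounded by its maximum times
    itself, so convergence in mean of [drift_gap] is enough. *)
Lemma driven_error k :
  L1 P (fun w => stayI k w * enorm (V (k%:R * h) w - Y k w) ^+ 2) /\
  ex P (fun w => stayI k w * enorm (V (k%:R * h) w - Y k w) ^+ 2) <= euler_eps k.
Proof.
have [l1 e1] := ito_riemann k hge0.
set E := (fun w => enorm (noise_part f x V (k%:R * h) w - riemann_ito W sgV h k w) ^+ 2) in l1 e1.
have lG : L1 P (drift_gap k).
  apply: (@L1_bounded _ _ _ _ _ (2 * KF * (k%:R * h))); first exact: measurable_drift_gap.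
  by move=> w; have /andP[g0 g1] := drift_gap_bound k w; rewrite ger0_norm.
pose C := 2 * d%:R ^+ 2 * (2 * KF * (k%:R * h)).
have C0 : 0 <= C by rewrite !mulr_ge0 ?exprn_ge0.
have bd w : stayI k w * enorm (V (k%:R * h) w - Y k w) ^+ 2 <= 2 * E w + C * drift_gap k w.
  have /andP[g0 g1] := drift_gap_bound k w.
  have E0 : 0 <= E w by rewrite exprn_ge0 ?enorm_ge0.
  have [->|[-> sw]] := stayI01 k w; first by rewrite mul0r; apply: addr_ge0; apply: mulr_ge0.
  rewrite mul1r.
  have -> : V (k%:R * h) w - Y k w = (noise_part f x V (k%:R * h) w - riemann_ito W sgV h k w)
     + (drift_integral f V (k%:R * h) w - \sum_(j < k) h *: F (V (j%:R * h) w)).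
    rewrite /noise_part /euler_driven.
    move: (\sum_(j < k) _) (riemann_ito _ _ _ _ _) (drift_integral _ _ _ _) => a b c.
    by apply/matrixP => i j; rewrite !mxE; ring.
  apply: le_trans (enorm_sqrD_le _ _) _; rewrite lerD2l.
  have := drift_integral_gap sw; move=> dg.
  apply: (@le_trans _ _ (2 * (d%:R * drift_gap k w) ^+ 2)).
    by rewrite ler_wpM2l// lerXn2r ?nnegrE ?enorm_ge0 ?mulr_ge0.
  have -> : 2 * (d%:R * drift_gap k w) ^+ 2 = 2 * d%:R ^+ 2 * (drift_gap k w) * drift_gap k w by ring.
  by rewrite /C ler_wpM2r// ler_wpM2l// mulr_ge0 ?exprn_ge0.
have lb : L1 P (fun w => 2 * E w + C * drift_gap k w) by apply: L1D; exact: L1Z.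
have l : L1 P (fun w => stayI k w * enorm (V (k%:R * h) w - Y k w) ^+ 2).
  apply: L1_le lb => [|w].
    apply: (measurable_fun_FT P_complete BM (t := k%:R * h)).
    apply: measurable_funM => //; apply: measurable_funX; apply: measurable_enorm.
    apply: measurable_mxB; last exact: measurable_driven.
    exact: (cs_adapted cV (kh0 k)).
  by rewrite ger0_norm ?bd// mulr_ge0 ?exprn_ge0 ?enorm_ge0.
split=> //; apply: le_trans (ex_le l lb bd) _.
rewrite exD; [|exact: L1Z|exact: L1Z]; rewrite !exZ// /euler_eps -/C lerD2r; lra.
Qed.

(** From (a + h b)^2 <= (1 + h) a^2 + 2 h b^2 for h <= 1, with b^2 and the squared noise difference
    bounded by Lf^2 and Ls^2 times |V - X|^2 <= 2 |Y - X|^2 + 2 |V - Y|^2. *)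
Definition gronwall_rate : R := 1 + 4 * Lf ^+ 2 + 2 * Ls ^+ 2.
Local Notation C1 := gronwall_rate.

Let C10 : 0 <= C1. Proof. by rewrite /gronwall_rate !addr_ge0// mulr_ge0// exprn_ge0. Qed.

(** The increment of Y - X has its coefficients evaluated at V and at X. Passing from V to X through
    Y turns their difference into a multiple of the current error plus the driven error, which acts
    as a source. *)
Lemma gronwall_step k : 
  let e j w := stayI j w * enorm (Y j w - X j w) ^+ 2 in
  let v w := stayI k w * enorm (V (k%:R * h) w - Y k w) ^+ 2 in
  L1 P (e k) -> L1 P (e k.+1) /\
    ex P (e k.+1) <= (1 + C1 * h) * ex P (e k) + C1 * h * ex P v.
Proof.
move=> e v le_.
have [lv _] := driven_error k; rewrite -/v in lv.
set tk := k%:R * h; set tk1 := k.+1%:R * h.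
have tk0 : 0 <= tk by exact: kh0.
have tkk : tk <= tk1 by exact: khS.
(* The indicator at time [tk] is placed inside the coefficients, which remain known at [tk]: the
   cross term with the next increment then has mean zero and the noise contributes its exact
   variance. *)
pose u w : 'cV[R]_d := stayI k w *: (Y k w - X k w + h *: (F (V tk w) - ft (X k w))).
pose Mx w : 'M[R]_d := stayI k w *: (sg (V tk w) - sg (X k w)).
have mVk := cs_adapted cV tk0.
have mXk : measurable_fun setT (X k : FT tk -> bspace R d 1) by exact: measurable_chain.
have mYk : measurable_fun setT (Y k : FT tk -> bspace R d 1) by exact: measurable_driven.
have mu : measurable_fun setT (u : FT tk -> bspace R d 1).
  have m1 : measurable_fun setT ((fun w => Y k w - X k w) : FT tk -> bspace R d 1) by exact: measurable_mxB.
  have m2 : measurable_fun setT ((fun w => F (V tk w) - ft (X k w)) : FT tk -> bspace R d 1).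
    by apply: measurable_mxB; [exact: (measurableT_comp mF mVk)|exact: (measurableT_comp mft mXk)].
  have m3 := measurable_mxZ (@measurable_cst _ _ (FT tk) R setT h) m2.
  have mI : measurable_fun setT (stayI k : FT tk -> R) by exact: mstayI.
  have m4 := measurable_mxD m1 m3.
  have := measurable_mxZ mI m4; exact.
have mM : measurable_fun setT (Mx : FT tk -> bspace R d d).
  have m1 : measurable_fun setT ((fun w => sg (V tk w) - sg (X k w)) : FT tk -> bspace R d d).
    by apply: measurable_mxB; [exact: (measurableT_comp msg mVk)|exact: (measurableT_comp msg mXk)].
  have mI : measurable_fun setT (stayI k : FT tk -> R) by exact: mstayI.
  have := measurable_mxZ mI m1; exact.
have MK w : enorm (Mx w) <= 2 * S.
  rewrite /Mx enormZ; have [->|[-> _]] := stayI01 k w; first by rewrite normr0 mul0r mulr_ge0.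
  rewrite normr1 mul1r; apply: le_trans (ler_enormB _ _) _.
  by have := sgS (V tk w); have := sgS (X k w); lra.
have [lMM eMM] := ex_bilinear_dW P_complete BM tk0 tkk mM mM MK MK.
have ptw w : enorm (u w) ^+ 2 + h * mdot (Mx w) (Mx w) <= (1 + C1 * h) * e k w + C1 * h * v w.
  rewrite /u /Mx /e /v; have [->|[-> sw]] := stayI01 k w.
    by rewrite !scale0r enorm0 mdot0l !mul0r !mulr0 expr0n addr0.
  rewrite !scale1r !mul1r -enorm_sqr -/tk.
  have VM : enorm (V tk w) <= M by apply: sw.
  have FE : F (V tk w) = ft (V tk w) by rewrite /drift_trunc rproj_id.
  rewrite FE.
  have b1 := ftL (V tk w) (X k w); have b2 := sgL (V tk w) (X k w).
  have vx : enorm (V tk w - X k w) ^+ 2 <= 2 * enorm (Y k w - X k w) ^+ 2 + 2 * enorm (V tk w - Y k w) ^+ 2.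
    have -> : V tk w - X k w = (Y k w - X k w) + (V tk w - Y k w).
      by apply/matrixP => i j; rewrite !mxE; ring.
    exact: enorm_sqrD_le.
  move: b1 b2 vx; set a := enorm (Y k w - X k w); set b := enorm (ft _ - ft _).
  set c := enorm (sg _ - sg _); set q := enorm (V tk w - X k w); set p := enorm (V tk w - Y k w).
  move=> b1 b2 vx.
  have a0 : 0 <= a := enorm_ge0 _. have b0 : 0 <= b := enorm_ge0 _.
  have c0 : 0 <= c := enorm_ge0 _. have q0 : 0 <= q := enorm_ge0 _.
  have t1 : enorm (Y k w - X k w + h *: (ft (V tk w) - ft (X k w))) ^+ 2 <= (a + h * b) ^+ 2.
    rewrite lerXn2r ?nnegrE ?enorm_ge0 ?addr_ge0 ?mulr_ge0//.
    by apply: le_trans (ler_enormD _ _) _; rewrite enormZ ger0_norm.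
  have t2 : b ^+ 2 <= Lf ^+ 2 * q ^+ 2 by rewrite -exprMn lerXn2r ?nnegrE ?mulr_ge0.
  have t3 : c ^+ 2 <= Ls ^+ 2 * q ^+ 2 by rewrite -exprMn lerXn2r ?nnegrE ?mulr_ge0.
  have t4 : (a + h * b) ^+ 2 <= (1 + h) * a ^+ 2 + 2 * h * b ^+ 2.
    have hh : h ^+ 2 <= h by have h1' := h1; rewrite expr2 ler_piMl.
    have := ler_wpM2r (sqr_ge0 b) hh; have := mulr_ge0 hge0 (sqr_ge0 (a - b)); lra.
  have t5 := ler_wpM2l (mulr_ge0 hge0 (sqr_ge0 Lf)) vx.
  have t6 := ler_wpM2l (mulr_ge0 hge0 (sqr_ge0 Ls)) vx.
  have t7 := ler_wpM2l hge0 t2; have t8 := ler_wpM2l hge0 t3.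
  have p0 : 0 <= h * p ^+ 2 by rewrite mulr_ge0 ?sqr_ge0.
  rewrite /gronwall_rate; move: t1 t4 t5 t6 t7 t8 p0.
  move: (enorm (Y k w - X k w + h *: (ft (V tk w) - ft (X k w)))) => T1; move: h => hh; lra.
have lr : L1 P (fun w => (1 + C1 * h) * e k w + C1 * h * v w) by apply: L1D; exact: L1Z.
have MM0 w : 0 <= mdot (Mx w) (Mx w) by rewrite -enorm_sqr exprn_ge0 ?enorm_ge0.
have lu : L1 P (fun w => enorm (u w) ^+ 2).
  apply: L1_le lr => [|w].
    by apply: (measurable_fun_FT P_complete BM (t := tk)); apply: measurable_funX; exact: measurable_enorm.
  rewrite ger0_norm ?exprn_ge0 ?enorm_ge0//; apply: le_trans (ptw w).
  by rewrite lerDl mulr_ge0.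
have lM : L1 P (fun w => mdot (Mx w) (Mx w)).
  apply: (@L1_bounded _ _ _ _ _ (2 * S * (2 * S))) => [|w].
    by apply: (measurable_fun_FT P_complete BM (t := tk)); exact: measurable_mdot.
  apply: le_trans (normr_mdot _ _) _.
  by apply: ler_pM; rewrite ?enorm_ge0.
pose vx w := (Mx w)^T *m u w.
have mvx : measurable_fun setT (vx : FT tk -> bspace R d 1).
  by apply: measurable_mulmx => //; exact: measurable_trmx.
have lvx : L1 P (fun w => enorm (vx w)).
  have lu1 := L1_enorm_sqr (measurable_fun_FT P_complete BM mu) lu.
  apply: L1_le (L1Z (2 * S) lu1) => [|w].
    by apply: (measurable_fun_FT P_complete BM (t := tk)); exact: measurable_enorm.
  rewrite ger0_norm ?enorm_ge0//; apply: le_trans (enorm_mulmx _ _) _.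
  by rewrite enorm_tr ler_wpM2r ?enorm_ge0.
have [lc ec] := ex_mdot_dW P_complete BM tk0 tkk mvx lvx.
pose dd w := dW tk tk1 w.
have full w : enorm (u w + Mx w *m dd w) ^+ 2
    = enorm (u w) ^+ 2 + 2 * mdot (vx w) (dd w) + mdot (Mx w *m dd w) (Mx w *m dd w).
  by rewrite enorm_sqrD -enorm_sqr /vx mdot_mulmxl trmxK.
have lf : L1 P (fun w => enorm (u w + Mx w *m dd w) ^+ 2).
  rewrite (_ : (fun w => _) = fun w => enorm (u w) ^+ 2 + 2 * mdot (vx w) (dd w) + mdot (Mx w *m dd w) (Mx w *m dd w)).
    by apply: L1D => //; apply: L1D => //; exact: L1Z.
  by apply/funext => w; exact: full.
have ek1 w : e k.+1 w <= enorm (u w + Mx w *m dd w) ^+ 2.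
  rewrite /e; have [->|[-> sw]] := stayI01 k.+1 w; first by rewrite mul0r exprn_ge0 ?enorm_ge0.
  (* Staying in the ball up to the later time implies it up to the earlier one, so the indicator of
     the new step may be bounded by the one already in the coefficients. *)
  have sk : stay tk w by move=> s s0 st; apply: sw => //; exact: le_trans st tkk.
  have I1 : stayI k w = 1 by rewrite /stayI indicE mem_set.
  rewrite mul1r /u /Mx I1 !scale1r le_eqVlt; apply/orP; left; apply/eqP; congr (enorm _ ^+ 2).
  rewrite euler_drivenS /= /euler_step mulmxBl /sgV -/tk -/tk1 -/(dd w).
  move: (sg (V tk w) *m dd w) (sg (X k w) *m dd w) => a b.
  by apply/matrixP => i j; rewrite !mxE; ring.
have lek1 : L1 P (e k.+1).
  apply: L1_le lf => [|w].
    apply: (measurable_fun_FT P_complete BM (t := tk1)).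
    apply: measurable_funM; first exact: mstayI.
    apply: measurable_funX; apply: measurable_enorm; apply: measurable_mxB.
      exact: measurable_driven.
    exact: measurable_chain.
  rewrite ger0_norm; first exact: ek1.
  rewrite /e mulr_ge0 ?exprn_ge0 ?enorm_ge0//.
split=> //; apply: le_trans (ex_le lek1 lf ek1) _.
have -> : ex P (fun w => enorm (u w + Mx w *m dd w) ^+ 2)
   = ex P (fun w => enorm (u w) ^+ 2 + h * mdot (Mx w) (Mx w)).
  rewrite (_ : (fun w => enorm (u w + _) ^+ 2) = fun w => enorm (u w) ^+ 2 + 2 * mdot (vx w) (dd w) + mdot (Mx w *m dd w) (Mx w *m dd w)); last first.
    by apply/funext => w; exact: full.
  rewrite exD//; last by apply: L1D => //; exact: L1Z.
  rewrite exD//; last exact: L1Z.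
  rewrite exZ// ec mulr0 addr0 eMM khD exD//; last exact: L1Z.
  by rewrite exZ.
have lum : L1 P (fun w => enorm (u w) ^+ 2 + h * mdot (Mx w) (Mx w)) by apply: L1D => //; exact: L1Z.
apply: le_trans (ex_le lum lr ptw) _.
by rewrite exD; [|exact: L1Z|exact: L1Z]; rewrite !exZ.
Qed.

Lemma gronwall eps n : 0 <= eps -> (forall k, (k <= n)%N -> euler_eps k <= eps) ->
  forall k, (k <= n)%N ->
  L1 P (fun w => stayI k w * enorm (Y k w - X k w) ^+ 2) /\
  ex P (fun w => stayI k w * enorm (Y k w - X k w) ^+ 2) <= k%:R * (C1 * h * eps) * (1 + C1 * h) ^+ k.
Proof.
move=> eps0 He; elim=> [|k IH] kn.
  rewrite (_ : (fun w => _) = fun=> 0); first by split; [exact: L1_cst|rewrite ex_cst !mul0r].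
  by apply/funext => w; rewrite /euler_driven /riemann_ito !big_ord0 !addr0 /= subrr enorm0 expr0n mulr0.
have [lk ek] := IH (ltnW kn).
have [l1 e1] := gronwall_step lk; split=> //.
apply: le_trans e1 _.
have [_ ev] := driven_error k.
have {}ev := le_trans ev (He k (ltnW kn)).
have C1h : 0 <= C1 * h by rewrite mulr_ge0.
have q1 : 0 <= 1 + C1 * h by rewrite addr_ge0.
have t1 := ler_wpM2l q1 ek; have t2 := ler_wpM2l C1h ev.
have t3 : C1 * h * eps <= C1 * h * eps * (1 + C1 * h) ^+ k.+1.
  by rewrite ler_peMr ?mulr_ge0// exprn_ege1// lerDl.
rewrite -natr1 (exprS _ k); move: t3; rewrite (exprS _ k).
by move=> t3; exact: gronwall_arith t1 t2 t3.
Qed.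

End Gronwall.

End EulerConvergence.

Section TintMono.
Context {R : realType}.
Notation mu := (@lebesgue_measure R).

Lemma tint_widen a b (g : R -> R) : a <= b -> measurable_fun setT g -> (forall s, 0 <= g s) ->
  (tint a g <= tint b g)%E.
Proof.
move=> ab mg g0.
rewrite /tint; apply: ge0_subset_integral; [exact: measurable_itv0|exact: measurable_itv0|..].
- by apply/measurable_EFinP; exact: measurable_funS mg.
- by move=> s _; rewrite lee_fin.
- by move=> s /=; rewrite !in_itv/= => /andP[-> sa]; exact: le_trans ab.
Qed.

Lemma eq_tint a (g1 g2 : R -> R) : (forall s, s <= a -> g1 s = g2 s) -> tint a g1 = tint a g2.
Proof.
by move=> E; apply: eq_integral => s; rewrite inE/= in_itv/= => /andP[_ sa]; rewrite E.
Qed.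

(** The step approximation on fewer intervals is a restriction of the one on more. The gap at the
    final time thus dominates all earlier ones, and a single limit serves every step of the Gronwall
    induction; [riemann_gap_mono] has the same purpose. *)
Lemma path_gap_mono {m n} (phi : R -> 'M[R]_(m, n)) (K h : R) k l :
  measurable_fun setT (phi : measurableTypeR R -> bspace R m n) -> (forall s, enorm (phi s) <= K) ->
  0 < h -> (k <= l)%N -> path_gap phi h k <= path_gap phi h l.
Proof.
move=> mphi phiK h0 kl; have e1 := path_gapE k mphi phiK (ltW h0); have e2 := path_gapE l mphi phiK (ltW h0).
suff : (tint (k%:R * h) (fun s => enorm (phi s - rstep k h phi s)) <=
   tint (l%:R * h) (fun s => enorm (phi s - rstep l h phi s)))%E by rewrite e1 e2 lee_fin.
move=> {e1 e2}.
rewrite (eq_tint (g2 := fun s => enorm (phi s - rstep l h phi s))).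
  apply: tint_widen => [||s]; last exact: enorm_ge0.
    by rewrite ler_wpM2r ?ler_nat// ltW.
  by apply: measurable_enorm; apply: measurable_mxB => //; exact: measurable_rstep_path.
by move=> s sk; rewrite (rstep_mono _ h0 kl sk).
Qed.

End TintMono.

Section EulerLimit.
Context {R : realType} {d : nat} {disp : measure_display}
        {Omega : measurableType disp} (P : probability Omega R).
Hypothesis P_complete : measure_is_complete P.
Variable W : R -> Omega -> 'cV[R]_d.
Hypothesis BM : brownian_motion P W.
Local Notation FT := (FT P W).
Local Notation dW := (dW W).
Variables (f : 'cV[R]_d -> 'cV[R]_d) (sg : 'cV[R]_d -> 'M[R]_d) (S Ls : R).
Hypothesis mf : measurable_fun setT (f : bspace R d 1 -> bspace R d 1).
Hypothesis Ls0 : 0 <= Ls.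
Hypothesis sgL : forall x y, enorm (sg x - sg y) <= Ls * enorm (x - y).
Hypothesis sgS : forall x, enorm (sg x) <= S.
Variables (x : 'cV[R]_d) (V : R -> Omega -> 'cV[R]_d).
Hypothesis cV : clean_solution P W f sg x V.
Variables (ft : 'cV[R]_d -> 'cV[R]_d) (Lf M : R).
Hypothesis Lf0 : 0 <= Lf.
Hypothesis M0 : 0 <= M.
Hypothesis ftL : forall y z, enorm (ft y - ft z) <= Lf * enorm (y - z).
Hypothesis ft_f : forall y, enorm y <= M -> ft y = f y.

Let S0 : 0 <= S. Proof. by apply: le_trans (sgS 0); exact: enorm_ge0. Qed.
Let msg : measurable_fun setT (sg : bspace R d 1 -> bspace R d d).
Proof. by apply: measurable_eLipschitz; exists Ls. Qed.
Let mft : measurable_fun setT (ft : bspace R d 1 -> bspace R d 1).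
Proof. by apply: measurable_eLipschitz; exists Lf. Qed.
Local Notation F := (drift_trunc ft M).
Local Notation KF := (drift_bound ft Lf M).
Let mF : measurable_fun setT (F : bspace R d 1 -> bspace R d 1).
Proof. by apply: (measurableT_comp mft); exact: measurable_rproj. Qed.
Let FK y : enorm (F y) <= KF.
Proof.
have -> : F y = ft 0 + (ft (rproj M y) - ft 0) by rewrite addrC subrK.
apply: le_trans (ler_enormD _ _) _; rewrite lerD2l; apply: le_trans (ftL _ _) _.
by rewrite subr0 ler_wpM2l// enorm_rproj.
Qed.
Let KF0 : 0 <= KF. Proof. exact: le_trans (enorm_ge0 _) (FK 0). Qed.
Let mV s : 0 <= s -> measurable_fun setT (V s : Omega -> bspace R d 1).
Proof. exact: (clean_measurable P_complete BM cV). Qed.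
Let jV : measurable_fun setT ((fun p => V p.1 p.2) : measurableTypeR R * Omega -> bspace R d 1).
Proof. exact: (clean_joint P_complete BM cV). Qed.
Let jH : measurable_fun setT ((fun p => sgV sg V p.1 p.2) : measurableTypeR R * Omega -> bspace R d d).
Proof. exact: (measurableT_comp msg jV). Qed.
Let aH s : 0 <= s -> measurable_fun setT (sgV sg V s : FT s -> bspace R d d).
Proof. by move=> s0; exact: (measurableT_comp msg (cs_adapted cV s0)). Qed.
Let HK s w : enorm (sgV sg V s w) <= S. Proof. exact: sgS. Qed.
Let jFV : measurable_fun setT ((fun p => F (V p.1 p.2)) : measurableTypeR R * Omega -> bspace R d 1).
Proof. exact: (measurableT_comp mF jV). Qed.
Let mFV w : measurable_fun setT ((fun s => F (V s w)) : measurableTypeR R -> bspace R d 1).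
Proof. exact: (measurableT_comp jFV (@pair2_measurable _ _ (measurableTypeR R) Omega w)). Qed.

Let econtinuous_lip m n (phi : 'cV[R]_d -> 'M[R]_(m, n)) (L : R) w : 0 <= L ->
  (forall y z, enorm (phi y - phi z) <= L * enorm (y - z)) -> econtinuous (fun s => phi (V s w)).
Proof.
move=> L0 phiL s e e0; have L1 : 0 < L + 1 by rewrite ltr_wpDl.
have [de de0 H] := cs_cont cV w s (divr_gt0 e0 L1).
exists de => // u us; apply: le_lt_trans (phiL _ _) _.
have := H u us; rewrite ltr_pdivlMr// mulrC; apply: le_lt_trans.
by rewrite ler_wpM2r ?enorm_ge0// lerDl.
Qed.

Lemma riemann_gap_mono (h : R) k l w : 0 < h -> (k <= l)%N ->
  riemann_gap (sgV sg V) h k w <= riemann_gap (sgV sg V) h l w.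
Proof.
move=> h0 kl; have hh := ltW h0.
have e1 := tint_gap P_complete BM S0 HK jH aH k hh w; have e2 := tint_gap P_complete BM S0 HK jH aH l hh w.
suff : (tint (k%:R * h) (fun s => (enorm (sgV sg V s w - riemann_step (sgV sg V) h k s w) ^+ 2)%R) <=
   tint (l%:R * h) (fun s => (enorm (sgV sg V s w - riemann_step (sgV sg V) h l s w) ^+ 2)%R))%E.
  by rewrite e1 e2 lee_fin.
move=> {e1 e2}.
rewrite (eq_tint (g2 := fun s => enorm (sgV sg V s w - riemann_step (sgV sg V) h l s w) ^+ 2)).
  apply: tint_widen => [||s]; last by rewrite exprn_ge0 ?enorm_ge0.
    by rewrite ler_wpM2r ?ler_nat.
  apply: measurable_funX; apply: measurable_enorm; apply: measurable_mxB.
    exact: (measurableT_comp jH (@pair2_measurable _ _ (measurableTypeR R) Omega w)).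
  by apply: (@measurable_rstep_path R d d (sgV sg V ^~ w) h l).
by move=> s sk; have := rstep_mono (sgV sg V ^~ w) h0 kl sk; rewrite /rstep /riemann_step => ->.
Qed.

Lemma ex_riemann_gap_cvg (t : R) : 0 < t ->
  (fun n => ex P (riemann_gap (sgV sg V) (t / n.+1%:R) n.+1)) @ \oo --> 0.
Proof.
move=> t0.
have hn n : 0 <= t / n.+1%:R by rewrite divr_ge0// ltW.
have tE n : n.+1%:R * (t / n.+1%:R) = t by rewrite mulrC mulfVK// pnatr_eq0.
pose g n (p : measurableTypeR R * Omega) :=
  enorm (sgV sg V p.1 p.2 - rstep n.+1 (t / n.+1%:R) (sgV sg V ^~ p.2) p.1) ^+ 2.
have gE : (fun n => ex P (riemann_gap (sgV sg V) (t / n.+1%:R) n.+1)) =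
    fun n => ex P (fun w => fine (tint t (fun s => g n (s, w)))).
  by apply/funext => n; congr (ex P _); apply/funext => w; rewrite /riemann_gap tE.
rewrite gE {gE tE}.
apply: (@ex_tint_cvg0 R _ Omega P g (4 * S ^+ 2) t (ltW t0)).
- move=> n; apply: measurable_funX; apply: measurable_enorm; apply: measurable_mxB => //.
  apply: measurable_rstep => // s s0; exact: (measurable_fun_FT P_complete BM (aH s0)).
- move=> n p; rewrite exprn_ge0 ?enorm_ge0//=.
  apply: sqr_dist_le => //; apply: enorm_rstep => // s; exact: HK.
- move=> w s s0 st; apply/cvg0_eps => e e0.
  have m0 : 0 < Num.min 1 e by rewrite lt_min ltr01.
  have [n0 H] := rstep_cvg (econtinuous_lip w Ls0 sgL) s0 st m0.
  exists n0 => n /H; rewrite lt_min => /andP[a1 ae].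
  rewrite ger0_norm ?exprn_ge0 ?enorm_ge0//; apply: le_lt_trans ae.
  by rewrite /g/= -[leRHS]expr1 ler_wiXn2l ?enorm_ge0// ltW.
Qed.

Lemma ex_drift_gap_cvg (t : R) : 0 < t ->
  (fun n => ex P (drift_gap V ft M (t / n.+1%:R) n.+1)) @ \oo --> 0.
Proof.
move=> t0.
have hn n : 0 <= t / n.+1%:R by rewrite divr_ge0// ltW.
have tE n : n.+1%:R * (t / n.+1%:R) = t by rewrite mulrC mulfVK// pnatr_eq0.
pose g n (p : measurableTypeR R * Omega) :=
  enorm (F (V p.1 p.2) - rstep n.+1 (t / n.+1%:R) (fun s => F (V s p.2)) p.1).
have gE : (fun n => ex P (drift_gap V ft M (t / n.+1%:R) n.+1)) =
    fun n => ex P (fun w => fine (tint t (fun s => g n (s, w)))).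
  by apply/funext => n; congr (ex P _); apply/funext => w; rewrite /drift_gap /path_gap tE.
rewrite gE {gE tE}.
apply: (@ex_tint_cvg0 R _ Omega P g (2 * KF) t (ltW t0)).
- move=> n; apply: measurable_enorm; apply: measurable_mxB => //.
  apply: (measurable_rstep n.+1 (V := fun s w => F (V s w))) => // s s0; exact: (measurableT_comp mF (mV s0)).
- move=> n p; rewrite enorm_ge0/=.
  apply: le_trans (ler_enormB _ _) _.
  have := @enorm_rstep R d 1 (fun s => F (V s p.2)) KF (t / n.+1%:R) n.+1 (fun s => FK _) (hn n) p.1.
  by have := FK (V p.1 p.2); lra.
- move=> w s s0 st; apply/cvg0_eps => e e0.
  have Fl y z : enorm (F y - F z) <= Lf * enorm (y - z) by exact: drift_trunc_lip.
  have [n0 H] := rstep_cvg (econtinuous_lip w Lf0 Fl) s0 st e0.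
  by exists n0 => n /H; rewrite ger0_norm ?enorm_ge0.
Qed.

Lemma euler_eps_small (t e : R) : 0 < t -> 0 < e -> exists n0, forall n k, (n0 <= n)%N -> (k <= n.+1)%N ->
  euler_eps P sg V ft Lf M (t / n.+1%:R) k <= e.
Proof.
move=> t0 e0; pose C := 2 * d%:R ^+ 2 * (2 * KF * t).
have C0 : 0 <= C by rewrite /C mulr_ge0 ?mulr_ge0 ?exprn_ge0 ?(ltW t0).
have ea : 0 < e / 16 by rewrite divr_gt0.
have eb : 0 < e / 2 / (C + 1) by rewrite !divr_gt0 ?ltr_wpDl.
have [n1 H1] := (cvg0_eps _).1 (ex_riemann_gap_cvg t0) _ ea.
have [n2 H2] := (cvg0_eps _).1 (ex_drift_gap_cvg t0) _ eb.
exists (maxn n1 n2) => n k; rewrite geq_max => /andP[/H1 {}H1 /H2 {}H2] kn.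
have h0 : 0 < t / n.+1%:R by rewrite divr_gt0.
have hh := ltW h0.
have tE : n.+1%:R * (t / n.+1%:R) = t by rewrite mulrC mulfVK// pnatr_eq0.
have kt : k%:R * (t / n.+1%:R) <= t by rewrite -[leRHS]tE ler_wpM2r// ler_nat.
have b1 : ex P (riemann_gap (sgV sg V) (t / n.+1%:R) k) <= e / 16.
  apply: le_trans (le_trans (ler_norm _) (ltW H1)).
  apply: ex_le => [||w]; [exact: (L1_riemann_gap P_complete BM S0 HK jH aH)|exact: (L1_riemann_gap P_complete BM S0 HK jH aH)|exact: riemann_gap_mono].
have lG j : L1 P (drift_gap V ft M (t / n.+1%:R) j).
  apply: (@L1_bounded _ _ _ _ _ (2 * KF * (j%:R * (t / n.+1%:R)))).
    exact: (measurable_drift_gap P_complete BM cV Lf0 M0 ftL h0).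
  by move=> w; have /andP[g0 g1] := drift_gap_bound P_complete BM cV Lf0 M0 ftL h0 j w; rewrite ger0_norm.
have b2 : ex P (drift_gap V ft M (t / n.+1%:R) k) <= e / 2 / (C + 1).
  apply: le_trans (le_trans (ler_norm _) (ltW H2)).
  apply: ex_le; [exact: lG|exact: lG|move=> w; exact: (path_gap_mono (mFV w) (fun s => FK _) h0 kn)].
have g0 : 0 <= ex P (drift_gap V ft M (t / n.+1%:R) k).
  by apply: ex_ge0 => w; have /andP[] := drift_gap_bound P_complete BM cV Lf0 M0 ftL h0 k w.
rewrite /euler_eps.
have c1 : 2 * d%:R ^+ 2 * (2 * KF * (k%:R * (t / n.+1%:R))) * ex P (drift_gap V ft M (t / n.+1%:R) k) <= C * (e / 2 / (C + 1)).
  apply: ler_pM => //.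
    apply: mulr_ge0; first by rewrite mulr_ge0 ?exprn_ge0.
    by apply: mulr_ge0; apply: mulr_ge0.
  by rewrite /C !ler_wpM2l// ?mulr_ge0 ?exprn_ge0.
have c2 : C * (e / 2 / (C + 1)) <= e / 2.
  have -> : C * (e / 2 / (C + 1)) = (e / 2) * (C / (C + 1)) by field; rewrite gt_eqF// ltr_wpDl.
  by rewrite ler_piMr ?divr_ge0 ?(ltW e0)// ler_pdivrMr ?ltr_wpDl// mul1r lerDl.
have b8 : 8 * ex P (riemann_gap (sgV sg V) (t / n.+1%:R) k) <= e / 2 by rewrite [leRHS](_ : _ = 8 * (e / 16)) ?ler_wpM2l//; field.
by rewrite [leRHS](_ : e = e / 2 + e / 2) ?(lerD b8 (le_trans c1 c2))//; field.
Qed.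

Lemma euler_error (t e : R) : 0 < t -> 0 < e -> exists n0, forall n, (n0 <= n)%N ->
  let h := t / n.+1%:R in
  let E w := \1_(stay V M t) w * enorm (V t w - euler_chain W sg x ft h n.+1 w) ^+ 2 in
  L1 P E /\ ex P E <= e.
Proof.
move=> t0 e0.
pose C1 := gronwall_rate Ls Lf.
have C10 : 0 <= C1 by rewrite /C1 /gronwall_rate !addr_ge0// mulr_ge0// exprn_ge0.
(* The total coefficient of the consistency error: 2 for V - Y, and 2 t C1 exp(C1 t) for the
   Gronwall bound on Y - X. *)
pose A := 2 * (t * C1 * expR (C1 * t)) + 2.
have A0 : 0 < A by rewrite /A ltr_wpDl// !mulr_ge0 ?expR_ge0// ltW.
have eA : 0 < e / A by rewrite divr_gt0.
have [n0 H] := euler_eps_small t0 eA.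
have [n1 H1] := mesh_lt t ltr01.
exists (maxn n0 n1) => n; rewrite geq_max => /andP[nn0 nn1] h E.
have h0 : 0 < h by rewrite divr_gt0.
have h1 : h <= 1 by apply: ltW; exact: H1.
have tE : n.+1%:R * h = t by rewrite /h mulrC mulfVK// pnatr_eq0.
have Hk k : (k <= n.+1)%N -> euler_eps P sg V ft Lf M h k <= e / A by apply: H.
have [l1 e1] := gronwall P_complete BM mf Ls0 sgL sgS cV Lf0 M0 ftL ft_f h0 h1 (ltW eA) Hk (leqnn _).
have [l2 e2] := driven_error P_complete BM mf Ls0 sgL sgS cV Lf0 M0 ftL ft_f h0 n.+1.
have {}e2 := le_trans e2 (Hk _ (leqnn _)).
rewrite /stayI tE in l1 e1 l2 e2.
have EB w : E w <= 2 * (\1_(stay V M t) w * enorm (V t w - euler_driven W sg x V ft M h n.+1 w) ^+ 2)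
   + 2 * (\1_(stay V M t) w * enorm (euler_driven W sg x V ft M h n.+1 w - euler_chain W sg x ft h n.+1 w) ^+ 2).
  rewrite /E; have I0 : 0 <= \1_(stay V M t) w :> R by rewrite indicE.
  move: (\1_(stay V M t) w) I0 => I0 I00.
  have -> a b : 2 * (I0 * a) + 2 * (I0 * b) = I0 * (2 * a + 2 * b) by ring.
  rewrite ler_wpM2l//.
  have := enorm_sqrD_le (V t w - euler_driven W sg x V ft M h n.+1 w)
    (euler_driven W sg x V ft M h n.+1 w - euler_chain W sg x ft h n.+1 w).
  by rewrite addrA subrK.
have lB := L1D (L1Z 2 l2) (L1Z 2 l1).
have E0 w : 0 <= E w by rewrite mulr_ge0  ?exprn_ge0 ?enorm_ge0.
have lE : L1 P E.
  apply: L1_le lB => [|w]; last by rewrite ger0_norm ?EB.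
  apply: measurable_funM.
    apply: measurable_indic; apply: (measurable_FT P_complete BM (t := t)).
    exact: (measurable_stay cV M (ltW t0)).
  apply: measurable_funX; apply: measurable_enorm; apply: measurable_mxB; first exact: mV (ltW t0).
  apply: (measurable_fun_FT P_complete BM (t := n.+1%:R * h)).
  exact: (measurable_chain Ls0 sgL x Lf0 ftL h0).
split=> //; apply: le_trans (ex_le lE lB EB) _.
rewrite exD; [|exact: L1Z|exact: L1Z]; rewrite !exZ//.
have p1 : (1 + C1 * h) ^+ n.+1 <= expR (C1 * t).
  have -> : expR (C1 * t) = expR (C1 * h) ^+ n.+1 by rewrite -expRM_natl -tE mulrCA.
  have q0 : 0 <= 1 + C1 * h by rewrite addr_ge0// mulr_ge0// ltW.
  by apply: lerXn2r; rewrite ?nnegrE ?expR_ge0//; exact: expR_ge1Dx.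
have e3 : n.+1%:R * (C1 * h * (e / A)) * (1 + C1 * h) ^+ n.+1 <= t * C1 * (e / A) * expR (C1 * t).
  have -> : n.+1%:R * (C1 * h * (e / A)) = t * C1 * (e / A) by rewrite -tE; ring.
  by rewrite ler_wpM2l//; apply: mulr_ge0; [rewrite mulr_ge0// ltW|exact: ltW].
have -> : e = 2 * (e / A) + 2 * (t * C1 * (e / A) * expR (C1 * t)) by rewrite /A; field; rewrite gt_eqF.
by apply: lerD; rewrite ler_wpM2l//; exact: le_trans e1 e3.
Qed.

(** Off the event [stay] the two values of [g] differ by at most 1, which yields the probability; on
    it the Lipschitz bound and the mean square error are used. *)
Lemma euler_approx (g : 'cV[R]_d -> R) (L t e : R) : 0 <= L ->
  (forall y z, g y - g z <= L * enorm (y - z)) -> (forall y, 0 <= g y <= 1) ->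
  0 < t -> 0 < e -> exists n0, forall n, (n0 <= n)%N ->
  `|ex P (fun w => g (V t w)) - ex P (fun w => g (euler_chain W sg x ft (t / n.+1%:R) n.+1 w))|
   <= pr P (~` stay V M t) + e.
Proof.
move=> L0 gL g01 t0 e0.
pose c := e / 2; have c0 : 0 < c by rewrite divr_gt0.
(* The constant of Young's inequality L z <= c + k z^2, by which the mean square error controls the
   mean error. *)
pose k := (L ^+ 2 / c); have k0 : 0 <= k by rewrite divr_ge0 ?sqr_ge0 ?ltW.
have e'0 : 0 < c / (k + 1) by rewrite divr_gt0 ?ltr_wpDl.
have [n0 H] := euler_error t0 e'0.
exists n0 => n /H; set h := t / _ => -[lE eE].
set X := euler_chain _ _ _ _ _ _; rewrite -/X in lE eE.
have h0 : 0 < h by rewrite divr_gt0.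
have mS : measurable (stay V M t).
  apply: (measurable_FT P_complete BM (t := t)); exact: (measurable_stay cV M (ltW t0)).
have mg : measurable_fun setT (g : bspace R d 1 -> R).
  by apply: measurable_rLipschitz; exists L => // y z; rewrite ler_norml lerNl opprB -enorm_distC !gL enorm_distC gL.
have mX : measurable_fun setT (X : Omega -> bspace R d 1).
  apply: (measurable_fun_FT P_complete BM (t := n.+1%:R * h)); rewrite /X.
  exact: (measurable_chain Ls0 sgL x Lf0 ftL h0).
have lg (Z : Omega -> 'cV[R]_d) : measurable_fun setT (Z : Omega -> bspace R d 1) -> L1 P (fun w => g (Z w)).
  move=> mZ; apply: (@L1_bounded _ _ _ _ _ 1); first exact: (measurableT_comp mg mZ).
  by move=> w; have /andP[a b] := g01 (Z w); rewrite ger0_norm.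
have l1 := lg _ (mV (ltW t0)); have l2 := lg _ mX.
rewrite -exB//.
have lI := L1_indic P (measurableC mS).
have lc := L1_cst P c.
apply: le_trans (@normr_ex_le _ _ _ P _ (fun w => \1_(~` stay V M t) w + (c + k * (\1_(stay V M t) w * enorm (V t w - X w) ^+ 2))) (L1B l1 l2) _ _) _.
- by apply: L1D => //; apply: L1D => //; exact: L1Z.
- move=> w; rewrite !indicE in_setC; have [ws|ws] := boolP (w \in stay V M t) => /=.
    rewrite add0r mul1r.
    have b : `|g (V t w) - g (X w)| <= L * enorm (V t w - X w).
      by rewrite ler_norml lerNl opprB -[X in _ * X]enorm_distC gL enorm_distC gL.
    apply: le_trans b _; move: (enorm _) => z.
    have -> : c + k * z ^+ 2 = (c ^+ 2 + (L * z) ^+ 2) / c by rewrite /k; field; rewrite gt_eqF.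
    rewrite ler_pdivlMr//; have := sqr_ge0 (c - L * z); have := sqr_ge0 (L * z); have := sqr_ge0 c; lra.
  rewrite mul0r mulr0 addr0.
  have /andP[a1 b1] := g01 (V t w); have /andP[a2 b2] := g01 (X w).
  by rewrite ler_norml; apply/andP; split; move: (ltW c0); lra.
rewrite exD//; last by apply: L1D => //; exact: L1Z.
rewrite exD//; last exact: L1Z.
rewrite exZ// ex_cst ex_indic//; last exact: measurableC.
rewrite lerD2l.
have kk := ler_wpM2l k0 eE.
have k1 : k * (c / (k + 1)) <= c.
  have -> : k * (c / (k + 1)) = c * (k / (k + 1)) by field; rewrite gt_eqF// ltr_wpDl.
  by rewrite ler_piMr ?(ltW c0)// ler_pdivrMr ?ltr_wpDl// mul1r lerDl.
have -> : e = c + c by rewrite /c; field.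
by rewrite lerD2l; exact: le_trans kk k1.
Qed.

(** Peel off the last step: its increment is independent of the chain before it and has the law of
    [X0], so integrating it out applies [step_op] to the test function, and the induction hypothesis
    is used for that new function. *)
Lemma euler_markov (th : R) (X0 : Omega -> 'cV[R]_d) (u : 'cV[R]_d -> R) k : 0 < th ->
  gaussian P (th ^+ 2) X0 -> unit_meas u ->
  ex P (fun w => u (euler_chain W sg x ft (th ^+ 4) k w)) = iter k (step_op ft sg P X0 th) u x.
Proof.
move=> th0 gX; have h0 : 0 < th ^+ 4 by rewrite exprn_gt0.
elim: k u => [|k IH] u hu; first by rewrite /= ex_cst.
have hs := unit_step gX mft msg hu.
rewrite iterSr -(IH _ hs).
set h := th ^+ 4.
have kh0 (j : nat) : 0 <= j%:R * h by rewrite mulr_ge0// ltW.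
have khS : k%:R * h < k.+1%:R * h by rewrite ltr_pM2r// ltr_nat.
have gW := gaussian_dW P_complete BM (kh0 k) khS.
have sE : Num.sqrt (k.+1%:R * h - k%:R * h) = th ^+ 2.
  have -> : k.+1%:R * h - k%:R * h = (th ^+ 2) ^+ 2 by rewrite -natr1 /h; ring.
  by rewrite sqrtr_sqr ger0_norm// sqr_ge0.
rewrite sE in gW.
have mX := @measurable_chain _ _ _ _ P W _ _ Ls0 sgL x _ _ Lf0 ftL _ h0 k.
have mXT := measurable_fun_FT P_complete BM mX.
pose G (p : bspace R d 1 * bspace R d 1) := u (euler_step ft sg h p.1 p.2).
have mG : measurable_fun setT G.
  apply: (measurableT_comp hu.1); apply: measurable_mxD.
    apply: measurable_mxD; first exact: measurable_fst.
    by apply: (@measurable_mxZ _ _ _ _ _ (fun=> h)) => //; apply: (measurableT_comp mft); exact: measurable_fst.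
  by apply: measurable_mulmx; [apply: (measurableT_comp msg); exact: measurable_fst|exact: measurable_snd].
have Gb z : `|G z| <= 1 by have /andP[a b] := hu.2 (euler_step ft sg h z.1 z.2); rewrite ger0_norm.
have ind (A B : set (bspace R d 1)) : measurable A -> measurable B ->
  P (euler_chain W sg x ft h k @^-1` A `&` dW (k%:R * h) (k.+1%:R * h) @^-1` B)
  = (P (euler_chain W sg x ft h k @^-1` A) * P (dW (k%:R * h) (k.+1%:R * h) @^-1` B))%E.
  move=> mA mB; apply: (FT_indep P_complete BM (kh0 k) khS) => //.
  by rewrite -[X in measurable X]setTI; exact: mX.
have := ex_indep mXT gW.1 ind mG Gb; rewrite /G /= => ->.
congr (ex P _); apply/funext => w; rewrite /step_op.
apply: (@ex_same_law _ _ _ P _ (bspace R d 1) _ _ gW.1 gX.1 (gaussian_law gW gX) (fun v => u (euler_step ft sg h (euler_chain W sg x ft h k w) v))).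
by apply: (measurableT_comp hu.1); apply: (@measurable_euler_step _ _ _ _ th _ (bspace R d 1) id).
Qed.

End EulerLimit.

(** * From Lipschitz to Borel test functions *)

Section LipschitzApproximation.
Context {R : realType} {d : nat} {disp : measure_display} {Omega : measurableType disp}
        (P : probability Omega R).
Variables X Y : Omega -> 'cV[R]_d.
Hypothesis mX : measurable_fun setT (X : Omega -> bspace R d 1).
Hypothesis mY : measurable_fun setT (Y : Omega -> bspace R d 1).
Implicit Types u v g : 'cV[R]_d -> R.

(** One function [g] has to approximate [u] under the laws of [X] and [Y] simultaneously, since the
    difference of the two expectations is what is transferred. *)
Definition lip_approx u := unit_meas u /\ forall e : R, 0 < e -> exists g,
  [/\ rLipschitz g, forall y, 0 <= g y <= 1 &
   ex P (fun w => `|u (X w) - g (X w)|) + ex P (fun w => `|u (Y w) - g (Y w)|) <= e].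

Let unit_lip g : rLipschitz g -> (forall y, 0 <= g y <= 1) -> unit_meas g.
Proof. by move=> lg g01; split=> //; exact: measurable_rLipschitz. Qed.

Let L1_dist u v Z : unit_meas u -> unit_meas v -> measurable_fun setT (Z : Omega -> bspace R d 1) ->
  L1 P (fun w => `|u (Z w) - v (Z w)|).
Proof.
move=> [mu u01] [mv v01] mZ; apply: (@L1_bounded _ _ _ _ _ 1).
  apply: measurableT_comp => //; apply: measurable_funB; [exact: (measurableT_comp mu mZ)|exact: (measurableT_comp mv mZ)].
move=> w; rewrite normr_id; have /andP[a b] := u01 (Z w); have /andP[a' b'] := v01 (Z w).
by rewrite ler_norml; apply/andP; split; lra.
Qed.

Let ex_dist_le u v (u' v' u'' v'' : 'cV[R]_d -> R) Z : unit_meas u -> unit_meas v -> unit_meas u' -> unit_meas v' ->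
  unit_meas u'' -> unit_meas v'' -> measurable_fun setT (Z : Omega -> bspace R d 1) ->
  (forall y, `|u y - v y| <= `|u' y - v' y| + `|u'' y - v'' y|) ->
  ex P (fun w => `|u (Z w) - v (Z w)|) <= ex P (fun w => `|u' (Z w) - v' (Z w)|) + ex P (fun w => `|u'' (Z w) - v'' (Z w)|).
Proof.
move=> hu hv hu' hv' hu'' hv'' mZ H; rewrite -exD; [|exact: L1_dist|exact: L1_dist].
by apply: ex_le => [||w]; [exact: L1_dist|apply: L1D; exact: L1_dist|exact: H].
Qed.

Lemma lip_approx_lip g : rLipschitz g -> (forall y, 0 <= g y <= 1) -> lip_approx g.
Proof.
move=> lg g01; split; first exact: unit_lip.
move=> e e0; exists g; split=> //.
have E (Z : Omega -> 'cV[R]_d) : ex P (fun w => `|g (Z w) - g (Z w)|) = 0.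
  by rewrite (_ : (fun w => _) = fun=> 0) ?ex_cst//; apply/funext => w; rewrite subrr normr0.
by rewrite !E addr0 ltW.
Qed.

(** Bounded convergence under both laws gives an index that works for the two of them; then that
    member of the sequence is approximated. *)
Lemma lip_approx_lim (un : nat -> 'cV[R]_d -> R) u : (forall n, lip_approx (un n)) ->
  (forall y, un ^~ y @ \oo --> u y) -> lip_approx u.
Proof.
move=> aun lim.
have uu : unit_meas u.
  split.
    apply: (@measurable_fun_cvg _ (bspace R d 1) _ setT un) => [n|y _]; [exact: (aun n).1.1|exact: lim].
  move=> y; apply/andP; split; apply/ler_addgt0Pr => e e0.
    have /cvgrPdist_lt/(_ _ e0)[n _ /(_ n (leqnn n))] := lim y.
    have /andP[a b] := (aun n).1.2 y; rewrite ltr_norml => /andP[c1 c2]; lra.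
  have /cvgrPdist_lt/(_ _ e0)[n _ /(_ n (leqnn n))] := lim y.
  have /andP[a b] := (aun n).1.2 y; rewrite ltr_norml => /andP[c1 c2]; lra.
split=> // e e0; have e4 : 0 < e / 4 by rewrite divr_gt0.
have dist0 Z : measurable_fun setT (Z : Omega -> bspace R d 1) ->
    (fun n => ex P (fun w => `|u (Z w) - un n (Z w)|)) @ \oo --> 0.
  move=> mZ; apply: (@ex_cvg0 _ _ _ _ _ 1) => [n|n w|w].
  - by apply: L1_meas (L1_dist uu (aun n).1 mZ).
  - rewrite normr_id; have /andP[a b] := uu.2 (Z w); have /andP[a' b'] := (aun n).1.2 (Z w).
    by rewrite ler_norml; apply/andP; split; lra.
  - apply/cvg0_eps => e1 e10; have /cvgrPdist_lt/(_ _ e10)[n0 _ H] := lim (Z w).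
    by exists n0 => n /H; rewrite normr_id.
have [n1 H1] := (cvg0_eps _).1 (dist0 X mX) _ e4; have [n2 H2] := (cvg0_eps _).1 (dist0 Y mY) _ e4.
pose n := maxn n1 n2.
have {}H1 := le_trans (ler_norm _) (ltW (H1 n (leq_maxl _ _))).
have {}H2 := le_trans (ler_norm _) (ltW (H2 n (leq_maxr _ _))).
have e2 : 0 < e / 2 by rewrite divr_gt0.
have [g [lg g01 Hg]] := (aun n).2 _ e2.
have ug := unit_lip lg g01; have un1 := (aun n).1.
exists g; split=> //.
have T y : `|u y - g y| <= `|u y - un n y| + `|un n y - g y| by exact: ler_distD.
have b1 := ex_dist_le uu ug uu un1 un1 ug mX T; have b2 := ex_dist_le uu ug uu un1 un1 ug mY T.
apply: le_trans (lerD b1 b2) _; rewrite addrACA.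
have -> : e = (e / 4 + e / 4) + e / 2 by field.
by apply: lerD => //; exact: lerD.
Qed.

Lemma lip_approxC u : lip_approx u -> lip_approx (fun y => 1 - u y).
Proof.
move=> [[mu u01] Hu]; split.
  split; first by apply: measurable_funB => //; exact: measurable_cst.
  by move=> y; have /andP[a b] := u01 y; apply/andP; split; lra.
move=> e /Hu[g [[L L0 lg] g01 Hg]]; exists (fun y => 1 - g y); split.
- by exists L => // y z; rewrite opprB addrC addrA subrK distrC; exact: lg.
- by move=> y; have /andP[a b] := g01 y; apply/andP; split; lra.
- have E (Z : Omega -> 'cV[R]_d) : ex P (fun w => `|1 - u (Z w) - (1 - g (Z w))|) = ex P (fun w => `|u (Z w) - g (Z w)|).
    by congr (ex P _); apply/funext => w; rewrite opprB addrC addrA subrK distrC.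
  by rewrite !E.
Qed.

Let max_dist (a b a' b' : R) : `|Num.max a b - Num.max a' b'| <= `|a - a'| + `|b - b'|.
Proof.
have := ler_norm (a - a'); have := ler_norm (a' - a); rewrite distrC.
have := ler_norm (b - b'); have := ler_norm (b' - b); rewrite (distrC b' b).
move: `|a - a'| `|b - b'| => p q q1 q2 p1 p2.
by rewrite ler_norml; have [h1|h1] := leP a b; have [h2|h2] := leP a' b'; apply/andP; split; lra.
Qed.

Let min_dist (p q : R) : `|Num.min 1 p - Num.min 1 q| <= `|p - q|.
Proof.
have := ler_norm (p - q); have := ler_norm (q - p); rewrite distrC.
move: `|p - q| => r r1 r2.
by rewrite ler_norml; have [h1|h1] := leP 1 p; have [h2|h2] := leP 1 q; apply/andP; split; lra.
Qed.

Let max_unit (a b : R) : 0 <= a <= 1 -> 0 <= b <= 1 -> 0 <= Num.max a b <= 1.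
Proof. by move=> /andP[a0 a1] /andP[b0 b1]; rewrite le_max a0 ge_max a1 b1. Qed.

Lemma lip_approx_max u v : lip_approx u -> lip_approx v -> lip_approx (fun y => Num.max (u y) (v y)).
Proof.
move=> [uu Hu] [uv Hv].
have um : unit_meas (fun y => Num.max (u y) (v y)).
  split; first by apply: measurable_maxr; [exact: uu.1|exact: uv.1].
  by move=> y; apply: max_unit; [exact: uu.2|exact: uv.2].
split=> // e e0; have e2 : 0 < e / 2 by rewrite divr_gt0.
have [g [lg g01 Hg]] := Hu _ e2; have [k [lk k01 Hk]] := Hv _ e2.
have [L L0 lgL] := lg; have [L' L'0 lkL] := lk.
have lm : rLipschitz (fun y => Num.max (g y) (k y)).
  exists (L + L'); first exact: addr_ge0.
  by move=> y z; rewrite mulrDl; apply: le_trans (max_dist _ _ _ _) (lerD (lgL _ _) (lkL _ _)).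
have m01 y : 0 <= Num.max (g y) (k y) <= 1 by exact: max_unit.
exists (fun y => Num.max (g y) (k y)); split=> //.
have T y := max_dist (u y) (v y) (g y) (k y).
have ug := unit_lip lg g01; have uk := unit_lip lk k01; have umm := unit_lip lm m01.
have b1 := ex_dist_le um umm uu ug uv uk mX T; have b2 := ex_dist_le um umm uu ug uv uk mY T.
apply: le_trans (lerD b1 b2) _; rewrite addrACA.
have -> : e = e / 2 + e / 2 by field.
exact: lerD.
Qed.

Let lip_sets : set (set 'cV[R]_d) := [set A | lip_approx (\1_A)].

Let lip_sets_sigma : sigma_algebra setT lip_sets.
Proof.
have lip0 : lip_sets set0.
  rewrite /lip_sets/= (_ : \1_set0 = fun=> 0); last by apply/funext => y; rewrite indicE in_set0.
  apply: lip_approx_lip; last by move=> y; rewrite lexx ler01.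
  by exists 0 => // y z; rewrite subrr normr0 mul0r.
split=> //.
  move=> A; rewrite /lip_sets/= => /lip_approxC.
  rewrite (_ : (fun y => _) = \1_(setT `\` A))//.
  by apply/funext => y; rewrite !indicE setTD in_setC; case: (y \in A); rewrite ?subrr ?subr0.
move=> A HA; rewrite /lip_sets/=.
apply: (@lip_approx_lim (fun n => \1_(\bigcup_(k < n) A k))).
  elim=> [|n IH]; first by rewrite bigcup_mkord big_ord0.
  rewrite (_ : \1_(\bigcup_(k < n.+1) A k) = fun y => Num.max (\1_(\bigcup_(k < n) A k) y) (\1_(A n) y)).
    by apply: lip_approx_max => //; exact: HA.
  apply/funext => y; rewrite !indicE !bigcup_mkord big_ord_recr/= in_setU.
  by case: (y \in _); case: (y \in _) => /=; rewrite ?maxxx ?(max_l ler01) ?(max_r ler01).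
move=> y; rewrite indicE; have [/set_mem[k _ Ak]|yA] := boolP (y \in _).
  apply/cvgrPdist_lt => e e0; exists k.+1 => // n /= kn.
  by rewrite indicE mem_set ?subrr ?normr0//; exists k.
rewrite (_ : (fun n => _) = fun=> 0); first exact: cvg_cst.
apply/funext => n; rewrite indicE memNset// => -[k _ Ak].
by move: yA; rewrite mem_set//; exists k.
Qed.

(** The indicator of an open half-space y_i > a is the limit of the Lipschitz functions min(1, n
    (y_i - a)+); the sets with an approximable indicator form a sigma-algebra, and half-spaces along
    the axes make every coordinate measurable for it. *)
Lemma lip_approx_indic (A : set (bspace R d 1)) : measurable A -> lip_approx (\1_A).
Proof.
have : measurable_fun setT (fun x : g_sigma_algebraType lip_sets => x : bspace R d 1).
  apply: measurable_mx => i j; rewrite ord1.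
  apply: (measurability (@RGenOInfty.G R)); first exact: RGenOInfty.measurableE.
  move=> _ [_ [a ->] <-]; rewrite setTI.
  apply: sub_sigma_algebra; rewrite /lip_sets/=.
  pose g n y : R := Num.min 1 (n%:R * Num.max 0 ((y : 'cV[R]_d) i ord0 - a)).
  apply: (@lip_approx_lim g) => [n|y].
    apply: lip_approx_lip => [|y]; last first.
      by rewrite /g le_min ler01 ge_min lexx mulr_ge0// le_max lexx.
    exists n%:R => // y z; rewrite /g.
    apply: le_trans (min_dist _ _) _; rewrite -mulrBr normrM ger0_norm// ler_wpM2l//.
    have := max_dist 0 (y i ord0 - a) 0 (z i ord0 - a).
    rewrite subrr normr0 add0r opprB addrA subrK => /le_trans; apply.
    by have := entry_le_enorm (y - z) i ord0; rewrite !mxE.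
  rewrite indicE; have [/set_mem|/negP ya] := boolP (y \in _); rewrite /= ?in_itv/= ?andbT.
    move=> ya; have ya0 : 0 < y i ord0 - a by rewrite subr_gt0.
    apply/cvgrPdist_lt => e e0; exists (Num.truncn (y i ord0 - a)^-1).+1 => // n /= kn.
    rewrite /g max_r ?(ltW ya0)// min_l ?subrr ?normr0//.
    rewrite -ler_pdivrMr// mul1r; apply: le_trans (ltW (truncnS_gt _)) _.
    by rewrite ler_nat.
  rewrite (_ : (fun n => _) = fun=> 0); first exact: cvg_cst.
  apply/funext => n; rewrite /g max_l ?mulr0 ?min_r//.
  rewrite subr_le0 leNgt; apply/negP => ay; apply: ya; apply: mem_set.
  by rewrite /= in_itv/= andbT.
move=> /(_ measurableT) H mA.
have : <<s lip_sets >> A by have := H A mA; rewrite setTI.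
by rewrite sigma_algebra_id.
Qed.

Lemma lip_approx_le u (D : R) : lip_approx u ->
  (forall g, rLipschitz g -> (forall y, 0 <= g y <= 1) -> ex P (fun w => g (X w)) - ex P (fun w => g (Y w)) <= D) ->
  ex P (fun w => u (X w)) - ex P (fun w => u (Y w)) <= D.
Proof.
move=> [uu Hu] HD; apply/ler_addgt0Pr => e /Hu[g [lg g01 Hg]].
have ug := unit_lip lg g01.
have l1 v Z : unit_meas v -> measurable_fun setT (Z : Omega -> bspace R d 1) -> L1 P (fun w => v (Z w)).
  move=> [mv v01] mZ; apply: (@L1_bounded _ _ _ _ _ 1); first exact: (measurableT_comp mv mZ).
  by move=> w; have /andP[a b] := v01 (Z w); rewrite ger0_norm.
have dd Z : measurable_fun setT (Z : Omega -> bspace R d 1) ->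
    `|ex P (fun w => u (Z w)) - ex P (fun w => g (Z w))| <= ex P (fun w => `|u (Z w) - g (Z w)|).
  move=> mZ; rewrite -exB; [|exact: l1|exact: l1].
  apply: normr_ex_le => [||w//]; [by apply: L1B; exact: l1|exact: L1_dist].
have := dd X mX; have := dd Y mY; rewrite !ler_norml => /andP[a1 _] /andP[_ b1].
by have := HD g lg g01; move: Hg a1 b1; lra.
Qed.

(** Layer-cake with mesh 1 / n: the indicators of the sets [A k] add up to the integer part of n u.
    Each of these [n] indicators contributes at most [D], and dividing by n gives back [D], so
    passing from indicators to functions loses no constant. *)
Lemma unit_meas_le u (D : R) : unit_meas u ->
  (forall g, rLipschitz g -> (forall y, 0 <= g y <= 1) -> ex P (fun w => g (X w)) - ex P (fun w => g (Y w)) <= D) ->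
  ex P (fun w => u (X w)) - ex P (fun w => u (Y w)) <= D.
Proof.
move=> [mu u01] HD.
have HI A : measurable (A : set (bspace R d 1)) ->
    ex P (fun w => \1_A (X w)) - ex P (fun w => \1_A (Y w)) <= D.
  by move=> mA; apply: lip_approx_le => //; exact: lip_approx_indic.
apply/ler_addgt0Pr => e e0.
have [n0 Hn] := mesh_lt 2 e0; have {}Hn := Hn n0 (leqnn _).
pose n := n0.+1; pose A k : set (bspace R d 1) := [set y | k.+1%:R <= n%:R * u y].
have n0' : 0 < n%:R :> R by rewrite ltr0n.
have mA k : measurable (A k).
  rewrite (_ : A k = setT `&` (fun y => n%:R * u y) @^-1` `[k.+1%:R, +oo[%classic).
    have mm : measurable_fun setT ((fun y => n%:R * u y) : bspace R d 1 -> R) by exact: measurable_funM.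
    by apply: mm => //; exact: measurable_itv.
  by rewrite setTI; apply/seteqP; split => y; rewrite /A/= in_itv/= andbT.
pose s y : R := \sum_(k < n) \1_(A k) y.
have sn y : s y <= n%:R * u y <= s y + 1.
  have /andP[a b] := u01 y.
  have y0 : 0 <= n%:R * u y by rewrite mulr_ge0.
  have -> : s y = (Num.truncn (n%:R * u y))%:R.
    rewrite /s; set m := Num.truncn _.
    have mn : (m <= n)%N.
      have /andP[c1 _] := truncn_itv y0.
      by rewrite -(ler_nat R); apply: le_trans c1 _; rewrite ler_piMr.
    rewrite (eq_bigr (fun k : 'I_n => if (k < m)%N then 1 else 0)); last first.
      move=> k _; rewrite indicE /m truncn_gt_nat.
      have -> : (y \in A k) = (k.+1%:R <= n%:R * u y) by apply/idP/idP => [/set_mem|/mem_set].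
      by case: ifP.
    by rewrite -big_mkcond/= (big_ord_narrow mn) sumr_const card_ord.
  by have /andP[c1 c2] := truncn_itv y0; rewrite c1 natr1 ltW.
have ls Z : measurable_fun setT (Z : Omega -> bspace R d 1) -> L1 P (fun w => s (Z w)).
  move=> mZ; apply: L1_sum => k; rewrite (_ : (fun w => _) = \1_(Z @^-1` A k))//.
  by apply: L1_indic; rewrite -[X in measurable X]setTI; exact: mZ.
have es Z : measurable_fun setT (Z : Omega -> bspace R d 1) ->
    ex P (fun w => s (Z w)) = \sum_(k < n) ex P (fun w => \1_(A k) (Z w)).
  move=> mZ; rewrite /s ex_sum// => k; rewrite (_ : (fun w => _) = \1_(Z @^-1` A k))//.
  by apply: L1_indic; rewrite -[X in measurable X]setTI; exact: mZ.
have lu Z : measurable_fun setT (Z : Omega -> bspace R d 1) -> L1 P (fun w => u (Z w)).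
  move=> mZ; apply: (@L1_bounded _ _ _ _ _ 1); first exact: (measurableT_comp mu mZ).
  by move=> w; have /andP[a b] := u01 (Z w); rewrite ger0_norm.
have bX : n%:R * ex P (fun w => u (X w)) <= ex P (fun w => s (X w)) + 1.
  rewrite -exZ; last exact: lu.
  rewrite -[X in _ <= _ + X](ex_cst P) -exD; [|exact: ls|exact: L1_cst].
  apply: ex_le => [||w]; [by apply: L1Z; exact: lu|by apply: L1D; [exact: ls|exact: L1_cst]|].
  by have /andP[] := sn (X w).
have bY : ex P (fun w => s (Y w)) <= n%:R * ex P (fun w => u (Y w)).
  rewrite -exZ; last exact: lu.
  apply: ex_le => [||w]; [exact: ls|by apply: L1Z; exact: lu|].
  by have /andP[] := sn (Y w).
have bD : ex P (fun w => s (X w)) - ex P (fun w => s (Y w)) <= n%:R * D.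
  rewrite !es// -sumrB mulr_natl -[X in _ *+ X]card_ord -sumr_const.
  by apply: ler_sum => k _; exact: HI.
have ne : 2 < e * n%:R by rewrite -ltr_pdivrMr.
rewrite -(ler_pM2l n0'); move: bX bY bD ne.
rewrite mulrBr mulrDr (mulrC e); lra.
Qed.

(** Affine rescaling to values in [0, 1]; the interval from - K to K has length 2K, whence the
    factor. *)
Lemma bounded_meas_le (Phi : 'cV[R]_d -> R) (K D : R) : measurable_fun setT (Phi : bspace R d 1 -> R) ->
  (forall y, `|Phi y| <= K) ->
  (forall g, rLipschitz g -> (forall y, 0 <= g y <= 1) -> ex P (fun w => g (X w)) - ex P (fun w => g (Y w)) <= D) ->
  ex P (fun w => Phi (X w)) - ex P (fun w => Phi (Y w)) <= 2 * K * D.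
Proof.
move=> mPhi PK HD.
have K0 : 0 <= K by exact: le_trans (normr_ge0 _) (PK 0).
have lP Z : measurable_fun setT (Z : Omega -> bspace R d 1) -> L1 P (fun w => Phi (Z w)).
  by move=> mZ; apply: (@L1_bounded _ _ _ _ _ K) => //; exact: (measurableT_comp mPhi mZ).
have [Kp|Kn] := ltP 0 K; last first.
  have KE : K = 0 by apply/eqP; rewrite eq_le Kn.
  have PE Z : ex P (fun w => Phi (Z w)) = 0.
    rewrite (_ : (fun w => _) = fun=> 0) ?ex_cst//; apply/funext => w.
    by apply/eqP; rewrite -normr_le0 -KE.
  by rewrite !PE KE mulr0 mul0r subrr.
pose u y := (2 * K)^-1 * (Phi y + K).
have K2 : 0 < 2 * K by rewrite mulr_gt0.
have uu : unit_meas u.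
  split; first by apply: measurable_funM => //; apply: measurable_funD.
  move=> y; have := PK y; rewrite ler_norml => /andP[a b]; rewrite /u mulrC.
  by apply/andP; split; [rewrite divr_ge0 ?(ltW K2)//|rewrite ler_pdivrMr//]; lra.
have := unit_meas_le uu HD.
have E Z : measurable_fun setT (Z : Omega -> bspace R d 1) ->
    ex P (fun w => u (Z w)) = (2 * K)^-1 * (ex P (fun w => Phi (Z w)) + K).
  move=> mZ; rewrite /u exZ; last by apply: L1D; [exact: lP|exact: L1_cst].
  by rewrite exD; [rewrite ex_cst|exact: lP|exact: L1_cst].
rewrite !E// -mulrBr opprD addrACA subrr addr0 mulrC ler_pdivrMr//.
by rewrite (mulrC D).
Qed.

End LipschitzApproximation.

(** A pointwise limit of the compositions with the projections onto balls of integer radius, which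
    are globally Lipschitz; at each point the sequence is eventually constant. *)
Lemma measurable_locally_eLipschitz {R : realType} {d : nat} (f : 'cV[R]_d -> 'cV[R]_d) :
  locally_eLipschitz f -> measurable_fun setT (f : bspace R d 1 -> bspace R d 1).
Proof.
move=> lf; apply: measurable_mx => i j.
apply: (@measurable_fun_cvg _ (bspace R d 1) _ setT (fun n y => f (rproj n%:R y) i j)) => [n|y _].
  have [L L0 HL] := locally_eLipschitz_ball n%:R lf.
  have le : eLipschitz (f \o rproj n%:R).
    exists L => // y z; apply: le_trans (HL _ _ _ _) _; rewrite ?enorm_rproj//.
    by rewrite ler_wpM2l// rproj_lip.
  by have := measurable_mxP i j (measurable_eLipschitz le).
apply/cvgrPdist_lt => e e0; exists (Num.truncn (enorm y)).+1 => // n /= kn.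
rewrite rproj_id ?subrr ?normr0//; apply: le_trans (ltW (truncnS_gt _)) _.
by rewrite ler_nat.
Qed.

(** A continuous path is bounded on [0, t], so the indicator of leaving the ball vanishes for large
    radii along every path; its mean tends to 0 by bounded convergence. *)
Lemma stay_prob {R : realType} {d : nat} {disp : measure_display} {Omega : measurableType disp}
    (P : probability Omega R) (W : R -> Omega -> 'cV[R]_d) f sg x V (t e : R) :
  measure_is_complete P -> brownian_motion P W -> clean_solution P W f sg x V -> 0 <= t -> 0 < e ->
  exists n0 : nat, forall n, (n0 <= n)%N -> pr P (~` stay V n%:R t) < e.
Proof.
move=> Pc BM cV t0 e0.
have mS (n : nat) : measurable (~` stay V n%:R t).
  by apply: measurableC; apply: (measurable_FT Pc BM (t := t)); exact: (measurable_stay cV n%:R t0).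
have : (fun n : nat => ex P (\1_(~` stay V n%:R t) : Omega -> R)) @ \oo --> 0.
  apply: (@ex_cvg0 _ _ _ _ _ 1) => [n|n w|w].
  - by apply: measurable_indic.
  - by rewrite indicE; case: (_ \in _); rewrite ?normr1 ?normr0.
  - have cf : continuous (fun s => enorm (V s w)).
      move=> s; apply/cvgrPdist_lt => e1 e10; have [de de0 H] := cs_cont cV w s e10.
      apply/nbhs_ballP; exists de => // u us.
      have us' : `|u - s| < de by rewrite distrC.
      have := H u us'; have := lerB_enorm (V s w) (V u w); have := lerB_enorm (V u w) (V s w).
      rewrite (enorm_distC (V s w)) ltr_norml => a b c; apply/andP; split; lra.
    have [c _ Hc] := EVT_max t0 (continuous_subspaceT cf).
    apply/cvg0_eps => e1 e10; exists (Num.truncn (enorm (V c w))).+1 => n kn.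
    rewrite indicE memNset ?normr0// => H; apply: H => s s0 st.
    apply: le_trans (Hc s _) _; first by rewrite in_itv/= s0.
    by apply: le_trans (ltW (truncnS_gt _)) _; rewrite ler_nat.
move=> /cvg0_eps/(_ _ e0)[n0 H]; exists n0 => n /H.
by rewrite ex_indic//; apply: le_lt_trans; exact: ler_norm.
Qed.

(** * From Hypothesis (A) to the contraction estimate *)

Section Coefficients.
Context {R : realType} {d : nat}.
Variable sg : 'cV[R]_d -> 'M[R]_d.

(** The uniform bound [s] guarantees that the two nested suprema, over unit vectors and over points,
    are genuine upper bounds; homogeneity in [z] then gives the claim. *)
Lemma enorm_invmx_le (s : R) x (z : 'cV[R]_d) : (forall y, enorm (invmx (sg y)) <= s) ->
  enorm (invmx (sg x) *m z) <= inv_opnorm sg * enorm z.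
Proof.
move=> sK.
have opb y (v : 'cV[R]_d) : enorm v <= 1 -> enorm (invmx (sg y) *m v) <= opnorm (invmx (sg y)).
  move=> v1; apply: ub_le_sup; last by exists v.
  exists s => _ [v' v'1 <-]; apply: le_trans (enorm_mulmx _ _) _.
  apply: le_trans (sK y); rewrite -[leRHS]mulr1 ler_wpM2l ?enorm_ge0//.
have opi y : opnorm (invmx (sg y)) <= inv_opnorm sg.
  apply: ub_le_sup; last by exists y.
  exists s => _ [y' _ <-]; apply: ge_sup => [|_ [v' v'1 <-]].
    by exists (enorm (invmx (sg y') *m (0 : 'cV[R]_d))); exists 0 => //=; rewrite enorm0.
  apply: le_trans (enorm_mulmx _ _) _.
  apply: le_trans (sK y'); rewrite -[leRHS]mulr1 ler_wpM2l ?enorm_ge0//.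
have [->|z0] := eqVneq z 0; first by rewrite mulmx0 enorm0 mulr0.
have zp : 0 < enorm z by rewrite enorm_gt0.
rewrite -ler_pdivrMr//.
have z1 : enorm ((enorm z)^-1 *: z) <= 1.
  by rewrite enormZ ger0_norm ?invr_ge0 ?enorm_ge0// mulVf ?gt_eqF.
have := le_trans (opb x _ z1) (opi x).
by rewrite -scalemxAr enormZ ger0_norm ?invr_ge0 ?enorm_ge0// mulrC.
Qed.

Lemma step_coeffs_diffusion : hypA_diffusion sg -> exists S Ls K Lam : R,
  [/\ 0 <= S, 0 <= Ls, 0 < K & forall Lf eta B f, 0 <= Lf -> 0 < eta -> 0 <= B ->
    (forall x y, enorm (f x - f y) <= Lf * enorm (x - y)) ->
    (forall x y, mdot (f x - f y) (x - y) <= - eta * enorm (x - y) ^+ 2 + B * enorm (x - y)) ->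
    step_coeffs Lf eta B S Ls K Lam f sg].
Proof.
move=> [[Ls Ls0 sL] su [s sb] [Lam [l0 [Lam0 sLam l00 sl]]]].
have s0 : 0 <= s by apply: le_trans (sb 0).1; exact: enorm_ge0.
(* [K] has to be positive, and [s] is only known to be nonnegative. *)
exists s, Ls, (s + 1), Lam; split=> //; first by rewrite ltr_wpDl.
move=> Lf eta B f Lf0 eta0 B0 fL fD; split=> //.
- by rewrite ltr_wpDl.
- by move=> x; exact: (sb x).1.
- move=> x z; apply: le_trans (enorm_mulmx _ _) _; rewrite ler_wpM2r ?enorm_ge0//.
  by apply: le_trans (sb x).2 _; rewrite lerDl.
- by move=> x y; have := sLam y (x - y); rewrite (addrC y) subrK.
- move=> x z.
  have b := enorm_invmx_le x z (fun y => (sb y).2).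
  (* With [s = l0 * Lam ^+ 2], (iv) bounds the square of the left-hand side by
     [2 * (s - s ^+ 2) <= 1 / 2]. *)
  have LI : Lam * inv_opnorm sg <= 1.
    rewrite leNgt; apply/negP => L1.
    have L2 : 1 < (Lam * inv_opnorm sg) ^+ 2 by rewrite exprn_egt1.
    have Lp : 0 < Lam by rewrite lt_neqAle Lam0 andbT; apply/eqP => L0; move: L1; rewrite -L0 mul0r ltr10.
    have := ltr_pM2l (exprn_gt0 2 Lp) (inv_opnorm sg ^+ 2) (2 * (l0 - l0 ^+ 2 * Lam ^+ 2)).
    rewrite sl -exprMn; have := sqr_ge0 (2 * (l0 * Lam ^+ 2) - 1); move: L2; clear; lra.
  apply: le_trans (ler_wpM2l Lam0 b) _; rewrite mulrA.
  by rewrite -[leRHS]mul1r ler_wpM2r ?enorm_ge0.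
Qed.

(** Only [Lf] depends on the radius [M]. The one-sided bound, with eta / 4 from the truncation and 2
    |B| from the two values of [b], does not; these are the only data of the drift that the
    constants of [euler_contraction] see. *)
Lemma drift_coeffs (eta B M : R) (df b : 'cV[R]_d -> 'cV[R]_d) : 0 < eta -> 0 <= M ->
  hypA_drift eta B df b -> exists Lf ft, [/\ 0 <= Lf, forall x, enorm x <= M -> ft x = df x + b x,
    forall x y, enorm (ft x - ft y) <= Lf * enorm (x - y) &
    forall x y, mdot (ft x - ft y) (x - y) <= - (eta / 4) * enorm (x - y) ^+ 2 + 2 * `|B| * enorm (x - y)].
Proof.
move=> eta0 M0 [dd dl _ [Lb Lb0 bL] bB].
have [g [gE [Lg Lg0 gL] gd]] := dissipative_truncation eta0 M0 dd dl.
exists (Lg + Lb), (fun y => g y + b y); split.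
- exact: addr_ge0.
- by move=> x /gE ->.
- move=> x y; rewrite opprD addrACA mulrDl; apply: le_trans (ler_enormD _ _) _.
  by apply: lerD; [exact: gL|exact: bL].
- move=> x y; rewrite opprD addrACA mdotDl; apply: lerD.
    by have := gd x y; rewrite scalar_productE.
  apply: le_trans (mdot_le _ _) _; rewrite ler_wpM2r ?enorm_ge0//.
  apply: le_trans (ler_enormB _ _) _; have := bB x; have := bB y; have := ler_norm B; lra.
Qed.

End Coefficients.

Section Assembly.
Context {R : realType} {d : nat} {disp : measure_display} {Omega : measurableType disp}
        (P : probability Omega R).
Hypothesis P_complete : measure_is_complete P.
Variable W : R -> Omega -> 'cV[R]_d.
Hypothesis BM : brownian_motion P W.
Variable sg : 'cV[R]_d -> 'M[R]_d.
Hypothesis sgA : hypA_diffusion sg.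

Lemma clean_contraction (eta B : R) : 0 < eta -> exists C c : R, [/\ 0 < C, 0 < c &
  forall df b, hypA_drift eta B df b -> forall x y V V',
    clean_solution P W (fun z => df z + b z) sg x V ->
    clean_solution P W (fun z => df z + b z) sg y V' ->
  forall g t, rLipschitz g -> (forall z, 0 <= g z <= 1) -> 2 <= t ->
  ex P (fun w => g (V t w)) - ex P (fun w => g (V' t w)) <= C * (1 + enorm (x - y)) * expR (- c * t)].
Proof.
move=> eta0.
have [S [Ls [K [Lam [S0 Ls0 K0 sc]]]]] := step_coeffs_diffusion sgA.
have eta4 : 0 < eta / 4 by rewrite divr_gt0.
have B2 : 0 <= 2 * `|B| by rewrite mulr_ge0.
have [C [c [C0 c0 HC]]] := euler_contraction (d := d) Lam eta4 B2 S0 Ls0 K0.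
exists C, c; split=> // df b hA x y V V' cV cV' g t [L L0 gL] g01 t2.
have t0 : 0 < t by rewrite (lt_le_trans _ t2).
have gL1 z z' : g z - g z' <= L * enorm (z - z') by exact: le_trans (ler_norm _) (gL z z').
have ug : unit_meas g by split=> //; apply: measurable_rLipschitz; exists L.
(* Five errors: the probability of leaving the ball and the Euler error for each of the two
   solutions, and the discretization error of the contraction. *)
apply/ler_addgt0Pr => e' e'0; pose e := e' / 5.
have e0 : 0 < e by rewrite divr_gt0.
have [n1 H1] := stay_prob P_complete BM cV (ltW t0) e0.
have [n2 H2] := stay_prob P_complete BM cV' (ltW t0) e0.
pose M : R := (maxn n1 n2)%:R.
have {}H1 : pr P (~` stay V M t) < e by apply: H1; rewrite leq_maxl.
have {}H2 : pr P (~` stay V' M t) < e by apply: H2; rewrite leq_maxr.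
have M0 : 0 <= M by [].
have [Lf [ft [Lf0 ftE ftL ftD]]] := drift_coeffs eta0 M0 hA.
have sce := sc Lf (eta / 4) (2 * `|B|) ft Lf0 eta4 B2 ftL ftD.
have sgL := sc_sL sce; have sgS := sc_S sce.
have mf : measurable_fun setT ((fun z => df z + b z) : bspace R d 1 -> bspace R d 1).
  apply: measurable_mxD; first exact: (measurable_locally_eLipschitz (drift_locLip hA)).
  exact: (measurable_eLipschitz (drift_pertLip hA)).
have [k1 A1] := euler_approx P_complete BM mf Ls0 sgL sgS cV Lf0 M0 ftL ftE L0 gL1 g01 t0 e0.
have [k2 A2] := euler_approx P_complete BM mf Ls0 sgL sgS cV' Lf0 M0 ftL ftE L0 gL1 g01 t0 e0.
have [th0 th00 Hth] := HC Lf ft sg sce L t e L0 t2 e0.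
have [k3 A3] := mesh_lt t (exprn_gt0 4 th00).
pose n := maxn k1 (maxn k2 k3).
have {}A1 := A1 n (leq_maxl _ _).
have {}A2 := A2 n (leq_trans (leq_maxl _ _) (leq_maxr _ _)).
have {}A3 := A3 n (leq_trans (leq_maxr _ _) (leq_maxr _ _)).
(* The fourth root of the time step, since [step_op] measures time by [theta ^+ 4]. *)
pose th := Num.sqrt (Num.sqrt (t / n.+1%:R)).
have h0 : 0 < t / n.+1%:R by rewrite divr_gt0.
have thp : 0 < th by rewrite !sqrtr_gt0.
have th2 : th ^+ 2 = Num.sqrt (t / n.+1%:R) by rewrite sqr_sqrtr// sqrtr_ge0.
have th4 : th ^+ 4 = t / n.+1%:R by rewrite (exprM _ 2 2) th2 sqr_sqrtr// ltW.
have thth0 : th <= th0.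
  by rewrite leNgt; apply/negP => /ltW H; move: A3; rewrite -th4 ltNge lerXn2r// nnegrE ltW.
have gX : gaussian P (th ^+ 2) (dW W 0 (t / n.+1%:R)).
  by rewrite th2; have := gaussian_dW P_complete BM (lexx 0) h0; rewrite subr0.
have th12 : 0 < th <= th0 by rewrite thp.
have nE : n.+1%:R * th ^+ 4 = t by rewrite th4 mulrC mulfVK// pnatr_eq0.
have := Hth n.+1 th th12 nE _ Omega P _ gX g ug gL1 x y.
rewrite -!(euler_markov P_complete BM Ls0 sgL _ Lf0 ftL _ thp gX ug) th4.
move: A1 A2; rewrite !ler_norml => /andP[_ a1] /andP[a2 _] a3.
have e5 : e' = 5 * e by rewrite /e; field.
by rewrite e5; lra.
Qed.

End Assembly.

(* C and mu are chosen before df and b: for given sg they depend on the drift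
   f = df + b only through eta and B. *)
Theorem lemma2p5 (R : realType) (d : nat) (d_ge1 : (1 <= d)%N)
    (disp : measure_display) (Omega : measurableType disp)
    (P : probability Omega R) (P_complete : measure_is_complete P)
    (W : R -> Omega -> 'cV[R]_d) (W_brownian : brownian_motion P W)
    (sg : 'cV[R]_d -> 'M[R]_d) (sg_hypA : hypA_diffusion sg)
    (eta B : R) (eta_gt0 : 0 < eta) :
  exists C mu : R, [/\ 0 < C, 0 < mu &
    forall df b : 'cV[R]_d -> 'cV[R]_d, hypA_drift eta B df b ->
    forall V : 'cV[R]_d -> R -> Omega -> 'cV[R]_d,
      (forall x, strong_solution P W (fun y => df y + b y) sg x (V x)) ->
    forall (Phi : 'cV[R]_d -> R) (x x' : 'cV[R]_d) (t : R),
      bounded_borel Phi -> 0 <= t ->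
      `|semigroup P V t Phi x - semigroup P V t Phi x'|
      <= C * (1 + enorm x ^+ 2 + enorm x' ^+ 2) * expR (- mu * t)
           * sup_norm Phi].

Proof.
have [C [c [C0 c0 HC]]] := clean_contraction P_complete W_brownian sg_hypA B eta_gt0.
(* The term 4C serves t >= 2: one factor 2 is the width of the range of [Phi], the other comes from
   1 + |x - x'| <= 2q. The term 2 exp(2c) makes the trivial bound by twice the sup norm fit for t <
   2. *)
exists (4 * C + 2 * expR (c * 2)), c; split=> //.
  by rewrite addr_gt0// mulr_gt0// expR_gt0.
move=> df b hA V sV Phi x x' t [mPhi' [K0 PK0]] t0.
have mPhi : measurable_fun setT (Phi : bspace R d 1 -> R).
  by move=> _ A mA; rewrite setTI; exact: mPhi'.
set N := sup_norm Phi.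
have PN y : `|Phi y| <= N.
  by apply: ub_le_sup; [exists K0 => _ [z _ <-]|exists y].
have N0 : 0 <= N by exact: le_trans (normr_ge0 _) (PN 0).
have lsg := diff_Lip sg_hypA.
have mf : measurable_fun setT ((fun z => df z + b z) : bspace R d 1 -> bspace R d 1).
  apply: measurable_mxD; first exact: (measurable_locally_eLipschitz (drift_locLip hA)).
  exact: (measurable_eLipschitz (drift_pertLip hA)).
have lPhi Z : measurable_fun setT (Z : Omega -> bspace R d 1) -> L1 P (fun w => Phi (Z w)).
  by move=> mZ; apply: (@L1_bounded _ _ _ _ _ N) => //; exact: (measurableT_comp mPhi mZ).
(* The null set depends on the starting point, which is harmless because only two starting points
   are compared, each through its own expectation. *)
have clean y : exists V', clean_solution P W (fun z => df z + b z) sg y V' /\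
    semigroup P V t Phi y = ex P (fun w => Phi (V' t w)).
  have [V' [E [cV' mE PE VE]]] := clean_of_strong P_complete W_brownian mf lsg (sV y).
  exists V'; split=> //; rewrite /semigroup unlock.
  have mV : measurable_fun setT (V y t : Omega -> bspace R d 1).
    apply: (measurable_fun_FT P_complete W_brownian (t := t)); apply/measurable_wrtE.
    exact: sol_adapted (sV y) _ t0.
  have mV' := clean_measurable P_complete W_brownian cV' t0.
  apply/eqP; rewrite eq_le; apply/andP; split.
    by apply: (ex_le_ae mE PE (lPhi _ mV) (lPhi _ mV')) => w /VE ->.
  by apply: (ex_le_ae mE PE (lPhi _ mV') (lPhi _ mV)) => w /VE ->.
have [V1 [cV1 ->]] := clean x; have [V2 [cV2 ->]] := clean x'.
have m1 := clean_measurable P_complete W_brownian cV1 t0.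
have m2 := clean_measurable P_complete W_brownian cV2 t0.
have e0 : 0 < expR (- c * t) by exact: expR_gt0.
set q := 1 + enorm x ^+ 2 + enorm x' ^+ 2.
have q1 : 1 <= q by rewrite /q -addrA lerDl addr_ge0// exprn_ge0// enorm_ge0.
have [t2|t2] := leP 2 t.
  pose D := C * (1 + enorm (x - x')) * expR (- c * t).
  have b1 := bounded_meas_le m1 m2 mPhi PN (fun g lg g01 => HC df b hA x x' _ _ cV1 cV2 g t lg g01 t2).
  have b2 := bounded_meas_le m2 m1 mPhi PN (fun g lg g01 => HC df b hA x' x _ _ cV2 cV1 g t lg g01 t2).
  rewrite enorm_distC in b2.
  apply: (@le_trans _ _ (2 * N * D)); first by rewrite ler_norml b1 lerNl opprB b2.
  have xq : 1 + enorm (x - x') <= 2 * q.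
    apply: (@le_trans _ _ (1 + (enorm x + enorm x'))); first by rewrite lerD2l ler_enormB.
    rewrite /q; have := sqr_ge0 (enorm x - 1); have := sqr_ge0 (enorm x' - 1).
    have := sqr_ge0 (enorm x); have := sqr_ge0 (enorm x'); lra.
  have -> : 2 * N * D = 2 * C * (1 + enorm (x - x')) * expR (- c * t) * N by rewrite /D; ring.
  rewrite !ler_wpM2r ?(ltW e0)//.
  apply: (@le_trans _ _ (2 * C * (2 * q))); first by rewrite ler_wpM2l// mulr_ge0// ltW.
  have -> : 2 * C * (2 * q) = (4 * C) * q by ring.
  by rewrite ler_wpM2r ?(le_trans ler01)// lerDl mulr_ge0// expR_ge0.
apply: (@le_trans _ _ (2 * N)).
  have bd Z : measurable_fun setT (Z : Omega -> bspace R d 1) -> `|ex P (fun w => Phi (Z w))| <= N.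
    by move=> mZ; rewrite -[leRHS](ex_cst P); apply: normr_ex_le; [exact: lPhi|exact: L1_cst|].
  by apply: le_trans (ler_normB _ _) _; have := bd _ m1; have := bd _ m2; lra.
rewrite ler_wpM2r//.
have e1 : 1 <= expR (c * 2) * expR (- c * t).
  by rewrite -expRD -[leLHS]expR0 ler_expR mulNr subr_ge0 ler_wpM2l//; exact: ltW.
apply: (@le_trans _ _ (2 * (expR (c * 2) * expR (- c * t)))); first by rewrite ler_peMr.
rewrite mulrA ler_wpM2r ?(ltW e0)//.
apply: (@le_trans _ _ ((4 * C + 2 * expR (c * 2)) * 1)).
  by rewrite mulr1 lerDr mulr_ge0// ltW.
by rewrite ler_wpM2l// addr_ge0// mulr_ge0 ?expR_ge0// ltW.
Qed.
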